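(* Let $G$ be a compact Lie group and $P:C^\infty(G)\to C^\infty(G)$ a left-invariant continuous linear operator. Then $P$ is globally solvable (equivalently, has closed range) if and only if there exist $C,k>0$ such that $$\lambda_{\min}^{>0}[\sigma_P(\xi)]\ \ge\ C\,\langle\xi\rangle^{-k}\qquad\text{for every }[\xi]\in\widehat G\text{ such that }\sigma_P(\xi)\neq0.$$
   Context: $G$ is connected. $\widehat G$ is the set of equivalence classes of continuous irreducible unitary representations $\xi$ (matrix-valued, of dimension $d_\xi$). $\mathcal{L}_G$ is the positive Laplace–Beltrami operator of a fixed bi-invariant Riemannian metric; the matrix entries of $\xi$ are eigenfunctions of $\mathcal L_G$ with a common eigenvalue $\nu_\xi\ge0$, and $\langle\xi\rangle=\sqrt{1+\nu_\xi}$. Left-invariant means commuting with left translations. The symbol of $P$ is $\sigma_P(\xi)=\xi(x)^*(P\xi)(x)\in\mathbb C^{d_\xi\times d_\xi}$, independent of $x$. For a nonzero matrix $A$, $\lambda_{\min}^{>0}[A]$ is its smallest nonzero singular value. A continuous linear operator $P:C^\infty(M)\to C^\infty(M)$ on a compact manifold $M$ is globally solvable if for every $f\in(\ker{}^tP)^0$ there exists $u\in C^\infty(M)$ with $Pu=f$, where ${}^tP:\mathcal D'(M)\to\mathcal D'(M)$ is the transpose and $(\ker{}^tP)^0=\{f\in C^\infty(M):\langle u,f\rangle=0\ \ \forall u\in\ker{}^tP\subset\mathcal D'(M)\}$; since $\overline{\operatorname{ran}P}=(\ker{}^tP)^0$, this is equivalent to $P$ having closed range in $C^\infty(M)$. 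*)

(* Defs.v *)
From HB Require Import structures.
From mathcomp Require Import all_boot all_order all_algebra.
From mathcomp Require Import all_classical all_reals all_analysis.
From mathcomp Require Import complex spectral.

Set Implicit Arguments.
Unset Strict Implicit.
Unset Printing Implicit Defensive.

Import Order.TTheory GRing.Theory Num.Theory.
Import numFieldNormedType.Exports.

Local Open Scope classical_set_scope.
Local Open Scope ring_scope.
Local Open Scope sesquilinear_scope.

Section smooth_on.
Context {R : realType} {n : nat} {W : normedModType R}.
Implicit Types (f g : 'rV[R]_n -> W) (s : seq 'I_n) (U : set 'rV[R]_n).

Definition partial (i : 'I_n) f : 'rV[R]_n -> W := 'D_(delta_mx 0 i) f.

Definition partials s f : 'rV[R]_n -> W := foldr partial f s.

(* Meant for open U, so that the derivatives at the points of U do not depend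
   on the values of f outside U. *)
Definition smooth_on U f := forall s x, U x ->
  {for x, continuous (partials s f)} /\
  forall i, derivable (partials s f) x (delta_mx 0 i).

Lemma partials_lin U (a b : R) f g : open U -> smooth_on U f -> smooth_on U g ->
  forall s x, U x ->
    partials s (a \*: f + b \*: g) x = (a \*: partials s f + b \*: partials s g) x.
Proof.
move=> oU sf sg; elim=> [//|i s IH] x Ux.
have nU : \forall y \near x, U y by apply: open_nbhs_nbhs.
have [_ /(_ i) df] := sf s x Ux; have [_ /(_ i) dg] := sg s x Ux.
rewrite /= {1}/partial (@near_eq_derive _ _ _ _
    (a \*: partials s f + b \*: partials s g)).
  by rewrite deriveD ?deriveZ//; exact: derivableZ.
by apply: filterS nU => y; exact: IH.
Qed.

Lemma smooth_on_lin U (a b : R) f g : open U -> smooth_on U f -> smooth_on U g ->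
  smooth_on U (a \*: f + b \*: g).
Proof.
move=> oU sf sg s x Ux.
have nU : \forall y \near x, U y by apply: open_nbhs_nbhs.
have E : {near x, a \*: partials s f + b \*: partials s g =1
                  partials s (a \*: f + b \*: g)}.
  by apply: filterS nU => y Uy; rewrite (partials_lin _ _ oU sf sg).
have [cf df] := sf s x Ux; have [cg dg] := sg s x Ux.
split=> [|i].
  change (partials s (a \*: f + b \*: g) @ x -->
          partials s (a \*: f + b \*: g) x).
  rewrite (partials_lin _ _ oU sf sg)//.
  apply: cvg_trans (near_eq_cvg E) _.
  by apply: cvgD; apply: cvgZr.
by apply: (near_eq_derivable E); apply: derivableD; exact: derivableZ.
Qed.

End smooth_on.

Section manifold.
Context (R : realType) (n : nat).

(* coord and param are total functions, but coord is only meaningful on dom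
   and param on coord @` dom. *)
Record chart (M : topologicalType) := Chart {
  dom : set M;
  coord : M -> 'rV[R]_n;
  param : 'rV[R]_n -> M;
  dom_open : open dom;
  codom_open : open (coord @` dom);
  coordK : forall x, dom x -> param (coord x) = x;
  coord_continuous : {in dom, continuous coord};
  param_continuous : {in coord @` dom, continuous param} }.

Definition codom_chart (M : topologicalType) (c : chart M) := coord c @` dom c.

End manifold.

HB.mixin Record isLieGroup (R : realType) (n : nat) G of Group G & Topological G := {
  chart_index : Type;
  atlas : chart_index -> chart R n G;
  atlas_cover : forall x : G, exists i, dom (atlas i) x;
  atlas_compatible : forall i j,
    smooth_on (coord (atlas i) @` (dom (atlas i) `&` dom (atlas j)))
      (coord (atlas j) \o param (atlas i));
  lie_hausdorff : hausdorff_space G;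
  mulg_continuous : continuous (fun xy : G * G => (xy.1 * xy.2)%g);
  invg_continuous : continuous (fun x : G => (x^-1)%g);
  mulg_smooth : forall i j k,
    let mul (z : 'rV[R]_(n + n)) :=
      (param (atlas i) (lsubmx z) * param (atlas j) (rsubmx z))%g in
    smooth_on [set z | [/\ codom_chart (atlas i) (lsubmx z),
                           codom_chart (atlas j) (rsubmx z) &
                           dom (atlas k) (mul z)]]
      (coord (atlas k) \o mul);
  invg_smooth : forall i j,
    let inv (z : 'rV[R]_n) := ((param (atlas i) z)^-1)%g in
    smooth_on [set z | codom_chart (atlas i) z /\ dom (atlas j) (inv z)]
      (coord (atlas j) \o inv) }.

#[short(type="lieGroupType")]
HB.structure Definition LieGroup (R : realType) (n : nat) :=
  {G of Group G & Topological G & isLieGroup R n G}.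

Arguments chart_index {R n} G : rename.

Section smooth_functions.
Context (R : realType) (n : nat) (G : lieGroupType R n).
Implicit Types (f : G -> R[i]^o) (i : chart_index G).

Definition local_Re i f : 'rV[R]_n -> R := fun y => complex.Re (f (param (atlas i) y)).
Definition local_Im i f : 'rV[R]_n -> R := fun y => complex.Im (f (param (atlas i) y)).

Definition smooth f := forall i,
  smooth_on (codom_chart (atlas i)) (local_Re i f) /\
  smooth_on (codom_chart (atlas i)) (local_Im i f).

Definition smooth_pred : {pred G -> R[i]^o} := fun f => `[< smooth f >].

Lemma smooth_submod_closed : submod_closed smooth_pred.
Proof.
split.
  have z U : @smooth_on R n R U (fun=> 0).
    have E s : partials s (fun=> 0) = (fun=> 0) :> ('rV[R]_n -> R).
      elim: s => [//|i s IH]; rewrite /= IH; apply/funext => x.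
      exact: derive_cst.
    move=> s x _; rewrite E; split; first exact: cst_continuous.
    by move=> i; exact: derivable_cst.
  by apply/asboolP => i; split; exact: z.
move=> a f g /asboolP sf /asboolP sg; apply/asboolP => i.
have oU : open (codom_chart (atlas i)) by exact: codom_open.
have [sfr sfi] := sf i; have [sgr sgi] := sg i.
case: a => a b; split.
- have := smooth_on_lin 1 1 oU (smooth_on_lin a (- b) oU sfr sfi) sgr.
  congr smooth_on; apply/funext => x /=.
  rewrite /local_Re /local_Im !addrfctE /= !scale1r scalrfctE /=.
  by move: (f (param (atlas i) x)) (g (param (atlas i) x)) => [u v] [w t] /=;
     rewrite /GRing.scale /= mulNr.
- have := smooth_on_lin 1 1 oU (smooth_on_lin a b oU sfi sfr) sgi.
  congr smooth_on; apply/funext => x /=.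
  rewrite /local_Re /local_Im !addrfctE /= !scale1r scalrfctE /=.
  by move: (f (param (atlas i) x)) (g (param (atlas i) x)) => [u v] [w t] /=.
Qed.

HB.instance Definition _ :=
  GRing.isSubmodClosed.Build R[i] (G -> R[i]^o) smooth_pred smooth_submod_closed.

Record smooth_function := SmoothFunction {
  smooth_fun :> G -> R[i]^o;
  smooth_funP : smooth_fun \in smooth_pred }.

HB.instance Definition _ := [isSub for smooth_fun].
HB.instance Definition _ := [Choice of smooth_function by <:].
HB.instance Definition _ := [SubChoice_isSubLmodule of smooth_function by <:].

End smooth_functions.

Section smooth_topology.
Context (R : realType) (n : nat) (G : lieGroupType R n).

Definition compact_in_chart (i : chart_index G) : set (set 'rV[R]_n) :=
  [set K | compact K /\ K `<=` codom_chart (atlas i)].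

Definition jet_space : uniformType :=
  prod_topology (fun k : chart_index G * seq 'I_n =>
    {family compact_in_chart k.1, 'rV[R]_n -> R * R}).

Definition jet (f : smooth_function G) : jet_space := fun k y =>
  (partials k.2 (local_Re k.1 f) y, partials k.2 (local_Im k.1 f) y).

(* The Frechet topology of C^oo(G): uniform convergence of every partial
   derivative, in every chart, on every compact subset of the chart. *)
HB.instance Definition _ := Uniform.copy (smooth_function G) (initial_topology jet).

End smooth_topology.

Section operators.
Context (R : realType) (n : nat) (G : lieGroupType R n).
Implicit Types (f h u : smooth_function G) (T : {linear smooth_function G -> R[i]^o}).
Implicit Types P : {linear smooth_function G -> smooth_function G}.

(* h stands for the translate of f by a, as an element of C^oo(G). *)
Definition left_invariant P := forall (a : G) f h,
  (forall x, h x = f (a * x)%g) -> forall x, P h x = P f (a * x)%g.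

Definition distribution T := continuous (T : smooth_function G -> R[i]^o).

Definition transpose P T : {linear smooth_function G -> R[i]^o} := T \o P.

Lemma distribution_transpose P T :
  continuous P -> distribution T -> distribution (transpose P T).
Proof. by move=> cP cT f; apply: continuous_comp; [exact: cP|exact: cT]. Qed.

Definition ker_transpose P :=
  [set T | distribution T /\ forall f, transpose P T f = 0].

Definition annihilator (K : set {linear smooth_function G -> R[i]^o}) :=
  [set f | forall T, K T -> T f = 0].

Definition globally_solvable P := forall f, annihilator (ker_transpose P) f ->
  exists u, P u = f.

Definition closed_range P := closed (range P).

End operators.

Section metric.
Context (R : realType) (n : nat) (G : lieGroupType R n).

(* gram i x is the Gram matrix at x of the coordinate vector fields of the
   chart i.  With the row vector convention of 'J, F is an isometry when the
   matrices below agree for all charts around x and F x. *)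
Definition isometric (gram : chart_index G -> G -> 'M[R]_n) (F : G -> G) :=
  forall i j x, dom (atlas i) x -> dom (atlas j) (F x) ->
    let J := 'J (coord (atlas j) \o F \o param (atlas i)) (coord (atlas i) x) in
    gram i x = J *m gram j (F x) *m J^T.

Record biinvariant_metric := BiinvariantMetric {
  gram : chart_index G -> G -> 'M[R]_n;
  gram_sym : forall i x, dom (atlas i) x -> (gram i x)^T = gram i x;
  gram_pos : forall i x, dom (atlas i) x -> forall v : 'rV[R]_n, v != 0 ->
    0 < (v *m gram i x *m v^T) 0 0;
  gram_smooth : forall i,
    smooth_on (codom_chart (atlas i)) (gram i \o param (atlas i));
  gram_change_of_chart : isometric gram idfun;
  gram_left : forall a, isometric gram (fun x => a * x)%g;
  gram_right : forall a, isometric gram (fun x => x * a)%g }.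

Variable g : biinvariant_metric.

(* - |g|^(-1/2) sum_j d_j (|g|^(1/2) sum_k g^(jk) d_k h), |g| = det (g_jk) *)
Definition local_laplacian (i : chart_index G) (h : 'rV[R]_n -> R) : 'rV[R]_n -> R :=
  let gm y := gram g i (param (atlas i) y) in
  let vol y := Num.sqrt (\det (gm y)) in
  fun y => - (vol y)^-1 * \sum_j partial j
    (fun z => vol z * \sum_k invmx (gm z) j k * partial k h z) y.

Definition chart_at (x : G) : chart_index G := projT1 (cid (atlas_cover x)).

(* Independent of the chart around x, by gram_change_of_chart. *)
Definition laplace_beltrami (f : G -> R[i]^o) : G -> R[i]^o := fun x =>
  let i := chart_at x in let y := coord (atlas i) x in
  (local_laplacian i (local_Re i f) y +i* local_laplacian i (local_Im i f) y)%C.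

End metric.

Section dual.
Context (R : realType) (n : nat) (G : lieGroupType R n).

Record irrep (d : nat) := Irrep {
  rep_mx :> G -> 'M[R[i]]_d;
  rep_continuous : forall j k, continuous (fun x => rep_mx x j k : R[i]^o);
  rep1 : rep_mx 1%g = 1%:M;
  repM : forall x y, rep_mx (x * y)%g = rep_mx x *m rep_mx y;
  rep_unitary : forall x, rep_mx x \is unitarymx;
  rep_dim_gt0 : (0 < d)%N;
  (* The rows of U span a subspace of C^d, on which rep_mx x acts by
     v |-> rep_mx x *m v on column vectors. *)
  rep_irreducible : forall U : 'M[R[i]]_d,
    (forall x, stablemx U (rep_mx x)^T) -> U = 0 \/ row_full U }.

Definition entry d (xi : irrep d) (j k : 'I_d) : G -> R[i]^o := fun x => xi x j k.

Definition laplace_eigenvalue (g : biinvariant_metric G) d (xi : irrep d) : R :=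
  xget 0 [set nu | forall j k x,
    laplace_beltrami g (entry xi j k) x = (nu%:C)%C * entry xi j k x].

Definition bracket (g : biinvariant_metric G) d (xi : irrep d) : R :=
  Num.sqrt (1 + laplace_eigenvalue g xi).

(* 0 when h is not smooth; only used for the entries of a continuous
   representation, which are smooth. *)
Definition to_smooth (h : G -> R[i]^o) : smooth_function G := insubd 0 h.

Definition symbol_at (P : {linear smooth_function G -> smooth_function G})
    d (xi : irrep d) (x : G) : 'M[R[i]]_d :=
  (xi x)^t* *m \matrix_(j, k) P (to_smooth (entry xi j k)) x.

(* symbol_at P xi x does not depend on x when P is left-invariant. *)
Definition symbol (P : {linear smooth_function G -> smooth_function G})
    d (xi : irrep d) : 'M[R[i]]_d := symbol_at P xi 1%g.

Lemma symbol_at_const (P : {linear smooth_function G -> smooth_function G})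
    d (xi : irrep d) : left_invariant P -> (forall j k, smooth (entry xi j k)) ->
  forall x, symbol_at P xi x = symbol P xi.
Proof.
move=> Pinv sxi x; rewrite /symbol /symbol_at.
pose e j k := to_smooth (entry xi j k).
suff E : \matrix_(j, k) P (e j k) x = xi x *m \matrix_(j, k) P (e j k) 1%g.
  rewrite [X in _ *m X]E mulmxA -(invmx_unitary (rep_unitary xi x)) mulVmx.
    rewrite rep1 /= trmx1 map_mx1; reflexivity.
  exact: unitarymx_unit (rep_unitary xi x).
have eE j k y : e j k y = xi y j k.
  have : smooth_fun (e j k) = entry xi j k by apply: insubdK; apply/asboolP.
  by move=> ->.
clearbody e.
have sumE (h : 'I_d -> smooth_function G) y : (\sum_l h l) y = \sum_l h l y.
  exact: (big_morph (fun f : smooth_function G => f y : R[i])).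
have PE j k : P (e j k) x = \sum_l xi x j l * P (e l k) 1%g.
  have SE y : (\sum_l xi x j l *: e l k) y = e j k (x * y)%g.
    rewrite sumE eE repM mxE; apply: eq_bigr => l _.
    by rewrite -(eE l k y).
  have := Pinv x _ _ SE 1%g; rewrite (mulg1 x) => H; apply: (etrans (esym H)).
  by rewrite linear_sum sumE; apply: eq_bigr => l _; rewrite linearZ.
apply/matrixP => j k; rewrite [LHS]mxE [RHS]mxE PE.
by apply: eq_bigr => l _; rewrite [in RHS]mxE.
Qed.

End dual.

Definition singular_value (R : realType) d (A : 'M[R[i]]_d) : set R :=
  [set s | 0 <= s /\ eigenvalue (A^t* *m A) ((s ^+ 2)%:C)%C].

(* A minimum when A != 0, the set of singular values being finite. *)
Definition min_nonzero_singular_value (R : realType) d (A : 'M[R[i]]_d) : R :=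
  inf [set s | singular_value A s /\ s != 0].

(* Main.v *)
(* The Fourier coefficients of Pu at xi are those of u multiplied by the transpose
   of the symbol of P, and smooth functions correspond to the rapidly decreasing
   families of coefficients.  The equation Pu = f thus splits into one finite
   system per representation.  A functional in the kernel of the transpose detects
   whether that system is solvable, and its best solution grows by the inverse of
   the smallest nonzero singular value of the symbol; a polynomial lower bound on
   the singular values is therefore exactly what keeps solutions rapidly
   decreasing.  Conversely, singular values decreasing faster than every power
   along a sequence of representations give a function in the closure of the range
   none of whose preimages has decreasing coefficients.

   The Fourier series on G rest on a bi-invariant mean of continuous functions,
   obtained from averages of translates.  The Laplacian is minus a sum of products
   of left-invariant fields, so Schur's lemma makes it a scalar on each
   representation, and this scalar bounds all derivatives of the entries.  Smooth
   functions orthogonal to all smooth entries vanish, by compactness of convolution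
   operators, and a reproducing kernel argument shows that the number and the
   dimensions of the representations grow polynomially in the eigenvalue. *)
Require Import Defs.
From HB Require Import structures.
From mathcomp Require Import all_boot all_order all_algebra.
From mathcomp Require Import all_classical all_reals all_analysis.
From mathcomp Require Import fingroup perm complex spectral.
From mathcomp Require Import ring lra.

Set Implicit Arguments.
Unset Strict Implicit.
Unset Printing Implicit Defensive.

Import Order.TTheory GRing.Theory Num.Theory.
Import numFieldNormedType.Exports.

Local Open Scope classical_set_scope.
Local Open Scope ring_scope.

(** * Calculus on open sets *)

(** The equivalences close a cycle: solvability gives closed range, closed range forces the lower
    bound, the bound gives solvability. The analysis on G is done in the global frame of
    left-invariant fields; coordinate derivatives are compared with invariant fields once, with
    constants uniform on compact sets. Integration by parts only asks that an invariant field have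
    mean zero, which is seen at a maximum of an average of translates. An [irrep] is merely
    continuous, while eigenvalues and decay concern smooth entries. The Fourier series therefore
    runs over a maximal orthogonal family of smooth irreducible representations: entries of a
    non-smooth one are orthogonal to all smooth functions, and a representation with nonzero symbol
    is smooth because [to_smooth] sends non-smooth entries to 0. Bounds pass between arbitrary
    representations and the chosen representatives by an intertwiner, which Schur's lemma makes
    unitary up to a scalar, so that singular values are kept. *)

Lemma near_forall {T : topologicalType} {I : finType} (x : T) (P : I -> T -> Prop) :
  (forall i, \forall y \near x, P i y) -> \forall y \near x, forall i, P i y.
Proof. exact: filter_forall. Qed.

Lemma near_and {T : topologicalType} (x : T) (P Q : T -> Prop) :
  (\forall y \near x, P y) -> (\forall y \near x, Q y) -> \forall y \near x, P y /\ Q y.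
Proof. by move=> nP nQ; apply: filterS2 nP nQ => y; split. Qed.

Section line.
Context {R : realType} {n : nat}.
Implicit Types (f : 'rV[R]_n -> R) (x v : 'rV[R]_n).

Lemma is_derive_line f x v (t : R) : derivable f (t *: v + x) v ->
  is_derive t 1 (fun s : R => f (s *: v + x)) ('D_v f (t *: v + x)).
Proof.
have E : (fun h : R => h^-1 *: (((fun s : R => f (s *: v + x)) \o shift t) (h *: 1) -
    f (t *: v + x))) =
   (fun h => h^-1 *: ((f \o shift (t *: v + x)) (h *: v) - f (t *: v + x))).
  by apply/funext => h /=; rewrite scalerDl addrA [h *: 1]mulr1.
by move=> df; apply: DeriveDef; rewrite ?/derivable ?/derive E.
Qed.

Lemma mvt_line f x v (t : R) : (forall s : R, `|s| <= `|t| -> derivable f (s *: v + x) v) ->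
  exists2 s : R, `|s| <= `|t| & f (t *: v + x) - f x = t * 'D_v f (s *: v + x).
Proof.
move=> df; pose g (s : R) : R := f (s *: v + x).
have dg (s : R) : `|s| <= `|t| -> is_derive s 1 g ('D_v f (s *: v + x)).
  by move=> /df; exact: is_derive_line.
have g0 : g 0 = f x by rewrite /g scale0r add0r.
case: (lerP 0 t) => t0.
  have sub s : s \in `[0, t] -> `|s| <= `|t|.
    by rewrite in_itv/= => /andP[s0 st]; rewrite !ger0_norm.
  have [||s sI] := @MVT_segment _ g (fun s => 'D_v f (s *: v + x)) 0 t t0.
  - by move=> s; rewrite in_itv/= => /andP[s0 st]; apply/dg/sub; rewrite in_itv/= !ltW.
  - by apply: derivable_within_continuous => s /sub /dg [].
  by rewrite g0 subr0 mulrC => E; exists s => //; exact: sub.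
have sub s : s \in `[t, 0] -> `|s| <= `|t|.
  by rewrite in_itv/= => /andP[s0 st]; rewrite !ler0_norm ?lerN2// ltW.
have [||s sI] := @MVT_segment _ g (fun s => 'D_v f (s *: v + x)) t 0 (ltW t0).
- by move=> s; rewrite in_itv/= => /andP[s0 st]; apply/dg/sub; rewrite in_itv/= !ltW.
- by apply: derivable_within_continuous => s /sub /dg [].
rewrite g0 sub0r mulrN mulrC => /(congr1 -%R); rewrite opprB opprK => E.
by exists s => //; exact: sub.
Qed.

End line.

(** [differentiable] speaks of a differential picked by choice; [getPex] reduces it to exhibiting
    one continuous linear map with a little-o remainder, here obtained from an explicit epsilon
    estimate. *)
Lemma differentiable_expansion (R : realType) (V W : normedModType R) (f : V -> W) x
    (df : {linear V -> W}) : continuous df ->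
  (forall e : R, 0 < e -> \forall h \near (0 : V), `|f (h + x) - f x - df h| <= e * `|h|) ->
  differentiable f x.
Proof.
move=> dfc exp.
have {exp} exp : f \o shift x = cst (f x) + df +o_ 0 id.
  by apply/eqaddoP => e e0; near=> h; rewrite /= opprD addrA; near: h; exact: exp.
apply/diffP => /=.
apply: (@getPex _ (fun (df : {linear _ -> _}) => continuous df /\
  forall y, f y = f (lim (nbhs x)) + df (y - lim (nbhs x))
                  +o_(y \near x) (y - lim (nbhs x)))).
exists df; split=> //.
have {}exp h : f (h + x) = f x + df h +o_(h \near 0) h.
  by move: exp; rewrite funeqE => /(_ h).
apply: eqaddoEx; move=> y.
rewrite lim_id // -[in LHS](subrK x y) exp; congr (_ + _).
rewrite -(comp_centerK x id) -[X in the_littleo _ _ _ X](comp_centerK x).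
by rewrite -[_ (y - x)]/((_ \o (center x)) y) -littleo_center0.
Unshelve. all: by end_near. Qed.

Section C1.
Context {R : realType} {n : nat}.
Implicit Types (f : 'rV[R]_n -> R) (x h : 'rV[R]_n).

Lemma coord_le_norm h j : `|h 0 j| <= `|h|.
Proof. by rewrite [leRHS]/Num.Def.normr/= mx_normrE; exact: (le_bigmax _ _ (0, j)). Qed.

Lemma norm_le_coord h (e : R) : 0 <= e -> (forall j, `|h 0 j| <= e) -> `|h| <= e.
Proof.
move=> e0 he; rewrite [leLHS]/Num.Def.normr/= mx_normrE; apply: bigmax_le => // -[i j] _ /=.
by rewrite (ord1 i).
Qed.

Definition row_combination (c : 'I_n -> R) h : R := \sum_j h 0 j * c j.

Fact row_combination_linear c : linear (row_combination c).
Proof.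
move=> a u v; rewrite /row_combination /= scaler_sumr -big_split; apply: eq_bigr => j _ /=.
by rewrite !mxE mulrDl scalerAl.
Qed.

HB.instance Definition _ c := GRing.isLinear.Build R 'rV[R]_n R _ (row_combination c)
  (row_combination_linear c).

Lemma row_combination_continuous c : continuous (row_combination c).
Proof.
have -> : row_combination c = \sum_j (c j *: (fun h : 'rV[R]_n => h 0 j : R)).
  apply/funext => h; rewrite /row_combination fct_sumE; apply: eq_bigr => j _.
  by rewrite mulrC.
move=> x; apply: differentiable_continuous; apply: differentiable_sum => j.
by apply: differentiableZ; exact: differentiable_coord.
Qed.

(** The corners of the broken line from 0 to h that moves along one coordinate at a time. *)
Definition truncated_row h k : 'rV[R]_n := \row_j (if (j < k)%N then h 0 j else 0).

(** The increment is split along the broken line; on each piece [mvt_line] produces a partial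
    derivative at a point no farther from x than the norm of h, where it is close to its value at
    x. *)
Lemma C1_differentiable f x : (\forall y \near x, forall i, derivable f y (delta_mx 0 i)) ->
  (forall i, {for x, continuous (partial i f)}) -> differentiable f x.
Proof.
move=> df cf; pose L := row_combination (fun i => partial i f x).
apply: (@differentiable_expansion _ _ _ f x L); first exact: row_combination_continuous.
(* There are n pieces, each with error at most e' times the norm of h; dividing by [n.+1] also
   covers n = 0. *)
move=> e e0; pose e' := e / n.+1%:R.
have e'0 : 0 < e' by rewrite divr_gt0.
have : \forall y \near x, (forall i, derivable f y (delta_mx 0 i)) /\
    forall i, `|partial i f y - partial i f x| <= e'.
  have A : \forall y \near x, forall i, `|partial i f y - partial i f x| <= e'.
    by apply: near_forall => i; have /cvgrPdistC_le := cf i; apply.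
  by apply: filterS2 df A.
move=> /nbhs_normP[d /= d0 H].
have hd0 : \forall h \near (0 : 'rV[R]_n), `|h| < d by exact: nbhs0_lt.
apply: filterS hd0 => h hd.
pose t k := truncated_row h k.
have tS (k : 'I_n) : t k.+1 = h 0 k *: delta_mx 0 k + t k.
  apply/rowP => j; rewrite !mxE eqxx /= ltnS leq_eqVlt -val_eqE /=.
  by case: (eqVneq (j : nat) k) => [/val_inj->|_] /=; rewrite ?ltnn ?mulr1 ?addr0 ?mulr0 ?add0r.
have E : f (h + x) - f x = \sum_(k < n) (f (t k.+1 + x) - f (t k + x)).
  rewrite -(big_mkord xpredT (fun k => f (t k.+1 + x) - f (t k + x))) telescope_sumr//.
  have -> : t n = h by apply/rowP => j; rewrite !mxE ltn_ord.
  have -> : t 0%N = 0 by apply/rowP => j; rewrite !mxE.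
  by rewrite add0r.
rewrite E /L /row_combination -sumrB.
apply: le_trans (ler_norm_sum _ _ _) _.
have -> : e * `|h| = e' * `|h| *+ n.+1.
  by rewrite -mulr_natr /e' mulrAC divfK// pnatr_eq0.
apply: (@le_trans _ _ (\sum_(k < n) e' * `|h|)); last first.
  by rewrite sumr_const card_ord mulrS lerDr mulr_ge0// ltW.
apply: ler_sum => k _; rewrite tS -[_ *: _ + _ + x]addrA.
have bnd s : `|s| <= `|h 0 k| -> `|s *: delta_mx 0 k + t k| <= `|h|.
  move=> sk; apply: norm_le_coord => // j; rewrite !mxE eqxx /=.
  case: (eqVneq j k) => [->|_]; first by rewrite ltnn mulr1 addr0 (le_trans sk)// coord_le_norm.
  by rewrite mulr0 add0r; case: ifP => _; rewrite ?normr0// coord_le_norm.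
have bnd' s : `|s| <= `|h 0 k| -> `|x - (s *: delta_mx 0 k + (t k + x))| < d.
  by move=> sk; rewrite addrA opprD addrCA subrr addr0 normrN (le_lt_trans (bnd _ sk)).
have [s|s sk ->] := @mvt_line _ _ f (t k + x) (delta_mx 0 k) (h 0 k).
  by move=> /bnd' /H [/(_ k)].
rewrite -mulrBr normrM mulrC ler_pM// ?coord_le_norm//.
by have [_ /(_ k)] := H _ (bnd' _ sk).
Unshelve. all: by end_near. Qed.

End C1.

Lemma continuous_row {R : realType} {T : topologicalType} {m} (F : T -> 'rV[R]_m) x :
  (forall j, {for x, continuous (fun y => F y 0 j)}) -> {for x, continuous F}.
Proof.
move=> cF; apply/cvgrPdist_le => e e0.
have A : \forall y \near x, forall j, `|F x 0 j - F y 0 j| <= e.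
  by apply: near_forall => j; have /cvgrPdist_le := cF j; apply.
apply: filterS A => y Fy; apply: norm_le_coord; first exact: ltW.
by move=> j; rewrite !mxE.
Qed.

Lemma differentiable_row {R : realType} {V : normedModType R} {m} (F : V -> 'rV[R]_m) x :
  (forall j, differentiable (fun y => F y 0 j : R) x) -> differentiable F x.
Proof.
move=> dF; have -> : F = \sum_j (fun y => F y 0 j *: 'e_j).
  apply/funext => y; rewrite fct_sumE [LHS]row_sum_delta; reflexivity.
by apply: differentiable_sum => j; exact: differentiableZl.
Qed.

Lemma partial_comp {R : realType} {m n} (f : 'rV[R]_m -> R) (F : 'rV[R]_n -> 'rV[R]_m) x i :
  differentiable f (F x) -> (forall j, differentiable (fun y => F y 0 j : R) x) ->
  partial i (f \o F) x = \sum_j partial j f (F x) * partial i (fun y => F y 0 j) x.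
Proof.
move=> df dF; have dF' := differentiable_row dF.
rewrite /partial deriveE; last exact: differentiable_comp.
rewrite diff_comp//= -(@deriveE _ _ _ F x 'e_i dF').
have E : 'D_('e_i) F x = \matrix_(a, j) 'D_('e_i) (fun y => F y a j) x.
  by apply: derive_mx; exact: diff_derivable.
rewrite E [X in 'd f _ X]row_sum_delta linear_sum; apply: eq_bigr => j _.
by rewrite linearZ mxE -deriveE// mulrC.
Qed.

(** * Functions of class C^k *)

Section Ck.
Context {R : realType}.

(** Counting derivatives makes induction on k possible. The recursion differentiates on the inside,
    whereas [partials] adds outer derivatives; this suits products and compositions, whose first
    derivatives are built from functions of class C^(k-1). *)
Fixpoint Ck {n} k (U : set 'rV[R]_n) (f : 'rV[R]_n -> R) : Prop :=
  (forall x, U x -> {for x, continuous f}) /\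
  if k is k'.+1 then
    forall i, (forall x, U x -> derivable f x 'e_i) /\ Ck k' U (partial i f)
  else True.

Section domain.
Context {n : nat} (U : set 'rV[R]_n).
Implicit Types (f g : 'rV[R]_n -> R).

Lemma Ck_partials k s f : Ck (k + size s) U f -> Ck k U (partials s f).
Proof.
elim: s k => [|i s IH] k /=; first by rewrite addn0.
by rewrite addnS -addSn => /IH /= [_ /(_ i)[]].
Qed.

Lemma smooth_on_partial i f : smooth_on U f -> smooth_on U (partial i f).
Proof. by move=> sf s x Ux; have := sf (rcons s i) x Ux; rewrite /partials foldr_rcons. Qed.

Lemma smooth_onP f : smooth_on U f <-> forall k, Ck k U f.
Proof.
split=> [sf k|cf s x Ux].
  elim: k f sf => [|k IH] f sf /=; (split; first by move=> x Ux; case: (sf [::] x Ux)) => //.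
  move=> i; split=> [x Ux|]; first by case: (sf [::] x Ux).
  by apply: IH; exact: smooth_on_partial.
have [c1 d1] := Ck_partials (cf (1 + size s)%N).
by split=> [|i]; [exact: c1|exact: (d1 i).1].
Qed.

Lemma CkS k f : Ck k.+1 U f -> Ck k U f.
Proof.
elim: k f => [|k IH] f [cf df]; first by split.
by split=> // i; have [d c] := df i; split=> //; exact: IH.
Qed.

Lemma Ck_cst k a : Ck k U (cst a).
Proof.
elim: k a => [|k IH] a /=; (split; first by move=> x _; exact: cst_continuous) => // i.
split=> [x _|]; first exact: derivable_cst.
suff -> : partial i (cst a) = cst 0 by exact: IH.
by apply/funext => x; exact: derive_cst.
Qed.

Hypothesis oU : open U.

Lemma near_open x (P : 'rV[R]_n -> Prop) : U x -> (forall y, U y -> P y) ->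
  \forall y \near x, P y.
Proof. by move=> Ux UP; have : nbhs x U; [exact: open_nbhs_nbhs|exact: filterS]. Qed.

Lemma Ck_eq k f g : (forall x, U x -> f x = g x) -> Ck k U f -> Ck k U g.
Proof.
have near_eq f' g' x : (forall x, U x -> f' x = g' x) -> U x ->
    {near x, f' =1 g'} by move=> E Ux; exact: near_open.
have cE f' g' x : (forall x, U x -> f' x = g' x) -> U x ->
    {for x, continuous f'} -> {for x, continuous g'}.
  move=> E Ux; rewrite /prop_for /continuous_at -(E x Ux); apply: cvg_trans.
  have nE : \forall y \near x, f' y = g' y by exact: near_open.
  exact: near_eq_cvg nE.
elim: k f g => [|k IH] f g E [cf df].
  by split=> // x Ux; exact: cE (cf x Ux).
split=> [x Ux|i]; first exact: cE (cf x Ux).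
have [dfi cfi] := df i; split=> [x Ux|].
  by apply: near_eq_derivable (dfi x Ux); exact: near_eq.
by apply: IH cfi => x Ux; apply: near_eq_derive; exact: near_eq.
Qed.

Lemma Ck_add k f g : Ck k U f -> Ck k U g -> Ck k U (f \+ g).
Proof.
elim: k f g => [|k IH] f g [cf df] [cg dg].
  by split=> // x Ux; apply: continuousD; [exact: cf|exact: cg].
split=> [x Ux|i]; first by apply: continuousD; [exact: cf|exact: cg].
have [dfi cfi] := df i; have [dgi cgi] := dg i.
split=> [x Ux|]; first by apply: derivableD; [exact: dfi|exact: dgi].
apply: Ck_eq (IH _ _ cfi cgi) => x Ux.
by rewrite /partial deriveD//; [exact: dfi|exact: dgi].
Qed.

Lemma Ck_mul k f g : Ck k U f -> Ck k U g -> Ck k U (f \* g).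
Proof.
elim: k f g => [|k IH] f g cf' cg'; have [cf df] := cf'; have [cg dg] := cg'.
  by split=> // x Ux; apply: continuousM; [exact: cf|exact: cg].
split=> [x Ux|i]; first by apply: continuousM; [exact: cf|exact: cg].
have [dfi cfi] := df i; have [dgi cgi] := dg i.
split=> [x Ux|]; first by apply: derivableM; [exact: dfi|exact: dgi].
apply: Ck_eq (Ck_add (IH _ _ (CkS cf') cgi) (IH _ _ (CkS cg') cfi)) => x Ux.
by rewrite /partial deriveM//; [exact: dfi|exact: dgi].
Qed.

(** The derivative is minus [(f x)^-2] times that of f, and the induction hypothesis covers the
    inverse itself. *)
Lemma Ck_inv k f : (forall x, U x -> f x != 0) -> Ck k U f -> Ck k U (fun x => (f x)^-1).
Proof.
elim: k f => [|k IH] f f0 cf'; have [cf df] := cf'.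
  by split=> // x Ux; apply: continuousV; [exact: f0|exact: cf].
split=> [x Ux|i]; first by apply: continuousV; [exact: f0|exact: cf].
have [dfi cfi] := df i.
split=> [x Ux|]; first by apply: derivableV; [exact: f0|exact: dfi].
have ci := IH _ f0 (CkS cf').
apply: Ck_eq (Ck_mul (Ck_mul (Ck_cst k (-1)) (Ck_mul ci ci)) cfi) => x Ux.
rewrite /partial deriveV//; [|exact: f0|exact: dfi].
by rewrite /= -exprVn expr2 mulN1r.
Qed.

Lemma Ck_sum k I (r : seq I) (P : pred I) (h : I -> 'rV[R]_n -> R) :
  (forall i, Ck k U (h i)) -> Ck k U (fun x => \sum_(i <- r | P i) h i x).
Proof.
move=> ch; elim: r => [|i r IH].
  by apply: Ck_eq (Ck_cst k 0) => x _; rewrite big_nil.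
case Pi : (P i); last by apply: Ck_eq IH => x _; rewrite big_cons Pi.
by apply: Ck_eq (Ck_add (ch i) IH) => x _; rewrite big_cons Pi.
Qed.

Lemma Ck_prod k I (r : seq I) (P : pred I) (h : I -> 'rV[R]_n -> R) :
  (forall i, Ck k U (h i)) -> Ck k U (fun x => \prod_(i <- r | P i) h i x).
Proof.
move=> ch; elim: r => [|i r IH].
  by apply: Ck_eq (Ck_cst k 1) => x _; rewrite big_nil.
case Pi : (P i); last by apply: Ck_eq IH => x _; rewrite big_cons Pi.
by apply: Ck_eq (Ck_mul (ch i) IH) => x _; rewrite big_cons Pi.
Qed.

Lemma Ck_differentiable k f x : Ck k.+1 U f -> U x -> differentiable f x.
Proof.
move=> [_ df] Ux; apply: C1_differentiable => [|i].
  by apply: near_open Ux _ => y Uy i; exact: (df i).1.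
by have [_] := df i; case: k {df} => [|k] [cf _]; exact: cf.
Qed.

End domain.

(** Chain rule: a partial derivative of the composite is a sum of products of [partial j f \o F]
    with derivatives of components, to which the induction on k applies. *)
Lemma Ck_comp {m n} (U : set 'rV[R]_n) (V : set 'rV[R]_m) k f (F : 'rV[R]_n -> 'rV[R]_m) :
  open U -> open V -> (forall x, U x -> V (F x)) ->
  (forall j, Ck k U (fun x => F x 0 j)) -> Ck k V f -> Ck k U (f \o F).
Proof.
move=> oU oV UV; elim: k f => [|k IH] f cF cf.
  split=> // x Ux; apply: continuous_comp; last by apply: cf.1; exact: UV.
  by apply: continuous_row => j; apply: (cF j).1.
have dF x : U x -> forall j, differentiable (fun y => F y 0 j : R) x.
  by move=> Ux j; apply: Ck_differentiable (cF j) Ux.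
have df x : U x -> differentiable f (F x).
  by move=> /UV; exact: Ck_differentiable cf.
split=> [x Ux|i].
  by apply: differentiable_continuous; apply: differentiable_comp (df x Ux);
     exact/differentiable_row/dF.
split=> [x Ux|].
  by apply: diff_derivable; apply: differentiable_comp (df x Ux);
     exact/differentiable_row/dF.
have c := Ck_sum oU (index_enum _) xpredT (fun j =>
   Ck_mul oU (IH (partial j f) (fun l => CkS (cF l)) (cf.2 j).2) ((cF j).2 i).2).
apply: Ck_eq oU _ _ _ _ c => x Ux.
by rewrite partial_comp//; [exact: df|exact: dF].
Qed.

End Ck.

Section closure.
Context {R : realType} {n : nat} (U : set 'rV[R]_n).
Hypothesis oU : open U.
Implicit Types (f g : 'rV[R]_n -> R).

Lemma smooth_on_eq f g : (forall x, U x -> f x = g x) -> smooth_on U f -> smooth_on U g.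
Proof. by move=> E /smooth_onP cf; apply/smooth_onP => k; exact: Ck_eq (cf k). Qed.

Lemma smooth_on_cst a : smooth_on U (cst a : 'rV[R]_n -> R).
Proof. by apply/smooth_onP => k; exact: Ck_cst. Qed.

Lemma smooth_on_add f g : smooth_on U f -> smooth_on U g -> smooth_on U (f \+ g).
Proof. by move=> /smooth_onP cf /smooth_onP cg; apply/smooth_onP => k; exact: Ck_add. Qed.

Lemma smooth_on_mul f g : smooth_on U f -> smooth_on U g -> smooth_on U (f \* g).
Proof. by move=> /smooth_onP cf /smooth_onP cg; apply/smooth_onP => k; exact: Ck_mul. Qed.

Lemma smooth_on_inv f : (forall x, U x -> f x != 0) -> smooth_on U f ->
  smooth_on U (fun x => (f x)^-1).
Proof. by move=> f0 /smooth_onP cf; apply/smooth_onP => k; exact: Ck_inv. Qed.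

Lemma smooth_on_sum I (r : seq I) (P : pred I) (h : I -> 'rV[R]_n -> R) :
  (forall i, smooth_on U (h i)) -> smooth_on U (fun x => \sum_(i <- r | P i) h i x).
Proof.
by move=> ch; apply/smooth_onP => k; apply: Ck_sum => // i; move/smooth_onP : (ch i).
Qed.

Lemma smooth_on_prod I (r : seq I) (P : pred I) (h : I -> 'rV[R]_n -> R) :
  (forall i, smooth_on U (h i)) -> smooth_on U (fun x => \prod_(i <- r | P i) h i x).
Proof.
by move=> ch; apply/smooth_onP => k; apply: Ck_prod => // i; move/smooth_onP : (ch i).
Qed.

Lemma smooth_on_det m (A : 'rV[R]_n -> 'M[R]_m) :
  (forall i j, smooth_on U (fun x => A x i j)) -> smooth_on U (fun x => \det (A x)).
Proof.
move=> sA; apply: smooth_on_sum => s; apply: smooth_on_mul; first exact: smooth_on_cst.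
by apply: smooth_on_prod => i.
Qed.

(** Cramer's rule; cofactors are determinants, hence polynomials in the entries. *)
Lemma smooth_on_invmx m (A : 'rV[R]_n -> 'M[R]_m) :
  (forall x, U x -> A x \in unitmx) ->
  (forall i j, smooth_on U (fun x => A x i j)) ->
  forall i j, smooth_on U (fun x => invmx (A x) i j).
Proof.
move=> uA sA i j.
apply: (@smooth_on_eq (fun x => (\det (A x))^-1 * cofactor (A x) j i)).
  by move=> x Ux; rewrite /invmx uA// !mxE.
apply: smooth_on_mul.
  apply: smooth_on_inv (smooth_on_det sA) => x /uA.
  by rewrite unitmxE unitfE.
apply: smooth_on_mul; first exact: smooth_on_cst.
apply: smooth_on_det => k l.
by apply: (smooth_on_eq _ (sA (lift j k) (lift i l))) => x _; rewrite !mxE.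
Qed.

Lemma smooth_on_differentiable f x : smooth_on U f -> U x -> differentiable f x.
Proof. by move=> /smooth_onP cf Ux; exact: Ck_differentiable oU _ _ _ (cf 1) Ux. Qed.

Lemma smooth_on_derivable f x i : smooth_on U f -> U x -> derivable f x 'e_i.
Proof. by move=> sf Ux; exact: (sf [::] x Ux).2. Qed.

Lemma smooth_on_continuous f x : smooth_on U f -> U x -> {for x, continuous f}.
Proof. by move=> sf Ux; exact: (sf [::] x Ux).1. Qed.

End closure.

Lemma smooth_on_local {R : realType} {n} (U : set 'rV[R]_n) (f : 'rV[R]_n -> R) :
  (forall x, U x -> exists V, V x /\ smooth_on V f) -> smooth_on U f.
Proof. by move=> H s x /H [V [Vx]]; exact. Qed.

Lemma smooth_on_comp {R : realType} {m n} (U : set 'rV[R]_n) (V : set 'rV[R]_m)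
    (f : 'rV[R]_m -> R) (F : 'rV[R]_n -> 'rV[R]_m) :
  open U -> open V -> (forall x, U x -> V (F x)) ->
  (forall j, smooth_on U (fun x => F x 0 j)) -> smooth_on V f -> smooth_on U (f \o F).
Proof.
move=> oU oV UV sF /smooth_onP sf; apply/smooth_onP => k.
by apply: Ck_comp oU oV UV _ (sf k) => j; move/smooth_onP : (sF j).
Qed.

Section components.
Context {R : realType} {n m : nat} (U : set 'rV[R]_n).
Hypothesis oU : open U.
Implicit Types (F : 'rV[R]_n -> 'rV[R]_m).

(** The axioms on the atlas concern row-valued maps, the calculus above scalar ones; this is the
    passage between them. *)
Lemma partials_component F j s : smooth_on U F -> forall x, U x ->
  partials s (fun y => F y 0 j) x = partials s F x 0 j.
Proof.
move=> sF; elim: s => [//|i s IH] x Ux /=.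
rewrite /partial (@near_eq_derive _ _ _ _ (fun y => partials s F y 0 j)).
  have E : 'D_('e_i) (partials s F) x = \matrix_(a, k) 'D_('e_i) (fun y => partials s F y a k) x.
    by apply: derive_mx; exact: (sF s x Ux).2.
  by rewrite E mxE.
by apply: (near_open oU Ux) => y Uy; exact: IH.
Qed.

Lemma smooth_on_component F j : smooth_on U F -> smooth_on U (fun x => F x 0 j).
Proof.
move=> sF s x Ux; have [cF dF] := sF s x Ux.
have nE : {near x, (fun y => partials s F y 0 j) =1 partials s (fun y => F y 0 j)}.
  by apply: (near_open oU Ux) => y Uy; rewrite partials_component.
split=> [|i].
  rewrite /prop_for /continuous_at (partials_component _ _ sF Ux).
  apply: cvg_trans (near_eq_cvg nE) _.
  exact: (continuous_comp cF (@coord_continuous _ _ _ 0 j _)).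
apply: near_eq_derivable nE _.
exact: ((derivable_mxP _ _ _).1 (dF i)).
Qed.

Lemma smooth_on_row F : (forall j, smooth_on U (fun x => F x 0 j)) -> forall x, U x ->
  differentiable F x.
Proof. by move=> sF x Ux; apply: differentiable_row => j; have := smooth_on_differentiable oU (sF j) Ux. Qed.

Lemma jacobianE F x i j : (forall j, smooth_on U (fun x => F x 0 j)) -> U x ->
  ('J F x) i j = partial i (fun y => F y 0 j) x.
Proof.
move=> sF Ux; have dF := smooth_on_row sF Ux.
have := deriveEjacobian 'e_i dF; rewrite -rowE.
have E : 'D_('e_i) F x = \matrix_(a, k) 'D_('e_i) (fun y => F y a k) x.
  by apply: derive_mx; exact: diff_derivable.
by rewrite E => /matrixP /(_ 0 j); rewrite !mxE.
Qed.

End components.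

Lemma continuous_nearP {R : realType} {T : topologicalType} (f : T -> R) x :
  {for x, continuous f} <-> forall e, 0 < e -> \forall y \near x, `|f x - f y| <= e.
Proof. exact: cvgrPdist_le. Qed.

Lemma third_eq {R : realType} (a p q : R) :
  `|a - p| <= `|p - q| / 3 -> `|a - q| <= `|p - q| / 3 -> p = q.
Proof.
move=> h1 h2; apply/eqP; rewrite -subr_eq0 -normr_le0.
have : `|p - q| <= `|p - a| + `|a - q| by rewrite -{1}(subrKA a p) ler_normD.
by rewrite [`|p - a|]distrC; lra.
Qed.

(** * Symmetry of mixed derivatives *)

Section schwarz.
Context {R : realType} {n : nat} (U : set 'rV[R]_n).
Hypothesis oU : open U.

(** Both mixed derivatives are limits of the same second difference quotient, which is symmetric in
    i and j. *)
Lemma schwarz (f : 'rV[R]_n -> R) (i j : 'I_n) x : smooth_on U f -> U x ->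
  partial i (partial j f) x = partial j (partial i f) x.
Proof.
move=> sf Ux.
(* Two applications of the mean value theorem, along ['e_a] to the difference g and then along
   ['e_b], turn the second difference into [t ^+ 2] times a mixed derivative at a point near x. *)
have key (a b : 'I_n) (e : R) : 0 < e -> exists2 d, 0 < d & forall t : R, 0 < t -> t < d ->
    `|(f (t *: 'e_a + (t *: 'e_b + x)) - f (t *: 'e_b + x) - (f (t *: 'e_a + x) - f x)) / t ^+ 2
      - partial b (partial a f) x| <= e.
  move=> e0.
  have cp : {for x, continuous (partial b (partial a f))} by exact: (sf [:: b; a] x Ux).1.
  have A : \forall y \near x, U y /\ `|partial b (partial a f) y - partial b (partial a f) x| <= e.
    apply: near_and; first exact: (near_open oU Ux (fun y Uy => Uy)).
    by have /cvgrPdistC_le := cp; exact.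
  move/nbhs_normP : A => [d /= d0 H].
  exists (d / 2) => [|t t0 td]; first by rewrite divr_gt0.
  have nrm (s s' : R) : `|s| <= t -> `|s'| <= t ->
      `|x - (s *: 'e_a + (s' *: 'e_b + x))| < d.
    move=> st s't; rewrite addrA opprD addrCA subrr addr0 normrN (le_lt_trans (ler_normD _ _))//.
    rewrite (splitr d) ltrD// normrZ; apply: le_lt_trans td.
      apply: (le_trans _ st); rewrite ler_piMr// norm_le_coord// => k.
      by rewrite !mxE; case: (_ && _); rewrite ?normr0 ?normr1.
    apply: (le_trans _ s't); rewrite ler_piMr// norm_le_coord// => k.
    by rewrite !mxE; case: (_ && _); rewrite ?normr0 ?normr1.
  have t0' : `|t| = t by rewrite gtr0_norm.
  pose g y := f (t *: 'e_b + y) - f y.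
  have dgx s : `|s| <= `|t| -> is_derive (s *: 'e_a + x) 'e_a g
     (partial a f (t *: 'e_b + (s *: 'e_a + x)) - partial a f (s *: 'e_a + x)).
    rewrite t0' => st.
    have U1 : U (t *: 'e_b + (s *: 'e_a + x)).
      have tt : `|t| <= t by rewrite t0'.
      by have [] := H _ (nrm _ _ st tt); rewrite addrCA.
    have U2 : U (s *: 'e_a + x).
      have n0 : `|0 : R| <= t by rewrite normr0 ltW.
      by have [] := H _ (nrm _ _ st n0); rewrite scale0r add0r.
    apply: is_deriveB; last by apply: derivableP; exact: (sf [::] _ U2).2.
    have dd := (sf [::] _ U1).2 a.
    have E : (fun h : R => h^-1 *: (((fun y => f (t *: 'e_b + y)) \o shift (s *: 'e_a + x)) (h *: 'e_a) -
        f (t *: 'e_b + (s *: 'e_a + x)))) =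
      (fun h : R => h^-1 *: ((f \o shift (t *: 'e_b + (s *: 'e_a + x))) (h *: 'e_a) -
        f (t *: 'e_b + (s *: 'e_a + x)))).
      by apply/funext => h /=; rewrite [t *: _ + (h *: _ + _)]addrCA.
    by apply: DeriveDef; rewrite /derivable /derive E.
  have [s st E1] := @mvt_line _ _ g x 'e_a t (fun s st => (@ex_derive _ _ _ _ _ _ _ (dgx s st))).
  move: (E1); rewrite (@derive_val _ _ _ _ _ _ _ (dgx s st)) => E2.
  have [|s' s't E3] := @mvt_line _ _ (partial a f) (s *: 'e_a + x) 'e_b t.
    rewrite t0' => s'; move=> s't.
    have st' : `|s| <= t by rewrite -t0'.
    have [U1 _] := H _ (nrm _ _ st' s't).
    rewrite addrCA in U1.
    have sp := smooth_on_partial a sf.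
    exact: (sp [::] _ U1).2.
  rewrite t0' in st s't.
  have -> : f (t *: 'e_a + (t *: 'e_b + x)) - f (t *: 'e_b + x) - (f (t *: 'e_a + x) - f x) =
     t ^+ 2 * partial b (partial a f) (s *: 'e_a + (s' *: 'e_b + x)).
    rewrite expr2 -mulrA [s *: _ + _]addrCA -[t * partial _ _ _]E3 -E2 /g.
    by rewrite [t *: 'e_b + (_ + _)]addrCA; ring.
  rewrite mulrC mulKf ?expf_neq0 ?gt_eqF//.
  by have [] := H _ (nrm _ _ st s't).
apply/eqP/negP => /negP ne.
(* If the derivatives differed by e, a single number would lie within e/3 of both. *)
pose e := `|partial i (partial j f) x - partial j (partial i f) x|.
have e0 : 0 < e / 3 by rewrite divr_gt0// normr_gt0 subr_eq0.
have [d d0 H1] := key i j _ e0; have [d' d'0 H2] := key j i _ e0.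
pose t := Num.min d d' / 2.
have t0 : 0 < t by rewrite divr_gt0// lt_min d0.
have tm : t < Num.min d d' by rewrite ltr_pdivrMr// ltr_pMr ?lt_min ?d0// ltr1n.
have td : t < d by apply: lt_le_trans tm _; rewrite ge_min lexx.
have td' : t < d' by apply: lt_le_trans tm _; rewrite ge_min lexx orbT.
have {H1} := H1 t t0 td; have {H2} := H2 t t0 td'.
rewrite [t *: 'e_j + (_ + _)]addrCA.
set A := (_ / t ^+ 2); set B := (_ / t ^+ 2) => h1 h2.
have AB : A = B by rewrite /A /B; congr (_ / _); ring.
rewrite -AB /e in h1 h2; clear AB B key e0 td td' tm t0; clearbody A t.
move: (partial i (partial j f) x) (partial j (partial i f) x) ne h1 h2 => p q ne h1 h2.
by move/eqP : ne; apply; exact: third_eq h1 h2.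
Qed.

End schwarz.

(** * Derivatives of products and determinants *)

Section big_derive.
Context {R : realType} {V : normedModType R}.

Lemma is_derive_bigsum (I : Type) (r : seq I) (h dh : I -> _) (x v : V) :
  (forall i, is_derive x v (h i : V -> R) (dh i : R)) ->
  is_derive x v (fun y => \sum_(i <- r) h i y) (\sum_(i <- r) dh i).
Proof.
move=> d; elim: r => [|i r IH].
  rewrite big_nil (_ : (fun _ => _) = cst 0); first exact: is_derive_cst.
  by apply/funext => y; rewrite big_nil.
rewrite big_cons (_ : (fun _ => _) = h i + (fun y => \sum_(j <- r) h j y)).
  exact: is_deriveD.
by apply/funext => y; rewrite big_cons.
Qed.

Lemma is_derive_bigprod (I : eqType) (r : seq I) (h dh : I -> _) (x v : V) : uniq r ->
  (forall i, is_derive x v (h i : V -> R) (dh i : R)) ->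
  is_derive x v (fun y => \prod_(i <- r) h i y)
    (\sum_(i <- r) dh i * \prod_(j <- r | j != i) h j x).
Proof.
move=> + d; elim: r => [_|i r IH /= /andP[ir ur]].
  rewrite big_nil (_ : (fun _ => _) = cst 1); first exact: is_derive_cst.
  by apply/funext => y; rewrite big_nil.
rewrite (_ : (fun _ => _) = h i * (fun y => \prod_(j <- r) h j y)); last first.
  by apply/funext => y; rewrite big_cons.
apply: (is_derive_eq (is_deriveM (d i) (IH ur))).
rewrite big_cons addrC; congr (_ + _).
  rewrite big_cons eqxx mulrC; congr (_ * _); rewrite [LHS]big_seq [RHS]big_seq_cond.
  by apply: eq_bigl => j; case: (boolP (j \in r)) => //= jr; apply/esym; apply: contraNneq ir => <-.
rewrite [in LHS]/GRing.scale/= mulr_sumr [LHS]big_seq [RHS]big_seq; apply: eq_bigr => j jr.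
rewrite big_cons mulrCA; case: eqP => // ij.
by move: ir; rewrite ij jr.
Qed.

(** Jacobi's formula at a point where A is the identity: only the identity permutation
    contributes. *)
Lemma is_derive_det1 n (A : V -> 'M[R]_n) (dA : 'M[R]_n) (x v : V) : A x = 1%:M ->
  (forall i j, is_derive x v (fun y => A y i j) (dA i j)) ->
  is_derive x v (fun y => \det (A y)) (\tr dA).
Proof.
move=> A1 d; rewrite /determinant.
pose f (s : 'S_n) := fun i => fun y => A y i (s i).
have df (s : 'S_n) : is_derive x v (fun y => (-1) ^+ s * \prod_(i < n) A y i (s i))
   (if s == 1%g then \tr dA else 0).
  have dp := @is_derive_bigprod _ (index_enum 'I_n) (f s) (fun i => dA i (s i)) x v
    (index_enum_uniq _) (fun i => d i (s i)).
  have E : (fun y => (-1) ^+ s * \prod_(i < n) A y i (s i)) =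
    ((-1) ^+ s) \*: (fun y => \prod_(i < n) A y i (s i)) by [].
  rewrite E; apply: (is_derive_eq (is_deriveZ _ dp)).
  rewrite [LHS]/GRing.scale/=; case: eqP => [->|s1].
    rewrite odd_perm1 expr0 mul1r; apply: eq_bigr => i _.
    rewrite perm1 big1 ?mulr1// => j _.
    by rewrite /f A1 perm1 mxE eqxx.
  (* The product rule spares one factor i, but a permutation other than the identity moves some j
     other than i, and the factor at j vanishes at x. *)
  rewrite big1 ?mulr0// => i _.
  suff [j ji js] : exists2 j, j != i & s j != j.
    by rewrite (bigD1 j)//= /f A1 mxE eq_sym (negPf js) mul0r mulr0.
  apply: contrapT => H; apply: s1; apply/permP => j; rewrite perm1.
  have fixj k : k != i -> s k = k.
    by move=> ki; apply/eqP/negP => /negP sk; apply: H; exists k.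
  have [->|ji] := eqVneq j i; last exact: fixj.
  apply/eqP/negP => /negP si.
  by have /perm_inj si' := fixj _ si; move: si; rewrite si' eqxx.
have := is_derive_bigsum (index_enum {perm 'I_n}) df.
by rewrite -big_mkcond big_pred1_eq.
Qed.

End big_derive.

Lemma cauchy_limit {R : realType} (u : nat -> R) :
  (forall e, 0 < e -> exists N, forall k l, (N <= k)%N -> (N <= l)%N -> `|u k - u l| <= e) ->
  forall e N, (forall k l, (N <= k)%N -> (N <= l)%N -> `|u k - u l| <= e) ->
  forall k, (N <= k)%N -> `|u k - lim (u @ \oo)| <= e.
Proof.
move=> cu e N HN k Nk.
have c : cvg (u @ \oo).
  apply/cauchy_cvgP; apply: cauchy_exP => d d0.
  have d20 : 0 < d / 2 by rewrite divr_gt0.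
  have [M HM] := cu _ d20; exists (u M); exists M => // l /= Ml.
  rewrite /ball/=; apply: le_lt_trans (HM _ _ (leqnn _) Ml) _.
  by rewrite ltr_pdivrMr// ltr_pMr// ltr1n.
apply/ler_addgt0Pr => d d0.
have /cvgrPdist_le /(_ d d0) [M _ HM] : u @ \oo --> lim (u @ \oo) := c.
pose l := maxn M N.
rewrite -(subrKA (u l)) (le_trans (ler_normD _ _))// lerD//.
  by apply: HN; rewrite ?leq_maxr.
by rewrite distrC; apply: HM; rewrite /= leq_maxl.
Qed.

(** * Limits under locally uniform convergence of all derivatives *)

Section smooth_limit.
Context {R : realType} {n : nat} (U : set 'rV[R]_n).
Hypothesis oU : open U.
Variable v : nat -> 'rV[R]_n -> R.
Hypothesis sv : forall k, smooth_on U (v k).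
Hypothesis cv : forall s x, U x -> exists V, nbhs x V /\ forall e, 0 < e ->
  exists N, forall k l y, (N <= k)%N -> (N <= l)%N -> V y ->
    `|partials s (v k) y - partials s (v l) y| <= e.

Let G s x := lim (partials s (v k) x @[k --> \oo]).

Let GP s x : U x -> exists V, nbhs x V /\ forall e, 0 < e ->
  exists N, forall k y, (N <= k)%N -> V y -> `|partials s (v k) y - G s y| <= e.
Proof.
move=> /(cv s) [V [nV H]]; exists V; split=> // e e0.
have [N HN] := H _ e0; exists N => k y Nk Vy.
apply: (@cauchy_limit _ (fun k => partials s (v k) y)) Nk; last by move=> k' l ? ?; exact: HN.
by move=> d /H [M HM]; exists M => k' l ? ?; exact: HM.
Qed.

Let G_continuous s x : U x -> {for x, continuous (G s)}.
Proof.
move=> Ux; have [V [nV H]] := GP s Ux.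
apply/continuous_nearP => e e0.
have e30 : 0 < e / 3 by rewrite divr_gt0.
have [N HN] := H _ e30.
have c : {for x, continuous (partials s (v N))} := (sv N s Ux).1.
have nc : \forall y \near x, `|partials s (v N) x - partials s (v N) y| <= e / 3.
  by move/continuous_nearP : c; exact.
apply: filterS2 (nV) nc => y Vy hy.
have h1 := HN _ _ (leqnn N) Vy.
have h2 := HN _ _ (leqnn N) (nbhs_singleton nV).
rewrite -(subrKA (partials s (v N) x)) (le_trans (ler_normD _ _))//.
rewrite -[X in _ + `|X|](subrKA (partials s (v N) y)).
have -> : e = e / 3 + (e / 3 + e / 3) by lra.
by rewrite lerD// ?[`|G s x - _|]distrC// (le_trans (ler_normD _ _))// lerD.
Qed.

Let quotient_bound (a b c p q r t e : R) : `|p - b| <= e -> `|q - c| <= e ->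
  `|r - t| <= e -> `|a - t| <= e -> p - q = r -> `|a - (b - c)| <= 4 * e.
Proof. by rewrite !ler_norml => /andP[? ?] /andP[? ?] /andP[? ?] /andP[? ?] ?; apply/andP; split; lra. Qed.

(** The mean value theorem is applied to [v k], not to the limit, and k is chosen after the
    increment h: values must be known up to e/4 times the size of h to survive the division by h. *)
Let G_derive s x i : U x -> is_derive x 'e_i (G s) (G (i :: s) x).
Proof.
move=> Ux.
have lim : (fun h => h^-1 *: ((G s \o shift x) (h *: 'e_i) - G s x)) @ 0^' --> G (i :: s) x.
  apply/cvgrPdist_le => e e0.
  have e40 : 0 < e / 4 by rewrite divr_gt0.
  have [V [nV HV]] := GP (i :: s) Ux; have [N HN] := HV _ e40.
  have nc : \forall y \near x, `|G (i :: s) x - G (i :: s) y| <= e / 4.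
    by have /continuous_nearP := @G_continuous (i :: s) x Ux; exact.
  have : \forall y \near x, (U y /\ V y) /\ `|G (i :: s) x - G (i :: s) y| <= e / 4.
    by apply: near_and => //; apply: near_and => //; exact: (near_open oU Ux (fun _ => id)).
  move=> /nbhs_normP [d /= d0 Hd].
  have nh : \forall h \near (0 : R)^', h != 0 /\ `|h| < d.
    by near=> h; split; near: h; [exact: nbhs_dnbhs_neq|exact: dnbhs0_lt].
  apply: filterS nh => h [h0 hd].
  have inb (t : R) : `|t| <= `|h| -> ball_ Num.Def.normr x d (t *: 'e_i + x).
    move=> th; rewrite /ball_/= opprD addrCA subrr addr0 normrN normrZ.
    apply: le_lt_trans hd; apply: le_trans th; rewrite ler_piMr// norm_le_coord// => k.
    by rewrite !mxE; case: (_ && _); rewrite ?normr0 ?normr1.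
  have eh0 : 0 < e / 4 * `|h| by rewrite mulr_gt0// normr_gt0.
  have Uh : U (h *: 'e_i + x) by have [[]] := Hd _ (inb h (lexx _)).
  have [V1 [nV1 HV1]] := GP s Uh; have [N1 HN1] := HV1 _ eh0.
  have [V2 [nV2 HV2]] := GP s Ux; have [N2 HN2] := HV2 _ eh0.
  (* One index for three estimates: the derivative near x, the value at the shifted point, and the
     value at x. *)
  pose k := maxn N (maxn N1 N2).
  have [t th E] : exists2 t : R, `|t| <= `|h| & partials s (v k) (h *: 'e_i + x) - partials s (v k) x =
      h * partials (i :: s) (v k) (t *: 'e_i + x).
    have [|t th E] := @mvt_line _ _ (partials s (v k)) x 'e_i h; last by exists t.
    by move=> t /inb /Hd [[Ut _] _]; exact: (sv k s Ut).2.
  have [[Ut Vt] Gt] := Hd _ (inb t th).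
  have B1 := HN k _ (leq_maxl _ _) Vt.
  have B2 := HN1 k _ (leq_trans (leq_maxl _ _) (leq_maxr _ _)) (nbhs_singleton nV1).
  have B3 := HN2 k _ (leq_trans (leq_maxr _ _) (leq_maxr _ _)) (nbhs_singleton nV2).
  have B4 : `|h * (partials (i :: s) (v k) (t *: 'e_i + x) - G (i :: s) (t *: 'e_i + x))| <= e / 4 * `|h|.
    by rewrite normrM mulrC ler_pM2r// normr_gt0.
  have B5 : `|h * (G (i :: s) x - G (i :: s) (t *: 'e_i + x))| <= e / 4 * `|h|.
    by rewrite normrM mulrC ler_pM2r// normr_gt0.
  rewrite -[G (i :: s) x](mulKf h0) [h^-1 *: _]/(h^-1 * _) -mulrBr normrM normfV.
  rewrite mulrC ler_pdivrMr ?normr_gt0//=.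
  have -> : e * `|h| = 4 * (e / 4 * `|h|) by field.
  by rewrite !mulrBr in B4 B5; exact: quotient_bound B2 B3 B4 B5 E.
split; first by apply/cvg_ex; exists (G (i :: s) x).
exact: cvg_lim.
Unshelve. all: by end_near. Qed.

Let partials_limit s x : U x -> partials s (fun y => lim (v k y @[k --> \oo])) x = G s x.
Proof.
elim: s x => [//|i s IH] x Ux /=.
rewrite /partial (@near_eq_derive _ _ _ _ (G s)); last by apply: (near_open oU Ux) => y; exact: IH.
exact: (@derive_val _ _ _ _ _ _ _ (G_derive s i Ux)).
Qed.

Lemma smooth_on_limit : smooth_on U (fun y => lim (v k y @[k --> \oo])).
Proof.
move=> s x Ux.
have nE : \forall y \near x, G s y = partials s (fun y => lim (v k y @[k --> \oo])) y.
  by apply: (near_open oU Ux) => y Uy; rewrite partials_limit.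
split=> [|i]; last by apply: near_eq_derivable nE _; have [] := G_derive s i Ux.
rewrite /prop_for /continuous_at partials_limit//.
by apply: cvg_trans (near_eq_cvg nE) _; exact: G_continuous.
Qed.

Lemma smooth_on_limit_cvg s x : U x -> exists V, nbhs x V /\ forall e, 0 < e ->
  exists N, forall k y, (N <= k)%N -> V y ->
    `|partials s (v k) y - partials s (fun y => lim (v k y @[k --> \oo])) y| <= e.
Proof.
move=> Ux; have [V [nV H]] := GP s Ux; exists (V `&` U); split.
  by apply: filterI => //; exact: open_nbhs_nbhs.
move=> e /H [N HN]; exists N => k y Nk [Vy Uy].
by rewrite partials_limit//; exact: HN.
Qed.

End smooth_limit.

(** * Invariant mean on a compact group *)

Lemma continuous_sum {R : realType} {T : topologicalType} {I : Type} (r : seq I) (h : I -> T -> R) x :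
  (forall i, {for x, continuous (h i)}) -> {for x, continuous (fun y => \sum_(i <- r) h i y)}.
Proof.
move=> ch; elim: r => [|i r IH].
  by rewrite (_ : (fun _ => _) = cst 0); [exact: cst_continuous|apply/funext => y; rewrite big_nil].
rewrite (_ : (fun _ => _) = h i \+ (fun y => \sum_(j <- r) h j y)); first exact: continuousD.
by apply/funext => y; rewrite big_cons.
Qed.

Section cts.
Context {R : realType} {T : topologicalType}.
Implicit Types (f g : T -> R).

Lemma cts_add f g : continuous f -> continuous g -> continuous (fun x => f x + g x).
Proof. by move=> cf cg x; exact: (continuousD (cf x) (cg x)). Qed.

Lemma cts_mul f g : continuous f -> continuous g -> continuous (fun x => f x * g x).
Proof. by move=> cf cg x; exact: (continuousM (cf x) (cg x)). Qed.

Lemma cts_opp f : continuous f -> continuous (fun x => - f x).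
Proof. by move=> cf x; exact: (continuousN (cf x)). Qed.

Lemma cts_cst (c : R) : continuous (fun _ : T => c).
Proof. exact: cst_continuous. Qed.

Lemma cts_scale (c : R) f : continuous f -> continuous (fun x => c * f x).
Proof. by apply: cts_mul; exact: cts_cst. Qed.

Lemma cts_sum {I : Type} (r : seq I) (h : I -> T -> R) :
  (forall i, continuous (h i)) -> continuous (fun y => \sum_(i <- r) h i y).
Proof. by move=> ch x; apply: continuous_sum => i; exact: ch. Qed.

End cts.

Section mean.
Context {R : realType} {n : nat} {G : lieGroupType R n}.
Hypothesis cG : compact [set: G].
Implicit Types (f g : G -> R) (A B : seq G) (x y a b : G).

Definition average A f x : R := (size A)%:R^-1 * \sum_(a <- A) f (a * x)%g.

(** The parameter q lets one finite set of translates serve a whole family of functions, as Fubini's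
    theorem and the smoothness of convolutions require. *)
Definition uniformly_equicontinuous {Y} (F : G -> Y -> R) := forall e : R, 0 < e ->
  exists V, nbhs (1%g : G) V /\ forall x v q, V v -> `|F (x * v)%g q - F x q| <= e.

Lemma mulg_continuous_l a : continuous (fun x : G => a * x)%g.
Proof.
move=> x; apply: (@continuous_comp _ _ _ (fun y : G => (a, y)) (fun p : G * G => p.1 * p.2)%g).
  by apply: cvg_pair; [exact: cvg_cst|exact: cvg_id].
exact: mulg_continuous.
Qed.

Lemma mulg_continuous_r a : continuous (fun x : G => x * a)%g.
Proof.
move=> x; apply: (@continuous_comp _ _ _ (fun y : G => (y, a)) (fun p : G * G => p.1 * p.2)%g).
  by apply: cvg_pair; [exact: cvg_id|exact: cvg_cst].
exact: mulg_continuous.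
Qed.

Lemma near_mulVg x (V : set G) : nbhs (1%g : G) V -> \forall y \near x, V (x^-1 * y)%g.
Proof. by move=> nV; apply: (@mulg_continuous_l x^-1%g x); rewrite mulVg. Qed.

Lemma uniformly_equicontinuous_near {Y} (F : G -> Y -> R) x e :
  uniformly_equicontinuous F -> 0 < e ->
  \forall x' \near x, forall q, `|F x q - F x' q| <= e.
Proof.
move=> uF /uF [V [nV HV]]; apply: filterS (near_mulVg x nV) => x' Vx' y.
by rewrite distrC -{1}[x'](mulKVg x); exact: HV.
Qed.

Lemma uniformly_equicontinuous_cts {Y} (F : G -> Y -> R) q :
  uniformly_equicontinuous F -> continuous (fun x => F x q).
Proof.
move=> uF x; apply/continuous_nearP => e e0.
by apply: filterS (uniformly_equicontinuous_near x uF e0) => x' /(_ q).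
Qed.

(** The error vanishes at v = 1, so it is small on a neighbourhood of each point; the near-covering
    form of compactness of the product makes v uniform. *)
Lemma joint_equicontinuous {K : topologicalType} (F : G -> K -> R) : compact [set: K] ->
  continuous (fun p : G * K => F p.1 p.2) -> uniformly_equicontinuous F.
Proof.
move=> cK cF e e0.
have := compact_setX cG cK; rewrite setXTT => /compact_near_coveringP cov.
pose P (v : G) (p : G * K) := `|F (p.1 * v)%g p.2 - F p.1 p.2| <= e.
have nV : \forall v \near (1%g : G), [set: G * K] `<=` (fun p => P v p).
  apply: cov => p _; pose h (q : (G * K) * G) := F (q.1.1 * q.2)%g q.1.2 - F q.1.1 q.1.2.
  have ch : continuous h.
    move=> q; apply: continuousB.
      apply: (@continuous_comp _ _ _ (fun q : (G * K) * G => ((q.1.1 * q.2)%g, q.1.2))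
        (fun p : G * K => F p.1 p.2)); last exact: cF.
      apply: cvg_pair.
        apply: (@continuous_comp _ _ _ (fun q : (G * K) * G => (q.1.1, q.2))
          (fun p : G * G => p.1 * p.2)%g); last exact: mulg_continuous.
        apply: cvg_pair; last exact: cvg_snd.
        by apply: (@continuous_comp _ _ _ fst fst); [exact: cvg_fst|exact: cvg_fst].
      by apply: (@continuous_comp _ _ _ fst snd); [exact: cvg_fst|exact: cvg_snd].
    by apply: (@continuous_comp _ _ _ fst (fun p : G * K => F p.1 p.2)); [exact: cvg_fst|exact: cF].
  have /continuous_nearP /(_ e e0) := ch (p, 1%g).
  have -> : h (p, 1%g) = 0 by rewrite /h /= mulg1 subrr.
  apply: filterS => -[q v].
  by rewrite /P /h sub0r normrN.
exists [set v | [set: G * K] `<=` (fun p => P v p)]; split=> // x v q Vv.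
exact: (Vv (x, q) I).
Qed.

Lemma cts_bounded f : continuous f -> exists M, forall x, `|f x| <= M.
Proof.
move=> cf; have [x _ H] := @compact_EVT_max _ _ (fun x => `|f x|) [set: G] (ex_intro _ 1%g I) cG
  (continuous_subspaceT (fun x => @continuous_comp _ _ _ f Num.norm x (cf x) (@norm_continuous _ _ _))).
by exists `|f x| => y; apply: H; rewrite in_setT.
Qed.

Lemma translates_cover (V : set G) : nbhs (1%g : G) V ->
  exists A, forall x, exists2 a, a \in A & V (a * x)%g.
Proof.
(* The filter of finite sequences that eventually contain any given points turns the near-covering
   property into the choice of a finite subcover. *)
move=> nV; pose D := filter_from [set: seq G] (fun A0 => [set A : seq G | {subset A0 <= A}]).
have FD : Filter D.
  apply: filter_from_filter; first by exists [::].
  move=> A1 A2 _ _; exists (A1 ++ A2) => // A sA.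
  by split=> a aA; apply: sA; rewrite mem_cat aA ?orbT.
have /compact_near_coveringP cov := cG.
have [A0 _ HA0] : \forall A \near D, [set: G] `<=` [set x | exists2 a, a \in A & V (a * x)%g].
  apply: cov => x _; exists ((fun x' => V (x^-1 * x')%g), [set A : seq G | x^-1%g \in A]).
    split; first exact: near_mulVg.
    by exists [:: x^-1%g] => // A; apply; rewrite mem_head.
  by move=> [x' A] [/= Vx' xA]; exists x^-1%g.
by exists A0 => x; exact: (HA0 A0 (fun _ => id) x I).
Qed.

Lemma average_comp A B f x :
  average A (average B f) x = average [seq (b * a)%g | a <- A, b <- B] f x.
Proof.
rewrite /average size_allpairs natrM invfM -mulrA; congr (_ * _).
rewrite big_allpairs_dep /= mulr_sumr; apply: eq_bigr => a _; congr (_ * _).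
by apply: eq_bigr => b _; rewrite mulgA.
Qed.

Lemma average_le A f g x : (forall a, f (a * x)%g <= g (a * x)%g) ->
  average A f x <= average A g x.
Proof. by move=> fg; rewrite ler_wpM2l ?invr_ge0//; apply: ler_sum. Qed.

Lemma average_cst A c x : A != [::] -> average A (cst c) x = c.
Proof.
move=> A0; rewrite /average /= big_const_seq count_predT iter_addr_0 -[c *+ _]mulr_natl.
by rewrite mulKf// pnatr_eq0 size_eq0.
Qed.

Lemma average_add A f g x : average A (f \+ g) x = average A f x + average A g x.
Proof. by rewrite /average big_split mulrDr. Qed.

Lemma average_near A f c e x : A != [::] -> (forall y, `|f y - c| <= e) ->
  `|average A f x - c| <= e.
Proof.
move=> A0 fc; rewrite ler_distl -(average_cst (c - e) x A0) -(average_cst (c + e) x A0).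
by apply/andP; split; apply: average_le => a; have := fc (a * x)%g; rewrite ler_distl => /andP[].
Qed.

Lemma average_oscillation A (f : G -> R) (V : set G) (w e : R) :
  (forall x, exists2 a, a \in A & V (a * x)%g) ->
  (forall x y, f x - f y <= w) -> (forall v, V v -> `|f v - f 1%g| <= e) ->
  forall x y, average A f x - average A f y <= (1 - (size A)%:R^-1) * w + (size A)%:R^-1 * (2 * e).
Proof.
move=> cA fw fe x y; set N := size A.
pose t (k : 'I_N) := tnth (in_tuple A) k.
have avE z : average A f z = N%:R^-1 * \sum_(k < N) f (t k * z)%g.
  by rewrite /average (big_tnth _ _ A).
have ex z : exists k : 'I_N, V (t k * z)%g.
  have [a /(nthP 1%g) [k kN <-] Va] := cA z.
  by exists (Ordinal kN); rewrite /t (tnth_nth 1%g).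
have [i Vi] := ex x; have [j Vj] := ex y.
have N0 : (N%:R : R) != 0 by rewrite pnatr_eq0 -lt0n (leq_ltn_trans _ (ltn_ord i)).
(* The net effect is to apply the transposition of i and j to the sum at y only, which pairs
   [t i * x] with [t j * y]. *)
rewrite !avE -mulrBr (reindex_inj (@perm_inj _ (tperm i j)))/= [X in _ - X](reindex_inj (@perm_inj _ (tperm i j)))/=.
rewrite [X in X - _](reindex_inj (@perm_inj _ (tperm i j)))/=.
under [X in X - _]eq_bigr do rewrite tpermK.
rewrite -sumrB (bigD1 i)//= tpermL.
have -> : (1 - N%:R^-1) * w + N%:R^-1 * (2 * e) = N%:R^-1 * (2 * e + (N%:R - 1) * w) by field.
rewrite ler_wpM2l ?invr_ge0// lerD//.
  have := fe _ Vi; have := fe _ Vj; rewrite !ler_norml => /andP[? ?] /andP[? ?].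
  lra.
apply: (@le_trans _ _ (\sum_(k < N | k != i) w)); first by apply: ler_sum.
have := sumr_const 'I_N w; rewrite (bigD1 i)//= card_ord -[w *+ N]mulr_natl => E.
by rewrite mulrBl mul1r -E [w + _]addrC addrK.
Qed.

Section family.
Context {Y : Type} (F : G -> Y -> R).
Hypothesis uF : uniformly_equicontinuous F.
Hypothesis bF : exists M, forall x q, `|F x q| <= M.

(** By the contraction, an achievable bound w yields the achievable bound
    [(1 - c) * w + c * (2 * (e / 3))], with c the inverse size of a fixed cover; the infimum of the
    achievable bounds cannot exceed the fixed point [2 * (e / 3)]. *)
Lemma exists_average_oscillation e : 0 < e -> exists2 A, A != [::] & forall x x' q,
  average A (F^~ q) x - average A (F^~ q) x' <= e.
Proof.
move=> e0; have e30 : 0 < e / 3 by rewrite divr_gt0.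
have [V [nV HV]] := uF e30; have [A cA] := translates_cover nV.
have A0 : A != [::] by have [a aA _] := cA 1%g; apply: contraTneq aA => ->.
pose W := [set w | 0 <= w /\ exists2 B, B != [::] & forall x x' q,
  average B (F^~ q) x - average B (F^~ q) x' <= w].
have W0 : W !=set0.
  have [B FB] := bF; exists (Num.max 0 (B + B)); split; first by rewrite le_max lexx.
  exists [:: 1%g] => // x x' y; rewrite /average !big_seq1 !mul1g invr1 !mul1r le_max.
  apply/orP; right.
  have := FB x y; have := FB x' y; rewrite !ler_norml => /andP[? ?] /andP[? ?]; lra.
have lW : has_inf W by split => //; exists 0 => w [].
have step w : W w -> W ((1 - (size A)%:R^-1) * w + (size A)%:R^-1 * (2 * (e / 3))).
  move=> [w0 [B B0 HB]]; split.
    have sA : (0 < size A)%N by rewrite lt0n size_eq0.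
    have c1 : 0 <= 1 - (size A)%:R^-1 :> R by rewrite subr_ge0 invf_le1 ?ler1n ?ltr0n.
    by rewrite addr_ge0// mulr_ge0// ?invr_ge0 ?mulr_ge0 ?ltW.
  exists [seq (b * a)%g | a <- A, b <- B].
    by rewrite -size_eq0 size_allpairs muln_eq0 !size_eq0 negb_or A0.
  move=> x x' y; rewrite -!average_comp; apply: average_oscillation cA _ _ _ _.
    by move=> z z'; exact: HB.
  move=> v Vv; rewrite /average -mulrBr -sumrB.
  rewrite normrM ger0_norm ?invr_ge0//.
  rewrite -[leRHS](average_cst (e / 3) 1%g B0) ler_wpM2l ?invr_ge0//.
  apply: le_trans (ler_norm_sum _ _ _) _; apply: ler_sum => b _.
  by rewrite mulg1; exact: HV.
pose c := (size A)%:R^-1 : R.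
have c0 : 0 < c by rewrite invr_gt0 ltr0n lt0n size_eq0.
have infle w : W w -> inf W <= w by move=> Ww; apply: ge_inf => //; exists 0 => ? [].
have : inf W <= 2 * (e / 3).
  rewrite leNgt; apply/negP => lt.
  have d0 : 0 < c * (inf W - 2 * (e / 3)) by rewrite mulr_gt0// subr_gt0.
  have [w Ww wlt] := inf_adherent d0 lW.
  have := infle _ (step w Ww); rewrite -/c leNgt => /negP; apply.
  have c1 : c <= 1 by rewrite invf_le1 ?ler1n ?ltr0n lt0n size_eq0.
  nra.
move=> infW; have [w [w0 [B B0 HB]] wlt] := inf_adherent e30 lW.
exists B => // x x' y; apply: le_trans (HB x x' y) _.
by apply: ltW; apply: lt_le_trans wlt _; lra.
Qed.

End family.

Lemma cts_equicontinuous f : continuous f -> uniformly_equicontinuous (fun x (_ : unit) => f x).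
Proof.
move=> cf e e0; have [|V [nV HV]] := @joint_equicontinuous G (fun x _ => f x) cG _ e e0.
  by move=> p; apply: (@continuous_comp _ _ _ fst f); [exact: cvg_fst|exact: cf].
by exists V; split=> // x v _ Vv; exact: (HV x v 1%g).
Qed.

Lemma cts_translate_l f a : continuous f -> continuous (fun x => f (a * x)%g).
Proof.
by move=> cf x; apply: (@continuous_comp _ _ _ (fun x => a * x)%g f);
   [exact: mulg_continuous_l|exact: cf].
Qed.

Lemma cts_translate_r f a : continuous f -> continuous (fun x => f (x * a)%g).
Proof.
by move=> cf x; apply: (@continuous_comp _ _ _ (fun x => x * a)%g f);
   [exact: mulg_continuous_r|exact: cf].
Qed.

Lemma cts_inv f : continuous f -> continuous (fun x => f x^-1%g).
Proof.
by move=> cf x; apply: (@continuous_comp _ _ _ (fun x => x^-1)%g f);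
   [exact: invg_continuous|exact: cf].
Qed.

Lemma exists_average_oscillation1 f (e : R) : continuous f -> 0 < e ->
  exists2 A, A != [::] & forall x y, average A f x - average A f y <= e.
Proof.
move=> cf e0; have [M HM] := cts_bounded cf.
have [|A A0 HA] := exists_average_oscillation (cts_equicontinuous cf) _ e0.
  by exists M => x _; exact: HM.
by exists A => // x y; exact: HA tt.
Qed.

(* The Haar integral of a continuous function: averages over suitable finite sets
   of translates oscillate arbitrarily little, and mean f is their common limit. *)
Definition mean f : R := sup [set r | exists2 A, A != [::] & forall x, r <= average A f x].

(** Left averages commute with right averages. Passing to inverses gives a right average h of f with
    small oscillation, nearly a constant; left averages of h over [A] and over a competitor [A'] are
    close to that constant, so a competitor in the supremum exceeds [average A f x] by at most e. *)
Lemma average_mean_near f A (e : R) : continuous f -> A != [::] ->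
  (forall x y, average A f x - average A f y <= e) ->
  forall x, `|average A f x - mean f| <= e.
Proof.
move=> cf A0 oA x; rewrite /mean; set S := [set r | _].
have S_sub : S (average A f x - e) by exists A => // y; have := oA x y; lra.
have up r : S r -> r <= average A f x + e.
  move=> [A' A'0 rA']; apply/ler_addgt0Pr => d d0.
  have d20 : 0 < d / 2 by rewrite divr_gt0.
  have [B B0 oB] := exists_average_oscillation1 (cts_inv cf) d20.
  pose h y := average B (fun x => f x^-1%g) y^-1%g.
  have oh y z : h y - h z <= d / 2 by exact: oB.
  have hE A1 y : average A1 h y = average B (fun b => average A1 f (y * b^-1)%g) 1%g.
    rewrite /average /h /average -!mulr_sumr mulrCA exchange_big/=; congr (_ * (_ * _)).
    apply: eq_bigr => b _; apply: eq_bigr => a _.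
    by rewrite invgM invgK mulg1 mulgA.
  have h1 : r <= average A' h x.
    by rewrite hE -{1}(average_cst r 1%g B0); apply: average_le => b; exact: rA'.
  have h2 : average A' h x <= h 1%g + d / 2.
    rewrite -[leRHS](average_cst _ x A'0); apply: average_le => a.
    by have := oh (a * x)%g 1%g; rewrite /=; lra.
  have h3 : h 1%g - d / 2 <= average A h x.
    rewrite -[leLHS](average_cst _ x A0); apply: average_le => a.
    by have := oh 1%g (a * x)%g; rewrite /=; lra.
  have h4 : average A h x <= average A f x + e.
    rewrite hE -[leRHS](average_cst _ 1%g B0); apply: average_le => b.
    by have := oA (x * (b * 1)^-1)%g x; rewrite /=; lra.
  lra.
have S0 : S !=set0 by exists (average A f x - e).
have supS : sup S <= average A f x + e by apply: ge_sup.
have : average A f x - e <= sup S by apply: ub_le_sup => //; exists (average A f x + e).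
by rewrite ler_distl => ?; apply/andP; split; lra.
Qed.

Lemma mean_near f (e : R) : continuous f -> 0 < e ->
  exists2 A, A != [::] & forall x, `|average A f x - mean f| <= e.
Proof.
move=> cf e0; have [A A0 oA] := exists_average_oscillation1 cf e0.
by exists A => //; exact: average_mean_near.
Qed.

Lemma mean_unique f c : continuous f -> (forall e : R, 0 < e ->
  exists2 A, A != [::] & forall x, `|average A f x - c| <= e) -> mean f = c.
Proof.
move=> cf H; apply/eqP; rewrite -subr_eq0 -normr_le0; apply/ler_addgt0Pr => e e0.
have e30 : 0 < e / 3 by rewrite divr_gt0.
have [A A0 HA] := H _ e30.
have oA x y : average A f x - average A f y <= 2 * (e / 3).
  have := HA x; have := HA y; rewrite !ler_norml => /andP[? ?] /andP[? ?]; lra.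
have := average_mean_near cf A0 oA 1%g; have := HA 1%g.
rewrite add0r !ler_norml => /andP[? ?] /andP[? ?]; apply/andP; split; lra.
Qed.

Lemma mean_family {Y : Type} (F : G -> Y -> R) (e : R) : uniformly_equicontinuous F ->
  (exists M, forall x q, `|F x q| <= M) -> 0 < e ->
  exists2 A, A != [::] & forall x q, `|average A (F^~ q) x - mean (F^~ q)| <= e.
Proof.
move=> uF bF e0; have [A A0 oA] := exists_average_oscillation uF bF e0.
exists A => // x q; apply: average_mean_near => //.
exact: uniformly_equicontinuous_cts.
Qed.

Lemma mean_cst c : mean (cst c) = c.
Proof.
apply: mean_unique => [|e e0]; first exact: cst_continuous.
by exists [:: 1%g] => // x; rewrite average_cst// subrr normr0 ltW.
Qed.

Lemma cts_average f A : continuous f -> continuous (average A f).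
Proof.
move=> cf x; pose s B x : R := \sum_(a <- B) f (a * x)%g.
apply: (@continuousM _ _ (cst (size A)%:R^-1) (s A)); first exact: cst_continuous.
elim: A => [|a A IH].
  by rewrite (_ : s [::] = cst 0) ?/s; [exact: cst_continuous|apply/funext => y; rewrite big_nil].
rewrite (_ : s (a :: A) = (fun x => f (a * x)%g) \+ s A).
  by apply: continuousD IH; exact: cts_translate_l.
by apply/funext => y; rewrite /s big_cons.
Qed.

(** [A] settles f, then [B] is chosen for [average A g]; averaging once more over [B] does not spoil
    the estimate for f. *)
Lemma mean_add f g : continuous f -> continuous g -> mean (f \+ g) = mean f + mean g.
Proof.
move=> cf cg; apply: mean_unique => [x|e e0]; first by apply: continuousD; [exact: cf|exact: cg].
have e20 : 0 < e / 2 by rewrite divr_gt0.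
have [A A0 HA] := mean_near cf e20.
have [B B0 oB] := exists_average_oscillation1 (cts_average (A := A) cg) e20.
exists [seq (a * b)%g | b <- B, a <- A].
  by rewrite -size_eq0 size_allpairs muln_eq0 !size_eq0 negb_or A0 B0.
move=> x; rewrite -average_comp.
have -> : average A (f \+ g) = average A f \+ average A g.
  by apply/funext => y; rewrite average_add.
rewrite average_add (_ : _ - _ = (average B (average A f) x - mean f) +
  (average B (average A g) x - mean g)); last by ring.
rewrite (splitr e) (le_trans (ler_normD _ _))// lerD//; first exact: average_near.
rewrite average_comp; apply: average_mean_near => //.
  by rewrite -size_eq0 size_allpairs muln_eq0 !size_eq0 negb_or A0 B0.
by move=> y z; rewrite -!average_comp.
Qed.

Lemma mean_scale c f : continuous f -> mean (fun x => c * f x) = c * mean f.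
Proof.
move=> cf; apply: mean_unique => [x|e e0].
  by apply: continuousM; [exact: cst_continuous|exact: cf].
have d0 : 0 < e / (1 + `|c|) by rewrite divr_gt0// ltr_wpDr.
have [A A0 HA] := mean_near cf d0; exists A => // x.
have -> : average A (fun x => c * f x) x = c * average A f x.
  by rewrite /average -mulr_sumr mulrCA.
rewrite -mulrBr normrM; apply: le_trans (ler_wpM2l (normr_ge0 _) (HA x)) _.
rewrite mulrA ler_pdivrMr ?ltr_wpDr// mulrC ler_pM2l//.
by rewrite lerDr.
Qed.

Lemma mean_ge0 f : continuous f -> (forall x, 0 <= f x) -> 0 <= mean f.
Proof.
move=> cf f0; apply/ler_addgt0Pr => e e0; have [A A0 HA] := mean_near cf e0.
have : 0 <= average A f 1%g by rewrite -(average_cst 0 1%g A0); exact: average_le.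
by have := HA 1%g; rewrite ler_norml => /andP[? ?]; lra.
Qed.

Lemma mean_le f g : continuous f -> continuous g -> (forall x, f x <= g x) ->
  mean f <= mean g.
Proof.
move=> cf cg fg; pose h x := -1 * f x.
have ch : continuous h by exact: cts_scale.
have cgh : continuous (g \+ h) by exact: cts_add.
have : 0 <= mean (g \+ h).
  by apply: mean_ge0 => // x; rewrite /h /= mulN1r subr_ge0.
by rewrite mean_add// mean_scale// mulN1r subr_ge0.
Qed.

Lemma mean_norm f M : continuous f -> (forall x, `|f x| <= M) -> `|mean f| <= M.
Proof.
move=> cf fM; rewrite ler_norml; apply/andP; split.
  rewrite -[X in X <= _]mean_cst; apply: mean_le => // [|x]; first exact: cst_continuous.
  by have := fM x; rewrite ler_norml => /andP[].
rewrite -[X in _ <= X]mean_cst; apply: mean_le => // [|x]; first exact: cst_continuous.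
by have := fM x; rewrite ler_norml => /andP[].
Qed.

Lemma mean_translate_l f a : continuous f -> mean (fun x => f (a * x)%g) = mean f.
Proof.
move=> cf; apply: mean_unique => [|e e0]; first exact: cts_translate_l.
have [A A0 HA] := mean_near cf e0; exists [seq (a^-1 * b)%g | b <- A].
  by rewrite -size_eq0 size_map size_eq0.
move=> x; have := HA x; rewrite /average size_map big_map.
by under [in X in _ -> X]eq_bigr do rewrite mulgA mulKVg.
Qed.

(** Averages use left translates, which commute with right translations, so the same set [A]
    serves. *)
Lemma mean_translate_r f a : continuous f -> mean (fun x => f (x * a)%g) = mean f.
Proof.
move=> cf; apply: mean_unique => [|e e0]; first exact: cts_translate_r.
have [A A0 HA] := mean_near cf e0; exists A => // x.
have := HA (x * a)%g; rewrite /average.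
by under [in X in _ -> X]eq_bigr do rewrite -mulgA.
Qed.

Lemma mean_sum I (r : seq I) (h : I -> G -> R) : (forall i, continuous (h i)) ->
  mean (fun x => \sum_(i <- r) h i x) = \sum_(i <- r) mean (h i).
Proof.
move=> ch; elim: r => [|i r IH].
  by rewrite big_nil -[RHS]mean_cst; congr mean; apply/funext => x; rewrite big_nil.
rewrite big_cons -IH -mean_add//; last first.
  by move=> x; apply: continuous_sum => // j; exact: ch.
by congr mean; apply/funext => x; rewrite big_cons.
Qed.

(** Strict positivity: if f is positive at x, finitely many translates of the region where f exceeds
    half of [f x] cover G; the sum h of the corresponding translates of f is then at least [f x / 2]
    everywhere, yet has mean 0. *)
Lemma mean_eq0 f : continuous f -> (forall x, 0 <= f x) -> mean f = 0 -> forall x, f x = 0.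
Proof.
move=> cf f0 mf x; apply/eqP; rewrite eq_le f0 andbT leNgt; apply/negP => fx.
have [V [nV HV]] := cts_equicontinuous cf (divr_gt0 fx (ltr0n R 2)).
have [A cA] := translates_cover nV.
pose h y := \sum_(a <- A) f (x * (a * y))%g.
have ch : continuous h.
  by apply: cts_sum => a; apply: (@cts_translate_l (fun y => f (x * y)%g)); exact: cts_translate_l.
have : f x / 2 <= mean h.
  rewrite -[leLHS]mean_cst; apply: mean_le => // [|y]; first exact: cst_continuous.
  have [a aA Va] := cA y.
  rewrite /h (big_rem a)//= ler_wpDr ?sumr_ge0//.
  by have := HV x _ tt Va; rewrite ler_norml /= => /andP[? _]; lra.
rewrite /h mean_sum.
  rewrite big1 => [|a _]; first lra.
  rewrite -[RHS]mf -(mean_translate_l x cf).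
  by rewrite -(@mean_translate_l (fun y => f (x * y)%g) a)//; exact: cts_translate_l.
by move=> a; apply: (@cts_translate_l (fun y => f (x * y)%g)); exact: cts_translate_l.
Qed.

(** One set [A] of translates approximates the means of all [F ^~ y] at once, and a finite average
    commutes with the mean in y. *)
Lemma mean_fubini (F : G -> G -> R) : continuous (fun p : G * G => F p.1 p.2) ->
  mean (fun x => mean (F x)) = mean (fun y => mean (F ^~ y)).
Proof.
move=> cF.
have cF' : continuous (fun p : G * G => F p.2 p.1).
  move=> p; apply: (@continuous_comp _ _ _ (fun p : G * G => (p.2, p.1)) (fun p : G * G => F p.1 p.2)).
    by apply: cvg_pair; [exact: cvg_snd|exact: cvg_fst].
  exact: cF.
have uF := joint_equicontinuous cG cF.
have uF' := @joint_equicontinuous G (fun x y => F y x) cG cF'.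
have cF1 x : continuous (F x) := uniformly_equicontinuous_cts uF'.
have cF2 y : continuous (F ^~ y) := uniformly_equicontinuous_cts uF.
have bF : exists M, forall x q, `|F x q| <= M.
  have cGG : compact [set: G * G] by rewrite -setXTT; exact: compact_setX.
  have cn p : {for p, continuous (fun p : G * G => `|F p.1 p.2|)}.
    by apply: (@continuous_comp _ _ _ (fun p : G * G => F p.1 p.2) Num.norm);
       [exact: cF|exact: norm_continuous].
  have [p _ H] := @compact_EVT_max _ _ (fun p : G * G => `|F p.1 p.2|) [set: G * G]
    (ex_intro _ (1%g, 1%g) I) cGG (continuous_subspaceT cn).
  by exists `|F p.1 p.2| => x q; apply: (H (x, q)); rewrite in_setT.
pose c y := mean (F ^~ y); pose d x := mean (F x).
have mB u v e : 0 < e -> continuous u -> continuous v -> (forall x, `|u x - v x| <= e) ->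
    `|mean u - mean v| <= e.
  move=> e0 cu cv' uv; have -> : mean u - mean v = mean (u \+ (fun x => -1 * v x)).
    by rewrite mean_add ?mean_scale ?mulN1r//; exact: cts_scale.
  apply: mean_norm => [|x]; last by rewrite /= mulN1r.
  by apply: cts_add => //; exact: cts_scale.
have cc : continuous c.
  move=> y; apply/continuous_nearP => e e0.
  by apply: filterS (uniformly_equicontinuous_near y uF' e0) => y' H; apply: mB => // x.
have cd : continuous d.
  move=> x; apply/continuous_nearP => e e0.
  by apply: filterS (uniformly_equicontinuous_near x uF e0) => x' H; apply: mB => // y.
apply: mean_unique => // e e0; have [A A0 HA] := mean_family uF bF e0.
exists A => // x.
have -> : average A d x = mean (fun y => average A (F^~ y) x).
  by rewrite /average mean_scale ?mean_sum//; exact: cts_sum.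
by apply: mB => //; apply: cts_scale; exact: cts_sum.
Qed.

End mean.

(** * Charts and left-invariant vector fields *)

Section partial_rules.
Context {R : realType} {n : nat} (U : set 'rV[R]_n).
Hypothesis oU : open U.
Implicit Types (f g : 'rV[R]_n -> R).

Lemma partial_near f g x i : (\forall y \near x, f y = g y) -> partial i f x = partial i g x.
Proof. exact: near_eq_derive. Qed.

Lemma partial_mul f g x i : smooth_on U f -> smooth_on U g -> U x ->
  partial i (fun y => f y * g y) x = f x * partial i g x + g x * partial i f x.
Proof.
move=> sf sg Ux; rewrite /partial (@deriveM _ _ f g)//.
  exact: smooth_on_derivable sf Ux.
exact: smooth_on_derivable sg Ux.
Qed.

Lemma partial_add f g x i : smooth_on U f -> smooth_on U g -> U x ->
  partial i (fun y => f y + g y) x = partial i f x + partial i g x.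
Proof.
move=> sf sg Ux; rewrite /partial (@deriveD _ _ _ f g)//.
  exact: smooth_on_derivable sf Ux.
exact: smooth_on_derivable sg Ux.
Qed.

Lemma partial_cst (a : R) x i : partial i (fun _ : 'rV[R]_n => a) x = 0.
Proof. exact: derive_cst. Qed.

Lemma partial_scale a f x i : smooth_on U f -> U x ->
  partial i (fun y => a * f y) x = a * partial i f x.
Proof.
by move=> sf Ux; rewrite (partial_mul _ (@smooth_on_cst _ _ U a) sf Ux) partial_cst mulr0 addr0.
Qed.

Lemma partial_sum I (r : seq I) (h : I -> 'rV[R]_n -> R) x i : (forall j, smooth_on U (h j)) -> U x ->
  partial i (fun y => \sum_(j <- r) h j y) x = \sum_(j <- r) partial i (h j) x.
Proof.
move=> sh Ux; elim: r => [|j r IH].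
  rewrite big_nil -[RHS](partial_cst 0 x i); congr partial; apply/funext => y; exact: big_nil.
rewrite big_cons -IH -partial_add//; last by apply: smooth_on_sum.
by congr partial; apply/funext => y; exact: big_cons.
Qed.

Lemma smooth_on_coord j : smooth_on U (fun x => x 0 j).
Proof.
have pc (i : 'I_n) : partial i (fun x : 'rV[R]_n => x 0 j) = cst (('e_i : 'rV[R]_n) 0 j).
  apply/funext => x; rewrite /partial -[LHS]/('D_('e_i) (fun x : 'rV[R]_n => x 0 j) x).
  apply: cvg_lim => //; apply: (@cvg_trans _ (cst (('e_i : 'rV[R]_n) 0 j) @ (0 : R)^')); last exact: cvg_cst.
  apply: near_eq_cvg; near=> h; rewrite /= !mxE addrK.
  have h0 : h != 0 by near: h; exact: nbhs_dnbhs_neq.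
  by rewrite [_ *: _]mulKf.
have dj x : differentiable (fun x : 'rV[R]_n => x 0 j) x by exact: differentiable_coord.
apply/smooth_onP => k; case: k => [|k]; (split; first by move=> x _; exact: coord_continuous) => // i.
by split=> [x _|]; [exact: diff_derivable|rewrite pc; exact: Ck_cst].
Unshelve. all: by end_near. Qed.

End partial_rules.

(** * Derivatives in one group of variables *)

Section slices.
Context {R : realType} {m n : nat}.
Implicit Types (F : 'rV[R]_(m + n) -> R).

Lemma partial_slicel F (y : 'rV_m) (z : 'rV_n) i :
  partial i (fun y => F (row_mx y z)) y = partial (lshift n i) F (row_mx y z).
Proof.
apply: (congr1 (fun f : R -> R => lim (f @ 0^'))); apply/funext => h /=.
congr (_ *: (F _ - _)); apply/rowP => j; rewrite !mxE /=.
case: splitP => k jk; rewrite ?mxE ?eqxx /=.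
  by rewrite (_ : (j == _) = (k == i))// -val_eqE /= jk.
by rewrite (_ : (j == _) = false) ?mulr0 ?add0r// -val_eqE /= jk; apply/negbTE; rewrite neq_ltn ltn_addr ?orbT.
Qed.

Lemma partial_slicer F (y : 'rV_m) (z : 'rV_n) i :
  partial i (fun z => F (row_mx y z)) z = partial (rshift m i) F (row_mx y z).
Proof.
apply: (congr1 (fun f : R -> R => lim (f @ 0^'))); apply/funext => h /=.
congr (_ *: (F _ - _)); apply/rowP => j; rewrite !mxE /=.
case: splitP => k jk; rewrite ?mxE ?eqxx /=.
  by rewrite (_ : (j == _) = false) ?mulr0 ?add0r// -val_eqE /= jk; apply/negbTE; rewrite neq_ltn ltn_addr.
by rewrite (_ : (j == _) = (k == i))// -!val_eqE /= jk eqn_add2l.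
Qed.

Lemma smooth_on_slice_l F (D : set 'rV[R]_(m + n)) (U : set 'rV[R]_m) (z : 'rV_n) :
  open U -> open D -> (forall y, U y -> D (row_mx y z)) -> smooth_on D F ->
  smooth_on U (fun y => F (row_mx y z)).
Proof.
move=> oU oD UD sF; apply: (smooth_on_comp oU oD UD _ sF) => j.
case: (split_ordP j) => k ->.
  by apply: (smooth_on_eq oU _ (@smooth_on_coord _ _ U k)) => x _; rewrite row_mxEl.
by apply: (smooth_on_eq oU _ (@smooth_on_cst _ _ U (z 0 k))) => x _; rewrite row_mxEr.
Qed.

Lemma smooth_on_slice_r F (D : set 'rV[R]_(m + n)) (U : set 'rV[R]_n) (y : 'rV_m) :
  open U -> open D -> (forall z, U z -> D (row_mx y z)) -> smooth_on D F ->
  smooth_on U (fun z => F (row_mx y z)).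
Proof.
move=> oU oD UD sF; apply: (smooth_on_comp oU oD UD _ sF) => j.
case: (split_ordP j) => k ->.
  by apply: (smooth_on_eq oU _ (@smooth_on_cst _ _ U (y 0 k))) => x _; rewrite row_mxEl.
by apply: (smooth_on_eq oU _ (@smooth_on_coord _ _ U k)) => x _; rewrite row_mxEr.
Qed.

End slices.

Local Opaque partial.

Lemma continuous_pair {T U V : topologicalType} (f : T -> U) (g : T -> V) x :
  {for x, continuous f} -> {for x, continuous g} -> {for x, continuous (fun y => (f y, g y))}.
Proof. by move=> cf cg; exact: cvg_pair. Qed.

Section charts.
Context {R : realType} {n : nat} {G : lieGroupType R n}.
Implicit Types (i j k : chart_index G) (x a b : G) (y z : 'rV[R]_n) (u v : G -> R).

Local Notation C i := (codom_chart (atlas i)).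
Local Notation "\par_ i" := (param (atlas i)) (at level 0, i at level 0, format "\par_ i").
Local Notation "\co_ i" := (Defs.coord (atlas i)) (at level 0, i at level 0, format "\co_ i").

Lemma open_codom i : open (C i). Proof. exact: codom_open. Qed.

Lemma dom_param i y : C i y -> dom (atlas i) (\par_i y).
Proof. by move=> [x dx <-]; rewrite coordK. Qed.

Lemma paramK i y : C i y -> \co_i (\par_i y) = y.
Proof. by move=> [x dx <-]; rewrite coordK. Qed.

Lemma codom_coord i x : dom (atlas i) x -> C i (\co_i x).
Proof. by exists x. Qed.

Lemma near_dom i x : dom (atlas i) x -> \forall x' \near x, dom (atlas i) x'.
Proof. by move=> dx; apply: open_nbhs_nbhs; split => //; exact: dom_open. Qed.

Lemma near_codom i y : C i y -> \forall y' \near y, C i y'.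
Proof. by move=> cy; apply: open_nbhs_nbhs; split => //; exact: open_codom. Qed.

Lemma param_cvg i y : C i y -> {for y, continuous \par_i}.
Proof. by move=> cy; apply: param_continuous; exact: mem_set. Qed.

Lemma coord_cvg i x : dom (atlas i) x -> {for x, continuous \co_i}.
Proof. by move=> cy; apply: Defs.coord_continuous; exact: mem_set. Qed.

Lemma dom_chart_at x : dom (atlas (chart_at x)) x.
Proof. by rewrite /chart_at; case: cid. Qed.

Definition mul_dom i j k : set 'rV[R]_(n + n) :=
  [set w | [/\ C i (lsubmx w), C j (rsubmx w) &
               dom (atlas k) (\par_i (lsubmx w) * \par_j (rsubmx w))%g]].

Definition mul_coord i j k (w : 'rV[R]_(n + n)) : 'rV[R]_n :=
  \co_k (\par_i (lsubmx w) * \par_j (rsubmx w))%g.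

Lemma mul_param_cvg i j w : C i (lsubmx w) -> C j (rsubmx w) ->
  {for w, continuous (fun w : 'rV[R]_(n + n) => \par_i (lsubmx w) * \par_j (rsubmx w))%g}.
Proof.
move=> ci cj; apply: (@continuous_comp _ _ _ (fun w : 'rV[R]_(n + n) =>
  (\par_i (lsubmx w), \par_j (rsubmx w))) (fun p : G * G => p.1 * p.2)%g); last exact: mulg_continuous.
apply: continuous_pair.
  by apply: (@continuous_comp _ _ _ lsubmx \par_i); [exact: continuous_lsubmx|exact: param_cvg].
by apply: (@continuous_comp _ _ _ rsubmx \par_j); [exact: continuous_rsubmx|exact: param_cvg].
Qed.

Lemma open_mul_dom i j k : open (mul_dom i j k).
Proof.
rewrite openE => w [ci cj dk]; rewrite /interior.
have n1 : \forall w' \near w, C i (lsubmx w').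
  by apply: (@continuous_lsubmx _ _ _ _ w); exact: near_codom.
have n2 : \forall w' \near w, C j (rsubmx w').
  by apply: (@continuous_rsubmx _ _ _ _ w); exact: near_codom.
have n3 : \forall w' \near w, dom (atlas k) (\par_i (lsubmx w') * \par_j (rsubmx w'))%g.
  by apply: (mul_param_cvg ci cj); exact: near_dom.
by apply: filterS (near_and n1 (near_and n2 n3)) => w' [? []].
Qed.

Lemma smooth_mul_coord i j k l : smooth_on (mul_dom i j k) (fun w => mul_coord i j k w 0 l).
Proof. by apply: (@smooth_on_component _ _ _ _ (@open_mul_dom i j k) (mul_coord i j k) l); exact: mulg_smooth. Qed.

Definition smoothR u := forall i, smooth_on (C i) (u \o \par_i).

Lemma smoothR_continuous u : smoothR u -> continuous u.
Proof.
move=> su x; pose i := chart_at x; have dx : dom (atlas i) x := dom_chart_at x.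
have E : \forall x' \near x, (u \o \par_i) (\co_i x') = u x'.
  by apply: filterS (near_dom dx) => x' dx' /=; rewrite coordK.
have c : {for x, continuous ((u \o \par_i) \o \co_i)}.
  apply: continuous_comp; first exact: coord_cvg.
  exact: smooth_on_continuous (su i) (codom_coord dx).
rewrite /prop_for /continuous_at /= coordK// in c.
exact: cvg_trans (near_eq_cvg E) c.
Qed.

Definition mull_dom a i k : set 'rV[R]_n := [set y | C i y /\ dom (atlas k) (a * \par_i y)%g].
Definition mulr_dom b i k : set 'rV[R]_n := [set y | C i y /\ dom (atlas k) (\par_i y * b)%g].

Lemma open_mull_dom a i k : open (mull_dom a i k).
Proof.
rewrite openE => y [ci dk]; rewrite /interior.
have n1 := near_codom ci.
have n3 : \forall y' \near y, dom (atlas k) (a * \par_i y')%g.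
  have c : {for y, continuous (fun y => a * \par_i y)%g}.
    apply: (@continuous_comp _ _ _ \par_i (fun x => a * x)%g); first exact: param_cvg.
    exact: mulg_continuous_l.
  by apply: c; exact: near_dom.
by apply: filterS (near_and n1 n3).
Qed.

Lemma open_mulr_dom b i k : open (mulr_dom b i k).
Proof.
rewrite openE => y [ci dk]; rewrite /interior.
have n1 := near_codom ci.
have n3 : \forall y' \near y, dom (atlas k) (\par_i y' * b)%g.
  have c : {for y, continuous (fun y => \par_i y * b)%g}.
    apply: (@continuous_comp _ _ _ \par_i (fun x => x * b)%g); first exact: param_cvg.
    exact: mulg_continuous_r.
  by apply: c; exact: near_dom.
by apply: filterS (near_and n1 n3).
Qed.

Lemma smooth_mull a i k l : smooth_on (mull_dom a i k) (fun y => \co_k (a * \par_i y)%g 0 l).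
Proof.
pose j := chart_at a; have da : dom (atlas j) a := dom_chart_at a.
have s : smooth_on (mull_dom a i k) (fun y => mul_coord j i k (row_mx (\co_j a) y) 0 l).
  apply: (smooth_on_slice_r (@open_mull_dom a i k) (@open_mul_dom j i k) _ (@smooth_mul_coord j i k l)) => y [cy dy].
  rewrite /mul_dom /= row_mxKl row_mxKr coordK//; split=> //; exact: codom_coord.
apply: (smooth_on_eq (@open_mull_dom a i k) _ s) => y _.
by rewrite /mul_coord row_mxKl row_mxKr coordK.
Qed.

Lemma smooth_mulr b i k l : smooth_on (mulr_dom b i k) (fun y => \co_k (\par_i y * b)%g 0 l).
Proof.
pose j := chart_at b; have db : dom (atlas j) b := dom_chart_at b.
have s : smooth_on (mulr_dom b i k) (fun y => mul_coord i j k (row_mx y (\co_j b)) 0 l).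
  apply: (smooth_on_slice_l (@open_mulr_dom b i k) (@open_mul_dom i j k) _ (@smooth_mul_coord i j k l)) => y [cy dy].
  rewrite /mul_dom /= row_mxKl row_mxKr coordK//; split=> //; exact: codom_coord.
apply: (smooth_on_eq (@open_mulr_dom b i k) _ s) => y _.
by rewrite /mul_coord row_mxKl row_mxKr coordK.
Qed.

Lemma smoothR_translate_l u a : smoothR u -> smoothR (fun x => u (a * x)%g).
Proof.
move=> su i; apply: smooth_on_local => y cy; pose k := chart_at (a * \par_i y)%g.
exists (mull_dom a i k); split; first by split=> //; exact: dom_chart_at.
have s := smooth_on_comp (@open_mull_dom a i k) (@open_codom k) _ (@smooth_mull a i k) (su k).
apply: (smooth_on_eq (@open_mull_dom a i k) _ (s _)) => [y' [_ d] /=|y' [_ d]].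
  by rewrite coordK.
exact: codom_coord.
Qed.

Lemma smoothR_translate_r u b : smoothR u -> smoothR (fun x => u (x * b)%g).
Proof.
move=> su i; apply: smooth_on_local => y cy; pose k := chart_at (\par_i y * b)%g.
exists (mulr_dom b i k); split; first by split=> //; exact: dom_chart_at.
have s := smooth_on_comp (@open_mulr_dom b i k) (@open_codom k) _ (@smooth_mulr b i k) (su k).
apply: (smooth_on_eq (@open_mulr_dom b i k) _ (s _)) => [y' [_ d] /=|y' [_ d]].
  by rewrite coordK.
exact: codom_coord.
Qed.

Lemma smoothR_cst (c : R) : smoothR (fun=> c).
Proof. by move=> i; exact: smooth_on_cst. Qed.

Lemma smoothR_add u v : smoothR u -> smoothR v -> smoothR (fun x => u x + v x).
Proof. by move=> su sv i; exact: (@smooth_on_add _ _ _ (@open_codom i) (u \o \par_i) (v \o \par_i) (su i) (sv i)). Qed.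

Lemma smoothR_mul u v : smoothR u -> smoothR v -> smoothR (fun x => u x * v x).
Proof. by move=> su sv i; exact: (@smooth_on_mul _ _ _ (@open_codom i) (u \o \par_i) (v \o \par_i) (su i) (sv i)). Qed.

Lemma smoothR_scale (c : R) u : smoothR u -> smoothR (fun x => c * u x).
Proof. by apply: smoothR_mul; exact: smoothR_cst. Qed.

Lemma smoothR_opp u : smoothR u -> smoothR (fun x => - u x).
Proof.
by move=> /(smoothR_scale (-1)); under eq_fun do rewrite mulN1r.
Qed.

Lemma smoothR_sum I (r : seq I) (h : I -> G -> R) : (forall q, smoothR (h q)) ->
  smoothR (fun x => \sum_(q <- r) h q x).
Proof.
by move=> sh i; apply: (@smooth_on_sum _ _ _ (@open_codom i) _ r xpredT (fun q => h q \o \par_i)) => q; exact: sh.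
Qed.

Let i0 := chart_at (1%g : G).
Let z0 := \co_i0 (1%g : G).

Let d0 : dom (atlas i0) (1%g : G). Proof. exact: dom_chart_at. Qed.
Let c0 : C i0 z0. Proof. exact: codom_coord. Qed.
Let p0 : \par_i0 z0 = 1%g. Proof. exact: coordK. Qed.

(* The left-invariant vector field extending the c-th coordinate field at 1. *)
Definition invariant_field (c : 'I_n) u x : R := partial c (fun z => u (x * \par_i0 z)%g) z0.

(** Row c lists the components in chart i, at the point of coordinates y, of the c-th left-invariant
    field. *)
Definition field_mx i y : 'M[R]_n := \matrix_(c, k) partial c (fun z => \co_i (\par_i y * \par_i0 z)%g 0 k) z0.

Lemma invariant_field_translate (c : 'I_n) u b x :
  invariant_field c (fun x => u (b * x)%g) x = invariant_field c u (b * x)%g.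
Proof. by rewrite /invariant_field; congr partial; apply/funext => z; rewrite mulgA. Qed.

Lemma invariant_field_chart (c : 'I_n) u i y : smoothR u -> C i y ->
  invariant_field c u (\par_i y) = \sum_k field_mx i y c k * partial k (u \o \par_i) y.
Proof.
move=> su cy; pose V := mull_dom (\par_i y) i0 i.
have Vz : V z0 by split=> //; rewrite p0 mulg1; exact: dom_param.
have oV : open V by exact: open_mull_dom.
pose F z := \co_i (\par_i y * \par_i0 z)%g.
have Fz : F z0 = y by rewrite /F p0 mulg1 paramK.
rewrite /invariant_field (@partial_near _ _ _ ((u \o \par_i) \o F)); last first.
  by apply: (near_open oV Vz) => z [_ dz] /=; rewrite coordK.
rewrite partial_comp.
- by rewrite Fz; apply: eq_bigr => k _; rewrite mulrC mxE.
- by rewrite Fz; have := smooth_on_differentiable (@open_codom i) (su i) cy.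
- by move=> k; have := smooth_on_differentiable oV (@smooth_mull (\par_i y) i0 i k) Vz.
Qed.

(** The entries are derivatives of the multiplication in its second group of variables, restricted
    to the slice [z = z0]. *)
Lemma smooth_field_mx i (c k : 'I_n) : smooth_on (C i) (fun y => field_mx i y c k).
Proof.
have D y : C i y -> mul_dom i i0 i (row_mx y z0).
  move=> cy; rewrite /mul_dom /= row_mxKl row_mxKr p0 mulg1; split=> //; exact: dom_param.
have s := smooth_on_slice_l (@open_codom i) (@open_mul_dom i i0 i) D
  (smooth_on_partial (rshift n c) (@smooth_mul_coord i i0 i k)).
apply: (smooth_on_eq (@open_codom i) _ s) => y cy.
rewrite mxE -(partial_slicer (fun w => mul_coord i i0 i w 0 k) y z0 c).
suff -> : (fun z => mul_coord i i0 i (row_mx y z) 0 k) =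
  (fun z => \co_i (\par_i y * \par_i0 z)%g 0 k) by [].
by apply/funext => z; rewrite /mul_coord row_mxKl row_mxKr.
Qed.

Let smooth_at0 u x : smoothR u -> smooth_on (C i0) (fun z => u (x * \par_i0 z)%g).
Proof. by move=> su; exact: smoothR_translate_l. Qed.

Lemma invariant_field_add c u v x : smoothR u -> smoothR v ->
  invariant_field c (fun x => u x + v x) x = invariant_field c u x + invariant_field c v x.
Proof. by move=> su sv; exact: (partial_add _ (smooth_at0 x su) (smooth_at0 x sv) c0). Qed.

Lemma invariant_field_cst c (b : R) x : invariant_field c (fun=> b) x = 0.
Proof. exact: partial_cst. Qed.

Lemma invariant_field_mul c u v x : smoothR u -> smoothR v ->
  invariant_field c (fun x => u x * v x) x = u x * invariant_field c v x + v x * invariant_field c u x.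
Proof.
move=> su sv; have := partial_mul c (smooth_at0 x su) (smooth_at0 x sv) c0.
by rewrite p0 mulg1.
Qed.

Lemma invariant_field_scale c (b : R) u x : smoothR u ->
  invariant_field c (fun x => b * u x) x = b * invariant_field c u x.
Proof.
move=> su; rewrite (invariant_field_mul _ _ (@smoothR_cst b) su) invariant_field_cst.
by rewrite mulr0 addr0.
Qed.

Lemma invariant_field_sum c I (r : seq I) (h : I -> G -> R) x : (forall q, smoothR (h q)) ->
  invariant_field c (fun x => \sum_(q <- r) h q x) x = \sum_(q <- r) invariant_field c (h q) x.
Proof.
move=> sh; exact: (@partial_sum _ _ (C i0) (@open_codom i0) _ r (fun q z => h q (x * \par_i0 z)%g) z0 c (fun q => smooth_at0 x (sh q)) c0).
Qed.

Lemma smoothR_invariant_field c u : smoothR u -> smoothR (invariant_field c u).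
Proof.
move=> su i.
have s : smooth_on (C i) (fun y => \sum_k field_mx i y c k * partial k (u \o \par_i) y).
  apply: smooth_on_sum => [|k]; first exact: open_codom.
  apply: (@smooth_on_mul _ _ _ (@open_codom i)); first exact: smooth_field_mx.
  by apply: smooth_on_partial; exact: su.
by apply: (smooth_on_eq (@open_codom i) _ s) => y cy; rewrite /= invariant_field_chart.
Qed.

Section metric.
Variable g : biinvariant_metric G.

Definition gram1 : 'M[R]_n := gram g i0 1%g.

Lemma gram1_pos (v : 'rV[R]_n) : v != 0 -> 0 < (v *m gram1 *m v^T) 0 0.
Proof. exact: gram_pos d0 v. Qed.

Lemma gram1_sym : gram1^T = gram1. Proof. exact: gram_sym d0. Qed.

Lemma gram1_unit : gram1 \in unitmx.
Proof.
rewrite -row_free_unit -kermx_eq0; apply/rowV0P => v /sub_kermxP v0.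
by apply/eqP; apply: contraT => /gram1_pos; rewrite v0 mul0mx mxE ltxx.
Qed.

(** Left translation by the point of coordinates y is an isometry that carries the frame at 1 to the
    invariant frame there, and its Jacobian at 1 is [field_mx i y]. *)
Lemma gram1_chart i y : C i y ->
  gram1 = field_mx i y *m gram g i (\par_i y) *m (field_mx i y)^T.
Proof.
move=> cy; have V : mull_dom (\par_i y) i0 i z0.
  by split=> //; rewrite p0 mulg1; exact: dom_param.
have dy : dom (atlas i) (\par_i y * 1)%g by rewrite mulg1; exact: dom_param.
have := @gram_left _ _ _ g (\par_i y) i0 i 1%g d0 dy; rewrite mulg1 /=.
suff -> : 'J (\co_i \o (fun x => \par_i y * x)%g \o \par_i0) (\co_i0 (1%g : G)) = field_mx i y by [].
apply/matrixP => c k.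
rewrite (@jacobianE _ _ _ _ (@open_mull_dom (\par_i y) i0 i) _ _ c k _ V) ?mxE//.
by move=> l; exact: smooth_mull.
Qed.

(** Nondegeneracy of the metric at 1 makes the invariant fields a frame at every point. *)
Lemma field_mx_unit i y : C i y -> field_mx i y \in unitmx.
Proof.
move=> cy; have := gram1_unit; rewrite (gram1_chart cy) !unitmxE !det_mulmx.
by rewrite !unitfE !mulf_eq0 !negb_or => /andP[/andP[]].
Qed.

Lemma partial_invariant_field (k : 'I_n) u i y : smoothR u -> C i y ->
  partial k (u \o \par_i) y = \sum_c invmx (field_mx i y) k c * invariant_field c u (\par_i y).
Proof.
move=> su cy; pose D := \col_k partial k (u \o \par_i) y.
have E : \col_c invariant_field c u (\par_i y) = field_mx i y *m D.
  by apply/colP => c; rewrite !mxE invariant_field_chart//; apply: eq_bigr => l _; rewrite !mxE.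
have : D = invmx (field_mx i y) *m (\col_c invariant_field c u (\par_i y)).
  by rewrite E mulKmx// field_mx_unit.
by move=> /colP /(_ k); rewrite !mxE => ->; apply: eq_bigr => c _; rewrite !mxE.
Qed.

Lemma smooth_inv_field_mx i (k c : 'I_n) : smooth_on (C i) (fun y => invmx (field_mx i y) k c).
Proof.
apply: smooth_on_invmx => [|y cy|c' k']; first exact: open_codom.
  exact: field_mx_unit.
exact: smooth_field_mx.
Qed.

End metric.

End charts.

Lemma smooth_on_scale {R : realType} {n} (U : set 'rV[R]_n) (c : R) (f : 'rV[R]_n -> R) :
  open U -> smooth_on U f -> smooth_on U (fun x => c * f x).
Proof. by move=> oU sf; have := smooth_on_mul oU (@smooth_on_cst _ _ U c) sf. Qed.

Lemma partial_coord {R : realType} {n} (i j : 'I_n) (x : 'rV[R]_n) :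
  partial i (fun x : 'rV[R]_n => x 0 j) x = (i == j)%:R.
Proof.
Local Transparent partial.
apply: cvg_lim => //; apply: (@cvg_trans _ (cst ((i == j)%:R : R) @ (0 : R)^')); last exact: cvg_cst.
apply: near_eq_cvg; near=> h; rewrite /= !mxE addrK eqxx /= eq_sym.
have h0 : h != 0 by near: h; exact: nbhs_dnbhs_neq.
by rewrite [_ *: _]mulKf.
Unshelve. all: by end_near. Qed.

Lemma partial_inv {R : realType} {n} (U : set 'rV[R]_n) (f : 'rV[R]_n -> R) x i :
  smooth_on U f -> U x -> f x != 0 ->
  partial i (fun y => (f y)^-1) x = - (f x) ^- 2 * partial i f x.
Proof.
by move=> sf Ux f0; rewrite /partial deriveV//; exact: smooth_on_derivable sf Ux.
Qed.

Lemma partial_det1 {R : realType} {n m} (U : set 'rV[R]_n) (E : 'rV[R]_n -> 'M[R]_m) x i :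
  (forall j k, smooth_on U (fun z => E z j k)) -> U x -> E x = 1%:M ->
  partial i (fun z => \det (E z)) x = \sum_j partial i (fun z => E z j j) x.
Proof.
move=> sE Ux E1; pose dA := \matrix_(j, k) partial i (fun z => E z j k) x.
have d j k : is_derive x 'e_i (fun z => E z j k) (dA j k).
  by rewrite mxE; apply: derivableP; exact: smooth_on_derivable (sE j k) Ux.
have := @derive_val _ _ _ _ _ _ _ (is_derive_det1 E1 d).
by rewrite /partial => ->; apply: eq_bigr => j _; rewrite mxE.
Qed.

Local Opaque partial.

Lemma cts_prod {R : realType} {T : topologicalType} {I : Type} (r : seq I) (h : I -> T -> R) :
  (forall i, continuous (h i)) -> continuous (fun y => \prod_(i <- r) h i y).
Proof.
move=> ch; elim: r => [|i r IH].
  by under eq_fun do rewrite big_nil; exact: cts_cst.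
by under eq_fun do rewrite big_cons; exact: cts_mul.
Qed.

(** Along the segment from the identity to H the quadratic form stays positive, so the determinant
    does not vanish; it equals 1 at the identity, and the intermediate value theorem fixes its
    sign. *)
Lemma det_pos {R : realType} n (H : 'M[R]_n) :
  (forall v : 'rV[R]_n, v != 0 -> 0 < (v *m H *m v^T) 0 0) -> 0 < \det H.
Proof.
move=> Hp; pose K (t : R) := t *: H + (1 - t) *: 1%:M; pose f t := \det (K t).
have cf : continuous f.
  apply: cts_sum => s; apply: cts_scale; apply: cts_prod => i.
  rewrite (_ : (fun _ => _) = (fun t => H i (s i) * t + (1%:M : 'M[R]_n) i (s i) * (1 - t))).
    by apply: cts_add; apply: cts_scale; [|apply: cts_add; [exact: cts_cst|apply: cts_opp]];
       move=> x; exact: cvg_id.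
  by apply/funext => t; rewrite !mxE mulrC [X in _ + X]mulrC.
have f0 : f 0 = 1 by rewrite /f /K scale0r add0r subr0 scale1r det1.
have f1 : f 1 = \det H by rewrite /f /K scale1r subrr scale0r addr0.
have pos (v : 'rV[R]_n) : v != 0 -> 0 < (v *m v^T) 0 0.
  move=> v0; rewrite lt0r; apply/andP; split.
    apply: contra v0 => /eqP; rewrite mxE => vv; apply/eqP/rowP => j; rewrite [RHS]mxE.
    have /psumr_eq0P : \sum_k v 0 k * v^T k 0 = 0 by [].
    move=> /(_ (fun k _ => _)) H0; have : v 0 j * v^T j 0 = 0.
      by apply: H0 => // k; rewrite mxE -expr2 sqr_ge0.
    by rewrite mxE -expr2 => /eqP; rewrite sqrf_eq0 => /eqP.
  by rewrite mxE sumr_ge0// => k _; rewrite mxE -expr2 sqr_ge0.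
have fn0 t : 0 <= t -> t <= 1 -> f t != 0.
  move=> t0 t1; have : K t \in unitmx.
    rewrite -row_free_unit -kermx_eq0; apply/rowV0P => v /sub_kermxP v0.
    apply/eqP; apply: contraT => vn.
    have : (v *m K t *m v^T) 0 0 = t * (v *m H *m v^T) 0 0 + (1 - t) * (v *m v^T) 0 0.
      by rewrite /K mulmxDr -!scalemxAr mulmx1 mulmxDl -!scalemxAl !mxE.
    rewrite v0 mul0mx [LHS]mxE => E.
    have h1 := Hp _ vn; have h2 := pos _ vn.
    by case: (ltP t (1 / 2)) => ?; nra.
  by rewrite unitmxE unitfE.
rewrite ltNge -f1; apply/negP => f10.
have [||t] := @IVT R f 0 1 0 ler01.
- exact: continuous_subspaceT.
- by rewrite f0 ge_min le_max f10 ler01 orbT.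
by rewrite in_itv /= => /andP[t0 t1] /eqP; rewrite (negPf (fn0 _ t0 t1)).
Qed.

Lemma sg_near {R : realType} (a b : R) : a != 0 -> `|a - b| <= `|a| / 2 -> `|b| = Num.sg a * b.
Proof.
case: (ltrgtP a 0) => [a0 _|a0 _|->]; last by [].
  by rewrite ltr0_sg// (ltr0_norm a0) ler_norml mulN1r => /andP[? ?]; rewrite ler0_norm//; lra.
by rewrite gtr0_sg// (gtr0_norm a0) ler_norml mul1r => /andP[? ?]; rewrite ger0_norm//; lra.
Qed.

(** * The Laplacian in the left-invariant frame *)

Section laplacian.
Context {R : realType} {n : nat} {G : lieGroupType R n} (g : biinvariant_metric G).
Implicit Types (i : chart_index G) (x a b : G) (y z : 'rV[R]_n) (u v : G -> R) (j k c e : 'I_n).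

Local Notation C i := (codom_chart (atlas i)).
Local Notation "\par_ i" := (param (atlas i)) (at level 0, i at level 0, format "\par_ i").
Local Notation "\co_ i" := (Defs.coord (atlas i)) (at level 0, i at level 0, format "\co_ i").
Let i0 := chart_at (1%g : G).
Let z0 := \co_i0 (1%g : G).
Let d0 : dom (atlas i0) (1%g : G). Proof. exact: dom_chart_at. Qed.
Let c0 : C i0 z0. Proof. exact: codom_coord. Qed.
Let p0 : \par_i0 z0 = 1%g. Proof. exact: coordK. Qed.
Local Notation A := field_mx.

Lemma invmx_gram i y : C i y ->
  invmx (gram g i (\par_i y)) = (A i y)^T *m invmx (gram1 g) *m A i y.
Proof.
move=> cy; have Au := field_mx_unit g cy; have Hu := gram1_unit g.
have E2 := gram1_chart g cy.
set gm := gram g i _ in E2 *.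
have K : gm *m ((A i y)^T *m invmx (gram1 g) *m A i y) = 1%:M.
  apply: (can_inj (mulKmx Au)).
  by rewrite !mulmxA -E2 mulmxV// mul1mx mulmx1.
have gu : gm \in unitmx by have [] := mulmx1_unit K.
by rewrite -[LHS]mulmx1 -K mulKmx.
Qed.

Section at_point.
Variables (i : chart_index G) (y : 'rV[R]_n).
Hypothesis cy : C i y.

(** Up to sign and a constant, q is the inverse of the Riemannian density. [F] moves the point of
    coordinates y by right multiplication, and [E z] is the Jacobian matrix at y of right
    translation by the point of coordinates z. *)
Let q z := \det (A i z).
Let F z := \co_i (\par_i y * \par_i0 z)%g.
Let E z := \matrix_(j, k) partial j (fun y' => \co_i (\par_i y' * \par_i0 z)%g 0 k) y.
Let V := mull_dom (\par_i y) i0 i.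

Let oV : open V. Proof. exact: open_mull_dom. Qed.
Let Vz : V z0. Proof. by split=> //; rewrite p0 mulg1; exact: dom_param. Qed.
Let Fz : F z0 = y. Proof. by rewrite /F p0 mulg1 paramK. Qed.

Let EE z j k : E z j k = partial (lshift n j) (fun w => mul_coord i i0 i w 0 k) (row_mx y z).
Proof.
rewrite mxE -(partial_slicel (fun w => mul_coord i i0 i w 0 k) y z j).
suff -> : (fun y' => mul_coord i i0 i (row_mx y' z) 0 k) =
  (fun y' => \co_i (\par_i y' * \par_i0 z)%g 0 k) by [].
by apply/funext => y'; rewrite /mul_coord row_mxKl row_mxKr.
Qed.

Let VD z : V z -> mul_dom i i0 i (row_mx y z).
Proof. by move=> [cz dz]; rewrite /mul_dom /= row_mxKl row_mxKr. Qed.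

Let sE j k : smooth_on V (fun z => E z j k).
Proof.
have s := smooth_on_slice_r oV (@open_mul_dom _ _ _ i i0 i) VD
  (smooth_on_partial (lshift n j) (@smooth_mul_coord _ _ _ i i0 i k)).
by apply: (smooth_on_eq oV _ s) => z _; rewrite EE.
Qed.

Let E1 : E z0 = 1%:M.
Proof.
apply/matrixP => j k; rewrite !mxE -(partial_coord j k y).
apply: partial_near; apply: (near_open (@open_codom _ _ _ i) cy) => y' cy'.
by rewrite p0 mulg1 paramK.
Qed.

Let sq : smooth_on (C i) q.
Proof. by apply: smooth_on_det => [|c k]; [exact: open_codom|exact: smooth_field_mx]. Qed.

(** Determinants of three isometry relations: left translation from 1 to y, left translation from 1
    to [F z], right translation from y to [F z]. Gram determinants pick up squares of Jacobians,
    hence the squares here. *)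
Let q_change z : V z -> q (F z) ^+ 2 = (\det (E z)) ^+ 2 * q y ^+ 2.
Proof.
move=> [cz dz]; have dF : dom (atlas i) (\par_i y * \par_i0 z)%g by [].
have pF : \par_i (F z) = (\par_i y * \par_i0 z)%g by rewrite /F coordK.
have cF : C i (F z) by exact: codom_coord.
have H1 := congr1 determinant (gram1_chart g cy).
have H2 := congr1 determinant (gram1_chart g cF).
have H3 : gram g i (\par_i y) = E z *m gram g i (\par_i (F z)) *m (E z)^T.
  have := @gram_right _ _ _ g (\par_i0 z) i i (\par_i y) (dom_param cy) dF.
  rewrite /= paramK// pF => ->; congr (_ *m _ *m _^T); apply/matrixP => j k;
  rewrite (@jacobianE _ _ _ _ (@open_mulr_dom _ _ _ (\par_i0 z) i i) _ _ j k (@smooth_mulr _ _ _ (\par_i0 z) i i) (conj cy dF));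
  by rewrite mxE.
move/(congr1 determinant) : H3; rewrite !det_mulmx !det_tr in H1 H2 * => H3.
have := gram1_unit g; rewrite unitmxE unitfE H2 !mulf_eq0 !negb_or => /andP[/andP[q0 d2] _].
move: H1; rewrite H2 H3 -/(q _) -/(q _) => H4; apply: (mulIf d2).
move: d2 H4; set d2 := \det (gram _ _ _) => _ H4.
have -> : q (F z) ^+ 2 * d2 = q (F z) * d2 * q (F z) by ring.
by rewrite H4; ring.
Qed.

(* The divergence of the c-th left-invariant field with respect to the Riemannian
   volume vanishes, because its flow consists of right translations, which are
   isometries. *)
Lemma field_mx_div c : \sum_k A i y c k * partial k q y =
  q y * \sum_k partial k (fun y' => A i y' c k) y.
Proof.
have q0 : q y != 0 by have := field_mx_unit g cy; rewrite unitmxE unitfE.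
have sqF : smooth_on V (fun z => q (F z)).
  apply: (smooth_on_comp oV (@open_codom _ _ _ i) _ _ sq) => [z [_ dz]|k]; first exact: codom_coord.
  exact: smooth_mull.
have L : partial c (fun z => q (F z)) z0 = \sum_k A i y c k * partial k q y.
  rewrite (@partial_comp _ _ _ q F z0 c).
  - by rewrite Fz; apply: eq_bigr => k _; rewrite mulrC mxE.
  - by rewrite Fz; have := smooth_on_differentiable (@open_codom _ _ _ i) sq cy.
  - by move=> k; have := smooth_on_differentiable oV (@smooth_mull _ _ _ (\par_i y) i0 i k) Vz.
have sdet : smooth_on V (fun z => \det (E z)) by apply: smooth_on_det.
(* Jacobi's formula gives the trace of mixed derivatives of the multiplication map; exchanging their
   order turns it into the coordinate divergence of the c-th field. *)
have dE : partial c (fun z => \det (E z)) z0 = \sum_k partial k (fun y' => A i y' c k) y.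
  rewrite (partial_det1 c sE Vz E1); apply: eq_bigr => j _.
  rewrite (_ : (fun z => E z j j) = (fun z => partial (lshift n j)
    (fun w => mul_coord i i0 i w 0 j) (row_mx y z))); last by apply/funext => z; rewrite EE.
  rewrite partial_slicer (schwarz (@open_mul_dom _ _ _ i i0 i) _ _ (@smooth_mul_coord _ _ _ i i0 i j) (VD Vz)).
  rewrite -(partial_slicel (partial (rshift n c) (fun w => mul_coord i i0 i w 0 j)) y z0 j).
  suff -> : (fun y' => partial (rshift n c) (fun w => mul_coord i i0 i w 0 j) (row_mx y' z0)) =
     (fun y' => A i y' c j) by [].
  apply/funext => y'; rewrite mxE -(partial_slicer (fun w => mul_coord i i0 i w 0 j) y' z0 c).
  suff -> : (fun z => mul_coord i i0 i (row_mx y' z) 0 j) =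
    (fun z => \co_i (\par_i y' * \par_i0 z)%g 0 j) by [].
  by apply/funext => z; rewrite /mul_coord row_mxKl row_mxKr.
(* The squared relation is differentiated at [z0], where [F z0 = y] and [E z0] is the identity; the
   common factor [2 * q y] is cancelled at the end. *)
have : partial c (fun z => q (F z) * q (F z)) z0 =
    partial c (fun z => q y ^+ 2 * (\det (E z) * \det (E z))) z0.
  apply: partial_near; apply: (near_open oV Vz) => z Vz'.
  by rewrite -expr2 q_change// mulrC expr2.
rewrite (partial_mul _ sqF sqF Vz) (partial_scale _ _ (smooth_on_mul oV sdet sdet) Vz).
rewrite (partial_mul _ sdet sdet Vz) Fz L dE E1 det1 !mul1r => H.
apply: (mulfI q0); apply: (mulfI (_ : (2 : R) != 0)); first by rewrite pnatr_eq0.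
rewrite mulr_natl mulr2n H; move: (\sum_k partial k (fun y' => A i y' c k) y) => S2.
by ring.
Qed.

Lemma smooth_field_mx_quotient c k : smooth_on (C i) (fun z => A i z c k * (q z)^-1).
Proof.
apply: (@smooth_on_mul _ _ _ (@open_codom _ _ _ i) (fun z => A i z c k)); first exact: smooth_field_mx.
apply: smooth_on_inv => // [|z cz]; first exact: open_codom.
by have := field_mx_unit g cz; rewrite unitmxE unitfE.
Qed.

(** The form in which divergence-freeness is used: the density is proportional to the inverse of q
    near y, so density times field has coordinate divergence zero. *)
Lemma field_mx_quotient_div c : \sum_k partial k (fun z => A i z c k * (q z)^-1) y = 0.
Proof.
have q0 z : C i z -> q z != 0 by move=> cz; have := field_mx_unit g cz; rewrite unitmxE unitfE.
have sqV : smooth_on (C i) (fun z => (q z)^-1).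
  by apply: smooth_on_inv => //; exact: open_codom.
under eq_bigr => k _.
  rewrite (partial_mul _ (@smooth_field_mx _ _ _ i c k) sqV cy) (partial_inv _ sq cy (q0 _ cy)).
  over.
rewrite big_split /= -mulr_sumr.
have -> : \sum_k A i y c k * (- q y ^- 2 * partial k q y) = - q y ^- 2 * \sum_k A i y c k * partial k q y.
  by rewrite mulr_sumr; apply: eq_bigr => k _; rewrite mulrCA.
by rewrite field_mx_div; field; exact: q0.
Qed.

(** [invmx_gram] expresses the inverse metric in the invariant frame. The divergence form of the
    Laplacian becomes a sum over c and e in which the outer derivative falls on density times field
    c, contributing zero, or on the field e applied to u. *)
Lemma local_laplacianE u : smoothR u -> local_laplacian g i (u \o \par_i) y =
  - \sum_c \sum_e invmx (gram1 g) c e * invariant_field c (invariant_field e u) (\par_i y).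
Proof.
move=> su; set D := \det (gram1 g).
have D0 : 0 < D by apply: det_pos => v v0; exact: gram1_pos.
have q0 z : C i z -> q z != 0 by move=> cz; have := field_mx_unit g cz; rewrite unitmxE unitfE.
(* By continuity q keeps the sign s near y, so the density, a positive square root, is the constant
   [k0] divided by q. *)
pose s := Num.sg (q y); have s0 : s != 0 by rewrite sgr_eq0 q0.
pose k0 := s * Num.sqrt D; have k00 : k0 != 0 by rewrite mulf_neq0// gt_eqF// sqrtr_gt0.
pose vol z := Num.sqrt (\det (gram g i (\par_i z))).
have volE : \forall z \near y, vol z = k0 / q z.
  have nz : \forall z \near y, C i z /\ `|q y - q z| <= `|q y| / 2.
    apply: near_and; first exact: near_codom.
    have /continuous_nearP := smooth_on_continuous sq cy; apply.
    by rewrite divr_gt0// normr_gt0 q0.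
  apply: filterS nz => z [cz hz].
  have sz : `|q z| = s * q z.
    by apply: sg_near hz; exact: q0.
  have := congr1 determinant (gram1_chart g cz); rewrite !det_mulmx det_tr -/D -/(q z) => DE.
  have -> : vol z = Num.sqrt (D / (q z) ^+ 2).
    by rewrite /vol; congr Num.sqrt; rewrite DE; field; exact: q0.
  rewrite sqrtrM ?ltW// sqrtrV ?sqr_ge0// sqrtr_sqr sz /k0.
  have ss : s * s = 1 by have := sqr_sg (q y); rewrite q0// expr2.
  have sV : s^-1 = s by apply: (mulfI s0); rewrite mulfV// ss.
  by rewrite invfM sV; ring.
have W z k : C i z -> \sum_l invmx (gram g i (\par_i z)) k l * partial l (u \o \par_i) z =
    \sum_c \sum_e invmx (gram1 g) c e * (A i z c k * invariant_field e u (\par_i z)).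
  move=> cz; rewrite (invmx_gram cz).
  rewrite (eq_bigr (fun l => \sum_e ((A i z)^T *m invmx (gram1 g)) k e *
     (A i z e l * partial l (u \o \par_i) z))); last first.
    by move=> l _; rewrite mxE mulr_suml; apply: eq_bigr => e _; rewrite mulrA.
  rewrite exchange_big /= [RHS]exchange_big; apply: eq_bigr => e _.
  rewrite -mulr_sumr -invariant_field_chart// mxE mulr_suml; apply: eq_bigr => c _.
  by rewrite mxE; ring.
rewrite /local_laplacian -/vol.
have step k : partial k (fun z => vol z * \sum_l invmx (gram g i (\par_i z)) k l * partial l (u \o \par_i) z) y =
   \sum_c \sum_e (k0 * invmx (gram1 g) c e) * (A i y c k / q y * partial k (invariant_field e u \o \par_i) y
      + invariant_field e u (\par_i y) * partial k (fun z => A i z c k * (q z)^-1) y).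
  pose T c e z := (A i z c k * (q z)^-1) * (invariant_field e u \o \par_i) z.
  have sT c e : smooth_on (C i) (T c e).
    apply: smooth_on_mul (smooth_field_mx_quotient c k) _; first exact: open_codom.
    exact: smoothR_invariant_field.
  rewrite (@partial_near _ _ _ (fun z => \sum_c \sum_e (k0 * invmx (gram1 g) c e) * T c e z)).
    rewrite (partial_sum (@open_codom _ _ _ i) _ _ _ cy) => [|c]; last first.
      apply: smooth_on_sum => [|e]; first exact: open_codom.
      exact: (smooth_on_scale _ (@open_codom _ _ _ i) (sT c e)).
    apply: eq_bigr => c _; rewrite (partial_sum (@open_codom _ _ _ i) _ _ _ cy) => [|e]; last first.
      exact: (smooth_on_scale _ (@open_codom _ _ _ i) (sT c e)).
    apply: eq_bigr => e _; rewrite (partial_scale _ _ (sT c e) cy); congr (_ * _).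
    apply: partial_mul cy; first exact: smooth_field_mx_quotient.
    exact: smoothR_invariant_field.
  have nC := near_codom cy.
  apply: filterS2 (volE) nC => z vz cz; rewrite vz W// mulr_sumr; apply: eq_bigr => c _.
  by rewrite mulr_sumr; apply: eq_bigr => e _; rewrite /T /=; ring.
under eq_bigr do rewrite step.
rewrite exchange_big /=.
under eq_bigr => c _ do rewrite exchange_big /=.
have final c e : \sum_k k0 * invmx (gram1 g) c e * (A i y c k / q y * partial k (invariant_field e u \o \par_i) y
      + invariant_field e u (\par_i y) * partial k (fun z => A i z c k * (q z)^-1) y) =
    k0 / q y * (invmx (gram1 g) c e * invariant_field c (invariant_field e u) (\par_i y)).
  rewrite -mulr_sumr big_split /= -[X in _ + X]mulr_sumr field_mx_quotient_div mulr0 addr0.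
  rewrite (invariant_field_chart c (smoothR_invariant_field e su) cy).
  rewrite (eq_bigr (fun k => (q y)^-1 * (A i y c k * partial k (invariant_field e u \o \par_i) y))).
    by rewrite -mulr_sumr; ring.
  by move=> k _; ring.
under eq_bigr => c _ do (under eq_bigr => e _ do rewrite final; rewrite -mulr_sumr).
rewrite -mulr_sumr -/(vol y) (nbhs_singleton volE) mulNr; congr (- _).
by rewrite mulKf// mulf_neq0 ?invr_eq0 ?q0.
Qed.

End at_point.

End laplacian.

(** * Estimates by invariant fields and completeness *)

Lemma seqs_bounded (T : finType) m : exists L : seq (seq T), forall s, (size s <= m)%N -> s \in L.
Proof.
elim: m => [|m [L HL]]; first by exists [:: [::]] => -[|].
exists ([::] :: [seq c :: s | c <- enum T, s <- L]) => -[|c s] /=; first by rewrite mem_head.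
move=> /HL sL; rewrite inE; apply/orP; right; apply/allpairsP; exists (c, s) => //=.
by rewrite mem_enum.
Qed.

Lemma eventually_seqs (T : finType) (P : seq T -> nat -> Prop) m :
  (forall s k l, (k <= l)%N -> P s k -> P s l) -> (forall s, exists k, P s k) ->
  exists k, forall s, (size s <= m)%N -> P s k.
Proof.
move=> mP H; have [L HL] := seqs_bounded T m.
suff [k Hk] : exists k, forall s, s \in L -> P s k by exists k => s /HL /Hk.
elim: L {HL} => [|s L [k Hk]]; first by exists 0%N.
have [l Hl] := H s; exists (maxn k l) => t; rewrite inE => /orP[/eqP->|/Hk].
  by apply: mP Hl; rewrite leq_maxr.
by apply: mP; rewrite leq_maxl.
Qed.

Lemma partials_rcons {R : realType} {n} s (j : 'I_n) (f : 'rV[R]_n -> R) :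
  partials (rcons s j) f = partials s (partial j f).
Proof. exact: foldr_rcons. Qed.

Section partials_rules.
Context {R : realType} {n : nat} (U : set 'rV[R]_n).
Hypothesis oU : open U.
Implicit Types (f g : 'rV[R]_n -> R).

Lemma partials_eq s f g : (forall x, U x -> f x = g x) ->
  forall x, U x -> partials s f x = partials s g x.
Proof.
move=> E; elim: s => [//|i s IH] x Ux /=.
by apply: partial_near; apply: (near_open oU Ux).
Qed.

Lemma smooth_on_partials s f : smooth_on U f -> smooth_on U (partials s f).
Proof. by elim: s => [//|i s IH] /IH; exact: smooth_on_partial. Qed.

Lemma partials_add s f g x : smooth_on U f -> smooth_on U g -> U x ->
  partials s (fun y => f y + g y) x = partials s f x + partials s g x.
Proof.
move=> sf sg; elim: s x => [//|i s IH] x Ux /=.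
rewrite -(partial_add i (smooth_on_partials s sf) (smooth_on_partials s sg) Ux).
by apply: partial_near; apply: (near_open oU Ux).
Qed.

Lemma partials_cst0 s x : partials s (fun _ : 'rV[R]_n => 0 : R) x = 0.
Proof.
elim: s x => [//|i s IH] x /=; rewrite -[RHS](partial_cst 0 x i).
by congr (partial i _ x); apply/funext.
Qed.

Lemma partials_sum s I (r : seq I) (h : I -> 'rV[R]_n -> R) x : (forall j, smooth_on U (h j)) -> U x ->
  partials s (fun y => \sum_(j <- r) h j y) x = \sum_(j <- r) partials s (h j) x.
Proof.
move=> sh Ux; elim: r => [|j r IH].
  rewrite big_nil -[RHS](partials_cst0 s x); apply: partials_eq => // y _; exact: big_nil.
rewrite big_cons -IH -partials_add//; last exact: smooth_on_sum.
by apply: partials_eq => // y _; exact: big_cons.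
Qed.

Lemma partials_opp s f x : smooth_on U f -> U x ->
  partials s (fun y => - f y) x = - partials s f x.
Proof.
move=> sf Ux; apply/eqP; rewrite -addr_eq0.
have sN : smooth_on U (fun y => - f y).
  apply: (smooth_on_eq oU _ (smooth_on_mul oU (@smooth_on_cst _ _ U (-1)) sf)) => y _.
  by rewrite /= mulN1r.
rewrite -partials_add//; apply/eqP; rewrite -[RHS](partials_cst0 s x).
by apply: partials_eq => // y _; rewrite addNr.
Qed.

End partials_rules.

Lemma smoothR_on {R : realType} {n} {G : lieGroupType R n} (i : chart_index G) (u : G -> R) :
  smoothR u -> smooth_on (codom_chart (atlas i)) (u \o param (atlas i)).
Proof. exact. Qed.

Arguments smoothR_on {R n G} i [u] _.

Lemma smoothR_intro {R : realType} {n} {G : lieGroupType R n} (u : G -> R) :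
  (forall i : chart_index G, smooth_on (codom_chart (atlas i)) (u \o param (atlas i))) -> smoothR u.
Proof. exact. Qed.

Local Opaque smoothR smooth_on.

Section fields.
Context {R : realType} {n : nat} {G : lieGroupType R n}.
Hypothesis cG : compact [set: G].
Variable g : biinvariant_metric G.
Implicit Types (i : chart_index G) (x a b : G) (y z : 'rV[R]_n) (u v : G -> R) (j k c e : 'I_n).

Local Notation C i := (codom_chart (atlas i)).
Local Notation "\par_ i" := (param (atlas i)) (at level 0, i at level 0, format "\par_ i").

Definition fields (s : seq 'I_n) u : G -> R := foldr invariant_field u s.

Lemma smoothR_fields s u : smoothR u -> smoothR (fields s u).
Proof. by elim: s => [//|c s IH] /IH; exact: smoothR_invariant_field. Qed.

Lemma fields_translate s u b x : fields s (fun x => u (b * x)%g) x = fields s u (b * x)%g.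
Proof.
elim: s x => [//|c s IH] x /=; rewrite -invariant_field_translate.
by congr (invariant_field c _ x); apply/funext.
Qed.

Lemma fields_add s u v x : smoothR u -> smoothR v ->
  fields s (fun x => u x + v x) x = fields s u x + fields s v x.
Proof.
move=> su sv; elim: s x => [//|c s IH] x /=.
rewrite -invariant_field_add; [|exact: smoothR_fields|exact: smoothR_fields].
by congr (invariant_field c _ x); apply/funext.
Qed.

Lemma fields_scale s (c : R) u x : smoothR u -> fields s (fun x => c * u x) x = c * fields s u x.
Proof.
move=> su; elim: s x => [//|e s IH] x /=.
rewrite -invariant_field_scale; last exact: smoothR_fields.
by congr (invariant_field e _ x); apply/funext.
Qed.

Lemma fields_sum s I (r : seq I) (h : I -> G -> R) x : (forall q, smoothR (h q)) ->
  fields s (fun x => \sum_(q <- r) h q x) x = \sum_(q <- r) fields s (h q) x.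
Proof.
move=> sh; elim: s x => [//|e s IH] x /=.
rewrite -invariant_field_sum => [|q]; last exact: smoothR_fields.
by congr (invariant_field e _ x); apply/funext.
Qed.

Lemma smoothR_average (A : seq G) u : smoothR u -> smoothR (average A u).
Proof. by move=> su; apply: smoothR_scale; apply: smoothR_sum => a; exact: smoothR_translate_l. Qed.

Lemma invariant_field_average c (A : seq G) u x : smoothR u ->
  invariant_field c (average A u) x = average A (invariant_field c u) x.
Proof.
move=> su; have st a : smoothR (fun x => u (a * x)%g) := smoothR_translate_l a su.
rewrite /average invariant_field_scale; last exact: smoothR_sum.
by rewrite invariant_field_sum//; congr (_ * _); apply: eq_bigr => a _; exact: invariant_field_translate.
Qed.

Lemma invariant_field_max c u x : smoothR u -> (forall x', u x' <= u x) -> invariant_field c u x = 0.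
Proof.
move=> su ux; pose i0 := chart_at (1%g : G); pose z0 := Defs.coord (atlas i0) (1%g : G).
have d0 : dom (atlas i0) (1%g : G) := dom_chart_at _.
have c0 : C i0 z0 by exact: codom_coord.
have p0 : \par_i0 z0 = 1%g by exact: coordK.
pose f z := u (x * \par_i0 z)%g.
have sf : smooth_on (C i0) f := smoothR_on i0 (smoothR_translate_l x su).
have /nbhs_normP[d /= dp Hd] : nbhs z0 (C i0) by exact: near_codom.
have inC (t : R) : t \in `]- d, d[ -> C i0 (t *: 'e_c + z0).
  rewrite in_itv /= => /andP[t1 t2]; apply: Hd; rewrite /ball_/= opprD addrCA subrr addr0 normrN normrZ.
  apply: (@le_lt_trans _ _ `|t|); last by rewrite ltr_norml t1.
  rewrite ler_piMr// norm_le_coord// => k.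
  by rewrite !mxE; case: (_ && _); rewrite ?normr0 ?normr1.
have dl (t : R) : t \in `]- d, d[ -> is_derive t 1 (fun s : R => f (s *: 'e_c + z0)) (partial c f (t *: 'e_c + z0)).
  by move=> /inC ct; apply: is_derive_line; exact: smooth_on_derivable sf ct.
have dd : - d <= d by lra.
have zin : (0 : R) \in `]- d, d[ by rewrite in_itv /= oppr_lt0 dp.
have H0 : is_derive (0 : R) 1 (fun s : R => f (s *: 'e_c + z0)) 0.
  apply: (@derive1_at_max _ _ (- d) d) => // [t /dl[]//|t _].
  by rewrite scale0r add0r /f p0 mulg1.
have := dl 0 zin; rewrite scale0r add0r => /(@derive_val _ _ _ _ _ _ _).
by rewrite (@derive_val _ _ _ _ _ _ _ H0) => E; exact: (esym E).
Qed.

(** [A] is chosen so that the average of the derivative is everywhere near its mean. The field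
    commutes with left translations, so this average is the derivative of [average A u], which
    vanishes at a maximum of that function. *)
Lemma mean_invariant_field c u : smoothR u -> mean (invariant_field c u) = 0.
Proof.
move=> su; have cX : continuous (invariant_field c u).
  by apply: smoothR_continuous; exact: smoothR_invariant_field.
apply/eqP; rewrite -normr_le0; apply/ler_addgt0Pr => e e0; rewrite add0r.
have [A A0 HA] := mean_near cG cX e0.
have sA := smoothR_average A su.
have [x _ Hx] := @compact_EVT_max _ _ (average A u) [set: G] (ex_intro _ 1%g I) cG
  (continuous_subspaceT (smoothR_continuous sA)).
have := HA x; rewrite -invariant_field_average//.
rewrite invariant_field_max ?sub0r ?normrN// => x'; apply: Hx; rewrite in_setT.
by [].
Qed.

(** Coordinate derivatives are combinations of invariant fields with smooth coefficients. The weight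
    w absorbs the coefficients and their derivatives, which lets the induction close; K and the
    neighbourhood do not depend on u. *)
Lemma partials_bound i s (w : 'rV[R]_n -> R) : smooth_on (C i) w -> forall y, C i y ->
  exists2 K : R, 0 <= K & \forall z \near y, forall u (W : R), smoothR u ->
    (forall s' x, (size s' <= size s)%N -> `|fields s' u x| <= W) ->
    `|partials s (fun z => w z * u (\par_i z)) z| <= K * W.
Proof.
have oC : open (C i) by exact: open_codom.
(* The innermost derivative is peeled off: it falls on w, or on u, where it becomes a sum of
   invariant fields with new weights. *)
elim/last_ind: s w => [|s j IH] w sw y cy.
  exists (`|w y| + 1); first by rewrite addr_ge0.
  have nw : \forall z \near y, `|w y - w z| <= 1.
    by have /continuous_nearP := smooth_on_continuous sw cy; apply.
  apply: filterS nw => z hz u W su uW; rewrite /= normrM ler_pM//; last exact: (uW [::]).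
  have := ler_normD (w y) (w z - w y); rewrite addrC subrK => h.
  by apply: (le_trans h); rewrite lerD2l distrC.
have sB c : smooth_on (C i) (fun z => w z * invmx (field_mx i z) j c).
  have := smooth_on_mul oC sw (@smooth_inv_field_mx _ _ _ g i j c); apply.
have [K K0 HK] := IH _ (smooth_on_partial j sw) y cy.
have /choice[L HL] : forall c, exists L, 0 <= L /\ \forall z \near y, forall u (W : R), smoothR u ->
    (forall s' x, (size s' <= size s)%N -> `|fields s' u x| <= W) ->
    `|partials s (fun z => (w z * invmx (field_mx i z) j c) * u (\par_i z)) z| <= L * W.
  by move=> c; have [L L0 HL] := IH _ (sB c) y cy; exists L.
exists (K + \sum_c L c); first by rewrite addr_ge0// sumr_ge0// => c _; case: (HL c).
have nL : \forall z \near y, forall c, forall u (W : R), smoothR u ->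
    (forall s' x, (size s' <= size s)%N -> `|fields s' u x| <= W) ->
    `|partials s (fun z => (w z * invmx (field_mx i z) j c) * u (\par_i z)) z| <= L c * W.
  by apply: near_forall => c; case: (HL c).
have nA := near_and HK (near_and nL (near_codom cy)).
apply: filterS nA => z [HKz [HLz cz]] u W su uW.
have sup : smooth_on (C i) (fun z => u (\par_i z)) := smoothR_on i su.
have sXp c : smooth_on (C i) (fun z => invariant_field c u (\par_i z)) := smoothR_on i (smoothR_invariant_field c su).
have s1 : smooth_on (C i) (fun z => partial j w z * u (\par_i z)).
  by have := smooth_on_mul oC (smooth_on_partial j sw) sup.
have s2 c : smooth_on (C i) (fun z => (w z * invmx (field_mx i z) j c) * invariant_field c u (\par_i z)).
  by have := smooth_on_mul oC (sB c) (sXp c).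
rewrite partials_rcons.
rewrite (@partials_eq _ _ _ oC s _ (fun z => partial j w z * u (\par_i z) +
   \sum_c (w z * invmx (field_mx i z) j c) * invariant_field c u (\par_i z)) _ z cz); last first.
  move=> z' cz'; rewrite (partial_mul j sw sup cz').
  rewrite [partial j _ _](partial_invariant_field g j su cz') addrC mulrC mulr_sumr; congr (_ + _).
  by apply: eq_bigr => c _; rewrite mulrA.
rewrite (partials_add oC s s1 _ cz); last exact: smooth_on_sum.
rewrite (partials_sum oC s _ s2 cz) mulrDl.
apply: le_trans (ler_normD _ _) _; apply: lerD.
  by apply: HKz => // s' x ss; apply: uW; rewrite size_rcons leqW.
rewrite mulr_suml; apply: le_trans (ler_norm_sum _ _ _) _; apply: ler_sum => c _.
apply: HLz => [|s' x ss]; first exact: smoothR_invariant_field.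
by have := uW (rcons s' c) x; rewrite /fields foldr_rcons !size_rcons; exact.
Qed.

Lemma partials_bound_compact i s (K : set 'rV[R]_n) : compact K -> K `<=` C i ->
  exists M, forall z u (W : R), K z -> smoothR u ->
    (forall s' x, (size s' <= size s)%N -> `|fields s' u x| <= W) ->
    `|partials s (u \o \par_i) z| <= M * W.
Proof.
move=> cK KC; have oC : open (C i) by exact: open_codom.
pose P (M : R) z := forall u (W : R), smoothR u ->
    (forall s' x, (size s' <= size s)%N -> `|fields s' u x| <= W) ->
    `|partials s (u \o \par_i) z| <= M * W.
have /compact_near_coveringP cov := cK.
(* Local constants are made uniform over [K] by the near-covering property, with large M as the
   parameter. *)
have : \forall M \near +oo, K `<=` P M.
  apply: cov => y /KC cy.
  have [L L0 HL] := partials_bound s (@smooth_on_cst _ _ (C i) (1 : R)) cy.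
  exists ([set z | C i z /\ forall u (W : R), smoothR u ->
    (forall s' x, (size s' <= size s)%N -> `|fields s' u x| <= W) ->
    `|partials s (fun z => 1 * u (\par_i z)) z| <= L * W], [set M | L <= M]).
    split; first by apply: near_and HL; exact: near_codom.
    by apply: nbhs_pinfty_ge; rewrite num_real.
  move=> [z M] [/= [cz Hz] LM] u W su uW.
  have W0 : 0 <= W by apply: le_trans (uW [::] 1%g _).
  apply: le_trans (ler_wpM2r W0 LM).
  rewrite (@partials_eq _ _ _ oC s _ (fun z => 1 * u (\par_i z)) _ z cz); first exact: Hz.
  by move=> z' _; rewrite mul1r.
by move=> [M [_ HM]]; exists (M + 1) => z u W Kz; apply: HM => //; rewrite ltrDl.
Qed.

Section complete.
Variable v : nat -> G -> R.
Hypothesis sv : forall k : nat, smoothR (v k).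
Hypothesis cv : forall s (e : R), 0 < e -> exists N, forall (k l : nat) x, (N <= k)%N -> (N <= l)%N ->
  `|fields s (v k) x - fields s (v l) x| <= e.

(** Cauchy bounds on the invariant fields of order up to [size s], uniform on G, give a local Cauchy
    bound on the coordinate derivative s. *)
Let local_cauchy i s y : C i y -> exists V, nbhs y V /\ forall e : R, 0 < e ->
  exists N, forall (k l : nat) z, (N <= k)%N -> (N <= l)%N -> V z ->
    `|partials s (v k \o \par_i) z - partials s (v l \o \par_i) z| <= e.
Proof.
move=> cy; have oC : open (C i) by exact: open_codom.
have [K K0 HK] := partials_bound s (@smooth_on_cst _ _ (C i) (1 : R)) cy.
exists [set z | C i z /\ forall u (W : R), smoothR u ->
    (forall s' x, (size s' <= size s)%N -> `|fields s' u x| <= W) ->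
    `|partials s (fun z => 1 * u (\par_i z)) z| <= K * W]; split.
  by apply: near_and HK; exact: near_codom.
move=> e e0; have d0 : 0 < e / (K + 1) by rewrite divr_gt0// ltr_wpDl.
have [|s'|N HN] := @eventually_seqs _ (fun s N => forall (k l : nat) x, (N <= k)%N -> (N <= l)%N ->
  `|fields s (v k) x - fields s (v l) x| <= e / (K + 1)) (size s).
- by move=> s' N M NM H k l x Mk Ml; apply: H; exact: leq_trans NM _.
- exact: cv.
exists N => k l z Nk Nl [cz Hz].
have sN : smoothR (fun x => - v l x) by exact: smoothR_opp.
have sd : smoothR (fun x => v k x + - v l x) by exact: smoothR_add (sv k) sN.
have -> : partials s (v k \o \par_i) z - partials s (v l \o \par_i) z =
    partials s (fun z => 1 * (v k (\par_i z) + - v l (\par_i z))) z.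
  rewrite -(partials_opp oC s (smoothR_on i (sv l)) cz) -(partials_add oC s (smoothR_on i (sv k)) (smoothR_on i sN) cz).
  by apply: (partials_eq oC) => // z' _; rewrite mul1r.
apply: (le_trans (Hz _ (e / (K + 1)) sd _)).
  move=> s' x ss; rewrite (fields_add s' x (sv k) sN).
  have -> : fields s' (fun x => - v l x) x = - fields s' (v l) x.
    rewrite -mulN1r -(fields_scale s' (-1) x (sv l)); congr (fields s' _ x).
    by apply/funext => x'; rewrite mulN1r.
  exact: HN ss k l x Nk Nl.
by rewrite mulrA ler_pdivrMr ?ltr_wpDl// mulrDr mulr1 mulrC lerDl ltW.
Qed.

Lemma smoothR_limit : smoothR (fun x => lim (v m x @[m --> \oo])).
Proof.
apply: smoothR_intro => i; exact: (@smooth_on_limit _ _ _ (@open_codom _ _ _ i) (fun k : nat => v k \o \par_i)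
  (fun k : nat => smoothR_on i (sv k)) (fun s y => @local_cauchy i s y)).
Qed.

Lemma smoothR_limit_cvg i s (K : set 'rV[R]_n) (e : R) : compact K -> K `<=` C i -> 0 < e ->
  exists N, forall (k : nat) z, (N <= k)%N -> K z ->
    `|partials s (v k \o \par_i) z -
      partials s ((fun x => lim (v m x @[m --> \oo])) \o \par_i) z| <= e.
Proof.
move=> cK KC e0; have /compact_near_coveringP cov := cK.
pose P (k : nat) z := `|partials s (v k \o \par_i) z -
      partials s ((fun x => lim (v m x @[m --> \oo])) \o \par_i) z| <= e.
have [N _ HN] : \forall k \near \oo, K `<=` (fun z => P k z).
  apply: cov => y /KC cy.
  have [V [nV HV]] := @smooth_on_limit_cvg _ _ _ (@open_codom _ _ _ i) (fun k : nat => v k \o \par_i)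
    (fun k : nat => smoothR_on i (sv k)) (fun s y => @local_cauchy i s y) s y cy.
  have [N HN] := HV _ e0.
  exists (V, [set k : nat | (N <= k)%N]); first by split=> //; exists N.
  by move=> [z k] [/= Vz Nk]; exact: HN.
by exists N => k z Nk Kz; exact: HN.
Qed.

Lemma limit_near (e : R) : 0 < e -> exists N, forall (k : nat) x, (N <= k)%N ->
  `|v k x - lim (v m x @[m --> \oo])| <= e.
Proof.
move=> e0; have [N HN] := cv [::] e0; exists N => k x Nk.
apply: (@cauchy_limit _ (fun k : nat => v k x)) Nk => [d d0|k' l' ? ?]; last exact: HN.
by have [M HM] := cv [::] d0; exists M => k' l' ? ?; exact: HM.
Qed.

End complete.

End fields.

(** * Complex-valued functions *)

Section complex_numbers.
Context {R : realType}.
Implicit Types (z w : R[i]).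
Local Notation Re := (@complex.Re R).
Local Notation Im := (@complex.Im R).

Lemma cRe_add z w : Re (z + w) = Re z + Re w. Proof. by case: z; case: w. Qed.
Lemma cIm_add z w : Im (z + w) = Im z + Im w. Proof. by case: z; case: w. Qed.
Lemma cRe_mul z w : Re (z * w) = Re z * Re w - Im z * Im w. Proof. by case: z; case: w. Qed.
Lemma cIm_mul z w : Im (z * w) = Re z * Im w + Im z * Re w. Proof. by case: z; case: w. Qed.
Lemma cRe_conj z : Re z^* = Re z. Proof. by case: z. Qed.
Lemma cIm_conj z : Im z^* = - Im z. Proof. by case: z. Qed.
Lemma cRe_opp z : Re (- z) = - Re z. Proof. by case: z. Qed.
Lemma cIm_opp z : Im (- z) = - Im z. Proof. by case: z. Qed.

Lemma Re_sum I (r : seq I) (P : pred I) (F : I -> R[i]) :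
  Re (\sum_(i <- r | P i) F i) = \sum_(i <- r | P i) Re (F i).
Proof. by apply: (big_morph Re) => //; exact: cRe_add. Qed.

Lemma Im_sum I (r : seq I) (P : pred I) (F : I -> R[i]) :
  Im (\sum_(i <- r | P i) F i) = \sum_(i <- r | P i) Im (F i).
Proof. by apply: (big_morph Im) => //; exact: cIm_add. Qed.

Lemma complex_eq z w : Re z = Re w -> Im z = Im w -> z = w.
Proof. by case: z => a b; case: w => c d /= -> ->. Qed.

Lemma conjM z w : (z * w)^* = z^* * w^*. Proof. exact: rmorphM. Qed.
Lemma conjD z w : (z + w)^* = z^* + w^*. Proof. exact: rmorphD. Qed.
Lemma conjN z : (- z)^* = - z^*. Proof. exact: rmorphN. Qed.
Lemma conj_sum I (r : seq I) (P : pred I) (F : I -> R[i]) :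
  (\sum_(i <- r | P i) F i)^* = \sum_(i <- r | P i) (F i)^*.
Proof. exact: rmorph_sum. Qed.
Lemma conj_real (a : R) : (a%:C%C)^* = a%:C%C :> R[i].
Proof. by apply: complex_eq; rewrite ?cRe_conj ?cIm_conj /= ?oppr0. Qed.
Lemma conj1 : 1^* = 1 :> R[i]. Proof. exact: rmorph1. Qed.
Lemma conj_nat (N : nat) : (N%:R)^* = N%:R :> R[i]. Proof. exact: rmorph_nat. Qed.

Definition sqn z : R := Re z ^+ 2 + Im z ^+ 2.

Lemma sqn_ge0 z : 0 <= sqn z. Proof. by rewrite addr_ge0// sqr_ge0. Qed.

Lemma mulcJ z : z * z^* = (sqn z)%:C%C.
Proof. by apply: complex_eq; rewrite ?cRe_mul ?cIm_mul cRe_conj cIm_conj /sqn /=; ring. Qed.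

Lemma sqnM z w : sqn (z * w) = sqn z * sqn w.
Proof. by rewrite /sqn cRe_mul cIm_mul; ring. Qed.

Lemma sqnJ z : sqn z^* = sqn z. Proof. by rewrite /sqn cRe_conj cIm_conj sqrrN. Qed.
Lemma sqnN z : sqn (- z) = sqn z. Proof. by rewrite /sqn cRe_opp cIm_opp !sqrrN. Qed.
Lemma sqn_real (a : R) : sqn a%:C%C = a ^+ 2. Proof. by rewrite /sqn /= expr0n addr0. Qed.

Lemma sqn_eq0 z : (sqn z == 0) = (z == 0).
Proof.
rewrite paddr_eq0 ?sqr_ge0// !sqrf_eq0; case: z => a b /=.
by rewrite eq_complex.
Qed.

Lemma sqn0 : sqn 0 = 0. Proof. by apply/eqP; rewrite sqn_eq0. Qed.

Lemma sqnD z w : sqn (z + w) <= 2 * sqn z + 2 * sqn w.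
Proof.
have h (a b c e : R) : (a + c) ^+ 2 + (b + e) ^+ 2 <= 2 * (a ^+ 2 + b ^+ 2) + 2 * (c ^+ 2 + e ^+ 2).
  have := sqr_ge0 (a - c); have := sqr_ge0 (b - e); rewrite !sqrrB !sqrrD; lra.
by rewrite /sqn cRe_add cIm_add; exact: h.
Qed.

(* Used instead of the modulus, since smoothness and the topology of C^oo(G) are
   defined through real and imaginary parts. *)
Definition taxi z : R := `|Re z| + `|Im z|.

Lemma taxi_ge0 z : 0 <= taxi z. Proof. exact: addr_ge0. Qed.
Lemma taxi0 : taxi 0 = 0. Proof. by rewrite /taxi /= normr0 addr0. Qed.
Lemma taxiN z : taxi (- z) = taxi z. Proof. by rewrite /taxi cRe_opp cIm_opp !normrN. Qed.
Lemma taxiJ z : taxi z^* = taxi z. Proof. by rewrite /taxi cRe_conj cIm_conj normrN. Qed.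

Lemma taxiD z w : taxi (z + w) <= taxi z + taxi w.
Proof.
rewrite /taxi cRe_add cIm_add; have := ler_normD (Re z) (Re w); have := ler_normD (Im z) (Im w); lra.
Qed.

Lemma taxiM z w : taxi (z * w) <= taxi z * taxi w.
Proof.
rewrite /taxi cRe_mul cIm_mul mulrDl !mulrDr -!normrM.
have := ler_normB (Re z * Re w) (Im z * Im w); have := ler_normD (Re z * Im w) (Im z * Re w).
lra.
Qed.

Lemma taxi_sum I (r : seq I) (P : pred I) (F : I -> R[i]) :
  taxi (\sum_(i <- r | P i) F i) <= \sum_(i <- r | P i) taxi (F i).
Proof.
elim/big_rec2: _ => [|i a b _ H]; first by rewrite taxi0.
by apply: le_trans (taxiD _ _) _; rewrite lerD2l.
Qed.

Lemma taxi_sqn z : taxi z ^+ 2 <= 2 * sqn z.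
Proof.
rewrite /taxi /sqn -[Re z ^+ 2]real_normK ?num_real// -[Im z ^+ 2]real_normK ?num_real//.
by move: (`|Re z|) (`|Im z|) => a b; have := sqr_ge0 (a - b); rewrite sqrrB sqrrD; lra.
Qed.

Lemma sqn_taxi z : sqn z <= taxi z ^+ 2.
Proof.
rewrite /taxi /sqn -[Re z ^+ 2]real_normK ?num_real// -[Im z ^+ 2]real_normK ?num_real//.
have := normr_ge0 (Re z); have := normr_ge0 (Im z).
by move: (`|Re z|) (`|Im z|) => a b; nra.
Qed.

Lemma taxi_le z (M : R) : 0 <= M -> sqn z <= M ^+ 2 -> taxi z <= 2 * M.
Proof.
move=> M0 h; have := taxi_sqn z; have := taxi_ge0 z => h1 h2.
by rewrite -(@ler_pXn2r _ 2) ?nnegrE ?mulr_ge0//; nra.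
Qed.

End complex_numbers.

Section complex_functions.
Context {R : realType} {n : nat} {G : lieGroupType R n}.
Hypothesis cG : compact [set: G].
Implicit Types (f h : G -> R[i]) (x a b : G) (c : 'I_n) (z w : R[i]).
Local Notation Re := (@complex.Re R).
Local Notation Im := (@complex.Im R).

Record ctsC f : Prop := CtsC {
  ctsC_Re : continuous (fun x => Re (f x));
  ctsC_Im : continuous (fun x => Im (f x)) }.

Lemma ctsC_cst z : ctsC (fun=> z). Proof. by split; exact: cts_cst. Qed.

Lemma ctsC_add f h : ctsC f -> ctsC h -> ctsC (fun x => f x + h x).
Proof.
by move=> [f1 f2] [h1 h2]; split; under eq_fun do rewrite ?cRe_add ?cIm_add; exact: cts_add.
Qed.

Lemma ctsC_mul f h : ctsC f -> ctsC h -> ctsC (fun x => f x * h x).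
Proof.
move=> [f1 f2] [h1 h2]; split; under eq_fun do rewrite ?cRe_mul ?cIm_mul.
  by apply: cts_add; [exact: cts_mul|apply: cts_opp; exact: cts_mul].
by apply: cts_add; exact: cts_mul.
Qed.

Lemma ctsC_conj f : ctsC f -> ctsC (fun x => (f x)^*).
Proof.
by move=> [f1 f2]; split; under eq_fun do rewrite ?cRe_conj ?cIm_conj; [|exact: cts_opp].
Qed.

Lemma ctsC_opp f : ctsC f -> ctsC (fun x => - f x).
Proof. by move=> [f1 f2]; split; under eq_fun do rewrite ?cRe_opp ?cIm_opp; exact: cts_opp. Qed.

Lemma ctsC_sum I (r : seq I) (F : I -> G -> R[i]) : (forall i, ctsC (F i)) ->
  ctsC (fun x => \sum_(i <- r) F i x).
Proof.
move=> cF; split; under eq_fun do rewrite ?Re_sum ?Im_sum;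
  by apply: cts_sum => i; case: (cF i).
Qed.

Lemma ctsC_translate_l f a : ctsC f -> ctsC (fun x => f (a * x)%g).
Proof. by move=> [f1 f2]; split; [exact: (cts_translate_l f1)|exact: (cts_translate_l f2)]. Qed.

Lemma ctsC_translate_r f a : ctsC f -> ctsC (fun x => f (x * a)%g).
Proof. by move=> [f1 f2]; split; [exact: (cts_translate_r f1)|exact: (cts_translate_r f2)]. Qed.

Lemma ctsC_inv f : ctsC f -> ctsC (fun x => f x^-1%g).
Proof. by move=> [f1 f2]; split; [exact: (cts_inv f1)|exact: (cts_inv f2)]. Qed.

Lemma cts_sqn f : ctsC f -> continuous (fun x => sqn (f x)).
Proof. by move=> [f1 f2]; apply: cts_add; apply: cts_mul. Qed.

Lemma ctsC_bounded f : ctsC f -> exists M, forall x, taxi (f x) <= M.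
Proof.
move=> [/(cts_bounded cG)[M1 H1] /(cts_bounded cG)[M2 H2]].
by exists (M1 + M2) => x; apply: lerD.
Qed.

Definition cmean f : R[i] := (mean (fun x => Re (f x)) +i* mean (fun x => Im (f x)))%C.

Lemma cmean_cst z : cmean (fun=> z) = z.
Proof. by apply: complex_eq; exact: (mean_cst cG). Qed.

Lemma cmean_add f h : ctsC f -> ctsC h -> cmean (fun x => f x + h x) = cmean f + cmean h.
Proof.
move=> [f1 f2] [h1 h2]; apply: complex_eq; rewrite /cmean ?cRe_add ?cIm_add /= -mean_add//;
  by congr mean; apply/funext => x; rewrite /= ?cRe_add ?cIm_add.
Qed.

Lemma cmean_scale z f : ctsC f -> cmean (fun x => z * f x) = z * cmean f.
Proof.
move=> [f1 f2]; apply: complex_eq; rewrite /cmean ?cRe_mul ?cIm_mul /= -!(mean_scale cG)//.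
  rewrite -mulN1r -(mean_scale cG); last exact: cts_scale.
  rewrite -mean_add//; [|exact: cts_scale|by apply: cts_scale; exact: cts_scale].
  by congr mean; apply/funext => x; rewrite cRe_mul /= mulN1r.
rewrite -mean_add//; [|exact: cts_scale|exact: cts_scale].
by congr mean; apply/funext => x; rewrite cIm_mul /=.
Qed.

Lemma cmean_scaler z f : ctsC f -> cmean (fun x => f x * z) = cmean f * z.
Proof. by move=> cf; under eq_fun do rewrite mulrC; rewrite cmean_scale// mulrC. Qed.

Lemma cmean_sum I (r : seq I) (F : I -> G -> R[i]) : (forall i, ctsC (F i)) ->
  cmean (fun x => \sum_(i <- r) F i x) = \sum_(i <- r) cmean (F i).
Proof.
move=> cF; elim: r => [|i r IH].
  by rewrite big_nil -[RHS](cmean_cst 0); congr cmean; apply/funext => x; rewrite big_nil.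
rewrite big_cons -IH -cmean_add//; last exact: ctsC_sum.
by congr cmean; apply/funext => x; rewrite big_cons.
Qed.

Lemma cmean_conj f : ctsC f -> cmean (fun x => (f x)^*) = (cmean f)^*.
Proof.
move=> [f1 f2]; apply: complex_eq; rewrite ?cRe_conj ?cIm_conj /cmean /=.
  by congr mean; apply/funext => x; rewrite cRe_conj.
rewrite -mulN1r -(mean_scale cG)//; congr mean; apply/funext => x.
by rewrite cIm_conj mulN1r.
Qed.

Lemma cmean_translate_l f a : ctsC f -> cmean (fun x => f (a * x)%g) = cmean f.
Proof.
by move=> [f1 f2]; rewrite /cmean (mean_translate_l cG a f1) (mean_translate_l cG a f2).
Qed.

Lemma cmean_translate_r f a : ctsC f -> cmean (fun x => f (x * a)%g) = cmean f.
Proof.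
by move=> [f1 f2]; rewrite /cmean (mean_translate_r cG a f1) (mean_translate_r cG a f2).
Qed.

Lemma cmean_taxi f (M : R) : ctsC f -> (forall x, taxi (f x) <= M) -> taxi (cmean f) <= 2 * M.
Proof.
move=> [f1 f2] fM; rewrite /taxi /cmean /= mulr2n mulrDl !mul1r; apply: lerD.
  by apply: (mean_norm cG f1) => x; apply: le_trans (fM x); rewrite lerDl.
by apply: (mean_norm cG f2) => x; apply: le_trans (fM x); rewrite lerDr.
Qed.

Lemma cmean_real (u : G -> R) : cmean (fun x => (u x)%:C%C) = (mean u)%:C%C.
Proof. by apply: complex_eq => //; exact: (mean_cst cG). Qed.

Definition jcts (F : G -> G -> R[i]) :=
  continuous (fun p : G * G => Re (F p.1 p.2)) /\ continuous (fun p : G * G => Im (F p.1 p.2)).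

Lemma cmean_fubini F : jcts F -> cmean (fun x => cmean (F x)) = cmean (fun y => cmean (F ^~ y)).
Proof.
move=> [F1 F2]; apply: complex_eq.
  exact: (@mean_fubini _ _ _ cG (fun x y => Re (F x y)) F1).
exact: (@mean_fubini _ _ _ cG (fun x y => Im (F x y)) F2).
Qed.

Lemma jcts_mul F K : jcts F -> jcts K -> jcts (fun x y => F x y * K x y).
Proof.
move=> [f1 f2] [h1 h2]; split; under eq_fun do rewrite ?cRe_mul ?cIm_mul.
  by apply: cts_add; [exact: cts_mul|apply: cts_opp; exact: cts_mul].
by apply: cts_add; exact: cts_mul.
Qed.

Lemma jcts_comp f (p : G -> G -> G) : ctsC f -> continuous (fun q : G * G => p q.1 q.2) ->
  jcts (fun x y => f (p x y)).
Proof.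
move=> [f1 f2] cp; split => q.
  by apply: (@continuous_comp _ _ _ (fun q : G * G => p q.1 q.2) (fun x => Re (f x))); [exact: cp|exact: f1].
by apply: (@continuous_comp _ _ _ (fun q : G * G => p q.1 q.2) (fun x => Im (f x))); [exact: cp|exact: f2].
Qed.

Lemma jcts_ctsC F : jcts F -> ctsC (fun x => cmean (F x)).
Proof.
have c (K : G -> G -> R) : continuous (fun p : G * G => K p.1 p.2) -> continuous (fun x => mean (K x)).
  move=> cK x; apply/continuous_nearP => e e0.
  have uK := joint_equicontinuous cG cG cK.
  have cK' : continuous (fun p : G * G => K p.2 p.1).
    move=> p; apply: (@continuous_comp _ _ _ (fun p : G * G => (p.2, p.1)) (fun p : G * G => K p.1 p.2)).
      by apply: cvg_pair; [exact: cvg_snd|exact: cvg_fst].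
    exact: cK.
  have uK' := @joint_equicontinuous _ _ _ cG G (fun x y => K y x) cG cK'.
  have c1 y : continuous (K y) := uniformly_equicontinuous_cts uK'.
  apply: filterS (uniformly_equicontinuous_near x uK e0) => x' H.
  have -> : mean (K x) - mean (K x') = mean (K x \+ (fun y => -1 * K x' y)).
    by rewrite mean_add ?mean_scale ?mulN1r//; exact: cts_scale.
  apply: (mean_norm cG) => [|y]; last by rewrite /= mulN1r.
  by apply: cts_add => //; exact: cts_scale.
by move=> [F1 F2]; split; apply: c.
Qed.

Definition ip f h := cmean (fun x => f x * (h x)^*).
Definition norm2 f := mean (fun x => sqn (f x)).

Lemma ctsC_ip f h : ctsC f -> ctsC h -> ctsC (fun x => f x * (h x)^*).
Proof. by move=> cf ch; apply: ctsC_mul => //; exact: ctsC_conj. Qed.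

Lemma ip_self f : ip f f = (norm2 f)%:C%C.
Proof. by rewrite /ip -cmean_real; congr cmean; apply/funext => x; rewrite mulcJ. Qed.

Lemma ip_conj f h : ctsC f -> ctsC h -> (ip f h)^* = ip h f.
Proof.
move=> cf ch; rewrite /ip -cmean_conj; last exact: ctsC_ip.
by congr cmean; apply/funext => x; rewrite conjM conjCK mulrC.
Qed.

Lemma norm2_ge0 f : ctsC f -> 0 <= norm2 f.
Proof. by move=> cf; apply: (mean_ge0 cG) => [|x]; [exact: cts_sqn|exact: sqn_ge0]. Qed.

Lemma norm2_eq0 f : ctsC f -> norm2 f = 0 -> forall x, f x = 0.
Proof.
move=> cf f0 x; apply/eqP; rewrite -sqn_eq0; apply/eqP.
exact: (mean_eq0 cG (cts_sqn cf) (fun x => sqn_ge0 (f x)) f0).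
Qed.

Lemma ip_addl f1 f2 h : ctsC f1 -> ctsC f2 -> ctsC h ->
  ip (fun x => f1 x + f2 x) h = ip f1 h + ip f2 h.
Proof.
move=> c1 c2 ch; rewrite /ip -cmean_add; [|exact: ctsC_ip|exact: ctsC_ip].
by congr cmean; apply/funext => x; rewrite mulrDl.
Qed.

Lemma ip_scalel z f h : ctsC f -> ctsC h -> ip (fun x => z * f x) h = z * ip f h.
Proof.
move=> cf ch; rewrite /ip -cmean_scale; last exact: ctsC_ip.
by congr cmean; apply/funext => x; rewrite mulrA.
Qed.

Lemma ip_suml I (r : seq I) (F : I -> G -> R[i]) h : (forall i, ctsC (F i)) -> ctsC h ->
  ip (fun x => \sum_(i <- r) F i x) h = \sum_(i <- r) ip (F i) h.
Proof.
move=> cF ch; rewrite /ip -cmean_sum => [|i]; last exact: ctsC_ip.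
by congr cmean; apply/funext => x; rewrite mulr_suml.
Qed.

Lemma ip_sumr I (r : seq I) (F : I -> G -> R[i]) h : (forall i, ctsC (F i)) -> ctsC h ->
  ip h (fun x => \sum_(i <- r) F i x) = \sum_(i <- r) ip h (F i).
Proof.
move=> cF ch; rewrite /ip -cmean_sum => [|i]; last exact: ctsC_ip.
by congr cmean; apply/funext => x; rewrite conj_sum mulr_sumr.
Qed.

Lemma ip_scaler z f h : ctsC f -> ctsC h -> ip f (fun x => z * h x) = z^* * ip f h.
Proof.
move=> cf ch; rewrite /ip -cmean_scale; last exact: ctsC_ip.
by congr cmean; apply/funext => x; rewrite conjM mulrCA.
Qed.

(** The squared norm of the remainder r is [norm2 f] minus the sum, and it is nonnegative. *)
Lemma bessel N (e : 'I_N -> G -> R[i]) f : ctsC f -> (forall i, ctsC (e i)) ->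
  (forall i j, ip (e i) (e j) = (i == j)%:R) -> \sum_i sqn (ip f (e i)) <= norm2 f.
Proof.
move=> cf ce oe; pose p x := \sum_i ip f (e i) * e i x.
have cie i : ctsC (fun x => ip f (e i) * e i x) by apply: ctsC_mul => //; exact: ctsC_cst.
have cp : ctsC p by exact: ctsC_sum.
pose r x := f x + -1 * p x.
have cNp : ctsC (fun x => -1 * p x) by apply: ctsC_mul => //; exact: ctsC_cst.
have cr : ctsC r by exact: ctsC_add.
have S : \sum_i (sqn (ip f (e i)))%:C%C = (\sum_i sqn (ip f (e i)))%:C%C :> R[i].
  by rewrite rmorph_sum.
have fp : ip f p = (\sum_i sqn (ip f (e i)))%:C%C.
  rewrite /p ip_sumr// -S; apply: eq_bigr => i _.
  by rewrite ip_scaler// mulrC mulcJ.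
have pp : ip p p = (\sum_i sqn (ip f (e i)))%:C%C.
  rewrite {1}/p ip_suml// -S; apply: eq_bigr => i _.
  rewrite ip_scalel// -mulcJ; congr (_ * _); rewrite /p ip_sumr// (bigD1 i)//=.
  rewrite ip_scaler// oe eqxx mulr1 big1 ?addr0// => j ji.
  by rewrite ip_scaler// oe eq_sym (negPf ji) mulr0.
have pf : ip p f = (\sum_i sqn (ip f (e i)))%:C%C.
  by rewrite -ip_conj// fp conj_real.
have rp : ip r p = 0.
  by rewrite /r ip_addl// ip_scalel// fp pp mulN1r subrr.
have rr : ip r r = ip f f - (\sum_i sqn (ip f (e i)))%:C%C.
  rewrite {1}/r ip_addl// ip_scalel// -[ip p r]ip_conj// rp conjC0 mulr0 addr0.
  rewrite -[LHS]ip_conj// /r ip_addl// ip_scalel// pf mulN1r conjD conjN.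
  by rewrite ip_conj// conj_real.
have := norm2_ge0 cr; have := ip_self r; rewrite rr ip_self => /(congr1 Re) /= <-.
by rewrite subr_ge0.
Qed.

End complex_functions.

Section complex_continuity.
Context {R : realType} {T : topologicalType}.
Implicit Types (f : T -> R[i]).

Lemma normc_taxi (z : R[i]) : `|z| <= (taxi z)%:C%C.
Proof.
case: z => a b; rewrite -[(a +i* b)%C]/((a +i* b)%C) [(a +i* b)%C]complexE.
apply: le_trans (ler_normD _ _) _; rewrite normrM /taxi -complexE /= rmorphD.
by rewrite !normc_def /= !expr0n /= ?add0r !addr0 expr1n sqrtr1 mul1r !sqrtr_sqr.
Qed.

Lemma taxi_normc (z : R[i]) (e : R) : `|z| <= e%:C%C -> taxi z <= 2 * e.
Proof.
rewrite normc_def lecR => h; rewrite mulr2n mulrDl mul1r; apply: lerD; apply: le_trans h;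
  rewrite -sqrtr_sqr ler_wsqrtr// ?lerDl ?lerDr sqr_ge0//.
Qed.

Lemma complex_cvg_taxi f x : {for x, continuous (f : T -> R[i]^o)} <->
  forall e : R, 0 < e -> \forall y \near x, taxi (f x - f y) <= e.
Proof.
split=> [cf e e0|h].
  have e2 : (0 : R[i]) < (e / 2)%:C%C by rewrite ltcR divr_gt0.
  move/(@cvgrPdist_le _ R[i]^o): cf => /(_ _ e2); apply: filterS => y.
  by move=> /taxi_normc; rewrite mulrC divfK.
apply/(@cvgrPdist_le _ R[i]^o) => e e0.
have [er e0'] : e = (complex.Re e)%:C%C /\ 0 < complex.Re e.
  by move: e0; case: e => a b; rewrite ltcE /= => /andP[/eqP -> ->].
rewrite er; apply: filterS (h _ e0') => y hy.
by apply: le_trans (normc_taxi _) _; rewrite lecR.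
Qed.

Lemma complex_continuousP f : continuous (f : T -> R[i]^o) <->
  continuous (fun x => complex.Re (f x)) /\ continuous (fun x => complex.Im (f x)).
Proof.
split=> [cf|[c1 c2] x].
  by split=> x; apply/continuous_nearP => e e0;
    apply: filterS ((complex_cvg_taxi f x).1 (cf x) e e0) => y;
    rewrite /taxi cRe_add cIm_add cRe_opp cIm_opp; apply: le_trans; rewrite ?lerDl ?lerDr.
apply/complex_cvg_taxi => e e0; have e2 : 0 < e / 2 by rewrite divr_gt0.
have n1 := (continuous_nearP _ _).1 (c1 x) _ e2; have n2 := (continuous_nearP _ _).1 (c2 x) _ e2.
apply: filterS (near_and n1 n2) => y [h1 h2].
by rewrite /taxi cRe_add cIm_add cRe_opp cIm_opp [e]splitr lerD.
Qed.

End complex_continuity.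

Section complex_fields.
Context {R : realType} {n : nat} {G : lieGroupType R n}.
Hypothesis cG : compact [set: G].
Implicit Types (f h : G -> R[i]) (x a b : G) (c e : 'I_n) (z w : R[i]).
Local Notation Re := (@complex.Re R).
Local Notation Im := (@complex.Im R).

Record smoothC f : Prop := SmoothC {
  smoothC_Re : smoothR (fun x => Re (f x));
  smoothC_Im : smoothR (fun x => Im (f x)) }.

Lemma smoothCP f : @smooth R n G f <-> smoothC f.
Proof.
split=> [sf|[s1 s2] i]; last by split; [exact: (smoothR_on i s1)|exact: (smoothR_on i s2)].
by split; apply: smoothR_intro => i; [exact: (sf i).1|exact: (sf i).2].
Qed.

Lemma smoothC_cts f : smoothC f -> ctsC f.
Proof. by move=> [s1 s2]; split; [exact: (smoothR_continuous s1)|exact: (smoothR_continuous s2)]. Qed.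

Lemma smoothC_cst z : smoothC (fun=> z). Proof. by split; exact: smoothR_cst. Qed.

Lemma smoothC_add f h : smoothC f -> smoothC h -> smoothC (fun x => f x + h x).
Proof.
by move=> sf sh; have f1 := smoothC_Re sf; have f2 := smoothC_Im sf;
have h1 := smoothC_Re sh; have h2 := smoothC_Im sh; split; under eq_fun do rewrite ?cRe_add ?cIm_add; exact: smoothR_add.
Qed.

Lemma smoothC_mul f h : smoothC f -> smoothC h -> smoothC (fun x => f x * h x).
Proof.
move=> sf sh; have f1 := smoothC_Re sf; have f2 := smoothC_Im sf;
have h1 := smoothC_Re sh; have h2 := smoothC_Im sh; split; under eq_fun do rewrite ?cRe_mul ?cIm_mul.
  by apply: smoothR_add; [exact: smoothR_mul|apply: smoothR_opp; exact: smoothR_mul].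
by apply: smoothR_add; exact: smoothR_mul.
Qed.

Lemma smoothC_scale z f : smoothC f -> smoothC (fun x => z * f x).
Proof. by move=> sf; apply: smoothC_mul => //; exact: smoothC_cst. Qed.

Lemma smoothC_conj f : smoothC f -> smoothC (fun x => (f x)^*).
Proof.
move=> sf; have f1 := smoothC_Re sf; have f2 := smoothC_Im sf; split; under eq_fun do rewrite ?cRe_conj ?cIm_conj; first exact: f1.
exact: smoothR_opp.
Qed.

Lemma smoothC_opp f : smoothC f -> smoothC (fun x => - f x).
Proof. by move=> sf; have f1 := smoothC_Re sf; have f2 := smoothC_Im sf; split; under eq_fun do rewrite ?cRe_opp ?cIm_opp; exact: smoothR_opp. Qed.

Lemma smoothC_sum I (r : seq I) (F : I -> G -> R[i]) : (forall i, smoothC (F i)) ->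
  smoothC (fun x => \sum_(i <- r) F i x).
Proof.
move=> sF; split; under eq_fun do rewrite ?Re_sum ?Im_sum;
  apply: smoothR_sum => i.
- exact: smoothC_Re (sF i).
- exact: smoothC_Im (sF i).
Qed.

Lemma smoothC_translate_l f a : smoothC f -> smoothC (fun x => f (a * x)%g).
Proof.
by move=> sf; have f1 := smoothC_Re sf; have f2 := smoothC_Im sf; split; [exact: (smoothR_translate_l a f1)|exact: (smoothR_translate_l a f2)].
Qed.

Lemma smoothC_translate_r f a : smoothC f -> smoothC (fun x => f (x * a)%g).
Proof.
by move=> sf; have f1 := smoothC_Re sf; have f2 := smoothC_Im sf; split; [exact: (smoothR_translate_r a f1)|exact: (smoothR_translate_r a f2)].
Qed.

Definition cfield c f x : R[i] :=
  (invariant_field c (fun y => Re (f y)) x +i* invariant_field c (fun y => Im (f y)) x)%C.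

Definition cfields s f := foldr cfield f s.

Lemma smoothC_cfield c f : smoothC f -> smoothC (cfield c f).
Proof.
by move=> sf; have s1 := smoothC_Re sf; have s2 := smoothC_Im sf; split; [exact: (smoothR_invariant_field c s1)|
                           exact: (smoothR_invariant_field c s2)].
Qed.

Lemma smoothC_cfields s f : smoothC f -> smoothC (cfields s f).
Proof. by move=> sf; elim: s => [//|c s IH]; exact: smoothC_cfield. Qed.

Lemma Re_cfields s f x : Re (cfields s f x) = fields s (fun y => Re (f y)) x.
Proof.
suff -> : fields s (fun y => Re (f y)) = (fun x => Re (cfields s f x)) by [].
by elim: s => [//|c s IH]; rewrite /= IH.
Qed.

Lemma Im_cfields s f x : Im (cfields s f x) = fields s (fun y => Im (f y)) x.
Proof.
suff -> : fields s (fun y => Im (f y)) = (fun x => Im (cfields s f x)) by [].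
by elim: s => [//|c s IH]; rewrite /= IH.
Qed.

Lemma cfield_translate c f a x : cfield c (fun y => f (a * y)%g) x = cfield c f (a * x)%g.
Proof.
by rewrite /cfield (invariant_field_translate c (fun y => Re (f y)))
  (invariant_field_translate c (fun y => Im (f y))).
Qed.

Lemma cfield_add c f h x : smoothC f -> smoothC h ->
  cfield c (fun y => f y + h y) x = cfield c f x + cfield c h x.
Proof.
move=> sf sh; have f1 := smoothC_Re sf; have f2 := smoothC_Im sf;
have h1 := smoothC_Re sh; have h2 := smoothC_Im sh; apply: complex_eq; rewrite ?cRe_add ?cIm_add /=.
  by under [X in invariant_field c X]eq_fun do rewrite cRe_add; exact: invariant_field_add.
by under [X in invariant_field c X]eq_fun do rewrite cIm_add; exact: invariant_field_add.
Qed.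

Lemma cfield_cst c z x : cfield c (fun=> z) x = 0.
Proof. by rewrite /cfield !invariant_field_cst. Qed.

Lemma cfield_mul c f h x : smoothC f -> smoothC h ->
  cfield c (fun y => f y * h y) x = f x * cfield c h x + h x * cfield c f x.
Proof.
move=> sf sh; have f1 := smoothC_Re sf; have f2 := smoothC_Im sf;
have h1 := smoothC_Re sh; have h2 := smoothC_Im sh; apply: complex_eq; rewrite ?cRe_add ?cIm_add ?cRe_mul ?cIm_mul /=.
  under [X in invariant_field c X]eq_fun do rewrite cRe_mul.
  rewrite invariant_field_add; [|exact: smoothR_mul|by apply: smoothR_opp; exact: smoothR_mul].
  under [X in _ + invariant_field c X x]eq_fun do rewrite -mulN1r.
  rewrite (@invariant_field_scale _ _ _ _ _ _ _ (smoothR_mul f2 h2)) !invariant_field_mul//.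
  by ring.
under [X in invariant_field c X]eq_fun do rewrite cIm_mul.
rewrite (@invariant_field_add _ _ _ _ _ _ _ (smoothR_mul f1 h2) (smoothR_mul f2 h1)).
by rewrite !invariant_field_mul//; ring.
Qed.

Lemma cfield_scale c z f x : smoothC f -> cfield c (fun y => z * f y) x = z * cfield c f x.
Proof.
by move=> sf; rewrite cfield_mul// ?cfield_cst ?mulr0 ?addr0//; exact: smoothC_cst.
Qed.

Lemma cfield_conj c f x : smoothC f -> cfield c (fun y => (f y)^*) x = (cfield c f x)^*.
Proof.
move=> sf; have f1 := smoothC_Re sf; have f2 := smoothC_Im sf; apply: complex_eq; rewrite ?cRe_conj ?cIm_conj /=.
  by under eq_fun do rewrite cRe_conj.
under eq_fun do rewrite cIm_conj -mulN1r.
by rewrite invariant_field_scale// mulN1r.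
Qed.

Lemma cfield_sum c I (r : seq I) (F : I -> G -> R[i]) x : (forall i, smoothC (F i)) ->
  cfield c (fun y => \sum_(i <- r) F i y) x = \sum_(i <- r) cfield c (F i) x.
Proof.
move=> sF; elim: r => [|i r IH].
  by under eq_fun do rewrite big_nil; rewrite cfield_cst big_nil.
under eq_fun do rewrite big_cons.
by rewrite cfield_add ?IH ?big_cons//; exact: smoothC_sum.
Qed.

Lemma cfields_add s f h x : smoothC f -> smoothC h ->
  cfields s (fun y => f y + h y) x = cfields s f x + cfields s h x.
Proof.
move=> sf sh; suff -> : cfields s (fun y => f y + h y) = (fun x => cfields s f x + cfields s h x) by [].
elim: s => [//|c s IH]; apply/funext => y; rewrite /= IH.
by rewrite cfield_add//; exact: smoothC_cfields.
Qed.

Lemma cfields_scale s z f x : smoothC f -> cfields s (fun y => z * f y) x = z * cfields s f x.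
Proof.
move=> sf; suff -> : cfields s (fun y => z * f y) = (fun x => z * cfields s f x) by [].
elim: s => [//|c s IH]; apply/funext => y; rewrite /= IH.
by rewrite cfield_scale//; exact: smoothC_cfields.
Qed.

Lemma cfields_sum s I (r : seq I) (F : I -> G -> R[i]) x : (forall i, smoothC (F i)) ->
  cfields s (fun y => \sum_(i <- r) F i y) x = \sum_(i <- r) cfields s (F i) x.
Proof.
move=> sF; elim: r => [|i r IH]; last first.
  by under eq_fun do rewrite big_cons; rewrite cfields_add ?IH ?big_cons//; exact: smoothC_sum.
rewrite big_nil -[RHS](mul0r (cfields s (fun=> 0) x)) -cfields_scale; last exact: smoothC_cst.
by congr (cfields s _ x); apply/funext => y; rewrite big_nil mul0r.
Qed.

Lemma cmean_cfield c f : smoothC f -> cmean (cfield c f) = 0.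
Proof.
by move=> sf; have f1 := smoothC_Re sf; have f2 := smoothC_Im sf; apply: complex_eq; rewrite /=; exact: (mean_invariant_field cG).
Qed.

(** Integration by parts: the derivative of f times the conjugate of h has mean zero, and the fields
    are real. *)
Lemma ip_cfield c f h : smoothC f -> smoothC h -> ip (cfield c f) h = - ip f (cfield c h).
Proof.
move=> sf sh; apply/eqP; rewrite -addr_eq0 /ip -(cmean_add cG); last first.
- by apply: ctsC_ip; apply: smoothC_cts => //; exact: smoothC_cfield.
- by apply: ctsC_ip; apply: smoothC_cts => //; exact: smoothC_cfield.
apply/eqP; rewrite -[RHS](@cmean_cfield c (fun x => f x * (h x)^*)); last first.
  by apply: smoothC_mul => //; exact: smoothC_conj.
congr cmean; apply/funext => x.
by rewrite cfield_mul ?cfield_conj// 1?addrC 1?[(_^*) * _]mulrC//; exact: smoothC_conj.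
Qed.

Variable g : biinvariant_metric G.

Definition Hinv c e : R[i] := (invmx (gram1 g) c e)%:C%C.

Definition lap f x : R[i] := - \sum_c \sum_e Hinv c e * cfield c (cfield e f) x.

Lemma laplace_beltramiE f x : smoothC f -> laplace_beltrami g f x = lap f x.
Proof.
move=> sf; have f1 := smoothC_Re sf; have f2 := smoothC_Im sf; set i := chart_at x; have dx : dom (atlas i) x := dom_chart_at x.
have cy := codom_coord dx.
have E (u : G -> R) : smoothR u -> local_laplacian g i (u \o param (atlas i)) (Defs.coord (atlas i) x) =
    - \sum_c \sum_e invmx (gram1 g) c e * invariant_field c (invariant_field e u) x.
  by move=> su; rewrite (local_laplacianE g cy su) coordK.
apply: complex_eq; rewrite /laplace_beltrami /lap -/i /= ?cRe_opp ?cIm_opp ?Re_sum ?Im_sum.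
  rewrite [LHS](E _ f1); congr (- _); apply: eq_bigr => c _; rewrite Re_sum.
  by apply: eq_bigr => e _; rewrite cRe_mul /= mul0r subr0.
rewrite [LHS](E _ f2); congr (- _); apply: eq_bigr => c _; rewrite Im_sum.
by apply: eq_bigr => e _; rewrite cIm_mul /= mul0r addr0.
Qed.

Lemma Hinv_sym c e : Hinv c e = Hinv e c.
Proof. by rewrite /Hinv -[in RHS](gram1_sym g) -trmx_inv mxE. Qed.

Lemma Hinv_conj c e : (Hinv c e)^* = Hinv c e. Proof. exact: conj_real. Qed.

Lemma smoothC_lap f : smoothC f -> smoothC (lap f).
Proof.
move=> sf; apply: smoothC_opp; apply: smoothC_sum => c; apply: smoothC_sum => e.
by apply: smoothC_scale; do 2!apply: smoothC_cfield.
Qed.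

Lemma ip_lap f h : smoothC f -> smoothC h ->
  ip (lap f) h = \sum_c \sum_e Hinv c e * ip (cfield e f) (cfield c h).
Proof.
move=> sf sh; have ch := smoothC_cts sh.
have s2 c e : smoothC (cfield c (cfield e f)) by do 2!apply: smoothC_cfield.
have -> : lap f = (fun x => -1 * \sum_c \sum_e Hinv c e * cfield c (cfield e f) x).
  by apply/funext => x; rewrite mulN1r.
have c2 c e : ctsC (fun x => Hinv c e * cfield c (cfield e f) x).
  by apply: smoothC_cts; exact: smoothC_scale.
have c1 c : ctsC (fun x => \sum_e Hinv c e * cfield c (cfield e f) x) by exact: ctsC_sum.
rewrite ip_scalel//; last exact: ctsC_sum.
rewrite ip_suml// mulN1r -sumrN; apply: eq_bigr => c _.
rewrite ip_suml// -sumrN; apply: eq_bigr => e _.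
rewrite ip_scalel//; last exact: smoothC_cts.
by rewrite ip_cfield ?mulrN ?opprK//; exact: smoothC_cfield.
Qed.

(** The Dirichlet form of [ip_lap] is Hermitian, the inverse Gram matrix being real and
    symmetric. *)
Lemma ip_lap_sym f h : smoothC f -> smoothC h -> ip (lap f) h = ip f (lap h).
Proof.
move=> sf sh; rewrite ip_lap// -[RHS](ip_conj cG (smoothC_cts (smoothC_lap sh)) (smoothC_cts sf)).
rewrite ip_lap// conj_sum exchange_big/=; apply: eq_bigr => c _.
rewrite conj_sum; apply: eq_bigr => e _.
rewrite conjM Hinv_conj Hinv_sym ip_conj//; exact/smoothC_cts/smoothC_cfield.
Qed.

End complex_fields.

(** * The Laplacian is bi-invariant *)

Lemma change_of_form (F : comPzRingType) n (H A h : 'I_n -> 'I_n -> F) :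
  \sum_c \sum_e H c e * (\sum_e' \sum_c' A e e' * A c c' * h c' e') =
  \sum_c' \sum_e' (\sum_c \sum_e A c c' * H c e * A e e') * h c' e'.
Proof.
transitivity (\sum_c \sum_e \sum_c' \sum_e' A c c' * H c e * A e e' * h c' e').
  apply: eq_bigr => c _; apply: eq_bigr => e _; rewrite exchange_big mulr_sumr.
  apply: eq_bigr => c' _; rewrite mulr_sumr; apply: eq_bigr => e' _; ring.
under eq_bigr do rewrite exchange_big; rewrite exchange_big; apply: eq_bigr => c' _ /=.
under eq_bigr do rewrite exchange_big; rewrite exchange_big; apply: eq_bigr => e' _ /=.
by rewrite mulr_suml; apply: eq_bigr => c _; rewrite mulr_suml; apply: eq_bigr.
Qed.

Section adjoint.
Context {R : realType} {n : nat} {G : lieGroupType R n}.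
Variable g : biinvariant_metric G.
Implicit Types (x a b : G) (u : G -> R) (f h : G -> R[i]) (c e j k : 'I_n).

Let i0 := chart_at (1%g : G).
Let z0 := Defs.coord (atlas i0) (1%g : G).
Let d0 : dom (atlas i0) (1%g : G) := dom_chart_at (1%g : G).

(** Row c is the image under right translation by a of the c-th coordinate vector at 1, in the chart
    chosen at a. *)
Definition right_field_mx a : 'M[R]_n :=
  \matrix_(c, k) partial c (fun z => Defs.coord (atlas (chart_at a)) (param (atlas i0) z * a)%g 0 k) z0.

(** The same vectors in the left-invariant frame at a: in the usual notation the matrix of Ad(a^-1),
    with the images of basis vectors as rows. *)
Definition Ad a : 'M[R]_n :=
  right_field_mx a *m invmx (field_mx (chart_at a) (Defs.coord (atlas (chart_at a)) a)).

Let z0_mulr a : mulr_dom a i0 (chart_at a) z0.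
Proof.
split; first exact: codom_coord.
by rewrite (coordK d0) mul1g; exact: dom_chart_at.
Qed.

Lemma gram1_right a :
  gram1 g = right_field_mx a *m gram g (chart_at a) a *m (right_field_mx a)^T.
Proof.
have da : dom (atlas (chart_at a)) (1 * a)%g by rewrite mul1g; exact: dom_chart_at.
have := @gram_right _ _ _ g a i0 (chart_at a) 1%g d0 da; rewrite mul1g /=.
suff -> : 'J (Defs.coord (atlas (chart_at a)) \o (fun x => x * a)%g \o param (atlas i0))
  (Defs.coord (atlas i0) (1%g : G)) = right_field_mx a by [].
apply/matrixP => c k.
rewrite (@jacobianE _ _ _ _ (@open_mulr_dom _ _ _ a i0 (chart_at a)) _ _ c k _ (z0_mulr a)) ?mxE//.
by move=> l; exact: smooth_mulr.
Qed.

(** Left and right translation from 1 to a are both isometries, so passing from one image of the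
    frame to the other preserves the Gram matrix. *)
Lemma gram1_Ad a : gram1 g = Ad a *m gram1 g *m (Ad a)^T.
Proof.
have ca := codom_coord (dom_chart_at a); have U := field_mx_unit g ca.
rewrite /Ad [in RHS](gram1_chart g ca) (coordK (dom_chart_at a)) trmx_mul trmx_inv !mulmxA.
rewrite (mulmxKV U) mulmxK ?unitmx_tr//.
exact: gram1_right.
Qed.

Lemma invmx_gram1_Ad a : (Ad a)^T *m invmx (gram1 g) *m Ad a = invmx (gram1 g).
Proof.
have uH := gram1_unit g; have E := gram1_Ad a.
have uA : Ad a \in unitmx.
  by move: uH; rewrite {1}E !unitmxE !det_mulmx !unitfE !mulf_eq0 !negb_or => /andP[/andP[]].
have AH : Ad a *m gram1 g = gram1 g *m invmx (Ad a)^T by rewrite [in RHS]E mulmxK ?unitmx_tr.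
rewrite -[LHS](mulmxK uH) -[_ *m Ad a *m _]mulmxA AH !mulmxA.
by rewrite (mulmxKV uH) mulmxV ?unitmx_tr// mul1mx.
Qed.

Lemma invariant_field_translate_r c u a x : smoothR u ->
  invariant_field c (fun y => u (y * a)%g) x = \sum_e Ad a c e * invariant_field e u (x * a)%g.
Proof.
move=> su; set j := chart_at a; have da : dom (atlas j) a := dom_chart_at a.
have ca := codom_coord da; pose v y := u (x * y)%g.
have sv : smoothR v by exact: smoothR_translate_l.
pose F z := Defs.coord (atlas j) (param (atlas i0) z * a)%g.
have oV := @open_mulr_dom _ _ _ a i0 j; have Vz := z0_mulr a.
have Fz : F z0 = Defs.coord (atlas j) a by rewrite /F (coordK d0) mul1g.
rewrite /invariant_field (@partial_near _ _ _ ((v \o param (atlas j)) \o F)); last first.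
  by apply: (near_open oV Vz) => z [_ dz] /=; rewrite /F coordK// /v mulgA.
rewrite partial_comp; last first.
- by move=> k; have := smooth_on_differentiable oV (@smooth_mulr _ _ _ a i0 j k) Vz.
- by rewrite Fz; have := smooth_on_differentiable (@open_codom _ _ _ j) (smoothR_on j sv) ca.
rewrite Fz (eq_bigr (fun k => \sum_e right_field_mx a c k *
    invmx (field_mx j (Defs.coord (atlas j) a)) k e * invariant_field e u (x * a)%g)); last first.
  move=> k _; rewrite (partial_invariant_field g k sv ca) mulr_suml; apply: eq_bigr => e _.
  by rewrite (coordK da) /v invariant_field_translate mxE; ring.
rewrite exchange_big; apply: eq_bigr => e _.
by rewrite -mulr_suml mxE.
Qed.

Lemma cfield_translate_r c f a x : smoothC f ->
  cfield c (fun y => f (y * a)%g) x = \sum_e (Ad a c e)%:C%C * cfield e f (x * a)%g.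
Proof.
move=> [s1 s2]; apply: complex_eq; rewrite ?Re_sum ?Im_sum /=.
  rewrite (invariant_field_translate_r c a x s1); apply: eq_bigr => e _.
  by rewrite mul0r subr0.
rewrite (invariant_field_translate_r c a x s2); apply: eq_bigr => e _.
by rewrite mul0r addr0.
Qed.

(** Right translation mixes the fields by [Ad a], and the Laplacian contracts them with the inverse
    Gram matrix, which [Ad a] preserves by [invmx_gram1_Ad]. *)
Lemma lap_translate_r f a x : smoothC f -> lap g (fun y => f (y * a)%g) x = lap g f (x * a)%g.
Proof.
move=> sf; rewrite /lap; apply: (congr1 (fun z : R[i] => - z)).
have E c e : cfield c (cfield e (fun y => f (y * a)%g)) x =
    \sum_e' \sum_c' (Ad a e e')%:C%C * (Ad a c c')%:C%C * cfield c' (cfield e' f) (x * a)%g.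
  have -> : cfield e (fun y => f (y * a)%g) =
      (fun x => \sum_e' (Ad a e e')%:C%C * cfield e' f (x * a)%g).
    by apply/funext => y; exact: cfield_translate_r.
  rewrite cfield_sum => [|e']; last first.
    by apply/smoothC_scale/smoothC_translate_r/smoothC_cfield.
  apply: eq_bigr => e' _; rewrite cfield_scale; last exact/smoothC_translate_r/smoothC_cfield.
  rewrite cfield_translate_r; last exact: smoothC_cfield.
  by rewrite mulr_sumr; apply: eq_bigr => c' _; rewrite mulrA.
pose h c' e' := cfield c' (cfield e' f) (x * a)%g.
have A c' e' : \sum_c \sum_e (Ad a c c')%:C%C * Hinv g c e * (Ad a e e')%:C%C = Hinv g c' e' :> R[i].
  rewrite /Hinv -[in RHS](invmx_gram1_Ad a) mxE.
  rewrite exchange_big /= rmorph_sum; apply: eq_bigr => e _.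
  rewrite [((Ad a)^T *m _) c' e]mxE mulr_suml rmorph_sum; apply: eq_bigr => c _.
  by rewrite !mxE !rmorphM.
transitivity (\sum_c \sum_e Hinv g c e * (\sum_e' \sum_c' (Ad a e e')%:C%C * (Ad a c c')%:C%C * h c' e')).
  by apply: eq_bigr => c _; apply: eq_bigr => e _; exact: (congr1 (fun z => Hinv g c e * z) (E c e)).
apply: etrans (change_of_form (Hinv g) (fun e e' => (Ad a e e')%:C%C) h) _.
by apply: eq_bigr => c' _; apply: eq_bigr => e' _; rewrite A.
Qed.

(** Ellipticity: if the Gram form is at most K times the squared length, the inverse form is at
    least its K^-1 multiple. *)
Lemma invmx_gram1_lower : exists2 c0 : R, 0 < c0 & forall v : 'rV[R]_n,
  c0 * \sum_c v 0 c ^+ 2 <= \sum_c \sum_e invmx (gram1 g) c e * (v 0 e * v 0 c).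
Proof.
set H := gram1 g; set A := invmx H; pose Q (M : 'M[R]_n) (v w : 'rV[R]_n) := (v *m M *m w^T) 0 0.
have QE M v w : Q M v w = \sum_c \sum_e M e c * (v 0 e * w 0 c).
  rewrite /Q mxE; apply: eq_bigr => c _; rewrite !mxE mulr_suml; apply: eq_bigr => e _.
  by ring.
have uH : H \in unitmx := gram1_unit g.
have HT : H^T = H := gram1_sym g.
have AT : A^T = A by rewrite /A trmx_inv HT.
have Q0 (v : 'rV[R]_n) : 0 <= Q A v v.
  have -> : Q A v v = Q H (v *m A) (v *m A).
    by rewrite /Q trmx_mul AT -!mulmxA [H *m _]mulmxA mulmxV// mul1mx.
  have [->|nz] := eqVneq (v *m A) 0; first by rewrite /Q !mul0mx mxE.
  exact/ltW/(gram1_pos g).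
pose K := 1 + \sum_c \sum_e `|H e c|.
have K0 : 0 < K by rewrite ltr_wpDr// sumr_ge0// => c _; rewrite sumr_ge0.
have HK v : Q H v v <= K * \sum_c v 0 c ^+ 2.
  set S := \sum_c v 0 c ^+ 2.
  have S0 : 0 <= S by rewrite sumr_ge0// => c _; exact: sqr_ge0.
  have vS c : v 0 c ^+ 2 <= S by rewrite /S (bigD1 c)//= lerDl sumr_ge0// => i _; exact: sqr_ge0.
  rewrite QE mulrDl mul1r; apply: (@le_trans _ _ (\sum_c (\sum_e `|H e c|) * S)); last first.
    by rewrite mulr_suml lerDr.
  apply: ler_sum => c _; rewrite mulr_suml; apply: ler_sum => e _.
  apply: le_trans (ler_norm _) _; rewrite normrM ler_wpM2l//.
  have ab (a b s : R) : a ^+ 2 <= s -> b ^+ 2 <= s -> `|a * b| <= s.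
    move=> h1 h2; rewrite normrM; have := sqr_ge0 (`|a| - `|b|).
    by rewrite sqrrB !real_normK ?num_real//; lra.
  exact: ab.
exists K^-1 => [|v]; first by rewrite invr_gt0.
have -> : \sum_c \sum_e A c e * (v 0 e * v 0 c) = Q A v v.
  by rewrite QE; apply: eq_bigr => c _; apply: eq_bigr => e _; rewrite -[in LHS]AT mxE.
(* Completing the square: the inverse form is nonnegative at v minus K^-1 times [v *m H]. *)
set S := \sum_c v 0 c ^+ 2; have := Q0 (v - K^-1 *: (v *m H)).
have -> : Q A (v - K^-1 *: (v *m H)) (v - K^-1 *: (v *m H)) =
    Q A v v - 2 * K^-1 * S + K^-1 ^+ 2 * Q H v v.
  have E1 : Q A v (v *m H) = S.
    rewrite /Q trmx_mul HT -mulmxA [A *m _]mulmxA mulVmx// mul1mx mxE.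
    by apply: eq_bigr => c _; rewrite mxE expr2.
  have E2 : Q A (v *m H) v = S.
    rewrite /Q -[v *m H *m A]mulmxA mulmxV// mulmx1 mxE.
    by apply: eq_bigr => c _; rewrite mxE expr2.
  have E3 : Q A (v *m H) (v *m H) = Q H v v.
    by rewrite /Q -[v *m H *m A]mulmxA mulmxV// mulmx1 trmx_mul HT mulmxA.
  have QB (a b a' b' : 'rV[R]_n) : Q A (a - b) (a' - b') = Q A a a' - Q A a b' - Q A b a' + Q A b b'.
    rewrite /Q linearB /= mulmxBr !mulmxBl !mxE; ring.
  have QZl t (a b : 'rV[R]_n) : Q A (t *: a) b = t * Q A a b by rewrite /Q -!scalemxAl mxE.
  have QZr t (a b : 'rV[R]_n) : Q A a (t *: b) = t * Q A a b by rewrite /Q linearZ /= -scalemxAr mxE.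
  by rewrite QB !QZl !QZr E1 E2 E3; ring.
move=> h; have h2 := HK v; rewrite -/S in h2.
have h3 : K^-1 ^+ 2 * Q H v v <= K^-1 * S.
  have -> : K^-1 * S = K^-1 ^+ 2 * (K * S) by field; rewrite gt_eqF.
  by apply: ler_wpM2l => //; rewrite exprn_ge0// invr_ge0 ltW.
move: h h3; move: (Q A v v) (Q H v v) => q r; lra.
Qed.

End adjoint.

Section energy.
Context {R : realType} {n : nat} {G : lieGroupType R n}.
Hypothesis cG : compact [set: G].
Variable g : biinvariant_metric G.

(** The pointwise lower bound is applied to the real and imaginary parts of the fields of f and
    integrated. It makes eigenvalues nonnegative and controls first derivatives by the
    eigenvalue. *)
Lemma lap_energy : exists2 c0 : R, 0 < c0 & forall f : G -> R[i], smoothC f ->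
  c0 * \sum_c norm2 (cfield c f) <= complex.Re (ip (lap g f) f).
Proof.
have [c0 c0p H] := invmx_gram1_lower g; exists c0 => // f sf; rewrite (ip_lap cG)//.
have cf c : ctsC (cfield c f) by exact/smoothC_cts/smoothC_cfield.
have -> : \sum_c \sum_e Hinv g c e * ip (cfield e f) (cfield c f) =
    cmean (fun x => \sum_c \sum_e Hinv g c e * (cfield e f x * (cfield c f x)^*)).
  have c1 c e : ctsC (fun x => Hinv g c e * (cfield e f x * (cfield c f x)^*)).
    by apply: ctsC_mul; [exact: ctsC_cst|exact: ctsC_ip].
  rewrite (cmean_sum cG); last by move=> c; exact: ctsC_sum.
  apply: eq_bigr => c _; rewrite (cmean_sum cG)//; apply: eq_bigr => e _.
  by rewrite (cmean_scale cG)//; exact: ctsC_ip.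
rewrite /norm2 -(mean_sum cG); last by move=> c; exact: cts_sqn.
rewrite -(mean_scale cG); last by apply: cts_sum => c; exact: cts_sqn.
rewrite /cmean /=; apply: (mean_le cG).
- by apply/cts_scale/cts_sum => c; exact: cts_sqn.
- apply: (@ctsC_Re _ _ _ (fun x => \sum_c \sum_e Hinv g c e * (cfield e f x * (cfield c f x)^*))).
  apply: ctsC_sum => c; apply: ctsC_sum => e.
  by apply: ctsC_mul; [exact: ctsC_cst|exact: ctsC_ip].
move=> x; rewrite /sqn big_split /= mulrDr.
have h1 := H (\row_c complex.Re (cfield c f x)); have h2 := H (\row_c complex.Im (cfield c f x)).
have sE (u : 'I_n -> R) : \sum_c (\row_c u c) 0 c ^+ 2 = \sum_c u c ^+ 2.
  by apply: eq_bigr => c _; rewrite mxE.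
rewrite !sE in h1 h2.
apply: le_trans (lerD h1 h2) _; rewrite Re_sum -big_split /=.
apply: ler_sum => c _; rewrite Re_sum -big_split /=; apply: ler_sum => e _.
by rewrite !mxE mul0r subr0 mulrN opprK mulrDr.
Qed.

End energy.

(** * Schur orthogonality *)

(** A finite subfamily of largest rank spans all members: adding one that escapes would raise the
    rank. *)
Lemma span_family (F : fieldType) d (I : Type) (w : I -> 'rV[F]_d) :
  exists m (f : 'I_m -> I), forall i, (w i <= \matrix_(k < m) w (f k))%MS.
Proof.
pose B m (f : 'I_m -> I) : 'M[F]_(m, d) := \matrix_k w (f k).
pose Q r := `[< exists m (f : 'I_m -> I), \rank (B m f) = r >].
have Q0 : exists r, Q r.
  exists 0%N; apply/asboolP; exists 0%N, (fun i : 'I_0 => match notF (ltn_ord i) with end).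
  by apply/eqP; rewrite mxrank_eq0 flatmx0.
have Qd r : Q r -> (r <= d)%N by move=> /asboolP[m [f <-]]; exact: rank_leq_col.
case: (ex_maxnP Q0 Qd) => r /asboolP[m [f fr]] rmax; exists m, f => i.
apply: contraT => ni.
pose f' (k : 'I_(1 + m)%N) : I := match fintype.split k with inl _ => i | inr k' => f k' end.
have S : (B m f <= B _ f')%MS.
  apply/row_subP => k; rewrite rowK.
  have -> : w (f k) = row (rshift 1 k) (B _ f').
    by rewrite rowK /f'; case: fintype.splitP => [j|j] /= E; [have := ltn_ord j; rewrite -E ltnNge|
      congr (w (f _)); apply/val_inj/(@addnI 1)].
  exact: row_sub.
have Si : (w i <= B _ f')%MS.
  have -> : w i = row (lshift m 0) (B _ f').
    by rewrite rowK /f'; case: fintype.splitP => [//|j] /= E.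
  exact: row_sub.
have lt : (B m f < B _ f')%MS.
  rewrite /ltmx S /=; apply: contra ni => S'; exact: submx_trans Si S'.
have := rmax (\rank (B _ f')); rewrite leqNgt -fr rank_ltmx//= => /(_ _)/negP; case.
  by apply/asboolP; exists (1 + m)%N, f'.
by [].
Qed.

Section adjoint_matrix.
Context {R : realType}.
Local Open Scope sesquilinear_scope.

Lemma adjM m n p (A : 'M[R[i]]_(m, n)) (B : 'M[R[i]]_(n, p)) :
  (A *m B)^t* = B^t* *m A^t*.
Proof. by rewrite trmx_mul map_mxM. Qed.

Lemma adjK m n (A : 'M[R[i]]_(m, n)) : (A^t*)^t* = A.
Proof. by apply/matrixP => i j; rewrite !mxE conjCK. Qed.

End adjoint_matrix.

Section irreps.
Context {R : realType} {n : nat} {G : lieGroupType R n}.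
Hypothesis cG : compact [set: G].
Implicit Types (x y a b : G).
Local Notation C := R[i].

Section one_irrep.
Context {d : nat} (xi : irrep G d).
Implicit Types (j k l : 'I_d).

Lemma ctsC_entry j k : ctsC (entry xi j k).
Proof. by have [] := (@complex_continuousP _ _ _).1 (@rep_continuous _ _ _ _ xi j k). Qed.

Lemma entryM j k x y : entry xi j k (x * y)%g = \sum_l entry xi j l x * entry xi l k y.
Proof. by rewrite /entry repM mxE. Qed.

Lemma entry1 j k : entry xi j k 1%g = (j == k)%:R.
Proof. by rewrite /entry rep1 mxE. Qed.

Lemma repV x : xi x^-1%g = (xi x)^t*%sesqui.
Proof.
rewrite -(invmx_unitary (rep_unitary xi x)).
have U := unitarymx_unit (rep_unitary xi x).
by rewrite -[LHS](mulKmx U) -repM mulgV rep1 mulmx1.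
Qed.

Lemma entryV j k x : entry xi j k x^-1%g = (entry xi k j x)^*.
Proof. by rewrite /entry repV !mxE. Qed.

Lemma entry_row j l x : \sum_k entry xi j k x * (entry xi l k x)^* = (j == l)%:R.
Proof.
rewrite -entry1 -(mulgV x) entryM; apply: eq_bigr => k _.
by rewrite entryV.
Qed.

Lemma entry_col j l x : \sum_k (entry xi k j x)^* * entry xi k l x = (j == l)%:R.
Proof.
rewrite -entry1 -(mulVg x) entryM; apply: eq_bigr => k _.
by rewrite entryV.
Qed.

Lemma entry_row_sqn j x : \sum_k sqn (entry xi j k x) = 1.
Proof.
have := entry_row j j x; rewrite eqxx => /(congr1 (@complex.Re R)) /= <-.
by rewrite Re_sum; apply: eq_bigr => k _; rewrite mulcJ.
Qed.

Lemma entry_sqn j k x : sqn (entry xi j k x) <= 1.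
Proof.
rewrite -(entry_row_sqn j x) (bigD1 k)//= lerDl sumr_ge0// => l _; exact: sqn_ge0.
Qed.

Lemma entry_taxi j k x : taxi (entry xi j k x) <= 2.
Proof. by rewrite -[leRHS]mulr1; apply: taxi_le => //; rewrite expr1n entry_sqn. Qed.

(** The span of the orbit of v is stable, hence everything. [<<B>>] appears because
    [rep_irreducible] asks for a square matrix. *)
Lemma rep_span (v : 'rV[C]_d) : v != 0 ->
  exists m (f : 'I_m -> G), row_full (\matrix_(i < m) (v *m (xi (f i))^T)).
Proof.
move=> v0; have [m [f H]] := span_family (fun x => v *m (xi x)^T); exists m, f.
set B := \matrix_(i < m) _; rewrite -(eq_row_full (genmxE B)).
case: (@rep_irreducible _ _ _ _ xi <<B>>%MS) => //.
  move=> x; rewrite (eqmxMr _ (genmxE B)) genmxE; apply/row_subP => i.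
  by rewrite row_mul rowK -mulmxA -trmx_mul -repM; exact: H.
move=> /eqP; rewrite -mxrank_eq0 mxrank_gen mxrank_eq0 => /eqP B0.
have : (v *m (xi 1%g)^T <= B)%MS := H 1%g.
rewrite B0 => /submx0null; rewrite rep1 trmx1 mulmx1 => /eqP.
by rewrite (negPf v0).
Qed.

End one_irrep.

Section intertwiner.
Context {d d' : nat} (xi : irrep G d) (eta : irrep G d') (T : 'M[C]_(d, d')).
Hypothesis intT : forall x, xi x *m T = T *m eta x.

(** The column space of T is stable under xi and its kernel, as a map on columns, under eta;
    transposes convert both to row spaces. *)
Lemma schur : T != 0 -> row_free T /\ row_full T.
Proof.
move=> T0; split.
  rewrite /row_free -mxrank_tr -[_ == _]/(row_full T^T) -(eq_row_full (genmxE T^T)).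
  case: (@rep_irreducible _ _ _ _ xi <<T^T>>%MS) => //.
    move=> x; rewrite (eqmxMr _ (genmxE _)) genmxE -trmx_mul intT trmx_mul.
    exact: submxMl.
  move=> /eqP; rewrite -mxrank_eq0 mxrank_gen mxrank_eq0 => /eqP E.
  by move: T0; rewrite -[T]trmxK E trmx0 eqxx.
rewrite /row_full -mxrank_tr -[_ == _]/(row_free T^T) -kermx_eq0.
case: (@rep_irreducible _ _ _ _ eta (kermx T^T)) => [x|->//|/row_fullP[B]].
  by apply/sub_kermxP; rewrite -mulmxA -trmx_mul -intT trmx_mul mulmxA mulmx_ker mul0mx.
move=> E; have := mulmx_ker T^T => /(congr1 (mulmx B)).
rewrite mulmxA E mul1mx mulmx0 => E'.
by move: T0; rewrite -[T]trmxK E' trmx0 eqxx.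
Qed.

Lemma schur_dim : T != 0 -> d = d'.
Proof. by move=> /schur[/eqP rd /eqP]; rewrite rd. Qed.

End intertwiner.

Lemma schur_scalar d (xi : irrep G d) (T : 'M[C]_d) :
  (forall x, xi x *m T = T *m xi x) -> exists c, T = c%:M.
Proof.
move=> intT; have d0 := rep_dim_gt0 xi.
have [c] : exists c, root (char_poly T) c.
  by apply/closed_rootP; rewrite size_char_poly; case: (d) d0.
rewrite -eigenvalue_root_char => /eigenvalueP[v vT v0]; exists c.
apply/eqP; rewrite -subr_eq0; apply: contraT => nz.
have int' x : xi x *m (T - c%:M) = (T - c%:M) *m xi x.
  by rewrite mulmxBr mulmxBl intT scalar_mxC.
have [+ _] := schur int' nz; rewrite -kermx_eq0 => /eqP K.
have : (v <= kermx (T - c%:M))%MS.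
  by apply/sub_kermxP; rewrite mulmxBr vT mul_mx_scalar subrr.
by rewrite K submx0 (negPf v0).
Qed.

Lemma ip_entry_invariant d d' (xi : irrep G d) (eta : irrep G d') j k l m a :
  ip (entry xi j k) (entry eta l m) =
  \sum_p \sum_q entry xi j p a * (entry eta l q a)^* * ip (entry xi p k) (entry eta q m).
Proof.
have cp p q : ctsC (fun x => entry xi j p a * (entry eta l q a)^* *
    (entry xi p k x * (entry eta q m x)^*)).
  by apply: ctsC_mul; [exact: ctsC_cst|apply: ctsC_ip; exact: ctsC_entry].
rewrite /ip -(cmean_translate_l cG a); last by apply: ctsC_ip; exact: ctsC_entry.
transitivity (cmean (fun x => \sum_p \sum_q entry xi j p a * (entry eta l q a)^* *
    (entry xi p k x * (entry eta q m x)^*))).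
  congr cmean; apply/funext => x; rewrite !entryM conj_sum mulr_suml.
  apply: eq_bigr => p _; rewrite mulr_sumr; apply: eq_bigr => q _.
  by rewrite conjM mulrACA.
rewrite (cmean_sum cG) => [|p]; last exact: ctsC_sum.
apply: eq_bigr => p _; rewrite (cmean_sum cG)//; apply: eq_bigr => q _.
by rewrite (cmean_scale cG)//; apply: ctsC_ip; exact: ctsC_entry.
Qed.

(** T is the mean over y of [xi y] times a matrix unit times the adjoint of [eta y]; left invariance
    of the mean makes it an intertwiner. *)
Lemma ip_entry_intertwiner d d' (xi : irrep G d) (eta : irrep G d') k m x :
  let T := \matrix_(j, l) ip (entry xi j k) (entry eta l m) in xi x *m T = T *m eta x.
Proof.
move=> T; have U := rep_unitary eta x; have U' := unitarymx_unit U.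
suff E : T = xi x *m T *m invmx (eta x) by rewrite [in RHS]E mulmxKV.
apply/matrixP => j l; rewrite [LHS]mxE (ip_entry_invariant xi eta j k l m x) (invmx_unitary U) [RHS]mxE.
rewrite exchange_big; apply: eq_bigr => q _; rewrite !mxE mulr_suml; apply: eq_bigr => p _.
by rewrite !mxE mulrAC.
Qed.

Lemma ip_entry_self d (xi : irrep G d) j k l m :
  ip (entry xi j k) (entry xi l m) = (j == l)%:R * (k == m)%:R / d%:R.
Proof.
have d0 := rep_dim_gt0 xi.
have [c Tc] := schur_scalar (fun x => ip_entry_intertwiner xi xi k m x).
have E j' l' : ip (entry xi j' k) (entry xi l' m) = (j' == l')%:R * c.
  by have /matrixP/(_ j' l') := Tc; rewrite !mxE mulr_natl.
(* The scalar c is found by summing over j = l, where orthonormality of the columns of [xi x] gives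
   the value pointwise. *)
have S : \sum_p ip (entry xi p k) (entry xi p m) = (k == m)%:R.
  rewrite -(cmean_cst cG (k == m)%:R) /ip -(cmean_sum cG); last first.
    by move=> p; apply: ctsC_ip; exact: ctsC_entry.
  congr cmean; apply/funext => x; rewrite eq_sym -(entry_col xi m k x).
  by apply: eq_bigr => p _; rewrite mulrC.
have cd : c *+ d = (k == m)%:R.
  rewrite -S -[in LHS](card_ord d) -sumr_const; apply: eq_bigr => p _.
  by rewrite E eqxx mul1r.
rewrite E -mulrA -cd -[c *+ d]mulr_natr mulfK//.
by rewrite pnatr_eq0 -lt0n.
Qed.

Lemma equivalent_irreps d d' (xi : irrep G d) (eta : irrep G d') j k l m :
  ip (entry xi j k) (entry eta l m) != 0 ->
  exists T : 'M[C]_(d, d'), [/\ d = d', T != 0 & forall x, xi x *m T = T *m eta x].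
Proof.
move=> nz; pose T := \matrix_(j, l) ip (entry xi j k) (entry eta l m).
have T0 : T != 0 by apply: contraNneq nz => /matrixP/(_ j l); rewrite !mxE => ->.
have intT := ip_entry_intertwiner xi eta k m.
by exists T; split=> //; exact: schur_dim intT T0.
Qed.

Section equivalence.
Context {d : nat} (xi eta : irrep G d) (T : 'M[C]_d).
Hypothesis intT : forall x, xi x *m T = T *m eta x.
Hypothesis T0 : T != 0.

Lemma intertwiner_unit : T \in unitmx.
Proof. by have [_] := schur intT T0; rewrite row_full_unit. Qed.

Lemma intertwiner_conj x : eta x = invmx T *m xi x *m T.
Proof. by rewrite -mulmxA intT mulKmx// intertwiner_unit. Qed.

(** T times its adjoint commutes with xi, so Schur's lemma makes it a scalar: T is unitary up to a
    factor, and conjugation by T preserves singular values. *)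
Lemma intertwiner_adjoint : exists2 c : C, c != 0 & T *m T^t*%sesqui = c%:M.
Proof.
have adj x : eta x *m T^t*%sesqui = T^t*%sesqui *m xi x.
  have := intT x^-1%g; rewrite !repV => /(congr1 (fun M : 'M[C]_d => M^t*%sesqui)).
  by rewrite !adjM !adjK.
have [c E] : exists c, T *m T^t*%sesqui = c%:M.
  by apply: (@schur_scalar _ xi) => x; rewrite mulmxA intT -mulmxA adj mulmxA.
exists c => //; apply: contraNneq T0 => c0.
have U := intertwiner_unit.
have : T^t*%sesqui = 0 by rewrite -[LHS](mulKmx U) E c0 raddf0 mulmx0.
by move=> /(congr1 (fun M : 'M[C]_d => M^t*%sesqui)); rewrite adjK => ->; rewrite trmx0 map_mx0.
Qed.

End equivalence.

(** An [irrep] is only required to be continuous; its fields and its Laplace eigenvalue are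
    controlled under this condition. *)
Definition smooth_rep d (xi : irrep G d) := forall j k, smoothC (entry xi j k).

Lemma smooth_rep_equivalent d (xi eta : irrep G d) (T : 'M[C]_d) :
  (forall x, xi x *m T = T *m eta x) -> T != 0 -> smooth_rep xi -> smooth_rep eta.
Proof.
move=> intT T0 sxi j k.
have -> : entry eta j k = (fun x => \sum_l (\sum_p invmx T j p * entry xi p l x) * T l k).
  apply/funext => x; rewrite /entry (intertwiner_conj intT T0) mxE.
  by apply: eq_bigr => l _; rewrite mxE.
apply: smoothC_sum => l; apply: smoothC_mul; last exact: smoothC_cst.
by apply: smoothC_sum => p; exact: smoothC_scale.
Qed.

(** Right translation by [f i] replaces v by [v *m (xi (f i))^T], and such vectors span by
    [rep_span], so every entry of a row is a combination of translates of a smooth function. *)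
Lemma smooth_rep_column d (xi : irrep G d) (v : 'rV[C]_d) : v != 0 ->
  (forall j, smoothC (fun x => \sum_l entry xi j l x * v 0 l)) -> smooth_rep xi.
Proof.
move=> v0 sv j k; have [m [f /row_fullP[D DB]]] := rep_span xi v0.
have -> : entry xi j k = (fun x => \sum_i D k i * \sum_l entry xi j l (x * f i)%g * v 0 l).
  apply/funext => x.
  have -> : entry xi j k x = \sum_p entry xi j p x * (1%:M : 'M[C]_d) k p.
    rewrite (bigD1 k)//= mxE eqxx mulr1 big1 ?addr0// => p pk.
    by rewrite mxE eq_sym (negPf pk) mulr0.
  rewrite -DB (eq_bigr (fun p => \sum_i D k i * (entry xi j p x *
      \sum_l v 0 l * entry xi p l (f i)))); last first.
    move=> p _; rewrite mxE mulr_sumr; apply: eq_bigr => i _.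
    by rewrite mulrCA !mxE; congr (_ * (_ * _)); apply: eq_bigr => l _; rewrite !mxE.
  rewrite exchange_big; apply: eq_bigr => i _; rewrite -mulr_sumr; congr (_ * _).
  under [RHS]eq_bigr do rewrite entryM mulr_suml.
  rewrite exchange_big; apply: eq_bigr => p _; rewrite mulr_sumr; apply: eq_bigr => l _.
  by rewrite mulrA mulrAC.
by apply: smoothC_sum => i; apply: smoothC_scale; exact: (smoothC_translate_r (f i) (sv j)).
Qed.

(** Left translates of one entry yield its whole column, which is the case of a basis vector in
    [smooth_rep_column]. Smoothness must propagate from a single entry because [to_smooth] is
    decided entry by entry. *)
Lemma smooth_rep_entry d (xi : irrep G d) j k : smoothC (entry xi j k) -> smooth_rep xi.
Proof.
move=> sjk; have v0 : (delta_mx 0 k : 'rV[C]_d) != 0.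
  by apply/eqP => /matrixP/(_ 0 k)/eqP; rewrite !mxE !eqxx oner_eq0.
apply: (smooth_rep_column v0) => l.
have -> : (fun x => \sum_p entry xi l p x * (delta_mx 0 k : 'rV[C]_d) 0 p) = entry xi l k.
  apply/funext => x; rewrite (bigD1 k)//= mxE !eqxx mulr1 big1 ?addr0// => p pk.
  by rewrite mxE (negPf pk) mulr0.
have w0 : (delta_mx 0 j : 'rV[C]_d) != 0.
  by apply/eqP => /matrixP/(_ 0 j)/eqP; rewrite !mxE !eqxx oner_eq0.
have [m [f /row_fullP[D DB]]] := rep_span xi w0.
(* Conjugating the spanning columns at [f i] gives the rows at the inverses. *)
have -> : entry xi l k = (fun x => \sum_i (D l i)^* * entry xi j k ((f i)^-1 * x)%g).
  apply/funext => x.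
  have -> : entry xi l k x = \sum_p ((1%:M : 'M[C]_d) l p)^* * entry xi p k x.
    rewrite (bigD1 l)//= mxE eqxx conj1 mul1r big1 ?addr0// => p pk.
    by rewrite mxE eq_sym (negPf pk) conj_nat mul0r.
  rewrite -DB (eq_bigr (fun p => \sum_i (D l i)^* * (entry xi j p (f i)^-1%g * entry xi p k x))); last first.
    move=> p _; rewrite mxE conj_sum mulr_suml; apply: eq_bigr => i _.
    rewrite conjM -mulrA; congr (_ * (_ * _)); rewrite entryV !mxE (bigD1 j)//= big1 ?addr0.
      by rewrite !mxE !eqxx mul1r.
    by move=> q qj; rewrite mxE (negPf qj) mul0r.
  rewrite exchange_big; apply: eq_bigr => i _; rewrite -mulr_sumr entryM; congr (_ * _).
by apply: smoothC_sum => i; apply: smoothC_scale; exact: (smoothC_translate_l _ sjk).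
Qed.

End irreps.

(** * Casimir eigenvalues *)

Section casimir.
Context {R : realType} {n : nat} {G : lieGroupType R n}.
Hypothesis cG : compact [set: G].
Variable g : biinvariant_metric G.
Implicit Types (x y a b : G) (c e : 'I_n) (s : seq 'I_n).
Local Notation C := R[i].

Lemma cfield_scaler c (z : C) (f : G -> C) x : smoothC f ->
  cfield c (fun y => f y * z) x = cfield c f x * z.
Proof.
move=> sf; rewrite mulrC -cfield_scale//; congr (cfield c _ x).
by apply/funext => y; rewrite mulrC.
Qed.

Lemma lap_add (f h : G -> C) x : smoothC f -> smoothC h ->
  lap g (fun y => f y + h y) x = lap g f x + lap g h x.
Proof.
move=> sf sh; rewrite /lap -opprD -big_split; apply: (congr1 (fun z : C => - z)).
apply: eq_bigr => c _; rewrite -big_split; apply: eq_bigr => e _ /=.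
by rewrite -mulrDr; apply: (congr1 (fun z : C => Hinv g c e * z)); exact: (@cfields_add _ _ _ [:: c; e]).
Qed.

Lemma lap_scale (z : C) (f : G -> C) x : smoothC f ->
  lap g (fun y => z * f y) x = z * lap g f x.
Proof.
move=> sf; rewrite /lap mulrN mulr_sumr; apply: (congr1 (fun z : C => - z)).
apply: eq_bigr => c _; rewrite mulr_sumr; apply: eq_bigr => e _ /=.
rewrite mulrCA; apply: (congr1 (fun z : C => Hinv g c e * z)).
exact: (@cfields_scale _ _ _ [:: c; e]).
Qed.

Lemma lap_sum I (r : seq I) (F : I -> G -> C) x : (forall i, smoothC (F i)) ->
  lap g (fun y => \sum_(i <- r) F i y) x = \sum_(i <- r) lap g (F i) x.
Proof.
move=> sF; elim: r => [|i r IH]; last first.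
  under [X in lap g X]eq_fun do rewrite big_cons.
  by rewrite lap_add ?IH ?big_cons//; exact: smoothC_sum.
rewrite big_nil -[RHS](mul0r (lap g (fun=> 0) x)) -lap_scale; last exact: smoothC_cst.
by congr (lap g _ x); apply/funext => y; rewrite big_nil mul0r.
Qed.

Section one_irrep.
Context {d : nat} (xi : irrep G d).
Hypothesis sxi : smooth_rep xi.
Implicit Types (j k l : 'I_d).

(** The differential of xi at 1 along the c-th field; by left invariance the field acts on [xi x] as
    right multiplication by this matrix. *)
Definition drep c : 'M[C]_d := \matrix_(j, k) cfield c (entry xi j k) 1%g.

Definition dreps s : 'M[C]_d := foldr (fun c M => drep c *m M) 1%:M s.

Lemma cfield_entry c j k x :
  cfield c (entry xi j k) x = \sum_l entry xi j l x * drep c l k.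
Proof.
rewrite -{1}[x]mulg1 -cfield_translate.
have -> : (fun y => entry xi j k (x * y)%g) = (fun y => \sum_l entry xi j l x * entry xi l k y).
  by apply/funext => y; rewrite entryM.
rewrite cfield_sum => [|l]; last exact: smoothC_scale.
by apply: eq_bigr => l _; rewrite cfield_scale// mxE.
Qed.

Lemma cfields_entry s j k x :
  cfields s (entry xi j k) x = \sum_l entry xi j l x * dreps s l k.
Proof.
elim: s x => [|c s IH] x /=.
  rewrite (bigD1 k)//= mxE eqxx mulr1 big1 ?addr0// => p pk.
  by rewrite mxE (negPf pk) mulr0.
have -> : cfields s (entry xi j k) = (fun x => \sum_l entry xi j l x * dreps s l k).
  exact/funext.
rewrite cfield_sum => [|l]; last by apply: smoothC_mul => //; exact: smoothC_cst.
rewrite (eq_bigr _ (fun l _ => cfield_scaler c (dreps s l k) x (sxi j l))).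
under eq_bigr do rewrite cfield_entry mulr_suml.
rewrite exchange_big; apply: eq_bigr => l _; rewrite mxE mulr_sumr.
by apply: eq_bigr => p _; rewrite mulrA.
Qed.

Lemma lap_entry_mx : exists K : 'M[C]_d, forall j k x,
  lap g (entry xi j k) x = \sum_l entry xi j l x * K l k.
Proof.
exists (- \sum_c \sum_e Hinv g c e *: dreps [:: c; e]) => j k x.
rewrite /lap (eq_bigr (fun c => \sum_l \sum_e entry xi j l x * (Hinv g c e * dreps [:: c; e] l k))).
  rewrite exchange_big -sumrN; apply: eq_bigr => l _.
  rewrite mxE summxE mulrN mulr_sumr; congr (- _); apply: eq_bigr => c _.
  by rewrite summxE mulr_sumr; apply: eq_bigr => e _; rewrite [in RHS]mxE.
move=> c _; rewrite exchange_big; apply: eq_bigr => e _.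
rewrite -[cfield c _ x]/(cfields [:: c; e] (entry xi j k) x) cfields_entry mulr_sumr.
by apply: eq_bigr => l _; rewrite mulrCA.
Qed.

(* The matrix of the previous lemma commutes with xi, the Laplacian being also
   right-invariant; hence it is scalar by Schur's lemma. *)
Lemma casimir_scalar : exists z : C, forall j k x, lap g (entry xi j k) x = z * entry xi j k x.
Proof.
have [K KE] := lap_entry_mx.
have KC x : xi x *m K = K *m xi x.
  apply/matrixP => j k; rewrite !mxE.
  have := lap_translate_r g x 1%g (sxi j k); rewrite mul1g KE.
  have -> : (fun y => entry xi j k (y * x)%g) = (fun y => \sum_l entry xi l k x * entry xi j l y).
    by apply/funext => y; rewrite entryM; apply: eq_bigr => l _; rewrite mulrC.
  move=> <-; rewrite lap_sum => [|l]; last exact: smoothC_scale.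
  under eq_bigr do rewrite lap_scale//.
  apply: eq_bigr => l _; rewrite mulrC KE (bigD1 j)//= entry1 eqxx mul1r big1 ?addr0// => p pj.
  by rewrite entry1 eq_sym (negPf pj) mul0r.
have [z Kz] := schur_scalar KC; exists z => j k x.
rewrite KE Kz (bigD1 k)//= mxE eqxx mulrC big1 ?addr0// => p pk.
by rewrite mxE (negPf pk) mulr0.
Qed.

Let d0 : (0 < d)%N := rep_dim_gt0 xi.
Let k0 : 'I_d := Ordinal d0.

(** The scalar is read off the inner product of a diagonal entry with its Laplacian: symmetry makes
    it real, and the energy inequality makes it nonnegative. *)
Lemma laplace_eigenvalueP : exists nu : R, 0 <= nu /\ forall j k x,
  lap g (entry xi j k) x = nu%:C%C * entry xi j k x.
Proof.
have [z zE] := casimir_scalar; have [c0 c0p H] := lap_energy cG g.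
have ie : ip (lap g (entry xi k0 k0)) (entry xi k0 k0) = z / d%:R.
  have -> : lap g (entry xi k0 k0) = (fun x => z * entry xi k0 k0 x) by apply/funext => x.
  by rewrite (ip_scalel cG) ?(ip_entry_self cG) ?eqxx ?mulr1 ?mul1r//; exact: ctsC_entry.
have ce := @ctsC_entry _ _ _ _ xi k0 k0.
have r : (z / d%:R)^* = z / d%:R.
  rewrite -ie (ip_conj cG) ?(ip_lap_sym cG)//.
  exact/smoothC_cts/smoothC_lap.
have dR : (d%:R : C) = (d%:R : R)%:C%C by rewrite rmorph_nat.
have d1 : (d%:R : C) != 0 by rewrite pnatr_eq0 -lt0n.
have Imz : complex.Im z = 0.
  have zz : z^* = z.
    by move: r; rewrite conjM fmorphV /= conj_nat; apply: (mulIf (invr_neq0 d1)).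
  by have := congr1 (@complex.Im R) zz; rewrite cIm_conj; lra.
have zR : z = (complex.Re z)%:C%C by apply: complex_eq.
exists (complex.Re z); split => [|j k x]; last by rewrite -zR.
have := H _ (sxi k0 k0); rewrite ie zR dR -fmorphV -rmorphM /= => h.
have : 0 <= complex.Re z / d%:R.
  apply: le_trans h; apply: mulr_ge0; first exact: ltW.
  apply: sumr_ge0 => c _; exact/(norm2_ge0 cG)/smoothC_cts/smoothC_cfield.
by rewrite pmulr_lge0// invr_gt0 ltr0n.
Qed.

Lemma laplace_eigenvalueE : 0 <= laplace_eigenvalue g xi /\ forall j k x,
  lap g (entry xi j k) x = (laplace_eigenvalue g xi)%:C%C * entry xi j k x.
Proof.
have [nu [nu0 H]] := laplace_eigenvalueP.
have ex : exists m : R, [set nu | forall j k x, laplace_beltrami g (entry xi j k) x =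
    (nu%:C)%C * entry xi j k x] m.
  by exists nu => j k x; rewrite laplace_beltramiE.
(* The set defining the eigenvalue is inhabited, so [xget] returns one of its members and not the
   default 0. *)
have := xgetPex 0 ex; rewrite -/(laplace_eigenvalue g xi) /= => E.
have E' j k x : lap g (entry xi j k) x = (laplace_eigenvalue g xi)%:C%C * entry xi j k x.
  by rewrite -laplace_beltramiE.
split=> //; have := E' k0 k0 1%g; rewrite H entry1 eqxx !mulr1 => /(congr1 (@complex.Re R)) /= <-.
exact: nu0.
Qed.

Lemma laplace_eigenvalue_unique (nu : R) :
  (forall j k x, lap g (entry xi j k) x = nu%:C%C * entry xi j k x) ->
  laplace_eigenvalue g xi = nu.
Proof.
move=> H; have [_ E] := laplace_eigenvalueE.
by have := E k0 k0 1%g; rewrite H entry1 eqxx !mulr1 => /(congr1 (@complex.Re R)) /= <-.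
Qed.

Lemma norm2_cfield_entry c j k :
  norm2 (cfield c (entry xi j k)) = d%:R^-1 * \sum_l sqn (drep c l k).
Proof.
have := ip_self cG (cfield c (entry xi j k)).
have -> : cfield c (entry xi j k) = (fun x => \sum_l drep c l k * entry xi j l x).
  by apply/funext => x; rewrite cfield_entry; apply: eq_bigr => l _; rewrite mulrC.
have ct l : ctsC (fun x => drep c l k * entry xi j l x).
  by apply: ctsC_mul; [exact: ctsC_cst|exact: ctsC_entry].
set f := fun x => \sum_l _ => E; have {E} -> : norm2 f = complex.Re (ip f f) by rewrite E.
rewrite {1}/f (ip_suml cG)//; last exact: ctsC_sum.
rewrite mulr_sumr Re_sum; apply: eq_bigr => l _.
rewrite (ip_scalel cG); [|exact: ctsC_entry|exact: ctsC_sum].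
rewrite /f (ip_sumr cG)//; last exact: ctsC_entry.
rewrite (bigD1 l)//= big1 => [|p pl]; last first.
  rewrite (ip_scaler cG); [|exact: ctsC_entry|exact: ctsC_entry].
  by rewrite (ip_entry_self cG) [l == p]eq_sym (negPf pl) mulr0 mul0r mulr0.
rewrite addr0 (ip_scaler cG); [|exact: ctsC_entry|exact: ctsC_entry].
rewrite (ip_entry_self cG) !eqxx !mul1r mulrA mulcJ.
by rewrite -[d%:R](rmorph_nat (real_complex R)) -fmorphV -rmorphM /= mulrC.
Qed.

End one_irrep.

(** Energy inequality for a diagonal entry: the squared norms of the entry and of its fields both
    carry the factor 1/d, which cancels, so K is the same for all representations. *)
Lemma drep_sqn : exists2 K : R, 0 <= K & forall d (xi : irrep G d), smooth_rep xi ->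
  forall c k, \sum_l sqn (drep xi c l k) <= K * laplace_eigenvalue g xi.
Proof.
have [c0 c0p H] := lap_energy cG g; exists c0^-1 => [|d xi sxi c k]; first by rewrite invr_ge0 ltW.
have d0 : (0 < d%:R :> R) by rewrite ltr0n (rep_dim_gt0 xi).
have := H _ (sxi k k); have [_ E] := laplace_eigenvalueE sxi.
have -> : lap g (entry xi k k) = (fun x => (laplace_eigenvalue g xi)%:C%C * entry xi k k x).
  by apply/funext => x.
rewrite (ip_scalel cG); [|exact: ctsC_entry|exact: ctsC_entry].
rewrite (ip_entry_self cG) !eqxx !mul1r -[d%:R](rmorph_nat (real_complex R)) -fmorphV -rmorphM /=.
move=> h; rewrite ler_pdivlMl// -[leRHS](mulfVK (lt0r_neq0 d0)) -[X in _ <= X]mulrC.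
apply: (@le_trans _ _ (d%:R * (c0 * norm2 (cfield c (entry xi k k))))).
  rewrite norm2_cfield_entry// le_eqVlt; apply/orP; left; apply/eqP; field.
  by rewrite lt0r_neq0.
apply: ler_wpM2l; first exact: ltW.
apply: le_trans h; apply: ler_wpM2l; first exact: ltW.
rewrite (bigD1 c)//= lerDl; apply: sumr_ge0 => e _; exact/(norm2_ge0 cG)/smoothC_cts/smoothC_cfield.
Qed.

(** Each field costs one product by a matrix [drep]: a factor d for the sum and, crudely, a multiple
    of 1 plus the eigenvalue for the entries. *)
Lemma cfields_entry_bound : exists2 K : R, 0 <= K & forall d (xi : irrep G d), smooth_rep xi ->
  forall s j k x, taxi (cfields s (entry xi j k) x) <=
    2 * d%:R * (d%:R * (K * (1 + laplace_eigenvalue g xi))) ^+ size s.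
Proof.
have [K K0 H] := drep_sqn; exists (2 * (1 + K)) => [|d xi sxi s j k x].
  by rewrite mulr_ge0// addr_ge0.
have [nu0 _] := laplace_eigenvalueE sxi; set nu := laplace_eigenvalue g xi in nu0 *.
have D c l m : taxi (drep xi c l m) <= 2 * (1 + K) * (1 + nu).
  rewrite -mulrA; apply: taxi_le; first by rewrite mulr_ge0 ?addr_ge0.
  apply: (@le_trans _ _ (K * nu)).
    apply: le_trans (H _ _ sxi c m); rewrite (bigD1 l)//= lerDl sumr_ge0// => p _; exact: sqn_ge0.
  by rewrite exprMn; move: nu nu0 => nu nu0; nra.
set B := 2 * (1 + K) * (1 + nu) in D *.
have B0 : 0 <= B by rewrite !mulr_ge0 ?addr_ge0.
have DS l m : taxi (dreps xi s l m) <= (d%:R * B) ^+ size s.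
  elim: s l => [|c s IH] l /=.
    rewrite mxE expr0; case: eqP => _; rewrite ?taxi0// /taxi /= normr1 normr0 addr0//.
  rewrite mxE; apply: le_trans (taxi_sum _ _ _) _.
  rewrite exprS -mulrA -[d in d%:R * (B * _)]card_ord mulr_natl -sumr_const; apply: ler_sum => p _.
  by apply: le_trans (taxiM _ _) _; apply: ler_pM => //; exact: taxi_ge0.
rewrite cfields_entry//; apply: le_trans (taxi_sum _ _ _) _.
rewrite -mulrA [2 * (_ * _)]mulrCA -[d in d%:R * (2 * _)]card_ord mulr_natl -sumr_const; apply: ler_sum => p _.
apply: le_trans (taxiM _ _) _; apply: ler_pM; rewrite ?taxi_ge0//; exact: entry_taxi.
Qed.

Lemma laplace_eigenvalue_equivalent d (xi eta : irrep G d) (T : 'M[C]_d) :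
  (forall x, xi x *m T = T *m eta x) -> T != 0 -> smooth_rep xi ->
  laplace_eigenvalue g eta = laplace_eigenvalue g xi.
Proof.
move=> intT T0 sxi; have seta := smooth_rep_equivalent intT T0 sxi.
have [_ E] := laplace_eigenvalueE sxi.
apply: (laplace_eigenvalue_unique seta) => j k x.
have eE : entry eta j k = (fun x => \sum_l T l k * \sum_p invmx T j p * entry xi p l x).
  apply/funext => y; rewrite /entry (intertwiner_conj intT T0) mxE.
  by apply: eq_bigr => l _; rewrite mxE mulrC.
have s1 l p : smoothC (fun x => invmx T j p * entry xi p l x) by exact: smoothC_scale.
have s2 l : smoothC (fun x => \sum_p invmx T j p * entry xi p l x) by exact: smoothC_sum.
rewrite eE lap_sum => [|l]; last exact: smoothC_scale.
rewrite mulr_sumr; apply: eq_bigr => l _; rewrite lap_scale// lap_sum// mulrCA.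
congr (_ * _); rewrite mulr_sumr; apply: eq_bigr => p _.
by rewrite lap_scale// E mulrCA.
Qed.

End casimir.

(** * The Peter-Weyl theorem *)

(** A cluster point in the product topology. The index type may be uncountable, so no subsequence is
    claimed: each finite set of coordinates and each tolerance has its own m. *)
Lemma tychonoff_cluster {R : realType} (I : eqType) (u : nat -> I -> R) (M : R) :
  (forall m i, `|u m i| <= M) -> exists v : I -> R, (forall i, `|v i| <= M) /\
  forall (s : seq I) (e : R) N, 0 < e -> exists2 m, (N <= m)%N & forall i, i \in s -> `|u m i - v i| <= e.
Proof.
move=> uM; pose F (B : set (I -> R)) := exists N, forall m, (N <= m)%N -> B (u m).
have FF : ProperFilter F.
  split; first by move=> [N] /(_ N (leqnn _)).
  split; first by exists 0%N.
    move=> A B [N1 H1] [N2 H2]; exists (maxn N1 N2) => m; rewrite geq_max => /andP[h1 h2].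
    by split; [exact: H1|exact: H2].
  by move=> A B AB [N H]; exists N => m /H /AB.
have FA : F [set f | forall i, [set` `[- M, M]] (f i)].
  by exists 0%N => m _ i; rewrite /= in_itv /= -ler_norml.
have [v [Av cv]] := @tychonoff I (fun=> R) (fun=> [set` `[- M, M]]) (fun=> @segment_compact R (- M) M) F FF FA.
exists v; split=> [i|s e N e0]; first by have := Av i; rewrite /= in_itv /= -ler_norml.
pose B := [set f : I -> R | forall i, i \in s -> `|f i - v i| <= e].
have nB : nbhs (v : prod_topology (fun _ : I => R)) B.
  have Fv : Filter (nbhs (v : prod_topology (fun _ : I => R))) := nbhs_filter _.
  rewrite /B {B}; elim: s => [|i s IH]; first by apply: (@filterS _ _ _ setT); [move=> f _ i|exact: filterT].
  have ni : nbhs (v : prod_topology (fun _ : I => R)) [set f : I -> R | `|f i - v i| <= e].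
    have := @proj_continuous I (fun=> R) i v [set t : R | `|t - v i| <= e].
    apply; apply: filterS ((continuous_nearP id (v i)).1 (fun _ h => h) e e0) => t.
    by rewrite /= distrC.
  apply: filterS (filterI ni IH) => f [h1 h2] j; rewrite inE => /orP[/eqP -> //|].
  exact: h2.
have FN : F [set f | exists2 m, (N <= m)%N & f = u m] by exists N => m Nm; exists m.
have [f [[m Nm ->] Bf]] := cv _ _ FN nB.
by exists m.
Qed.

(** * Convolution operators and their compactness *)

Section convolution.
Context {R : realType} {n : nat} {G : lieGroupType R n}.
Hypothesis cG : compact [set: G].
Implicit Types (f h phi psi kappa : G -> R[i]) (x y a b : G) (z : R[i]).
Local Notation C := R[i].

(** Integrating [u (x^-1 * y)] in either order gives the mean of u or that of its composite with
    inversion. *)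
Lemma mean_inv (u : G -> R) : continuous u -> mean (fun x => u x^-1%g) = mean u.
Proof.
move=> cu; have ci := cts_inv cu; pose F x y := u (x^-1 * y)%g.
have cF : continuous (fun p : G * G => F p.1 p.2).
  move=> p; apply: (@continuous_comp _ _ _ (fun p : G * G => (p.1^-1 * p.2)%g) u); last exact: cu.
  apply: (@continuous_comp _ _ _ (fun p : G * G => (p.1^-1, p.2)%g) (fun p : G * G => p.1 * p.2)%g).
    apply: continuous_pair; last exact: cvg_snd.
    by apply: (@continuous_comp _ _ _ fst (fun x : G => x^-1%g)); [exact: cvg_fst|exact: invg_continuous].
  exact: mulg_continuous.
have := mean_fubini cG cF.
have -> : (fun x => mean (F x)) = fun=> mean u.
  by apply/funext => x; rewrite -(mean_translate_l cG x^-1%g cu).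
have -> : (fun y => mean (fun x => F x y)) = fun=> mean (fun x => u x^-1%g).
  apply/funext => y; rewrite -(mean_translate_l cG y^-1%g ci).
  by congr mean; apply/funext => x; rewrite invMg invgK.
by rewrite !(mean_cst cG).
Qed.

Lemma cmean_inv f : ctsC f -> cmean (fun x => f x^-1%g) = cmean f.
Proof. by move=> [c1 c2]; rewrite /cmean (mean_inv c1) (mean_inv c2). Qed.

Lemma norm2_scale z f : ctsC f -> norm2 (fun x => z * f x) = sqn z * norm2 f.
Proof.
move=> cf; rewrite /norm2 -(mean_scale cG); last exact: cts_sqn.
by congr mean; apply/funext => x; rewrite sqnM.
Qed.

Lemma norm2_add f h : ctsC f -> ctsC h ->
  norm2 (fun x => f x + h x) <= 2 * norm2 f + 2 * norm2 h.
Proof.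
move=> cf ch; have c1 := cts_sqn cf; have c2 := cts_sqn ch.
rewrite /norm2 -!(mean_scale cG)// -(mean_add cG); [|exact: cts_scale|exact: cts_scale].
apply: (mean_le cG) => [||x]; [exact/cts_sqn/ctsC_add| |exact: sqnD].
by apply: cts_add; exact: cts_scale.
Qed.

Lemma norm2_bound f (B : R) : ctsC f -> (forall x, sqn (f x) <= B) -> norm2 f <= B.
Proof.
move=> cf fB; rewrite /norm2 -(mean_cst cG B); apply: (mean_le cG) => [||x]; [exact: cts_sqn| |exact: fB].
exact: cts_cst.
Qed.

Lemma norm2_translate f a : ctsC f -> norm2 (fun x => f (a * x)%g) = norm2 f.
Proof. by move=> cf; rewrite /norm2 -(mean_translate_l cG a (cts_sqn cf)). Qed.

Lemma norm2_conj f : norm2 (fun x => (f x)^*) = norm2 f.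
Proof. by congr mean; apply/funext => x; rewrite sqnJ. Qed.

Lemma normalize f : ctsC f -> norm2 f != 0 ->
  norm2 (fun x => ((Num.sqrt (norm2 f))^-1)%:C%C * f x) = 1.
Proof.
move=> cf f0; rewrite norm2_scale// sqn_real exprVn sqr_sqrtr ?mulVf//.
exact: norm2_ge0.
Qed.

(** Bessel's inequality for the single vector h, normalized. *)
Lemma cauchy_schwarz f h : ctsC f -> ctsC h -> sqn (ip f h) <= norm2 f * norm2 h.
Proof.
move=> cf ch; have [h0|h0] := eqVneq (norm2 h) 0.
  have -> : ip f h = 0.
    rewrite -(cmean_cst cG 0); congr cmean; apply/funext => x.
    by rewrite (norm2_eq0 cG ch h0) rmorph0 mulr0.
  by rewrite sqn0 h0 mulr0.
have hp : 0 < norm2 h by rewrite lt_def h0 norm2_ge0.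
set r := ((Num.sqrt (norm2 h))^-1)%:C%C : C; pose e (_ : 'I_1) x := r * h x.
have ce (i : 'I_1) : ctsC (e i) by apply: ctsC_mul => //; exact: ctsC_cst.
have oe (i j : 'I_1) : ip (e i) (e j) = (i == j)%:R.
  by rewrite !ord1 eqxx (ip_self cG) normalize.
have := bessel cG cf ce oe; rewrite big_ord1.
have -> : ip f (e ord0) = r^* * ip f h := ip_scaler cG r cf ch.
rewrite sqnM sqnJ /r sqn_real exprVn sqr_sqrtr ?norm2_ge0//.
by rewrite ler_pdivrMl// mulrC.
Qed.

(** An average of right translates of phi, hence commuting with left translations, so that
    eigenspaces carry representations. *)
Definition convol kappa phi x : C := cmean (fun y => kappa y * phi (x * y)%g).

Definition convol_adjoint kappa y : C := (kappa y^-1%g)^*.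

Lemma ctsC_adjoint kappa : ctsC kappa -> ctsC (convol_adjoint kappa).
Proof. by move=> ck; apply: ctsC_conj; exact: (ctsC_inv ck). Qed.

Lemma ctsC_conv kappa phi : ctsC kappa -> ctsC phi -> ctsC (convol kappa phi).
Proof.
move=> ck cp; apply: (jcts_ctsC cG); apply: jcts_mul.
  by apply: (jcts_comp ck) => p; exact: cvg_snd.
exact: (jcts_comp cp mulg_continuous).
Qed.

Lemma convol_integrand kappa phi x : ctsC kappa -> ctsC phi ->
  ctsC (fun y => kappa y * phi (x * y)%g).
Proof. by move=> ck cp; apply: ctsC_mul => //; exact: (ctsC_translate_l x cp). Qed.

Lemma convol_add kappa phi psi x : ctsC kappa -> ctsC phi -> ctsC psi ->
  convol kappa (fun y => phi y + psi y) x = convol kappa phi x + convol kappa psi x.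
Proof.
move=> ck cp cq; rewrite /convol -(cmean_add cG); [|exact: convol_integrand|exact: convol_integrand].
by congr cmean; apply/funext => y; rewrite mulrDr.
Qed.

Lemma convol_scale kappa z phi x : ctsC kappa -> ctsC phi ->
  convol kappa (fun y => z * phi y) x = z * convol kappa phi x.
Proof.
move=> ck cp; rewrite /convol -(cmean_scale cG); last exact: convol_integrand.
by congr cmean; apply/funext => y; rewrite mulrCA.
Qed.

Lemma convol_sum kappa I (r : seq I) (F : I -> G -> C) x : ctsC kappa -> (forall i, ctsC (F i)) ->
  convol kappa (fun y => \sum_(i <- r) F i y) x = \sum_(i <- r) convol kappa (F i) x.
Proof.
move=> ck cF; rewrite /convol -(cmean_sum cG) => [|i]; last exact: convol_integrand.
by congr cmean; apply/funext => y; rewrite mulr_sumr.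
Qed.

Lemma convol_translate kappa phi a x :
  convol kappa (fun y => phi (a * y)%g) x = convol kappa phi (a * x)%g.
Proof. by congr cmean; apply/funext => y; rewrite mulgA. Qed.

Lemma convol_adjointP kappa phi psi : ctsC kappa -> ctsC phi -> ctsC psi ->
  ip (convol kappa phi) psi = ip phi (convol (convol_adjoint kappa) psi).
Proof.
move=> ck cp cq; have ci := ctsC_inv ck.
have c1 x : ctsC (fun y => kappa y * phi (x * y)%g) by exact: convol_integrand.
pose F x y := kappa y * phi (x * y)%g * (psi x)^*.
have jF : jcts F.
  apply: jcts_mul; first apply: jcts_mul.
  - by apply: (jcts_comp ck) => p; exact: cvg_snd.
  - exact: (jcts_comp cp mulg_continuous).
  - by apply: (jcts_comp (ctsC_conj cq)) => p; exact: cvg_fst.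
have -> : ip (convol kappa phi) psi = cmean (fun x => cmean (F x)).
  by congr cmean; apply/funext => x; rewrite /F (cmean_scaler cG).
rewrite (cmean_fubini cG jF).
(* K is the integrand after replacing x by [x * y^-1]. *)
pose K x y := kappa y * (phi x * (psi (x * y^-1)%g)^*).
have cdiv : continuous (fun p : G * G => p.1 * p.2^-1)%g.
  move=> p; apply: (@continuous_comp _ _ _ (fun p : G * G => (p.1, p.2^-1)%g) (fun p : G * G => p.1 * p.2)%g).
    apply: continuous_pair; first exact: cvg_fst.
    by apply: (@continuous_comp _ _ _ snd (fun x : G => x^-1%g)); [exact: cvg_snd|exact: invg_continuous].
  exact: mulg_continuous.
have jK : jcts K.
  apply: jcts_mul; first by apply: (jcts_comp ck) => p; exact: cvg_snd.
  apply: jcts_mul; first by apply: (jcts_comp cp) => p; exact: cvg_fst.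
  exact: (jcts_comp (ctsC_conj cq) cdiv).
transitivity (cmean (fun y => cmean (fun x => K x y))).
  congr cmean; apply/funext => y.
  have cx : ctsC (fun x => K x y).
    apply: ctsC_mul; first exact: ctsC_cst.
    by apply: ctsC_mul => //; exact: (ctsC_translate_r y^-1%g (ctsC_conj cq)).
  rewrite -(cmean_translate_r cG y cx); congr cmean; apply/funext => x.
  by rewrite /F /K mulgK mulrA.
rewrite -(cmean_fubini cG jK); congr cmean; apply/funext => x.
have cxp : ctsC (fun y => (psi (x * y)%g)^*) by exact: (ctsC_translate_l x (ctsC_conj cq)).
rewrite /convol -(cmean_conj cG); last first.
  by apply: convol_integrand => //; exact: ctsC_adjoint.
have cy : ctsC (fun y => kappa y * (psi (x * y^-1)%g)^*).
  by apply: ctsC_mul => //; exact: (ctsC_inv cxp).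
transitivity (phi x * cmean (fun y => kappa y * (psi (x * y^-1)%g)^*)).
  by rewrite -(cmean_scale cG)//; congr cmean; apply/funext => y; rewrite /K mulrCA.
congr (_ * _); rewrite -(cmean_inv cy); congr cmean; apply/funext => y.
by rewrite invgK conjM /convol_adjoint conjCK.
Qed.

Lemma convol_sqn kappa phi x : ctsC kappa -> ctsC phi ->
  sqn (convol kappa phi x) <= norm2 kappa * norm2 phi.
Proof.
move=> ck cp; rewrite -(norm2_translate x cp) -[norm2 kappa]norm2_conj mulrC.
have cx := ctsC_translate_l x cp.
apply: le_trans (cauchy_schwarz cx (ctsC_conj ck)).
suff -> : convol kappa phi x = ip (fun y => phi (x * y)%g) (fun y => (kappa y)^*) by [].
by congr cmean; apply/funext => y; rewrite conjCK mulrC.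
Qed.

Lemma convol_shift kappa phi x v : ctsC kappa -> ctsC phi ->
  convol kappa phi (x * v)%g - convol kappa phi x = convol (fun y => kappa (v^-1 * y)%g - kappa y) phi x.
Proof.
move=> ck cp; have cv := ctsC_translate_l v^-1%g ck.
have -> : convol kappa phi (x * v)%g = cmean (fun y => kappa (v^-1 * y)%g * phi (x * y)%g).
  rewrite -(cmean_translate_l cG v); last exact: convol_integrand.
  by congr cmean; apply/funext => y; rewrite mulKg mulgA.
rewrite -mulN1r -(cmean_scale cG); last exact: convol_integrand.
rewrite -(cmean_add cG); last first.
- by apply: ctsC_mul; [exact: ctsC_cst|exact: convol_integrand].
- exact: convol_integrand.
by congr cmean; apply/funext => y; rewrite mulN1r mulrBl.
Qed.

(** Moving the shift to the kernel and applying Cauchy-Schwarz leaves only the modulus of continuity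
    of kappa, the same for all phi in the unit ball. *)
Lemma convol_equicontinuous kappa (e : R) : ctsC kappa -> 0 < e ->
  exists V, nbhs (1%g : G) V /\ forall phi x v, ctsC phi -> norm2 phi <= 1 -> V v ->
    taxi (convol kappa phi (x * v)%g - convol kappa phi x) <= e.
Proof.
move=> ck e0; have e4 : 0 < e / 4 by rewrite divr_gt0.
have J (u : G -> R) : continuous u -> uniformly_equicontinuous (fun v y => u (v^-1 * y)%g).
  move=> cu; apply: (@joint_equicontinuous _ _ _ cG _ (fun v y => u (v^-1 * y)%g) cG) => p.
  apply: (@continuous_comp _ _ _ (fun p : G * G => (p.1^-1 * p.2)%g) u); last exact: cu.
  apply: (@continuous_comp _ _ _ (fun p : G * G => (p.1^-1, p.2)%g) (fun p : G * G => p.1 * p.2)%g).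
    apply: continuous_pair; last exact: cvg_snd.
    by apply: (@continuous_comp _ _ _ fst (fun x : G => x^-1%g)); [exact: cvg_fst|exact: invg_continuous].
  exact: mulg_continuous.
have [V1 [n1 H1]] := J _ (ctsC_Re ck) _ e4; have [V2 [n2 H2]] := J _ (ctsC_Im ck) _ e4.
exists (V1 `&` V2); split=> [|phi x v cp p1 [h1 h2]]; first exact: filterI.
rewrite convol_shift// [e](_ : e = 2 * (e / 2)); last by field.
have cd : ctsC (fun y => kappa (v^-1 * y)%g - kappa y).
  by apply: ctsC_add; [exact: (ctsC_translate_l v^-1%g ck)|exact: ctsC_opp].
have e20 : 0 <= e / 2 by rewrite divr_ge0// ltW.
apply: taxi_le => //.
apply: le_trans (convol_sqn _ cd cp) _; rewrite -[leRHS]mulr1.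
apply: ler_pM => //; [exact: norm2_ge0|exact: norm2_ge0|].
apply: norm2_bound => // y; apply: le_trans (sqn_taxi _) _.
rewrite ler_pXn2r ?nnegrE ?taxi_ge0// /taxi cRe_add cRe_opp cIm_add cIm_opp.
have := H1 1%g v y h1; have := H2 1%g v y h2; rewrite !mul1g !invg1 !mul1g.
have -> : e / 2 = e / 4 + e / 4 by field.
by move=> q1 q2; apply: lerD.
Qed.

(** The cluster point is controlled at finitely many points only; equicontinuity carries this to all
    of G through a finite net. Real and imaginary parts are separate coordinates, indexed by
    booleans. *)
Lemma ascoli (u : nat -> G -> C) (M : R) : (forall m, ctsC (u m)) ->
  (forall m x, taxi (u m x) <= M) ->
  (forall e : R, 0 < e -> exists V, nbhs (1%g : G) V /\ forall m x v, V v ->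
    taxi (u m (x * v)%g - u m x) <= e) ->
  exists2 psi, ctsC psi & forall (e : R) N, 0 < e ->
    exists2 m, (N <= m)%N & forall x, taxi (u m x - psi x) <= e.
Proof.
move=> cu uM uE.
pose w m (p : bool * G) := if p.1 then complex.Re (u m p.2) else complex.Im (u m p.2).
have wM m p : `|w m p| <= M.
  by apply: le_trans (uM m p.2); rewrite /w /taxi; case: p.1; rewrite ?lerDl ?lerDr.
have [v [_ H]] := tychonoff_cluster wM.
pose psi x : C := (v (true, x) +i* v (false, x))%C; exists psi.
  have cl (e : R) (s : seq G) : 0 < e -> exists m, forall x, x \in s -> taxi (u m x - psi x) <= e.
    move=> e0; have e2 : 0 < e / 2 by rewrite divr_gt0.
    have [m _ Hm] := H [seq (q, x) | q <- [:: true; false], x <- s] _ 0%N e2.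
    exists m => x xs; rewrite /taxi cRe_add cRe_opp cIm_add cIm_opp [e]splitr; apply: lerD.
      by apply: (Hm (true, x)); rewrite allpairs_f.
    by apply: (Hm (false, x)); rewrite allpairs_f.
  have near x (e : R) : 0 < e -> \forall y \near x, taxi (psi x - psi y) <= e.
    move=> e0; have e3 : 0 < e / 3 by rewrite divr_gt0.
    have [V [nV HV]] := uE _ e3; apply: filterS (near_mulVg x nV) => y Vy.
    have [m Hm] := cl _ [:: x; y] e3.
    have -> : psi x - psi y = (psi x - u m x) + ((u m x - u m y) + (u m y - psi y)) by ring.
    apply: le_trans (taxiD _ _) _; have -> : e = e / 3 + (e / 3 + e / 3) by field.
    apply: lerD; first by rewrite -taxiN opprB Hm// inE eqxx.
    apply: le_trans (taxiD _ _) _; apply: lerD; last by rewrite Hm// !inE eqxx orbT.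
    by rewrite -taxiN opprB; have := HV m x _ Vy; rewrite mulKVg.
  by split=> x; apply/continuous_nearP => e e0; apply: filterS (near x e e0) => y;
    rewrite /taxi cRe_add cRe_opp cIm_add cIm_opp; apply: le_trans; rewrite ?lerDl ?lerDr.
(* Two errors of e/8 from equicontinuity and three of twice e/8 from the approximations add up to
   e. *)
move=> e N e0; have e3 : 0 < e / 8 by rewrite divr_gt0.
have [V [nV HV]] := uE _ e3; have [A HA] := translates_cover cG nV.
have [m Nm Hm] := H [seq (q, a^-1%g) | q <- [:: true; false], a <- A] _ N e3.
(* A second index m' is used to compare psi with its value at a^-1. *)
exists m => // x; have [a aA Va] := HA x.
have [m' _ Hm'] := H ((true, x) :: (false, x) :: [seq (q, a^-1%g) | q <- [:: true; false], a <- A]) _ 0%N e3.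
have T k y (q : R) : `|w k (true, y) - v (true, y)| <= q -> `|w k (false, y) - v (false, y)| <= q ->
    taxi (u k y - psi y) <= q + q.
  by move=> h1 h2; rewrite /taxi cRe_add cRe_opp cIm_add cIm_opp; apply: lerD.
have t1 : taxi (u m a^-1%g - psi a^-1%g) <= e / 8 + e / 8 by apply: T; apply: Hm; rewrite allpairs_f.
have t2 : taxi (u m' a^-1%g - psi a^-1%g) <= e / 8 + e / 8.
  by apply: T; apply: Hm'; rewrite !inE allpairs_f ?orbT.
have t3 : taxi (u m' x - psi x) <= e / 8 + e / 8 by apply: T; apply: Hm'; rewrite !inE eqxx ?orbT.
have s k : taxi (u k x - u k a^-1%g) <= e / 8 by have := HV k a^-1%g _ Va; rewrite mulKg.
have s1' := s m; have := s m'; rewrite -taxiN => s2'; have := t2; rewrite -taxiN => t2'.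
have -> : u m x - psi x = (u m x - u m a^-1%g) + ((u m a^-1%g - psi a^-1%g) +
    (- (u m' a^-1%g - psi a^-1%g) + (- (u m' x - u m' a^-1%g) + (u m' x - psi x)))) by ring.
have D z1 z2 (q1 q2 : R) : taxi z1 <= q1 -> taxi z2 <= q2 -> taxi (z1 + z2) <= q1 + q2.
  by move=> h1 h2; apply: le_trans (taxiD _ _) (lerD h1 h2).
have := D _ _ _ _ s1' (D _ _ _ _ t1 (D _ _ _ _ t2' (D _ _ _ _ s2' t3))).
by move=> h; apply: le_trans h _; rewrite le_eqVlt; apply/orP; left; apply/eqP; field.
Qed.

End convolution.

Lemma ctsC_scale {R : realType} {n} {G : lieGroupType R n} (z : R[i]) (f : G -> R[i]) :
  ctsC f -> ctsC (fun x => z * f x).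
Proof. by move=> cf; apply: ctsC_mul => //; exact: ctsC_cst. Qed.

(** * Eigenspaces of convolution operators *)

Section eigenfunction.
Context {R : realType} {n : nat} {G : lieGroupType R n}.
Hypothesis cG : compact [set: G].
Variable kappa : G -> R[i].
Hypothesis ck : ctsC kappa.
Implicit Types (f h phi psi : G -> R[i]) (x y a b : G) (z : R[i]).
Local Notation C := R[i].

Let S := convol kappa.
Let S' := convol (convol_adjoint kappa).
Let ck' : ctsC (convol_adjoint kappa) := ctsC_adjoint ck.
Let cS phi : ctsC phi -> ctsC (S phi) := fun cp => ctsC_conv cG ck cp.
Let cS' phi : ctsC phi -> ctsC (S' phi) := fun cp => ctsC_conv cG ck' cp.

(** The square of the operator norm on L^2, and the eigenvalue of [S] composed with [S'] that is
    found below. *)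
Definition convol_norm : R := sup [set norm2 (convol kappa phi) | phi in [set phi | ctsC phi /\ norm2 phi <= 1]].
Local Notation L := convol_norm.

Let norm2_0 : norm2 (fun _ : G => 0 : C) = 0.
Proof. by rewrite /norm2 sqn0; exact: (mean_cst cG 0). Qed.

Let values := [set norm2 (S phi) | phi in [set phi | ctsC phi /\ norm2 phi <= 1]].

Let values_sup : has_sup values.
Proof.
split; first by exists (norm2 (S (fun=> 0))), (fun=> 0) => //; split; [exact: ctsC_cst|rewrite norm2_0].
exists (norm2 kappa) => _ [phi [cp p1] <-]; apply: (norm2_bound cG) => [|x]; first exact: cS.
apply: le_trans (convol_sqn cG x ck cp) _.
by rewrite -[leRHS]mulr1 ler_wpM2l// norm2_ge0.
Qed.

Lemma convol_norm2 phi : ctsC phi -> norm2 (S phi) <= L * norm2 phi.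
Proof.
move=> cp; have [p0|p0] := eqVneq (norm2 phi) 0.
  have -> : S phi = (fun=> 0).
    apply/funext => x; rewrite -(cmean_cst cG 0); congr cmean; apply/funext => y.
    by rewrite (norm2_eq0 cG cp p0) mulr0.
  by rewrite norm2_0 p0 mulr0.
have pp : 0 < norm2 phi by rewrite lt_def p0 norm2_ge0.
set r := ((Num.sqrt (norm2 phi))^-1)%:C%C : C.
have : norm2 (S (fun x => r * phi x)) <= L.
  apply: (ub_le_sup (proj2 values_sup)); exists (fun x => r * phi x) => //; split; first exact: ctsC_scale.
  by rewrite normalize.
have -> : S (fun x => r * phi x) = (fun x => r * S phi x).
  by apply/funext => x; exact: (convol_scale cG).
rewrite (norm2_scale cG); last exact: cS.
by rewrite /r sqn_real exprVn sqr_sqrtr ?norm2_ge0// ler_pdivrMl// mulrC.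
Qed.

Let L0 : 0 <= L.
Proof.
apply: (@le_trans _ _ (norm2 (S (fun=> 0)))); first by apply: (norm2_ge0 cG); apply: cS; exact: ctsC_cst.
apply: (ub_le_sup (proj2 values_sup)); exists (fun=> 0) => //; split; first exact: ctsC_cst.
by rewrite norm2_0.
Qed.

(** With [t = norm2 (S' psi)], adjointness and Cauchy-Schwarz give [t * t <= L * norm2 psi * t]. *)
Lemma convol_adjoint_norm2 psi : ctsC psi -> norm2 (S' psi) <= L * norm2 psi.
Proof.
move=> cp; set t := norm2 (S' psi); have t0 : 0 <= t by apply: (norm2_ge0 cG); exact: cS'.
have E : ip (S (S' psi)) psi = t%:C%C by rewrite (convol_adjointP cG ck (cS' cp) cp) (ip_self cG).
have := cauchy_schwarz cG (cS (cS' cp)) cp; rewrite E sqn_real.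
have := convol_norm2 (cS' cp); rewrite -/t => h1 h2.
have p0 := norm2_ge0 cG cp.
have : t * t <= L * norm2 psi * t.
  by rewrite -expr2; apply: le_trans h2 _; rewrite [leRHS]mulrAC; exact: ler_wpM2r.
have [-> _|tp] := eqVneq t 0; first exact: mulr_ge0.
by rewrite ler_pM2r// lt_def tp.
Qed.

Let residual phi x := S' (S phi) x + (- L)%:C%C * phi x.

(** Almost maximizing vectors are almost eigenvectors of [S'] after [S]: the squared norm is
    expanded, and the bound on [S'] leaves L times the defect of [norm2 (S phi)]. *)
Let residual_norm2 phi : ctsC phi -> norm2 phi <= 1 ->
  norm2 (residual phi) <= L * (L - norm2 (S phi)).
Proof.
move=> cp p1; have c1 := cS' (cS cp); have c2 := ctsC_scale (- L)%:C%C cp.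
have E : ip (residual phi) (residual phi) =
   ((norm2 (S' (S phi)))%:C - (2 * L * norm2 (S phi))%:C + (L ^+ 2 * norm2 phi)%:C)%C.
  have i1 : ip (S' (S phi)) phi = (norm2 (S phi))%:C%C.
    by rewrite -[LHS](ip_conj cG cp c1) -(convol_adjointP cG ck cp (cS cp)) (ip_self cG) conj_real.
  have i2 : ip phi (S' (S phi)) = (norm2 (S phi))%:C%C.
    by rewrite -(convol_adjointP cG ck cp (cS cp)) (ip_self cG).
  have cr : ctsC (residual phi) by exact: ctsC_add.
  rewrite {1}/residual (ip_addl cG c1 c2 cr) (ip_scalel cG _ cp cr).
  rewrite -[ip (S' _) _](ip_conj cG cr c1) -[ip phi _](ip_conj cG cr cp).
  rewrite /residual !(ip_addl cG c1 c2)// !(ip_scalel cG _ cp)// i1 i2 !(ip_self cG).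
  rewrite !conjD !conjM !conj_real.
  by apply: complex_eq; rewrite ?cRe_add ?cIm_add /=; ring.
have := ip_self cG (residual phi); rewrite E => /(congr1 (@complex.Re R)) /= <-.
have := convol_adjoint_norm2 (cS cp); have := norm2_ge0 cG (cS cp); have := L0.
move: (norm2 (S' _)) (norm2 (S phi)) (norm2 phi) p1 L => p q r p1 l l0 q0 h.
have : l ^+ 2 * r <= l ^+ 2 by rewrite -[leRHS]mulr1 ler_wpM2l// sqr_ge0.
by move: h; rewrite mulrBr expr2; lra.
Qed.

(* Convolutions are compact operators, so norm2 (convol kappa phi) attains its
   maximum on the unit ball. *)
Lemma eigenfunction phi0 x0 : ctsC phi0 -> convol kappa phi0 x0 != 0 ->
  0 < L /\ exists psi, [/\ ctsC psi, norm2 psi != 0 & forall x, S (S' psi) x = L%:C%C * psi x].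
Proof.
move=> c0 nz.
have Lp : 0 < L.
  rewrite lt_def L0 andbT; apply: contraNneq nz => LE.
  have := convol_norm2 c0; rewrite LE mul0r => h.
  apply/eqP/(norm2_eq0 cG (cS c0))/eqP; rewrite eq_le h; exact/(norm2_ge0 cG)/cS.
split=> //.
have ap m : exists phi, [/\ ctsC phi, norm2 phi <= 1 & L - m.+1%:R^-1 <= norm2 (S phi)].
  have m0 : (0 : R) < m.+1%:R^-1 by rewrite invr_gt0 ltr0n.
  have [_ [phi [cp p1] <-] H] := sup_adherent m0 values_sup.
  by exists phi; split=> //; exact: ltW.
have [phi phiP] := choice ap.
(* The images, rather than the maximizing vectors, form a relatively compact family; their cluster
   point is therefore an eigenvector of [S] after [S']. *)
pose u m := S (phi m); have cu m : ctsC (u m) by apply: cS; case: (phiP m).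
have uM m x : taxi (u m x) <= 2 * (1 + norm2 kappa).
  have [cp p1 _] := phiP m; have k0 := norm2_ge0 cG ck.
  apply: taxi_le; first by rewrite addr_ge0.
  apply: le_trans (convol_sqn cG x ck cp) _; move: (norm2 kappa) (norm2 (phi m)) k0 p1 (norm2_ge0 cG cp) => k q k0 q1 q0; nra.
have uE (e : R) : 0 < e -> exists V, nbhs (1%g : G) V /\ forall m x v, V v ->
    taxi (u m (x * v)%g - u m x) <= e.
  move=> e0; have [V [nV HV]] := convol_equicontinuous cG ck e0; exists V; split=> // m x v Vv.
  by have [cp p1 _] := phiP m; exact: HV.
have [psi cpsi H] := ascoli cG cu uM uE; exists psi; split=> //.
  have L3 : 0 < L / 8 by rewrite divr_gt0.
  have e0 : 0 < Num.min 1 (L / 8) by rewrite lt_min ltr01.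
  have [m Nm Hm] := H _ (Num.bound (8 / L)) e0.
  have [cp p1 p2] := phiP m.
  apply/eqP => z0; have p0 x : psi x = 0 := norm2_eq0 cG cpsi z0 x.
  have small : norm2 (S (phi m)) <= L / 8.
    apply: (norm2_bound cG) => [|x]; first exact: cS.
    apply: le_trans (sqn_taxi _) _; have := Hm x; rewrite p0 subr0 le_min => /andP[h1 h2].
    by rewrite expr2; apply: le_trans (ler_pM (taxi_ge0 _) (taxi_ge0 _) h1 h2) _; rewrite mul1r.
  have : m.+1%:R^-1 <= L / 8.
    rewrite invf_ple ?posrE ?ltr0n// invf_div; apply/ltW/(lt_le_trans (archi_boundP _)).
      by rewrite divr_ge0// ltW.
    by rewrite ler_nat ltnW.
  by move: p2 small Lp; move: (m.+1%:R^-1 : R) (norm2 (S (phi m))) L => q s l; lra.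
pose D x := S (S' psi) x + (- L)%:C%C * psi x.
have cD : ctsC D by apply: ctsC_add; [exact/cS/cS'|exact: ctsC_scale].
suff D0 : norm2 D = 0.
  move=> x; have := norm2_eq0 cG cD D0 x; rewrite /D => /eqP; rewrite addr_eq0 => /eqP ->.
  by rewrite rmorphN mulNr opprK.
apply/eqP; rewrite eq_le (norm2_ge0 cG cD) andbT.
apply/ler_addgt0Pr => e e0; rewrite add0r.
(* Twice the constants [L ^+ 2] of [b1] and [4 * L ^+ 2] of [b2], the factor 2 being that of
   [norm2_add]. *)
pose K := 2 * L ^+ 2 + 8 * L ^+ 2; have K0 : 0 < K by rewrite addr_gt0// mulr_gt0// exprn_gt0.
have eK : 0 < e / K by rewrite divr_gt0.
have d0 : 0 < Num.min 1 (e / K) by rewrite lt_min ltr01.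
have [m Nm Hm] := H _ (Num.bound (K / e)) d0; have [cp p1 p2] := phiP m.
have mK : m.+1%:R^-1 <= e / K.
  rewrite invf_ple ?posrE ?ltr0n// invf_div; apply/ltW/(lt_le_trans (archi_boundP _)).
    by rewrite divr_ge0// ltW.
  by rewrite ler_nat ltnW.
pose r x := psi x + -1 * u m x.
have cr : ctsC r by apply: ctsC_add => //; exact: ctsC_scale.
have rn : norm2 r <= e / K.
  apply: (norm2_bound cG) => // x; rewrite -sqnN.
  have -> : - r x = u m x - psi x by rewrite /r; ring.
  apply: le_trans (sqn_taxi _) _; have := Hm x; rewrite le_min => /andP[h1 h2].
  by rewrite expr2; apply: le_trans (ler_pM (taxi_ge0 _) (taxi_ge0 _) h1 h2) _; rewrite mul1r.
have cres : ctsC (residual (phi m)) by apply: ctsC_add; [exact/cS'/cS|exact: ctsC_scale].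
pose E x := S (S' r) x + (- L)%:C%C * r x.
have cE : ctsC E by apply: ctsC_add; [exact/cS/cS'|exact: ctsC_scale].
(* D differs from the image under S of the residual of [phi m] by the same operator expression
   applied to the small function r. *)
have DE : D = (fun x => S (residual (phi m)) x + E x).
  have E1 x : S (residual (phi m)) x = S (S' (u m)) x + (- L)%:C%C * u m x.
    rewrite [LHS](convol_add cG x ck (cS' (cS cp)) (ctsC_scale _ cp)).
    by rewrite (convol_scale cG _ x ck cp).
  have E2 : S' r = (fun y => S' psi y + -1 * S' (u m) y).
    apply/funext => y; rewrite [LHS](convol_add cG y ck' cpsi (ctsC_scale _ (cu m))).
    by rewrite (convol_scale cG _ y ck' (cu m)).
  have E3 x : S (S' r) x = S (S' psi) x + -1 * S (S' (u m)) x.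
    rewrite E2 [LHS](convol_add cG x ck (cS' cpsi) (ctsC_scale _ (cS' (cu m)))).
    by rewrite (convol_scale cG _ x ck (cS' (cu m))).
  by apply/funext => x; rewrite /D /E E1 E3 /r; ring.
rewrite DE; apply: le_trans (norm2_add cG (cS cres) cE) _.
have b1 : norm2 (S (residual (phi m))) <= L ^+ 2 * (e / K).
  apply: le_trans (convol_norm2 cres) _; rewrite expr2 -mulrA ler_wpM2l//.
  apply: le_trans (residual_norm2 cp p1) _; rewrite ler_wpM2l//.
  by move: p2 mK; move: (m.+1%:R^-1 : R) (norm2 (S (phi m))) L (e / K) => q s l t; lra.
have b2 : norm2 E <= 4 * L ^+ 2 * (e / K).
  apply: le_trans (norm2_add cG (cS (cS' cr)) (ctsC_scale _ cr)) _.
  rewrite (norm2_scale cG _ cr) sqn_real sqrrN.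
  have h1 : norm2 (S (S' r)) <= L ^+ 2 * (e / K).
    apply: le_trans (convol_norm2 (cS' cr)) _; rewrite expr2 -mulrA ler_wpM2l//.
    by apply: le_trans (convol_adjoint_norm2 cr) _; rewrite ler_wpM2l.
  have h2 : L ^+ 2 * norm2 r <= L ^+ 2 * (e / K) by rewrite ler_wpM2l// sqr_ge0.
  by move: h1 h2; rewrite -mulrA; lra.
apply: (@le_trans _ _ (K * (e / K))); last by rewrite mulrC divfK// gt_eqF.
by move: b1 b2; rewrite /K mulrDl -!mulrA; lra.
Qed.

Definition eigenspace_of (phi : G -> C) := ctsC phi /\ forall x, S (S' phi) x = L%:C%C * phi x.

Lemma eigenspace_sum I (r : seq I) (F : I -> G -> C) (z : I -> C) :
  (forall i, eigenspace_of (F i)) -> eigenspace_of (fun x => \sum_(i <- r) z i * F i x).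
Proof.
move=> eF; have cF i : ctsC (F i) by case: (eF i).
have cz i : ctsC (fun x => z i * F i x) by exact: ctsC_scale.
split=> [|x]; first exact: ctsC_sum.
have -> : S' (fun x => \sum_(i <- r) z i * F i x) = (fun x => \sum_(i <- r) z i * S' (F i) x).
  apply/funext => y; rewrite [LHS](convol_sum cG _ y ck' cz); apply: eq_bigr => i _.
  by rewrite (convol_scale cG _ y ck' (cF i)).
rewrite [LHS](convol_sum cG _ x ck (fun i => ctsC_scale (z i) (cS' (cF i)))) mulr_sumr.
apply: eq_bigr => i _; rewrite (convol_scale cG _ x ck (cS' (cF i))).
by have [_ E] := eF i; rewrite [convol kappa _ x]E mulrCA.
Qed.

Lemma eigenspace_translate phi a : eigenspace_of phi -> eigenspace_of (fun x => phi (a * x)%g).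
Proof.
move=> [cp ep]; split=> [|x]; first exact: (ctsC_translate_l a cp).
rewrite -[RHS](ep (a * x)%g) -[RHS](convol_translate kappa (S' phi)).
congr (convol kappa _ x); apply/funext => y.
by rewrite [LHS](convol_translate (convol_adjoint kappa) phi).
Qed.

Definition orthonormal_family N (e : 'I_N -> G -> C) := forall i j, ip (e i) (e j) = (i == j)%:R.

Hypothesis Lp : 0 < L.

(** A trace estimate. The functions [S' (e i)], divided by the square root of L, are orthonormal; at
    each x, Bessel's inequality for a translate of the conjugated kernel bounds L times the sum of
    the [sqn (e i x)] by [norm2 kappa]. Integration in x gives the claim. *)
Lemma eigenspace_dim N (e : 'I_N -> G -> C) : (forall i, eigenspace_of (e i)) -> orthonormal_family e ->
  N%:R * L <= norm2 kappa.
Proof.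
move=> ee oe; have ce i : ctsC (e i) by case: (ee i).
pose r := ((Num.sqrt L)^-1)%:C%C : C; pose w i x := r * S' (e i) x.
have sr : sqn r = L^-1 by rewrite /r sqn_real exprVn sqr_sqrtr// ltW.
have cw i : ctsC (w i) by exact/ctsC_scale/cS'.
have ow : forall i j, ip (w i) (w j) = (i == j)%:R.
  move=> i j; rewrite /w (ip_scalel cG _ (cS' (ce i)) (cw j)) (ip_scaler cG _ (cS' (ce i)) (cS' (ce j))).
  rewrite -(convol_adjointP cG ck (cS' (ce i)) (ce j)) mulrA mulcJ sr.
  have -> : convol kappa (S' (e i)) = (fun x => L%:C%C * e i x).
    by apply/funext => x; have [_ E] := ee i; exact: E.
  by rewrite (ip_scalel cG _ (ce i) (ce j)) oe mulrA -rmorphM /= mulVf ?lt0r_neq0// mul1r.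
have pt x : \sum_i sqn (e i x) * L <= norm2 kappa.
  pose k y := (kappa (x^-1 * y)%g)^*.
  have ck1 := ctsC_translate_l x^-1%g ck.
  have ckx : ctsC k by exact: ctsC_conj.
  have <- : norm2 k = norm2 kappa by rewrite /k norm2_conj (norm2_translate cG).
  apply: le_trans (bessel cG ckx cw ow); apply: ler_sum => i _.
  rewrite -[sqn (ip k _)]sqnJ (ip_conj cG ckx (cw i)).
  have -> : ip (w i) k = r * (L%:C%C * e i x).
    rewrite /w (ip_scalel cG _ (cS' (ce i)) ckx); congr (_ * _); have [_ <-] := ee i.
    rewrite -[LHS](cmean_translate_l cG x); last exact/ctsC_ip/ckx/cS'.
    by congr cmean; apply/funext => y; rewrite /k conjCK mulKg mulrC.
  by rewrite !sqnM sr sqn_real expr2 mulrA mulrA mulVf ?gt_eqF// mul1r mulrC.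
have : mean (fun x => \sum_i sqn (e i x) * L) <= norm2 kappa.
  have c1 i : continuous (fun x => sqn (e i x) * L).
    by under eq_fun do rewrite mulrC; apply: cts_scale; exact: cts_sqn.
  rewrite -[leRHS](mean_cst cG); apply: (mean_le cG) => [||x]; [exact: cts_sum|exact: cts_cst|exact: pt].
rewrite (mean_sum cG) => [|i]; last by under eq_fun do rewrite mulrC; apply: cts_scale; exact: cts_sqn.
under eq_bigr do under [X in mean X]eq_fun do rewrite mulrC.
under eq_bigr do rewrite (mean_scale cG _ (cts_sqn (ce _))).
have n1 i : mean (fun x => sqn (e i x)) = 1.
  by have := oe i i; rewrite (ip_self cG) eqxx => /(congr1 (@complex.Re R)).
by under eq_bigr do rewrite n1 mulr1; rewrite sumr_const card_ord mulr_natl.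
Qed.

End eigenfunction.

(** * Irreducible representations in invariant spaces of functions *)

Section invariant_space.
Context {R : realType} {n : nat} {G : lieGroupType R n}.
Hypothesis cG : compact [set: G].
Local Notation C := R[i].
Variable E : (G -> C) -> Prop.
Hypothesis Ec : forall f, E f -> ctsC f.
Hypothesis Esum : forall I (r : seq I) (F : I -> G -> C) (z : I -> C), (forall i, E (F i)) ->
  E (fun x => \sum_(i <- r) z i * F i x).
Hypothesis Et : forall f a, E f -> E (fun x => f (a * x)%g).
Variable bound : nat.
Hypothesis Eb : forall N (e : 'I_N -> G -> C), (forall i, E (e i)) -> orthonormal_family e -> (N <= bound)%N.
Implicit Types (f h psi : G -> C) (x y a b : G) (z : C).

Lemma orthonormal_coef N (e : 'I_N -> G -> C) (c : 'I_N -> C) j :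
  (forall i, ctsC (e i)) -> orthonormal_family e -> ip (fun x => \sum_i c i * e i x) (e j) = c j.
Proof.
move=> ce oe; rewrite (ip_suml cG)//; last by move=> i; exact: ctsC_scale.
rewrite (bigD1 j)//= (ip_scalel cG)// oe eqxx mulr1 big1 ?addr0// => i ij.
by rewrite (ip_scalel cG)// oe (negPf ij) mulr0.
Qed.

(** An orthonormal family of largest size, which exists by [Eb]; a nonzero remainder r would extend
    it. *)
Lemma orthonormal_basis psi : E psi -> norm2 psi != 0 -> exists N (e : 'I_N -> G -> C),
  [/\ (0 < N)%N, forall i, E (e i), orthonormal_family e &
      forall f, E f -> forall x, f x = \sum_i ip f (e i) * e i x].
Proof.
move=> Epsi psi0; pose P N := `[< exists e : 'I_N -> G -> C, (forall i, E (e i)) /\ orthonormal_family e >].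
have Escale z f : E f -> E (fun x => z * f x).
  by move=> Ef; have := @Esum unit [:: tt] (fun=> f) (fun=> z) (fun=> Ef);
     under eq_fun do rewrite big_seq1.
have Eadd z f h : E f -> E h -> E (fun x => f x + z * h x).
  move=> Ef Eh; have := @Esum bool [:: true; false] (fun q => if q then f else h)
    (fun q => if q then 1 else z) (fun q => if q as q return E (if q then f else h) then Ef else Eh).
  by under eq_fun do rewrite big_cons big_seq1 mul1r.
have P1 : P 1%N.
  apply/asboolP; exists (fun _ x => ((Num.sqrt (norm2 psi))^-1)%:C%C * psi x); split=> [i|i j].
    exact: Escale.
  by rewrite !ord1 eqxx (ip_self cG) normalize//; exact: Ec.
have Pb N : P N -> (N <= bound)%N by move=> /asboolP[e [Ee oe]]; exact: Eb Ee oe.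
case: (ex_maxnP (ex_intro _ 1%N P1) Pb) => N /asboolP[e [Ee oe]] Nmax.
exists N, e; split=> //; first exact: Nmax.
have ce i : ctsC (e i) by exact: Ec.
move=> f Ef; pose p x := \sum_i ip f (e i) * e i x; pose r x := f x + -1 * p x.
have Ep : E p by exact: Esum.
have Er : E r by exact: Eadd.
have cf := Ec Ef; have cp := Ec Ep; have cr := Ec Er.
have re i : ip r (e i) = 0.
  rewrite (ip_addl cG)// ?(ip_scalel cG)//; last exact: ctsC_scale.
  by rewrite orthonormal_coef// mulN1r subrr.
have [r0|r0] := eqVneq (norm2 r) 0.
  by move=> x; have := norm2_eq0 cG cr r0 x; rewrite /r mulN1r => /eqP; rewrite subr_eq0 => /eqP.
exfalso; pose s x := ((Num.sqrt (norm2 r))^-1)%:C%C * r x.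
have Es : E s by exact: Escale.
have se i : ip s (e i) = 0 by rewrite (ip_scalel cG)// re mulr0.
have es i : ip (e i) s = 0.
  by rewrite -(ip_conj cG (Ec Es) (ce i)) se rmorph0.
pose e' (k : 'I_N.+1) := oapp e s (unlift ord0 k).
have := Nmax N.+1; rewrite ltnn => /(_ _)/negP; case=> //; apply/asboolP; exists e'; split=> [i|i j].
  by rewrite /e'; case: unliftP => [i'|] _ /=.
rewrite /e'; case: unliftP => [i'|] -> /=; case: unliftP => [j'|] -> /=.
- by rewrite oe (inj_eq (@lift_inj _ ord0)).
- by rewrite es.
- by rewrite se.
- by rewrite (ip_self cG) normalize.
Qed.

Definition invariant_family d (e : 'I_d -> G -> C) := forall a, exists D : 'M[C]_d,
  forall k x, e k (a * x)%g = \sum_j D k j * e j x.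

Definition family_mx d (e : 'I_d -> G -> C) a : 'M[C]_d :=
  \matrix_(k, j) ip (fun x => e k (a * x)%g) (e j).

Section family.
Context {d : nat} (e : 'I_d -> G -> C).
Hypothesis Ee : forall i, E (e i).
Hypothesis oe : orthonormal_family e.
Hypothesis ie : invariant_family e.
Let ce i : ctsC (e i) := Ec (Ee i).
Let cte i a : ctsC (fun x => e i (a * x)%g) := ctsC_translate_l a (ce i).
Local Notation X := (family_mx e).

Lemma family_mxE a k x : e k (a * x)%g = \sum_j X a k j * e j x.
Proof.
have [D H] := ie a; rewrite H; apply: eq_bigr => j _; congr (_ * _); rewrite mxE.
have -> : (fun x => e k (a * x)%g) = (fun x => \sum_j D k j * e j x) by apply/funext => y; exact: H.
by rewrite orthonormal_coef.
Qed.

Lemma family_mx1 : X 1%g = 1%:M.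
Proof.
apply/matrixP => k j; rewrite !mxE -oe; congr (ip _ _).
by apply/funext => x; rewrite mul1g.
Qed.

Lemma family_mxM a b : X (a * b)%g = X a *m X b.
Proof.
apply/matrixP => k l; rewrite !mxE.
have -> : (fun x => e k (a * b * x)%g) = (fun x => \sum_j X a k j * e j (b * x)%g).
  by apply/funext => x; rewrite -mulgA family_mxE.
rewrite (ip_suml cG)//; last by move=> i; exact: ctsC_scale.
by apply: eq_bigr => j _; rewrite (ip_scalel cG)// [X b j l]mxE.
Qed.

Lemma family_mx_unitary a : X a \is unitarymx.
Proof.
apply/unitarymxP/matrixP => k l; rewrite !mxE -[RHS]oe.
have -> : ip (e k) (e l) = ip (fun x => e k (a * x)%g) (fun x => e l (a * x)%g).
  by rewrite /ip -(cmean_translate_l cG a); last exact: ctsC_ip.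
have -> : (fun x => e k (a * x)%g) = (fun x => \sum_j X a k j * e j x).
  by apply/funext => x; rewrite family_mxE.
rewrite (ip_suml cG)//; last by move=> i; exact: ctsC_scale.
apply: eq_bigr => j _; rewrite (ip_scalel cG)// !mxE; congr (_ * _).
by rewrite (ip_conj cG).
Qed.

Lemma family_mx_continuous k j : continuous (fun a => X a k j : C^o).
Proof.
apply: (complex_continuousP (fun a => X a k j)).2.
have [c1 c2] : ctsC (fun a => X a k j); last by split.
have -> : (fun a => X a k j) = (fun a => cmean (fun x => e k (a * x)%g * (e j x)^*)).
  by apply/funext => a; rewrite mxE.
apply: (jcts_ctsC cG); apply: jcts_mul; first exact: (jcts_comp (ce k) mulg_continuous).
by apply: (jcts_comp (ctsC_conj (ce j))) => p; exact: cvg_snd.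
Qed.

Lemma family_mxV a : X a^-1%g = (X a)^t*%sesqui.
Proof.
rewrite -(invmx_unitary (family_mx_unitary a)).
have U := unitarymx_unit (family_mx_unitary a).
by rewrite -[LHS](mulKmx U) -family_mxM mulgV family_mx1 mulmx1.
Qed.

Hypothesis dmin : forall d' (e' : 'I_d' -> G -> C), (0 < d')%N -> (forall i, E (e' i)) ->
  orthonormal_family e' -> invariant_family e' -> (d <= d')%N.

(** A stable subspace, if nonzero, provides an orthonormal invariant family of size its rank; the
    minimality of d makes that rank full. *)
Lemma family_mx_irreducible (U : 'M[C]_d) :
  (forall x, stablemx U (X x)^T) -> U = 0 \/ row_full U.
Proof.
move=> sU; have [->|U0] := eqVneq U 0; [by left|right].
(* Stability is given for the transposes. Conjugating, and using that [X] at the inverse is the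
   adjoint, turns it into stability of V under [X a] itself. *)
pose V : 'M[C]_d := map_mx (@Num.conj _) U.
have sV a : (V *m X a <= V)%MS.
  have -> : V *m X a = map_mx (@Num.conj _) (U *m (X a^-1%g)^T).
    rewrite map_mxM; congr (_ *m _); rewrite family_mxV.
    exact: (esym (adjK _)).
  by rewrite map_submx; exact: sU.
have rVU : \rank V = \rank U := mxrank_map _ U.
set r := \rank V; have r0 : (0 < r)%N by rewrite /r rVU lt0n mxrank_eq0.
pose B := schmidt (row_base V) : 'M[C]_(r, d).
have BV : (B :=: V)%MS.
  by apply: eqmx_trans (eqmx_schmidt_free (row_base_free V)) (eq_row_base V).
have BU : B \is unitarymx by apply: schmidt_unitarymx; exact: rank_leq_col.
pose f (m : 'I_r) x := \sum_k B m k * e k x.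
have Ef m : E (f m) by exact: Esum.
have of_ : orthonormal_family f.
  move=> m p; rewrite {1}/f (ip_suml cG); last exact/Ec.
    have /matrixP/(_ m p) := unitarymxP BU; rewrite !mxE => <-; apply: eq_bigr => k _.
    rewrite (ip_scalel cG _ (ce k) (Ec (Ef p))) !mxE; congr (_ * _).
    by rewrite -(ip_conj cG (Ec (Ef p)) (ce k)) orthonormal_coef.
  by move=> i; exact: ctsC_scale.
have jf : invariant_family f.
  move=> a; have /submxP[D DB] : (B *m X a <= B)%MS by rewrite BV (eqmxMr _ BV).
  exists D => m x; rewrite /f.
  transitivity (\sum_j (B *m X a) m j * e j x).
    under eq_bigr do rewrite family_mxE mulr_sumr; rewrite exchange_big; apply: eq_bigr => j _.
    by rewrite mxE mulr_suml; apply: eq_bigr => k _; rewrite mulrA.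
  rewrite DB; under [RHS]eq_bigr do rewrite mulr_sumr; rewrite exchange_big; apply: eq_bigr => j _.
  by rewrite mxE mulr_suml; apply: eq_bigr => k _; rewrite mulrA.
have := dmin r0 Ef of_ jf; rewrite /r rVU => dr.
by rewrite /row_full eqn_leq rank_leq_col dr.
Qed.

End family.

(* The matrix coefficients of an orthonormal basis of an invariant subspace of
   smallest positive dimension. *)
Lemma invariant_space_irrep psi : E psi -> norm2 psi != 0 ->
  exists d (xi : irrep G d) (e : 'I_d -> G -> C), [/\ forall i, E (e i), orthonormal_family e &
    forall a k x, e k (a * x)%g = \sum_j entry xi k j a * e j x].
Proof.
move=> Epsi psi0; pose P d := `[< (0 < d)%N /\ exists e : 'I_d -> G -> C,
  [/\ forall i, E (e i), orthonormal_family e & invariant_family e] >].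
have exP : exists d, P d.
  have [N [e [N0 Ee oe be]]] := orthonormal_basis Epsi psi0; exists N; apply/asboolP; split=> //.
  exists e; split=> // a; exists (family_mx e a) => k x.
  rewrite (be _ (Et a (Ee k))); apply: eq_bigr => j _; by rewrite mxE.
case: (ex_minnP exP) => d /asboolP[d0 [e [Ee oe ie]]] dmin.
have dmin' d' (e' : 'I_d' -> G -> C) : (0 < d')%N -> (forall i, E (e' i)) ->
    orthonormal_family e' -> invariant_family e' -> (d <= d')%N.
  by move=> *; apply: dmin; apply/asboolP; split=> //; exists e'.
exists d, (@Irrep R n G d (family_mx e) (family_mx_continuous Ee) (family_mx1 oe)
  (family_mxM Ee oe ie) (family_mx_unitary Ee oe ie) d0 (family_mx_irreducible Ee oe ie dmin')), e.
by split=> // a k x; exact: family_mxE.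
Qed.

End invariant_space.

Section peter_weyl.
Context {R : realType} {n : nat} {G : lieGroupType R n}.
Hypothesis cG : compact [set: G].
Local Notation C := R[i].
Implicit Types (f h : G -> C) (x y a b : G).

(** With the conjugate of h as kernel, the operator is nonzero since its value on h at 1 is
    [norm2 h], so there is an eigenspace of positive eigenvalue, containing an irreducible family e.
    Its members are combinations of entries, which the adjoint operator kills by orthogonality to h;
    hence they vanish, a contradiction. *)
Lemma peter_weyl h : ctsC h ->
  (forall d (xi : irrep G d) j k, ip h (entry xi j k) = 0) -> forall x, h x = 0.
Proof.
move=> ch h0 x; apply: contrapT => hx.
pose kappa y := (h y)^*; have ck : ctsC kappa by exact: ctsC_conj.
have nz : convol kappa h 1%g != 0.
  have -> : convol kappa h 1%g = (norm2 h)%:C%C.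
    by rewrite -(ip_self cG); congr cmean; apply/funext => y; rewrite mul1g mulrC.
  apply/eqP => /(congr1 (@complex.Re R)) /= n0; exact: hx (norm2_eq0 cG ch n0 x).
have [Lp [psi [cpsi psi0 epsi]]] := eigenfunction cG ck ch nz.
set L := convol_norm kappa in Lp epsi.
have Ec f : eigenspace_of kappa f -> ctsC f by case.
have Eb N (e : 'I_N -> G -> C) : (forall i, eigenspace_of kappa (e i)) -> orthonormal_family e ->
    (N <= Num.bound (norm2 kappa / L))%N.
  move=> Ee oe; rewrite -(ler_nat R); apply/ltW/(le_lt_trans _ (archi_boundP _)).
    by rewrite ler_pdivlMr//; exact: (eigenspace_dim cG ck Lp Ee oe).
  by apply: divr_ge0; [exact: norm2_ge0|exact: ltW].
have [d [xi [e [Ee oe ie]]]] := invariant_space_irrep cG Ec (@eigenspace_sum _ _ _ cG kappa ck)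
  (@eigenspace_translate _ _ _ kappa) Eb (conj cpsi epsi) psi0.
pose k0 : 'I_d := Ordinal (rep_dim_gt0 xi).
have cE i j := ctsC_entry xi i j.
have S'0 j y : convol (convol_adjoint kappa) (entry xi k0 j) y = 0.
  have -> : convol (convol_adjoint kappa) (entry xi k0 j) y =
      \sum_p entry xi k0 p y * ip h (entry xi j p).
    have c1 p : ctsC (fun z => h z * (entry xi j p z)^*) by exact: ctsC_ip.
    transitivity (cmean (fun z => \sum_p entry xi k0 p y * (h z * (entry xi j p z)^*))).
      rewrite -(cmean_inv cG); last first.
        by apply: ctsC_sum => p; exact: ctsC_scale.
      congr cmean; apply/funext => z; rewrite /convol_adjoint /kappa conjCK entryM mulr_sumr.
      apply: eq_bigr => p _; rewrite mulrCA; congr (_ * (_ * _)).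
      by rewrite -entryV invgK.
    rewrite (cmean_sum cG) => [|p]; last exact: ctsC_scale.
    by apply: eq_bigr => p _; rewrite (cmean_scale cG).
  by rewrite big1 // => p _; rewrite h0 mulr0.
have ek0 : e k0 = (fun x => \sum_j e j 1%g * entry xi k0 j x).
  by apply/funext => y; rewrite -{1}[y]mulg1 ie; apply: eq_bigr => j _; rewrite mulrC.
have S'e : convol (convol_adjoint kappa) (e k0) = (fun=> 0).
  apply/funext => y; have ck' := ctsC_adjoint ck.
  rewrite ek0 (convol_sum cG _ _ ck') => [|j]; last exact: ctsC_scale.
  by rewrite big1 // => j _; rewrite (convol_scale cG)// S'0 mulr0.
have e0 y : e k0 y = 0.
  have [_ /(_ y)] := Ee k0; rewrite S'e.
  have -> : convol kappa (fun=> 0) y = 0.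
    by rewrite -[RHS](cmean_cst cG 0); congr cmean; apply/funext => z; rewrite mulr0.
  move=> /esym/eqP; rewrite mulf_eq0 => /orP[/eqP/(congr1 (@complex.Re R))/= L0|/eqP//].
  by move: Lp; rewrite /L L0 ltxx.
have := oe k0 k0; rewrite eqxx.
have -> : ip (e k0) (e k0) = 0.
  by rewrite -[RHS](cmean_cst cG 0); congr cmean; apply/funext => z; rewrite e0 mul0r.
by move=> /esym/eqP; rewrite oner_eq0.
Qed.

End peter_weyl.

(** * Smoothness of convolutions *)

Section smooth_convolution.
Context {R : realType} {n : nat} {G : lieGroupType R n}.
Hypothesis cG : compact [set: G].
Variable g : biinvariant_metric G.
Implicit Types (u w : G -> R) (x y a b : G) (s : seq 'I_n).

Let ctsF u w : continuous u -> continuous w ->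
  continuous (fun p : G * G => u (p.1 * p.2)%g * w p.1).
Proof.
move=> cu cw; apply: cts_mul => p.
  by apply: (@continuous_comp _ _ _ (fun p : G * G => p.1 * p.2)%g u); [exact: mulg_continuous|exact: cu].
by apply: (@continuous_comp _ _ _ fst w); [exact: cvg_fst|exact: cw].
Qed.

(** Restricting to words in the finite list L keeps the family bounded and equicontinuous, so that
    one finite average serves every translate a and every word of L. *)
Let F u w (L : seq (seq 'I_n)) y (q : G * seq 'I_n) : R :=
  if q.2 \in L then fields q.2 u (y * q.1)%g * w y else 0.

Let F_equicontinuous u w L : smoothR u -> continuous w -> uniformly_equicontinuous (F u w L).
Proof.
move=> su cw; elim: L => [|s L IH] e e0.
  by exists setT; split=> [|x v q _]; [exact: filterT|rewrite /F /= subrr normr0 ltW].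
have cs := smoothR_continuous (smoothR_fields s su).
have J := @joint_equicontinuous _ _ _ cG _ (fun y a => fields s u (y * a)%g * w y) cG (ctsF cs cw).
have [V1 [n1 H1]] := J _ e0; have [V2 [n2 H2]] := IH _ e0.
exists (V1 `&` V2); split=> [|x v [a t] [v1 v2]]; first exact: filterI.
rewrite /F /= inE; case: eqP => [->|_] /=; first exact: H1.
exact: (H2 x v (a, t) v2).
Qed.

Let F_bounded u w L : smoothR u -> continuous w -> exists M, forall y q, `|F u w L y q| <= M.
Proof.
move=> su cw; have [W HW] := cts_bounded cG cw; have W0 : 0 <= W := le_trans (normr_ge0 _) (HW 1%g).
elim: L => [|s L [M HM]]; first by exists 0 => y q; rewrite /F in_nil normr0.
have [K HK] := cts_bounded cG (smoothR_continuous (smoothR_fields s su)).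
exists (Num.max M (K * W)) => y [a t]; rewrite /F /= inE le_max; case: eqP => [->|_] /=.
  by rewrite normrM (ler_pM _ _ (HK _) (HW _)) ?orbT.
by rewrite (HM y (a, t)).
Qed.

(** Finite averages in y are combinations of left translates of u, hence smooth in a. The m-th one
    is within 1/(m+1) of the mean for all fields of order at most m, and smooth functions are
    complete for such convergence. *)
Lemma smoothR_convolution u w : smoothR u -> continuous w ->
  smoothR (fun a => mean (fun y => u (y * a)%g * w y)).
Proof.
move=> su cw.
have ap m : exists A : seq G, A != [::] /\ forall s a, (size s <= m)%N ->
    `|average A (fun y => fields s u (y * a)%g * w y) 1%g - mean (fun y => fields s u (y * a)%g * w y)|
      <= m.+1%:R^-1.
  have [L HL] := seqs_bounded 'I_n m; have m0 : (0 : R) < m.+1%:R^-1 by rewrite invr_gt0 ltr0n.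
  have [A A0 HA] := mean_family cG (F_equicontinuous L su cw) (F_bounded L su cw) m0.
  exists A; split=> // s a sm; have := HA 1%g (a, s).
  by rewrite /F /= (HL s sm).
have [A HA] := choice ap.
pose v m a := (size (A m))%:R^-1 * \sum_(b <- A m) (w b * u (b * a)%g).
have sb b : smoothR (fun a => u (b * a)%g) := smoothR_translate_l b su.
have swb b : smoothR (fun a => w b * u (b * a)%g) := smoothR_scale (w b) (sb b).
have ss m : smoothR (fun a => \sum_(b <- A m) (w b * u (b * a)%g)) := smoothR_sum (A m) swb.
have sv m : smoothR (v m) := smoothR_scale (size (A m))%:R^-1 (ss m).
have vE s m a : fields s (v m) a = average (A m) (fun y => fields s u (y * a)%g * w y) 1%g.
  rewrite /v (fields_scale s _ _ (ss m)) (fields_sum s (A m) _ swb) /average; congr (_ * _).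
  apply: eq_bigr => b _; rewrite (fields_scale s _ _ (sb b)) mulg1 mulrC.
  by rewrite (fields_translate s u b a).
have near s m a : (size s <= m)%N ->
    `|fields s (v m) a - mean (fun y => fields s u (y * a)%g * w y)| <= m.+1%:R^-1.
  by move=> sm; rewrite vE; have [_] := HA m; exact.
have small (e : R) : 0 < e -> exists N, forall m, (N <= m)%N -> m.+1%:R^-1 <= e.
  move=> e0; exists (Num.bound e^-1) => m Nm.
  rewrite invf_ple ?posrE ?ltr0n//; apply/ltW/(lt_le_trans (archi_boundP _)).
    by rewrite invr_ge0 ltW.
  by rewrite ler_nat ltnW.
have cv s (e : R) : 0 < e -> exists N, forall (k l : nat) x, (N <= k)%N -> (N <= l)%N ->
    `|fields s (v k) x - fields s (v l) x| <= e.
  move=> e0; have e2 : 0 < e / 2 by rewrite divr_gt0.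
  have [N HN] := small _ e2; exists (maxn N (size s)) => k l x.
  rewrite !geq_max => /andP[k1 k2] /andP[l1 l2].
  rewrite [e]splitr; apply: le_trans (ler_distD (mean (fun y => fields s u (y * x)%g * w y)) _ _) _.
  apply: lerD; first exact: le_trans (near s k x k2) (HN k k1).
  by rewrite distrC; exact: le_trans (near s l x l2) (HN l l1).
suff -> : (fun a => mean (fun y => u (y * a)%g * w y)) = (fun x => lim (v m x @[m --> \oo])).
  have H := smoothR_limit g sv cv; exact: H.
apply/funext => a; apply/eqP; rewrite -subr_eq0 -normr_eq0 eq_le normr_ge0 andbT.
apply/ler_addgt0Pr => e e0; rewrite add0r; have e2 : 0 < e / 2 by rewrite divr_gt0.
have [N HN] := small _ e2; have [N' HN'] := limit_near cv e2.
pose k := maxn N N'; rewrite [e]splitr.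
apply: le_trans (ler_distD (v k a) _ _) _; apply: lerD; last by apply: HN'; rewrite leq_maxr.
by rewrite distrC; apply: le_trans (near [::] k a _) (HN k _); rewrite // leq_maxl.
Qed.

Lemma smoothC_convolution (h phi : G -> R[i]) : smoothC h -> ctsC phi ->
  smoothC (fun a => cmean (fun y => h (y * a)%g * phi y)).
Proof.
move=> [h1 h2] [p1 p2].
have c u w a : smoothR u -> continuous w -> continuous (fun y => u (y * a)%g * w y).
  by move=> su cw; apply: cts_mul => //; exact: (cts_translate_r (smoothR_continuous su)).
have E1 : (fun a => complex.Re (cmean (fun y => h (y * a)%g * phi y))) =
  (fun a => mean (fun y => complex.Re (h (y * a)%g) * complex.Re (phi y)) +
            - mean (fun y => complex.Im (h (y * a)%g) * complex.Im (phi y))).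
  apply/funext => a; rewrite -mulN1r -(mean_scale cG); last exact: (c _ _ a h2 p2).
  rewrite -(mean_add cG); [|exact: (c _ _ a h1 p1)|exact/cts_scale/(c _ _ a h2 p2)].
  by congr mean; apply/funext => y; rewrite /= cRe_mul mulN1r.
have E2 : (fun a => complex.Im (cmean (fun y => h (y * a)%g * phi y))) =
  (fun a => mean (fun y => complex.Re (h (y * a)%g) * complex.Im (phi y)) +
            mean (fun y => complex.Im (h (y * a)%g) * complex.Re (phi y))).
  apply/funext => a.
  rewrite -(mean_add cG); [|exact: (c _ _ a h1 p2)|exact: (c _ _ a h2 p1)].
  by congr mean; apply/funext => y; rewrite /= cIm_mul.
split; rewrite ?E1 ?E2.
  exact: (smoothR_add (smoothR_convolution h1 p1) (smoothR_opp (smoothR_convolution h2 p2))).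
exact: (smoothR_add (smoothR_convolution h1 p2) (smoothR_convolution h2 p1)).
Qed.

(* Convolving h with an entry gives a smooth combination of a row of xi. *)
Lemma smooth_rep_of_ip d (xi : irrep G d) (h : G -> R[i]) k l : smoothC h ->
  ip h (entry xi k l) != 0 -> smooth_rep xi.
Proof.
move=> sh nz; have ch := smoothC_cts sh; have cE i j := ctsC_entry xi i j.
pose v : 'rV[R[i]]_d := \row_m ip h (entry xi k m).
have v0 : v != 0 by apply: contraNneq nz => /rowP/(_ l); rewrite !mxE => ->.
apply: (smooth_rep_column v0) => j.
have -> : (fun a => \sum_m entry xi j m a * v 0 m) =
    (fun a => cmean (fun y => h (y * a)%g * (entry xi k j y)^*)).
  apply/funext => a.
  have c1 : ctsC (fun y => h (y * a)%g * (entry xi k j y)^*).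
    by apply: ctsC_mul; [exact: (ctsC_translate_r a ch)|exact: ctsC_conj].
  rewrite -(cmean_translate_r cG a^-1%g c1).
  have -> : (fun x => h (x * a^-1 * a)%g * (entry xi k j (x * a^-1)%g)^*) =
      (fun x => \sum_m entry xi j m a * (h x * (entry xi k m x)^*)).
    apply/funext => x; rewrite mulgKV entryM conj_sum mulr_sumr; apply: eq_bigr => m _.
    by rewrite conjM entryV conjCK mulrA mulrC.
  have cm m : ctsC (fun x => h x * (entry xi k m x)^*) by exact: ctsC_ip.
  rewrite (cmean_sum cG) => [|m]; last exact: ctsC_scale.
  by apply: eq_bigr => m _; rewrite (cmean_scale cG)// mxE.
exact: (smoothC_convolution sh (ctsC_conj (cE k j))).
Qed.

(** Entries of a representation that is not smooth are orthogonal to h by [smooth_rep_of_ip]. *)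
Lemma smooth_peter_weyl (h : G -> R[i]) : smoothC h ->
  (forall d (xi : irrep G d), smooth_rep xi -> forall j k, ip h (entry xi j k) = 0) ->
  forall x, h x = 0.
Proof.
move=> sh H; apply: (peter_weyl cG (smoothC_cts sh)) => d xi j k.
have [//|nz] := eqVneq (ip h (entry xi j k)) 0.
exact: H (smooth_rep_of_ip sh nz) j k.
Qed.

End smooth_convolution.

(** * Growth of the dual *)

Section cubes.
Context {R : realType} {n : nat}.
Implicit Types (y z q : 'rV[R]_n).

Definition cube z (r : R) : set 'rV[R]_n := [set y | forall k, `|y 0 k - z 0 k| <= r].

Lemma cube_compact z r : compact (cube z r).
Proof.
have -> : cube z r = [set y : 'rV[R]_n | forall k, [set` `[z 0 k - r, z 0 k + r]] (y 0 k)].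
  by apply/seteqP; split=> y H k; have := H k; rewrite /= in_itv /= ler_distl.
by apply: (@rV_compact R n (fun k => [set` `[z 0 k - r, z 0 k + r]])) => k; exact: segment_compact.
Qed.

Lemma open_cube (U : set 'rV[R]_n) z : open U -> U z -> exists2 r : R, 0 < r & cube z r `<=` U.
Proof.
move=> oU Uz; have /(@nbhs_ballP _ _ z U)[e /= e0 H] : nbhs z U by exact: open_nbhs_nbhs.
exists (e / 2) => [|y cy]; first by rewrite divr_gt0.
apply: H; rewrite -ball_normE /=; apply: (@le_lt_trans _ _ (e / 2)); last by rewrite ltr_pdivrMr// ltr_pMr// ltr1n.
by apply: norm_le_coord => [|k]; [rewrite divr_ge0// ltW|rewrite !mxE distrC; exact: cy].
Qed.

Lemma cube_mean_value (f : 'rV[R]_n -> R) (U : set 'rV[R]_n) z r (B : R) y q : open U ->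
  smooth_on U f -> cube z r `<=` U -> (forall k w, cube z r w -> `|partial k f w| <= B) ->
  cube z r y -> cube z r q -> `|f y - f q| <= B * \sum_k `|y 0 k - q 0 k|.
Proof.
move=> oU sf cU pB cy cq.
(* Both points are reached from the midpoint x, since [mvt_line] asks for differentiability on a
   symmetric segment, and the one around x stays inside the cube. *)
pose x := 2^-1 *: (y + q); pose v := 2^-1 *: (y - q).
have inc (s : R) : `|s| <= 1 -> cube z r (s *: v + x).
  move=> s1 k; have := cy k; have := cq k; rewrite !mxE.
  move: (y 0 k) (q 0 k) (z 0 k) => a b c; move: s1; rewrite !ler_norml => /andP[s1 s2] /andP[a1 a2] /andP[b1 b2].
  by apply/andP; split; nra.
have D w : cube z r w -> `|'D_v f w| <= B * (2^-1 * \sum_k `|y 0 k - q 0 k|).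
  move=> cw; have dw := smooth_on_differentiable oU sf (cU _ cw).
  rewrite deriveE// [v]row_sum_delta linear_sum mulrCA mulr_sumr mulr_sumr.
  apply: le_trans (ler_norm_sum _ _ _) _; apply: ler_sum => k _.
  rewrite linearZ /= -deriveE// normrM !mxE normrM ger0_norm ?invr_ge0//.
  rewrite -mulrA ler_wpM2l ?invr_ge0// mulrC ler_wpM2r//.
  exact: pB.
have dl (t s : R) : `|t| <= 1 -> `|s| <= `|t| -> derivable f (s *: v + x) v.
  move=> t1 st; apply: diff_derivable; apply: (smooth_on_differentiable oU sf); apply: cU.
  by apply: inc; exact: le_trans st t1.
have M (t : R) : `|t| = 1 -> `|f (t *: v + x) - f x| <= B * (2^-1 * \sum_k `|y 0 k - q 0 k|).
  move=> t1; have [|s s1 ->] := @mvt_line _ _ f x v t; first by move=> s; apply: dl; rewrite t1.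
  by rewrite normrM t1 mul1r; apply: D; apply: inc; rewrite -t1.
have Ey : 1 *: v + x = y.
  by apply/rowP => k; rewrite !mxE; field.
have Eq : (-1) *: v + x = q.
  by apply/rowP => k; rewrite !mxE; field.
have h1 := M 1 (normr1 _); have h2 := M (-1) (normrN1 _); rewrite Ey in h1; rewrite Eq in h2.
rewrite -[\sum_k _](_ : 2^-1 * (\sum_k `|y 0 k - q 0 k|) + 2^-1 * (\sum_k `|y 0 k - q 0 k|) = _); last by field.
rewrite mulrDr; apply: le_trans (ler_distD (f x) _ _) _; apply: lerD => //.
by rewrite distrC.
Qed.

Lemma nat_near (m : nat) (s : R) : 0 <= s -> s <= m.+1%:R ->
  exists j : 'I_m.+1, `|s - j%:R| <= 1.
Proof.
move=> s0; elim: m => [|m IH] sm.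
  by exists ord0; rewrite subr0 ger0_norm.
have [/IH[j Hj]|h] := leP s m.+1%:R.
  by exists (widen_ord (leqnSn _) j).
exists ord_max; rewrite ger0_norm; last by rewrite subr_ge0 ltW.
by rewrite lerBlDr -natr1 addrC in sm *.
Qed.

(** There are [m.+1] points per axis, starting at the lower face; the upper face is missed by one
    step, which [grid_near] tolerates. *)
Definition grid z (r : R) m : seq 'rV[R]_n :=
  [seq \row_k (z 0 k - r + 2 * r * (f k)%:R / m.+1%:R) | f : {ffun 'I_n -> 'I_m.+1}].

Lemma size_grid z r m : size (grid z r m) = (m.+1 ^ n)%N.
Proof. by rewrite /grid size_map -cardE card_ffun !card_ord. Qed.

Lemma grid_near z r m y : 0 < r -> cube z r y -> exists2 q, q \in grid z r m &
  cube z r q /\ forall k, `|y 0 k - q 0 k| <= 2 * r / m.+1%:R.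
Proof.
move=> r0 cy; have m0 : (0 : R) < m.+1%:R by rewrite ltr0n.
have H k : exists j : 'I_m.+1, `|(y 0 k - z 0 k + r) * m.+1%:R / (2 * r) - j%:R| <= 1.
  have := cy k; rewrite ler_norml => /andP[h1 h2]; apply: nat_near.
    apply: divr_ge0; first by apply: mulr_ge0; [lra|exact: ltW].
    by apply: mulr_ge0 => //; exact: ltW.
  rewrite ler_pdivrMr ?mulr_gt0// mulrC; apply: ler_wpM2l; first exact: ltW.
  lra.
have [j Hj] := choice H.
exists (\row_k (z 0 k - r + 2 * r * (j k)%:R / m.+1%:R)).
  apply/mapP; exists (finfun j); first by rewrite mem_enum.
  by apply/rowP => k; rewrite !mxE ffunE.
split=> k; rewrite mxE.
  have jm : (j k)%:R <= m.+1%:R :> R by rewrite ler_nat ltnW.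
  have q0 : 0 <= (j k)%:R / m.+1%:R :> R by rewrite divr_ge0// ltW.
  have q1 : (j k)%:R / m.+1%:R <= 1 :> R by rewrite ler_pdivrMr// mul1r.
  rewrite ler_norml -mulrA; move: (_ / _) q0 q1 => q q0 q1; apply/andP; split; nra.
have -> : y 0 k - (z 0 k - r + 2 * r * (j k)%:R / m.+1%:R) =
    ((y 0 k - z 0 k + r) * m.+1%:R / (2 * r) - (j k)%:R) * (2 * r / m.+1%:R).
  by field; rewrite !gt_eqF.
rewrite normrM [X in _ * X]ger0_norm; last by rewrite divr_ge0 ?mulr_ge0// ltW.
rewrite -[leRHS]mul1r; apply: ler_wpM2r; last exact: Hj.
by rewrite divr_ge0 ?mulr_ge0// ltW.
Qed.

End cubes.

Section net.
Context {R : realType} {n : nat} {G : lieGroupType R n}.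
Hypothesis cG : compact [set: G].
Variable g : biinvariant_metric G.
Implicit Types (x y a p : G) (u : G -> R).

(* Left translations preserve the bounds on the invariant fields, so a grid in
   one chart at the identity suffices. *)
Lemma invariant_net : exists (K : R) (N : nat), 0 <= K /\ forall m, exists P : seq G,
  (size P <= N * m.+1 ^ n)%N /\ forall y, exists2 p, p \in P &
    forall u (W : R), smoothR u -> (forall s x, (size s <= 1)%N -> `|fields s u x| <= W) ->
      `|u y - u p| <= K * W / m.+1%:R.
Proof.
pose i0 := chart_at (1%g : G); have d0 : dom (atlas i0) (1%g : G) := dom_chart_at (1%g : G).
set z0 := Defs.coord (atlas i0) (1%g : G); have c0 : codom_chart (atlas i0) z0 := codom_coord d0.
have [r r0 rU] := open_cube (@open_codom _ _ _ i0) c0.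
have bk k := partials_bound_compact g [:: k] (@cube_compact _ _ z0 r) rU.
have [M HM] := choice bk; pose B := \sum_k `|M k|.
have B0 : 0 <= B by exact: sumr_ge0.
have nV : nbhs (1%g : G) [set x | dom (atlas i0) x /\ cube z0 r (Defs.coord (atlas i0) x)].
  apply: (near_and (near_dom d0)); apply: near_forall => k.
  have ck : {for (1%g : G), continuous (fun x => Defs.coord (atlas i0) x 0 k)}.
    apply: (@continuous_comp _ _ _ (Defs.coord (atlas i0)) (fun z : 'rV[R]_n => z 0 k)); first exact: coord_cvg.
    exact: coord_continuous.
  by apply: filterS ((continuous_nearP _ _).1 ck _ r0) => x; rewrite distrC.
have [A HA] := translates_cover cG nV.
exists (B * (n%:R * (2 * r))), (size A); split; first by rewrite !mulr_ge0// ltW.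
move=> m; exists [seq (a^-1 * param (atlas i0) q)%g | a <- A, q <- grid z0 r m]; split.
  by rewrite size_allpairs size_grid.
move=> y; have [a aA [da ca]] := HA y.
have [q qg [cq yq]] := grid_near m r0 ca.
exists (a^-1 * param (atlas i0) q)%g; first by apply/allpairsP; exists (a, q).
move=> u W su uW; have W0 : 0 <= W := le_trans (normr_ge0 _) (uW [::] 1%g isT).
pose v x := u (a^-1 * x)%g; have sv : smoothR v := smoothR_translate_l a^-1%g su.
have -> : u y = (v \o param (atlas i0)) (Defs.coord (atlas i0) (a * y)%g).
  by rewrite /= coordK// /v mulKg.
have bd k w : cube z0 r w -> `|partial k (v \o param (atlas i0)) w| <= B * W.
  move=> cw; apply: (@le_trans _ _ (M k * W)).
    apply: (HM k w v W cw sv) => s x s1; rewrite /v (fields_translate s u a^-1%g x).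
    exact: uW.
  rewrite ler_wpM2r//; apply: le_trans (ler_norm _) _.
  by rewrite /B (bigD1 k)//= lerDl sumr_ge0.
apply: le_trans (cube_mean_value (@open_codom _ _ _ i0) (smoothR_on i0 sv) rU bd ca cq) _.
rewrite -[X in _ <= X]mulrA -[X in _ <= X]mulrA [X in _ <= X](_ : _ = B * W * (n%:R * (2 * r / m.+1%:R))); last by ring.
rewrite ler_wpM2l ?mulr_ge0//.
apply: le_trans (ler_sum _ (fun k _ => yq k)) _.
by rewrite sumr_const card_ord -[leLHS]mulr_natl.
Qed.

(* The reproducing kernel of the span equals #|I| on the diagonal and is
   #|I|/2 or more near it, at a distance of order 1/(1 + B); comparing with its
   L^2 norm over a net of about (1 + B)^n points bounds #|I|. *)
Lemma orthonormal_dim : exists2 K : R, 0 <= K & forall (I : finType) (e : I -> G -> R[i]) (B : R), 0 <= B ->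
  (forall i, smoothC (e i)) -> (forall i j, ip (e i) (e j) = (i == j)%:R) ->
  (forall x, \sum_i sqn (e i x) = #|I|%:R) ->
  (forall c x, \sum_i sqn (cfield c (e i) x) <= #|I|%:R * B) ->
  #|I|%:R <= K * (1 + B) ^+ n.
Proof.
have [K [N [K0 net]]] := invariant_net.
(* From [D <= 4 * size P], [size P <= N * m.+1 ^ n] and [m.+1 <= (4 * K + 2) * (1 + B)]. *)
exists (4 * N%:R * (4 * K + 2) ^+ n) => [|I e B B0 se oe e1 eB].
  by rewrite mulr_ge0 ?mulr_ge0// exprn_ge0// addr_ge0// mulr_ge0.
have ar1 (d b : R) : 0 < d -> 0 <= b -> d + d <= 2 * d * (1 + b) by move=> *; nra.
have ar2 (d b : R) : 0 < d -> 0 <= b -> d + d * b <= 2 * d * (1 + b) by move=> *; nra.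
have ar3 (k d b t : R) : 0 < d -> 0 <= b -> 4 * k * (1 + b) <= t ->
    k * (2 * d * (1 + b)) <= d / 2 * t by move=> *; nra.
have ar4 (d p : R) : 0 < d -> d / 2 * (d / 2) <= p * d -> d <= 4 * p.
  by move=> d0 h; rewrite -(ler_pM2r d0); lra.
have ar5 (k b t : R) : 0 <= b -> t <= 4 * k * (1 + b) -> t + 1 <= (4 * k + 2) * (1 + b).
  by move=> *; nra.
set D : R := #|I|%:R; have [D0|D0] := eqVneq D 0.
  by rewrite D0 mulr_ge0// ?exprn_ge0 ?addr_ge0// mulr_ge0 ?mulr_ge0// exprn_ge0// addr_ge0// mulr_ge0.
have Dp : 0 < D by rewrite lt_def D0 ler0n.
have ce i : ctsC (e i) := smoothC_cts (se i).
pose kap x y := \sum_i (e i x)^* * e i y.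
have skap x : smoothC (kap x) by apply: smoothC_sum => i; exact: smoothC_scale.
have kapxx x : complex.Re (kap x x) = D.
  rewrite /kap Re_sum /D -(e1 x); apply: eq_bigr => i _.
  by rewrite mulrC mulcJ.
have amgm (z w : R[i]) : taxi (z * w) <= sqn z + sqn w.
  apply: le_trans (taxiM _ _) _; have h1 := taxi_sqn z; have h2 := taxi_sqn w.
  have := sqr_ge0 (taxi z - taxi w); rewrite sqrrB; lra.
have kb x y : taxi (kap x y) <= D + D.
  apply: le_trans (taxi_sum _ _ _) _; rewrite /D -{1}(e1 x) -(e1 y) -big_split; apply: ler_sum => i _.
  by apply: le_trans (amgm _ _) _; rewrite sqnJ.
have kcb c x y : taxi (cfield c (kap x) y) <= D + D * B.
  rewrite /kap cfield_sum => [|i]; last exact: smoothC_scale.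
  apply: le_trans (taxi_sum _ _ _) _.
  apply: (@le_trans _ _ (\sum_i (sqn (e i x) + sqn (cfield c (e i) y)))); last first.
    by rewrite big_split /= e1 lerD2l.
  by apply: ler_sum => i _; rewrite cfield_scale//; apply: le_trans (amgm _ _) _; rewrite sqnJ.
have normk x : norm2 (kap x) = D.
  have := ip_self cG (kap x) => /(congr1 (@complex.Re R)) /= <-.
  rewrite -[mean _]/(complex.Re (ip (kap x) (kap x))) {1}/kap (ip_suml cG); last 2 first.
  - by move=> i; exact: ctsC_scale.
  - exact: smoothC_cts.
  rewrite Re_sum /D -(e1 x); apply: eq_bigr => i _.
  rewrite (ip_scalel cG)//; last exact: smoothC_cts.
  rewrite /kap (ip_sumr cG)//; last by move=> j; exact: ctsC_scale.
  rewrite (bigD1 i)//= (ip_scaler cG)// oe eqxx big1 ?addr0 => [|j ji].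
    by rewrite conjCK mulr1 mulrC mulcJ.
  by rewrite (ip_scaler cG)// oe eq_sym (negPf ji) mulr0.
pose W := 2 * D * (1 + B).
have fW x s y : (size s <= 1)%N -> `|fields s (fun y => complex.Re (kap x y)) y| <= W.
  have W1 : D + D <= W by exact: ar1.
  have W2 : D + D * B <= W by exact: ar2.
  case: s => [|c [|//]] _ /=.
    by apply: le_trans W1; apply: le_trans (kb x y); rewrite /taxi lerDl.
  by apply: le_trans W2; apply: le_trans (kcb c x y); rewrite /taxi lerDl.
(* The mesh is chosen so that the error [K * W / m.+1] of the net is at most half of D. *)
pose m := Num.truncn (4 * K * (1 + B)).
have KB0 : 0 <= 4 * K * (1 + B) by rewrite mulr_ge0 ?mulr_ge0// addr_ge0.
have [P [sP HP]] := net m.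
have mK : 4 * K * (1 + B) <= m.+1%:R.
  by have /andP[_ /ltW] := truncn_itv KB0.
have m0 : (0 : R) < m.+1%:R by rewrite ltr0n.
have big y : D / 2 * (D / 2) <= \sum_(p <- P) sqn (kap p y).
  have [p pP Hp] := HP y; have := Hp _ W (smoothC_Re (skap p)) (fW p).
  rewrite kapxx => h.
  have hh : K * W / m.+1%:R <= D / 2 by rewrite ler_pdivrMr//; exact: ar3.
  have h2 : D / 2 <= complex.Re (kap p y).
    move: (le_trans h hh); rewrite ler_norml => /andP[h1 _]; lra.
  apply: (@le_trans _ _ (sqn (kap p y))).
    have h3 : 0 <= D / 2 by rewrite divr_ge0// ltW.
    rewrite /sqn -expr2; apply: (@le_trans _ _ (complex.Re (kap p y) ^+ 2)); last by rewrite lerDl sqr_ge0.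
    by rewrite ler_pXn2r// nnegrE; exact: le_trans h2.
  rewrite (big_rem p)//= lerDl sumr_ge0// => q _; exact: sqn_ge0.
have ckp p : continuous (fun y => sqn (kap p y)) by apply: cts_sqn; exact: smoothC_cts.
have : D / 2 * (D / 2) <= (size P)%:R * D.
  have -> : (size P)%:R * D = mean (fun y => \sum_(p <- P) sqn (kap p y)).
    rewrite (mean_sum cG)//; rewrite (eq_bigr (fun=> D)); last by move=> p _; exact: normk.
    by rewrite big_const_seq count_predT iter_addr_0 mulr_natl.
  rewrite -[leLHS](mean_cst cG); apply: (mean_le cG) => [||y]; [exact: cts_cst|exact: cts_sum|exact: big].
move=> h; have h2 : D <= 4 * (size P)%:R by exact: ar4.
 apply: le_trans h2 _; rewrite -!mulrA ler_wpM2l//.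
apply: (@le_trans _ _ (N * m.+1 ^ n)%:R); first by rewrite ler_nat.
rewrite natrM natrX ler_wpM2l// -exprMn lerXn2r ?nnegrE ?ler0n//.
  by rewrite mulr_ge0 ?addr_ge0 ?mulr_ge0.
have /andP[+ _] := truncn_itv KB0; rewrite -/m.
by rewrite -[m.+1%:R]natr1 => h3; exact: ar5.
Qed.

End net.

(** * Families of pairwise orthogonal representations *)

Section representations.
Context {R : realType} {n : nat} (G : lieGroupType R n).

Definition representation := {d : nat & irrep G d}.

HB.instance Definition _ := gen_eqMixin representation.
HB.instance Definition _ := gen_choiceMixin representation.

End representations.

Lemma sum_sigma (V : nmodType) m (d : 'I_m -> nat) (F : {q : 'I_m & ('I_(d q) * 'I_(d q))%type} -> V) :
  \sum_p F p = \sum_q \sum_j \sum_k F (existT (fun q => ('I_(d q) * 'I_(d q))%type) q (j, k)).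
Proof.
pose J q : finType := ('I_(d q) * 'I_(d q))%type.
pose H q (p : J q) := F (existT (fun q => ('I_(d q) * 'I_(d q))%type) q p).
have E := @sig_big_dep V 0 +%R 'I_m J xpredT (fun _ _ => true) H.
transitivity (\sum_q \sum_(p : J q) H q p); last first.
  by apply: eq_bigr => q _; rewrite pair_big; apply: eq_bigr => [[j k] _].
by rewrite E; apply: eq_bigr => [[q p] _].
Qed.

Section dual.
Context {R : realType} {n : nat} {G : lieGroupType R n}.
Hypothesis cG : compact [set: G].
Variable g : biinvariant_metric G.
Local Notation C := R[i].
Implicit Types (xi eta : representation G) (x y : G) (t : R).

Definition rdim xi : nat := projT1 xi.
Definition rep xi : irrep G (rdim xi) := projT2 xi.
Definition ev xi : R := laplace_eigenvalue g (rep xi).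
Definition rentry xi j k : G -> C := entry (rep xi) j k.
Arguments rentry _ _ _ _ : clear implicits.
Definition orthogonal_reps xi eta := forall j k l m, ip (rentry xi j k) (rentry eta l m) = 0.

Lemma orthogonal_reps_sym xi eta : orthogonal_reps xi eta -> orthogonal_reps eta xi.
Proof.
move=> H j k l m; rewrite -(ip_conj cG) ?H ?rmorph0//; exact: ctsC_entry.
Qed.

Lemma ev_ge0 xi : smooth_rep (rep xi) -> 0 <= ev xi.
Proof. by move=> s; have [] := laplace_eigenvalueE cG g s. Qed.

Definition independent (A : set (representation G)) :=
  (forall xi, A xi -> smooth_rep (rep xi)) /\
  (forall xi eta, A xi -> A eta -> xi <> eta -> orthogonal_reps xi eta).

(* By the Schur relations, a maximal such A contains exactly one representative of
   each class of smooth irreducible representations. *)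
Lemma maximal_independent : exists A, independent A /\
  forall eta, smooth_rep (rep eta) -> exists2 xi, A xi & ~ orthogonal_reps xi eta.
Proof.
have [|A [[sA oA] Amax]] := @Zorn_bigcup (representation G) [set A | independent A].
  move=> F FI Ft; split=> [xi [X FX Xxi]|xi eta [X FX Xxi] [Y FY Yeta] ne].
    by have [s _] := FI _ FX; exact: s.
  have [XY|YX] := Ft _ _ FX FY.
    by have [_ o] := FI _ FY; apply: o => //; exact: XY.
  by have [_ o] := FI _ FX; apply: o => //; exact: YX.
exists A; split=> // eta seta; apply: contrapT => no.
have o xi : A xi -> orthogonal_reps xi eta.
  by move=> Axi; apply: contrapT => h; apply: no; exists xi.
have nA : ~ A eta.
  move=> Aeta; have := o eta Aeta; pose k : 'I_(rdim eta) := Ordinal (rep_dim_gt0 (rep eta)).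
  move=> /(_ k k k k); rewrite /rentry (ip_entry_self cG) !eqxx !mul1r => /eqP.
  by rewrite invr_eq0 pnatr_eq0 eqn0Ngt (rep_dim_gt0 (rep eta)).
apply: (Amax (A `|` [set eta])).
  split=> [x Ax|sub]; first by left.
  by apply: nA; apply: sub; right.
split=> [xi [Axi|->//]|xi zeta]; first exact: sA.
move=> [Ax|->] [Az|->] ne; [exact: oA|exact: o| |by case: ne].
exact/orthogonal_reps_sym/o.
Qed.

Lemma entry_mul_sqn d (xi : irrep G d) (v : 'I_d -> C) x :
  \sum_j sqn (\sum_l entry xi j l x * v l) = \sum_l sqn (v l).
Proof.
suff : (\sum_j sqn (\sum_l entry xi j l x * v l))%:C%C = (\sum_l sqn (v l))%:C%C :> C.
  by move=> /(congr1 (@complex.Re R)).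
rewrite !rmorph_sum.
transitivity (\sum_j \sum_l \sum_p (entry xi j l x * v l) * (entry xi j p x * v p)^*).
  apply: eq_bigr => j _; rewrite -[LHS]mulcJ conj_sum mulr_suml; apply: eq_bigr => l _.
  by rewrite mulr_sumr.
rewrite exchange_big; apply: eq_bigr => l _ /=; rewrite exchange_big /=.
transitivity (\sum_p v l * (v p)^* * \sum_j (entry xi j p x)^* * entry xi j l x).
  apply: eq_bigr => p _; rewrite mulr_sumr; apply: eq_bigr => j _.
  by rewrite conjM; ring.
rewrite (bigD1 l)//= entry_col eqxx mulr1 mulcJ big1 ?addr0// => p pl.
by rewrite entry_col (negPf pl) mulr0.
Qed.

(** The entries scaled by the square root of the dimension are orthonormal by the Schur relations,
    their pointwise sum of squares is constant by unitarity, and [drep_sqn] bounds their fields;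
    their number is the sum of the squared dimensions. *)
Lemma dim_bound : exists2 K : R, 0 <= K & forall (S : seq (representation G)) t, 0 <= t -> uniq S ->
  independent [set` S] -> (forall xi, xi \in S -> ev xi <= t) ->
  \sum_(xi <- S) (rdim xi)%:R ^+ 2 <= K * (1 + t) ^+ n.
Proof.
have [K K0 H] := orthonormal_dim cG g; have [B B0 HB] := drep_sqn cG g.
exists (K * (1 + B) ^+ n) => [|S t t0 uS [sS oS] evS]; first by rewrite mulr_ge0// exprn_ge0// addr_ge0.
pose s (q : 'I_(size S)) := tnth (in_tuple S) q.
have sq q : s q \in S by exact: mem_tnth.
pose d q := rdim (s q); pose J q : finType := ('I_(d q) * 'I_(d q))%type.
pose I : finType := {q : 'I_(size S) & J q}.
have d0 q : (0 : R) < (d q)%:R by rewrite ltr0n; exact: rep_dim_gt0 (rep (s q)).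
pose r q : C := (Num.sqrt (d q)%:R)%:C%C.
have r2 q : r q * (r q)^* = (d q)%:R.
  rewrite mulcJ /r sqn_real sqr_sqrtr; last exact: ltW.
  by rewrite rmorph_nat.
have sr q : sqn (r q) = (d q)%:R by rewrite /r sqn_real sqr_sqrtr// ltW.
pose e (p : I) x := r (tag p) * rentry (s (tag p)) (tagged p).1 (tagged p).2 x.
have cent q j k : ctsC (rentry (s q) j k) by exact: ctsC_entry.
have smt q : smooth_rep (rep (s q)) by apply: sS; exact: sq.
have se p : smoothC (e p) by apply: smoothC_scale; exact: smt.
have cardI : (#|I|%:R : R) = \sum_(xi <- S) (rdim xi)%:R ^+ 2.
  rewrite -sum1_card natr_sum (sum_sigma (fun p => 1%:R : R)) (big_tnth _ _ S).
  apply: eq_bigr => q _; rewrite (eq_bigr (fun=> (d q)%:R)) => [|j _].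
    by rewrite sumr_const card_ord expr2 mulr_natl.
  by rewrite sumr_const card_ord.
have oe p p' : ip (e p) (e p') = (p == p')%:R.
  rewrite /e (ip_scalel cG)//; last by apply: ctsC_scale.
  rewrite (ip_scaler cG)// mulrA; move: p p' => [q [j k]] [q' [j' k']] /=.
  have [E|ne] := eqVneq q q'.
    subst q'; rewrite r2 /rentry (ip_entry_self cG) eq_Tagged /= xpair_eqE.
    have dn : ((d q)%:R : C) != 0 by rewrite pnatr_eq0 -lt0n; exact: rep_dim_gt0 (rep (s q)).
    by rewrite mulrCA -/(d q) mulfV// mulr1 -natrM mulnb.
  have -> : ip (rentry (s q) j k) (rentry (s q') j' k') = 0.
    apply: oS => /=; [exact: sq|exact: sq|] => E; move/eqP: ne; apply.
    apply: val_inj; apply/eqP; rewrite -(nth_uniq (s q) (ltn_ord q) (ltn_ord q') uS).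
    have nE w (p : 'I_(size S)) : nth w S p = s p by rewrite /s (tnth_nth w).
    by rewrite !nE E.
  rewrite mulr0; case: eqP => // /(congr1 tag) /= E; by rewrite E eqxx in ne.
have sum1 x : \sum_p sqn (e p x) = #|I|%:R.
  rewrite cardI sum_sigma (big_tnth _ _ S); apply: eq_bigr => q _ /=.
  rewrite (eq_bigr (fun=> (d q)%:R)) => [|j _].
    by rewrite sumr_const card_ord expr2 mulr_natl.
  transitivity ((d q)%:R * \sum_k sqn (entry (rep (s q)) j k x)); last by rewrite entry_row_sqn mulr1.
  rewrite mulr_sumr; apply: eq_bigr => k _.
  by rewrite sqnM sr.
have sumD c x : \sum_p sqn (cfield c (e p) x) <= #|I|%:R * (B * t).
  rewrite cardI sum_sigma (big_tnth _ _ S) mulr_suml; apply: ler_sum => q _ /=.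
  rewrite exchange_big /= (_ : _ * (B * t) = \sum_(k < d q) (d q)%:R * (B * t)); last first.
    by rewrite sumr_const card_ord expr2 -mulrA mulr_natl.
  apply: ler_sum => k _; rewrite (eq_bigr (fun j => (d q)%:R * sqn (\sum_l rentry (s q) j l x * drep (rep (s q)) c l k))); last first.
    move=> j _; rewrite cfield_scale; last exact: smt.
    by rewrite sqnM sr (cfield_entry (smt q)).
  rewrite -mulr_sumr; apply: ler_wpM2l; first exact: ltW.
  rewrite entry_mul_sqn.
  by apply: le_trans (HB _ _ (smt q) c k) _; rewrite ler_wpM2l// evS.
rewrite -cardI; apply: le_trans (H I e (B * t) _ se oe sum1 sumD) _; first exact: mulr_ge0.
rewrite -mulrA -exprMn ler_wpM2l// lerXn2r ?nnegrE ?mulr_ge0 ?addr_ge0 ?mulr_ge0//.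
by move: B0 t0; nra.
Qed.

(** Every dimension is at least 1, so [dim_bound] limits the size of a subfamily with eigenvalues up
    to t; one of largest size contains all of them. *)
Lemma finite_spectrum (A : set (representation G)) t : independent A -> 0 <= t ->
  exists S : seq (representation G), uniq S /\ forall xi, xi \in S <-> A xi /\ ev xi <= t.
Proof.
move=> [sA oA] t0; have [K K0 H] := dim_bound.
pose P N := `[< exists S : seq (representation G), [/\ uniq S, size S = N &
  forall xi, xi \in S -> A xi /\ ev xi <= t] >].
have P0 : P 0%N by apply/asboolP; exists [::].
have Pb N : P N -> (N <= Num.truncn (K * (1 + t) ^+ n))%N.
  move=> /asboolP[S [uS <- SA]].
  have E0 : 0 <= K * (1 + t) ^+ n by rewrite mulr_ge0// exprn_ge0// addr_ge0.
  rewrite -ltnS -(ltr_nat R); have /andP[_] := truncn_itv E0; apply: le_lt_trans.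
  have : independent [set` S].
    by split=> [xi /SA[/sA]//|xi eta /SA[Ax _] /SA[Ae _]]; exact: oA.
  move=> indS; apply: le_trans (H S t t0 uS indS (fun xi h => (SA xi h).2)).
  rewrite -sum1_size natr_sum; apply: ler_sum => xi _.
  by rewrite -natrX ler_nat expn_gt0; have := rep_dim_gt0 (rep xi); rewrite -/(rdim xi) => ->.
case: (ex_maxnP (ex_intro _ 0%N P0) Pb) => N /asboolP[S [uS sS SA]] Nmax.
exists S; split=> // xi; split=> [/SA//|[Ax ex]]; apply: contrapT => /negP nS.
have := Nmax N.+1; rewrite ltnn => /(_ _)/negP; case=> //; apply/asboolP.
exists (xi :: S); split=> [|/=|eta]; [by rewrite /= nS|by rewrite sS|].
by rewrite inE => /orP[/eqP ->//|/SA].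
Qed.

End dual.
Arguments rentry {R n G} _ _ _ _.

(** * The topology of smooth functions *)

Lemma initial_topology_cvg {S : choiceType} {T : topologicalType} (f : S -> T)
    (F : set_system S) (s : S) : Filter F ->
  (forall P, nbhs (f s) P -> F (f @^-1` P)) -> F --> (s : initial_topology f).
Proof.
move=> FF H P; rewrite nbhsE => -[B [[W oW WB] Bs] BP].
apply: filterS BP _; rewrite -WB; apply: H; apply: open_nbhs_nbhs; split=> //.
by rewrite -WB in Bs.
Qed.

Section topology.
Context {R : realType} {n : nat} {G : lieGroupType R n}.
Implicit Types (f h : smooth_function G) (i : chart_index G).

Lemma jet_cvg (F : nat -> smooth_function G) f :
  (forall k (K : set 'rV[R]_n), compact_in_chart k.1 K ->
    {uniform K, (fun m => jet (F m) k) @ \oo --> jet f k}) -> F @ \oo --> f.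
Proof.
move=> H; apply: (@initial_topology_cvg _ _ (@jet R n G)) => P nP.
have C : (fun m => jet (F m)) @ \oo --> (jet f : jet_space G).
  apply/cvg_sup => k; apply: initial_topology_cvg => Q nQ.
  have FF : Filter ((fun m => jet (F m) k) @ \oo) by exact: fmap_filter.
  exact: ((@fam_cvgP _ _ (compact_in_chart k.1) ((fun m => jet (F m) k) @ \oo) (jet f k) FF).2 (H k) Q nQ).
exact: C.
Qed.

Lemma smooth_cvg (F : nat -> smooth_function G) f :
  (forall i s (K : set 'rV[R]_n) (e : R), compact K -> K `<=` codom_chart (atlas i) -> 0 < e ->
    exists N, forall m z, (N <= m)%N -> K z ->
      `|partials s (local_Re i (F m)) z - partials s (local_Re i f) z| <= e /\
      `|partials s (local_Im i (F m)) z - partials s (local_Im i f) z| <= e) ->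
  F @ \oo --> f.
Proof.
move=> H; apply: jet_cvg => -[i s] K [/= cK KC] Q /uniform_nbhs[E [entE EQ]].
move: entE; rewrite -entourage_ballE => -[e e0 He].
have ep : 0 < e / 2 by rewrite divr_gt0.
have [N HN] := H i s K (e / 2) cK KC ep.
exists N => // m Nm; apply: EQ => z Kz; apply: He.
have [h1 h2] := HN m z Nm Kz.
have e2 : e / 2 < e by rewrite ltr_pdivrMr// ltr_pMr// ltr1n.
split; rewrite -ball_normE /= distrC.
  exact: le_lt_trans h1 e2.
exact: le_lt_trans h2 e2.
Qed.

Lemma smooth_eval_near f i (K : set 'rV[R]_n) (e : R) : compact K -> K `<=` codom_chart (atlas i) -> 0 < e ->
  nbhs f [set h : smooth_function G | forall z, K z ->
    `|local_Re i f z - local_Re i h z| <= e /\ `|local_Im i f z - local_Im i h z| <= e].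
Proof.
move=> cK KC e0; pose k : chart_index G * seq 'I_n := (i, [::]).
pose P (J : jet_space G) := forall z, K z ->
  `|(jet f k z).1 - (J k z).1| <= e /\ `|(jet f k z).2 - (J k z).2| <= e.
have nP : nbhs (jet f : jet_space G) P.
  have Fk : Filter (nbhs (jet f : jet_space G)) by exact: nbhs_filter.
  have /cvg_sup/(_ k) ik : nbhs (jet f : jet_space G) --> (jet f : jet_space G) by move=> ? ?.
  pose Q (J : {family compact_in_chart k.1, 'rV[R]_n -> R * R}) := forall z, K z ->
    `|(jet f k z).1 - (J z).1| <= e /\ `|(jet f k z).2 - (J z).2| <= e.
  have nQ : nbhs (jet f k : {family compact_in_chart k.1, 'rV[R]_n -> R * R}) Q.
    have Fj : Filter (nbhs (jet f k : {family compact_in_chart k.1, 'rV[R]_n -> R * R})) by exact: nbhs_filter.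
    have U := (@fam_cvgP _ _ (compact_in_chart k.1) _ _ Fj).1 (fun _ a => a) K (conj cK KC).
    apply: (U Q).
    apply/uniform_nbhs; exists [set xy | ball xy.1 e xy.2]; split.
      by rewrite -entourage_ballE; exists e.
    move=> J HJ z Kz; have [] := HJ z Kz; rewrite -ball_normE /= => h1 h2.
    by split; exact: ltW.
  exact: ik (@initial_continuous _ _ (fun J : jet_space G => J k) (jet f) Q nQ).
exact: (@initial_continuous _ _ (@jet R n G) f P nP).
Qed.

Hypothesis cG : compact [set: G].

(** The topology controls functions on compact subsets of charts; cubes around all points and the
    near-covering property spread the control over G. *)
Lemma smooth_sup_near f (e : R) : 0 < e ->
  nbhs f [set h : smooth_function G | forall x, taxi (f x - h x) <= e].
Proof.
move=> e0; have e2 : 0 < e / 2 by rewrite divr_gt0.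
have Ff : Filter (nbhs f) by exact: nbhs_filter.
have /compact_near_coveringP cov := cG.
have := cov _ (nbhs f) (fun (h : smooth_function G) x => taxi (f x - h x) <= e) Ff.
move=> H; apply: filterS (H _) => [h hx x|x _]; first exact: hx.
pose i := chart_at x; have dx : dom (atlas i) x := dom_chart_at x.
have [r r0 rU] := open_cube (@open_codom _ _ _ i) (codom_coord dx).
exists ([set y | dom (atlas i) y /\ cube (Defs.coord (atlas i) x) r (Defs.coord (atlas i) y)],
  [set h : smooth_function G | forall z, cube (Defs.coord (atlas i) x) r z ->
    `|local_Re i f z - local_Re i h z| <= e / 2 /\ `|local_Im i f z - local_Im i h z| <= e / 2]).
  split; last exact: smooth_eval_near (@cube_compact _ _ _ r) rU e2.
  apply: (near_and (near_dom dx)); apply: near_forall => k.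
  have ck : {for x, continuous (fun x => Defs.coord (atlas i) x 0 k)}.
    apply: (@continuous_comp _ _ _ (Defs.coord (atlas i)) (fun z : 'rV[R]_n => z 0 k)); first exact: coord_cvg.
    exact: coord_continuous.
  by apply: filterS ((continuous_nearP _ _).1 ck _ r0) => y; rewrite distrC.
move=> [y h] [/= [dy cy] Hh]; have [h1 h2] := Hh _ cy.
rewrite /local_Re /local_Im coordK// in h1 h2.
by rewrite /taxi cRe_add cRe_opp cIm_add cIm_opp [e]splitr; apply: lerD.
Qed.

(** Boundedness for the uniform norm gives continuity; it is how Fourier coefficients are recognized
    as distributions. *)
Lemma functional_continuous (T : {linear smooth_function G -> R[i]^o}) (C : R) : 0 <= C ->
  (forall h (M : R), (forall x, taxi (h x) <= M) -> taxi (T h) <= C * M) -> Defs.distribution T.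
Proof.
move=> C0 H f; apply/complex_cvg_taxi => e e0.
have C1 : 0 < C + 1 by rewrite ltr_wpDl.
have d0 : 0 < e / (C + 1) by rewrite divr_gt0.
apply: filterS (smooth_sup_near f d0) => h Hh.
rewrite -linearB; apply: le_trans (H (f - h) _ Hh) _.
rewrite mulrCA -[leRHS]mulr1; apply: ler_wpM2l; first exact: ltW.
by rewrite ler_pdivrMr// mul1r lerDl.
Qed.

End topology.

(** * Fourier series *)

Section fourier.
Context {R : realType} {n : nat} {G : lieGroupType R n}.
Hypothesis cG : compact [set: G].
Variable g : biinvariant_metric G.
Local Notation C := R[i].
Implicit Types (xi eta : representation G) (x y : G) (t : R) (f h : G -> C) (s : seq 'I_n).
Local Notation ev := (ev g).

(** The transpose of the usual coefficient, which is the integral of h times the adjoint of xi;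
    hence symbols act on it on the right, by their transposes. *)
Definition coef h xi : 'M[C]_(rdim xi) := \matrix_(j, k) ip h (rentry xi j k).

Lemma ctsC_rentry xi j k : ctsC (rentry xi j k). Proof. exact: ctsC_entry. Qed.

Lemma rdim_gt0 xi : (0 < rdim xi)%N. Proof. exact: rep_dim_gt0 (rep xi). Qed.

Lemma coef_bound h xi (M : R) j k : ctsC h -> (forall x, taxi (h x) <= M) ->
  taxi (coef h xi j k) <= 4 * M.
Proof.
move=> ch hM; rewrite mxE.
have -> : 4 * M = 2 * (M * 2) by ring.
apply: (cmean_taxi cG); first by apply: ctsC_ip => //; exact: ctsC_rentry.
move=> x; apply: le_trans (taxiM _ _) _; rewrite taxiJ.
by apply: ler_pM; rewrite ?taxi_ge0//; exact: entry_taxi.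
Qed.

(** By symmetry of the Laplacian, adding [lap g h] to h multiplies the coefficient by [1 + ev xi];
    each induction step gains one power. *)
Lemma coef_decay N h : smoothC h -> exists2 K : R, 0 <= K & forall xi, smooth_rep (rep xi) ->
  forall j k, taxi (coef h xi j k) * (1 + ev xi) ^+ N <= K.
Proof.
elim: N h => [|N IH] h sh.
  have [M HM] := ctsC_bounded cG (smoothC_cts sh).
  exists (4 * M) => [|xi _ j k]; first by rewrite mulr_ge0//; exact: le_trans (taxi_ge0 _) (HM 1%g).
  by rewrite expr0 mulr1; apply: coef_bound => //; exact: smoothC_cts.
have sl := smoothC_lap g sh.
have [K K0 HK] := IH _ (smoothC_add sh sl); exists K => // xi sxi j k.
have [nu0 E] := laplace_eigenvalueE cG g sxi.
have nu1 : 0 <= 1 + ev xi by rewrite addr_ge0.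
have cE : coef (fun x => h x + lap g h x) xi j k = (1 + ev xi)%:C%C * coef h xi j k.
  rewrite !mxE (ip_addl cG); [|exact: smoothC_cts|exact: smoothC_cts|exact: ctsC_rentry].
  rewrite (ip_lap_sym cG g sh (sxi j k)).
  have -> : lap g (rentry xi j k) = (fun x => (ev xi)%:C%C * rentry xi j k x).
    by apply/funext => x; exact: E.
  rewrite (ip_scaler cG); [|exact: smoothC_cts|exact: ctsC_rentry].
  by rewrite conj_real rmorphD mulrDl mul1r.
have := HK xi sxi j k; rewrite cE.
have taxi_real (a : R) (z : C) : 0 <= a -> taxi (a%:C%C * z) = a * taxi z.
  move=> a0; rewrite /taxi cRe_mul cIm_mul /= !mul0r subr0 addr0 !normrM ger0_norm//.
  by rewrite mulrDr.
by rewrite taxi_real// exprS mulrCA mulrA.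
Qed.

Variable A : set (representation G).
Hypothesis iA : independent A.
Let sA xi : A xi -> smooth_rep (rep xi) := iA.1 xi.

(** The factor [rdim xi] cancels the squared norm of an entry, so that c is recovered as the
    coefficient. *)
Definition fourier_term (c : forall xi, 'M[C]_(rdim xi)) xi x : C :=
  \sum_j \sum_k ((rdim xi)%:R * c xi j k) * rentry xi j k x.

Definition rapid (c : forall xi, 'M[C]_(rdim xi)) := forall N, exists K : R, forall xi, A xi ->
  forall j k, taxi (c xi j k) * (1 + ev xi) ^+ N <= K.

Lemma smoothC_fourier_term c xi : A xi -> smoothC (fourier_term c xi).
Proof.
move=> Ax; apply: smoothC_sum => j; apply: smoothC_sum => k; apply: smoothC_scale.
exact: (sA Ax).
Qed.

Lemma coef_fourier_term c xi : A xi -> coef (fourier_term c xi) xi = c xi.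
Proof.
move=> Ax; have d0 : ((rdim xi)%:R : C) != 0 by rewrite pnatr_eq0 -lt0n rdim_gt0.
have c1 z j k : ctsC (fun x => z * rentry xi j k x) by apply: ctsC_scale; exact: ctsC_rentry.
have c2 j : ctsC (fun x => \sum_k ((rdim xi)%:R * c xi j k) * rentry xi j k x) by exact: ctsC_sum.
apply/matrixP => l m; rewrite mxE /fourier_term (ip_suml cG)//; last exact: ctsC_rentry.
rewrite (bigD1 l)//= big1 ?addr0 => [|j jl].
  rewrite (ip_suml cG)//; last exact: ctsC_rentry.
  rewrite (bigD1 m)//= big1 ?addr0 => [|k km].
    rewrite (ip_scalel cG); [|exact: ctsC_rentry|exact: ctsC_rentry].
    by rewrite /rentry (ip_entry_self cG) !eqxx !mul1r mulrAC mulfV// mul1r.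
  rewrite (ip_scalel cG); [|exact: ctsC_rentry|exact: ctsC_rentry].
  by rewrite /rentry (ip_entry_self cG) (negPf km) mulr0 mul0r mulr0.
rewrite (ip_suml cG)//; last exact: ctsC_rentry.
apply: big1 => k _; rewrite (ip_scalel cG); [|exact: ctsC_rentry|exact: ctsC_rentry].
by rewrite /rentry (ip_entry_self cG) (negPf jl) !mul0r mulr0.
Qed.

Lemma coef_fourier_term_neq c xi eta : A xi -> A eta -> xi <> eta ->
  coef (fourier_term c xi) eta = 0.
Proof.
move=> Ax Ae ne; apply/matrixP => l m; rewrite !mxE /fourier_term.
have c1 z j k : ctsC (fun x => z * rentry xi j k x) by apply: ctsC_scale; exact: ctsC_rentry.
have ce : ctsC (rentry eta l m) by exact: ctsC_rentry.
rewrite (ip_suml cG)//; last by move=> j; exact: ctsC_sum.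
apply: big1 => j _; rewrite (ip_suml cG)//; apply: big1 => k _.
rewrite (ip_scalel cG)//; last exact: ctsC_rentry.
by rewrite (iA.2 _ _ Ax Ae ne) mulr0.
Qed.

(** [dim_bound] for a single representation, whose dimension is at most its square. *)
Lemma rdim_bound : exists2 K : R, 0 <= K & forall xi, A xi -> (rdim xi)%:R <= K * (1 + ev xi) ^+ n.
Proof.
have [K K0 H] := dim_bound cG g; exists K => // xi Ax.
have I1 : independent [set` [:: xi]].
  split=> [eta|eta zeta]; rewrite /= !inE => /eqP ->; first exact: sA.
  by move=> /eqP ->.
have e0 : 0 <= ev xi by apply: (ev_ge0 cG g); exact: sA.
have := H [:: xi] (ev xi) e0 isT I1; rewrite big_seq1 => h.
have le1 eta : eta \in [:: xi] -> ev eta <= ev xi by rewrite inE => /eqP ->.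
apply: le_trans (h le1); rewrite expr2 -natrM ler_nat.
by rewrite -[X in (X <= _)%N]mul1n leq_mul2r rdim_gt0 orbT.
Qed.

Lemma fourier_term_bound c s N : rapid c -> exists2 K : R, 0 <= K & forall xi, A xi -> forall x,
  taxi (cfields s (fourier_term c xi) x) * (1 + ev xi) ^+ N <= K.
Proof.
move=> rc; have [K1 K10 H1] := cfields_entry_bound cG g; have [K2 K20 H2] := rdim_bound.
set p := size s.
(* The term carries [4 + p] factors of the dimension (its own, two sums, and [1 + p] in the bound on
   entries), each worth n powers of [1 + ev xi], and p further powers from the fields. *)
have [K3 H3] := rc (n * (4 + p) + p + N)%N.
exists (2 * K1 ^+ p * K2 ^+ (4 + p) * `|K3|) => [|xi Ax x].
  by apply: mulr_ge0 => //; apply: mulr_ge0; [apply: mulr_ge0 => //|]; exact: exprn_ge0.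
have sx := sA Ax; have [e0 _] := laplace_eigenvalueE cG g sx; rewrite -/(ev xi) in e0.
have a0 : 0 <= 1 + ev xi by rewrite addr_ge0.
set d : R := (rdim xi)%:R; have d0 : 0 <= d by exact: ler0n.
set B := 2 * d * (d * (K1 * (1 + ev xi))) ^+ p.
have B0 : 0 <= B by rewrite mulr_ge0 ?mulr_ge0// exprn_ge0// !mulr_ge0.
set b := (1 + ev xi) ^+ (n * (4 + p) + p + N).
have bp : 0 < b by rewrite exprn_gt0// ltr_pwDl.
have taxi_nat (z : C) : taxi ((rdim xi)%:R * z) = d * taxi z.
  by rewrite mulr_natl /taxi (raddfMn (@complex.Re R)) (raddfMn (@complex.Im R)) !normrMn -mulrnDl mulr_natl.
have T1 j k : taxi (cfields s (fun y => ((rdim xi)%:R * c xi j k) * rentry xi j k y) x) <=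
    d * (`|K3| / b) * B.
  rewrite cfields_scale; last exact: sx.
  apply: le_trans (taxiM _ _) _; apply: ler_pM; rewrite ?taxi_ge0//; last exact: H1.
  rewrite taxi_nat ler_wpM2l// ler_pdivlMr//.
  exact: le_trans (H3 _ Ax j k) (ler_norm _).
have T2 : taxi (cfields s (fourier_term c xi) x) <= d * (d * (d * (`|K3| / b) * B)).
  have sm j k : smoothC (fun y => ((rdim xi)%:R * c xi j k) * rentry xi j k y).
    by apply: smoothC_scale; exact: sx.
  rewrite /fourier_term cfields_sum => [|j]; last exact: smoothC_sum.
  have dsum (u : R) : \sum_(j < rdim xi) u = d * u by rewrite sumr_const card_ord mulr_natl.
  apply: le_trans (taxi_sum _ _ _) _; rewrite -[leRHS]dsum; apply: ler_sum => j _.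
  rewrite cfields_sum//; apply: le_trans (taxi_sum _ _ _) _; rewrite -[leRHS]dsum.
  by apply: ler_sum => k _; exact: T1.
apply: le_trans (ler_wpM2r (exprn_ge0 N a0) T2) _.
have dK := H2 _ Ax; rewrite -/d in dK.
have E : d * (d * (d * (`|K3| / b) * B)) * (1 + ev xi) ^+ N =
    2 * K1 ^+ p * `|K3| * (d ^+ (4 + p) * ((1 + ev xi) ^+ (p + N) / b)).
  by rewrite /B !exprMn [in RHS]exprD exprD; ring.
have -> : 2 * K1 ^+ p * K2 ^+ (4 + p) * `|K3| = 2 * K1 ^+ p * `|K3| * K2 ^+ (4 + p) by ring.
rewrite E; apply: ler_wpM2l.
  by apply: mulr_ge0 => //; apply: mulr_ge0 => //; exact: exprn_ge0.
rewrite mulrA ler_pdivrMr// /b -addnA [_ ^+ (n * _ + _)]exprD mulrA; apply: ler_wpM2r; first exact: exprn_ge0.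
rewrite exprM -exprMn; apply: lerXn2r => //; rewrite nnegrE; apply: mulr_ge0 => //.
exact: exprn_ge0.
Qed.

Lemma spectrum_exists : exists S : nat -> seq (representation G), forall m,
  uniq (S m) /\ forall xi, xi \in S m <-> A xi /\ ev xi <= m%:R.
Proof.
have H m := finite_spectrum cG g iA (ler0n R m).
by have [S HS] := choice H; exists S.
Qed.

Section series.
Variable S : nat -> seq (representation G).
Hypothesis uS : forall m, uniq (S m).
Hypothesis memS : forall m xi, xi \in S m <-> A xi /\ ev xi <= m%:R.
Variable c : forall xi, 'M[C]_(rdim xi).

Definition fourier_sum m x : C := \sum_(xi <- S m) fourier_term c xi x.

(* Restricting the terms to A makes every summand smooth. *)
Let term xi x : C := if `[< A xi >] then fourier_term c xi x else 0.

Let smooth_term xi : smoothC (term xi).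
Proof.
rewrite /term; case: asboolP => Ax; first exact: smoothC_fourier_term.
exact: smoothC_cst.
Qed.

Let termE m : fourier_sum m = (fun x => \sum_(xi <- S m) term xi x).
Proof.
apply/funext => x; rewrite /fourier_sum big_seq [RHS]big_seq; apply: eq_bigr => xi /memS[Ax _].
by rewrite /term; case: asboolP.
Qed.

Lemma smoothC_fourier_sum m : smoothC (fourier_sum m).
Proof. by rewrite termE; exact: smoothC_sum. Qed.

Lemma coef_fourier_sum m xi : A xi ->
  coef (fourier_sum m) xi = if ev xi <= m%:R then c xi else 0.
Proof.
move=> Ax; have other eta : eta \in S m -> eta <> xi -> coef (term eta) xi = 0.
  move=> /memS[Ae _] ne; rewrite -(coef_fourier_term_neq c Ae Ax ne); congr (coef _ xi).
  by apply/funext => x; rewrite /term; case: asboolP.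
have E j k : coef (fourier_sum m) xi j k = \sum_(eta <- S m) coef (term eta) xi j k.
  rewrite mxE termE (ip_suml cG); last 2 first.
  - by move=> eta; exact: smoothC_cts.
  - exact: ctsC_rentry.
  by apply: eq_bigr => eta _; rewrite mxE.
apply/matrixP => j k; rewrite E; case: ifPn => em; last first.
  rewrite big1_seq ?mxE// => eta /andP[_ eS]; rewrite other ?mxE// => X.
  by move: eS; rewrite X => /memS[_ em']; rewrite em' in em.
have xS : xi \in S m by exact/memS.
rewrite (bigD1_seq xi)//= big1_seq ?addr0 => [|eta /andP[/eqP ne eS]].
  rewrite -(coef_fourier_term c Ax); congr (coef _ xi j k).
  by apply/funext => x; rewrite /term; case: asboolP.
by rewrite other// mxE.
Qed.

Hypothesis rc : rapid c.

(** Passing from m to [m.+1] adds terms with eigenvalue between these values, at most O(m^n) in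
    number and each O(m^-(n+2)); the increments, of order m^-2, are compared with a telescoping
    series. *)
Lemma fourier_sum_cauchy s : exists2 K : R, 0 <= K & forall k l x, (k <= l)%N ->
  taxi (cfields s (fourier_sum l) x - cfields s (fourier_sum k) x) <= K / k.+1%:R.
Proof.
have [K K0 HK] := fourier_term_bound s (n + 2) rc; have [K2 K20 HK2] := dim_bound cG g.
pose T x xi := cfields s (term xi) x.
have Fs m x : cfields s (fourier_sum m) x = \sum_(xi <- S m) T x xi by rewrite termE cfields_sum.
have size_S m : (size (S m))%:R <= K2 * (1 + m%:R) ^+ n.
  have I1 : independent [set` S m].
    split=> [xi /memS[Ax _]|xi eta /memS[Ax _] /memS[Ae _]]; [exact: sA|exact: iA.2].
  have m0 : (0 : R) <= m%:R by exact: ler0n.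
  apply: (le_trans _ (HK2 (S m) m%:R m0 (uS m) I1 (fun xi a => ((memS m xi).1 a).2))).
  rewrite -sum1_size natr_sum; apply: ler_sum => xi _.
  by rewrite -natrX ler_nat expn_gt0 rdim_gt0.
(* With [q = m.+1], the power of 2 comes from [1 + q <= 2 * q] and the outer 2 from
   [q ^- 2 <= 2 * (q^-1 - (q + 1)^-1)]. *)
pose B := 2 * (K * (K2 * 2 ^+ n)).
have B0 : 0 <= B by rewrite !mulr_ge0// exprn_ge0.
have step m x : taxi (cfields s (fourier_sum m.+1) x - cfields s (fourier_sum m) x) <=
    B * (m.+1%:R^-1 - m.+2%:R^-1).
  have -> : cfields s (fourier_sum m.+1) x - cfields s (fourier_sum m) x =
      \sum_(xi <- S m.+1 | ~~ (ev xi <= m%:R)) T x xi.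
    rewrite !Fs (bigID (fun xi => ev xi <= m%:R)) /= addrC; apply/eqP; rewrite subr_eq; apply/eqP.
    congr (_ + _); rewrite -big_filter; apply: perm_big; apply: uniq_perm => //.
      exact: filter_uniq.
    move=> xi; rewrite mem_filter; apply/andP/idP => [[em /memS[Ax _]]|/memS[Ax em]].
      exact/memS.
    split=> //; apply/memS; split=> //; apply: le_trans em _; by rewrite ler_nat.
  apply: le_trans (taxi_sum _ _ _) _; rewrite big_seq_cond.
  set q := (m.+1%:R : R); have q0 : 0 < q by rewrite ltr0n.
  apply: (@le_trans _ _ (\sum_(xi <- S m.+1 | (xi \in S m.+1) && ~~ (ev xi <= m%:R)) K / q ^+ (n + 2))).
    apply: ler_sum => xi /andP[/memS[Ax _]]; rewrite -ltNge => em.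
    have q1 : q <= 1 + ev xi by rewrite /q -natr1 addrC lerD2l ltW.
    rewrite ler_pdivlMr ?exprn_gt0//; apply: le_trans (HK _ Ax x).
    have -> : T x xi = cfields s (fourier_term c xi) x.
      by rewrite /T; congr (cfields s _ x); apply/funext => y; rewrite /term; case: asboolP.
    apply: ler_wpM2l; first exact: taxi_ge0.
    apply: lerXn2r => //; rewrite nnegrE; first exact: ltW.
    exact: le_trans (ltW q0) q1.
  have Kq : 0 <= K / q ^+ (n + 2) by rewrite divr_ge0// exprn_ge0// ltW.
  apply: (@le_trans _ _ (\sum_(xi <- S m.+1) K / q ^+ (n + 2))).
    by rewrite [leRHS](bigID (fun xi => (xi \in S m.+1) && ~~ (ev xi <= m%:R))) /= lerDl sumr_ge0.
  rewrite big_const_seq count_predT iter_addr_0 -[leLHS]mulr_natl.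
  apply: le_trans (ler_wpM2r Kq (size_S m.+1)) _.
  have q2 : 1 + m.+1%:R <= 2 * q by rewrite -/q mulr_natl mulr2n lerD2r /q ler1n.
  apply: (@le_trans _ _ (K2 * (2 * q) ^+ n * (K / q ^+ (n + 2)))).
    apply: ler_wpM2r => //; apply: ler_wpM2l => //; apply: lerXn2r => //; rewrite nnegrE.
      exact: addr_ge0.
    by apply: mulr_ge0 => //; exact: ltW.
  have -> : K2 * (2 * q) ^+ n * (K / q ^+ (n + 2)) = K * (K2 * 2 ^+ n) * q ^- 2.
    rewrite exprMn exprD; field; rewrite !expf_neq0 ?gt_eqF//.
  have -> : m.+2%:R = q + 1 :> R by rewrite /q natr1.
  rewrite /B; have E0 : 0 <= K * (K2 * 2 ^+ n) by rewrite !mulr_ge0// exprn_ge0.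
  rewrite [2 * (K * _)]mulrC -[leRHS]mulrA; apply: ler_wpM2l => //.
  have ar (a : R) : 1 <= a -> a ^- 2 <= 2 * (a^-1 - (a + 1)^-1).
    move=> a1; have a0 : 0 < a by lra.
    have a2 : 0 < a * (a + 1) by rewrite mulr_gt0// addr_gt0.
    have -> : a^-1 - (a + 1)^-1 = (a * (a + 1))^-1 by field; apply/andP; split; apply: lt0r_neq0; lra.
    rewrite -[leLHS]div1r ler_pdivrMr ?exprn_gt0// mulrAC ler_pdivlMr//; nra.
  by apply: ar; rewrite ler1n.
have tele k l x : (k <= l)%N ->
    taxi (cfields s (fourier_sum l) x - cfields s (fourier_sum k) x) <= B * (k.+1%:R^-1 - l.+1%:R^-1).
  elim: l => [|l IH]; first by rewrite leqn0 => /eqP ->; rewrite !subrr mulr0 taxi0.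
  rewrite leq_eqVlt => /orP[/eqP ->|]; first by rewrite !subrr mulr0 taxi0.
  rewrite ltnS => kl.
  have -> : cfields s (fourier_sum l.+1) x - cfields s (fourier_sum k) x =
     (cfields s (fourier_sum l.+1) x - cfields s (fourier_sum l) x) +
     (cfields s (fourier_sum l) x - cfields s (fourier_sum k) x) by ring.
  apply: le_trans (taxiD _ _) _; apply: le_trans (lerD (step l x) (IH kl)) _.
  by rewrite -mulrDr; apply: ler_wpM2l => //; rewrite [leLHS]addrC addrA subrK.
exists B => // k l x kl; apply: le_trans (tele k l x kl) _.
by rewrite ler_wpM2l// gerBl invr_ge0.
Qed.

End series.

End fourier.

(** * Fourier inversion and the action of the operator *)

Section series.
Context {R : realType} {n : nat} {G : lieGroupType R n}.
Hypothesis cG : compact [set: G].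
Variable g : biinvariant_metric G.
Local Notation C := R[i].
Implicit Types (xi eta : representation G) (x y : G) (u v f h : smooth_function G) (s : seq 'I_n).
Local Notation ev := (ev g).

Lemma smooth_functionC u : smoothC (u : G -> C).
Proof. by apply/smoothCP; apply/asboolP; exact: smooth_funP. Qed.

Lemma to_smoothE (w : G -> C) : smoothC w -> to_smooth w = w :> (G -> C).
Proof. by move=> sw; apply: insubdK; apply/asboolP; apply/smoothCP. Qed.

Lemma smooth_function_eq u v : (forall x, u x = v x) -> u = v.
Proof. by move=> uv; apply: val_inj; apply/funext. Qed.

Lemma coef_linear (a : C) u v xi : coef (a *: u + v) xi = a *: coef u xi + coef v xi.
Proof.
have [cu cv] : ctsC u /\ ctsC v by split; apply: smoothC_cts; exact: smooth_functionC.
apply/matrixP => j k; rewrite !mxE.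
transitivity (ip (fun x => a * u x + v x) (rentry xi j k)); first by [].
rewrite (ip_addl cG); [|exact: ctsC_scale|done|exact: ctsC_rentry].
by rewrite (ip_scalel cG)//; exact: ctsC_rentry.
Qed.

Lemma coef0 xi : coef (0 : smooth_function G) xi = 0.
Proof. by have := coef_linear (-1) 0 0 xi; rewrite scaler0 addr0 scaleN1r addNr. Qed.

Lemma coef_sub u v xi : coef (u - v) xi = coef u xi - coef v xi.
Proof. by rewrite addrC -scaleN1r coef_linear scaleN1r addrC. Qed.

(** Convergence of smooth functions is uniform by [smooth_sup_near], so coefficients pass to the
    limit; here they are eventually constant. *)
Lemma coef_limit (F : nat -> smooth_function G) u xi (M : 'M[C]_(rdim xi)) :
  F @ \oo --> u -> (\forall m \near \oo, coef (F m) xi = M) -> coef u xi = M.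
Proof.
move=> Fu FM; apply/matrixP => j k; apply/eqP; rewrite -subr_eq0 -sqn_eq0.
apply/eqP; apply: le_anti; rewrite sqn_ge0 andbT; apply/ler_addgt0Pl => e e0.
rewrite addr0.
have [d d0 de] : exists2 d : R, 0 < d & (4 * d) ^+ 2 <= e.
  exists (Num.min 1 (e / 16)); first by rewrite lt_min ltr01 divr_gt0.
  set d := Num.min _ _.
  have d1 : d <= 1 by rewrite ge_min lexx.
  have d2 : d <= e / 16 by rewrite ge_min lexx orbT.
  have d3 : 0 <= d by rewrite le_min ler01 ltW// divr_gt0.
  by move: d d1 d2 d3 => d d1 d2 d3; nra.
have [m [H1 H2]] : exists m, (forall x, taxi (u x - F m x) <= d) /\ coef (F m) xi = M.
  have N := Fu _ (smooth_sup_near cG u d0).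
  have N' : \forall m \near \oo, forall x, taxi (u x - F m x) <= d by exact: N.
  by have [m [H1 H2]] := @filter_ex _ _ _ _ (filterI N' FM); exists m.
have <- : (u - F m) =1 (fun x => u x - F m x) -> coef (u - F m) xi j k = coef u xi j k - M j k.
  by rewrite coef_sub H2 !mxE.
apply: le_trans (sqn_taxi _) _; apply: le_trans de.
rewrite lerXn2r ?nnegrE ?taxi_ge0//; first by rewrite mulr_ge0// ltW.
by apply: coef_bound => //; apply: smoothC_cts; exact: smooth_functionC.
by [].
Qed.

Lemma ip_entry_equivalent d (xi eta : irrep G d) (T : 'M[C]_d) (h : G -> C) : ctsC h ->
  (forall x, xi x *m T = T *m eta x) -> T != 0 -> (forall j k, ip h (entry xi j k) = 0) ->
  forall j k, ip h (entry eta j k) = 0.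
Proof.
move=> ch intT T0 H j k.
have -> : entry eta j k = (fun x => \sum_q \sum_p (invmx T j p * T q k) * entry xi p q x).
  apply/funext => x; rewrite /entry (intertwiner_conj intT T0) !mxE; apply: eq_bigr => q _.
  by rewrite mxE mulr_suml; apply: eq_bigr => p _; rewrite mulrAC.
have c1 q p : ctsC (fun x => (invmx T j p * T q k) * entry xi p q x).
  by apply: ctsC_scale; exact: ctsC_entry.
rewrite (ip_sumr cG)//; last by move=> q; exact: ctsC_sum.
apply: big1 => q _; rewrite (ip_sumr cG)//; apply: big1 => p _.
by rewrite (ip_scaler cG)// ?H ?mulr0//; exact: ctsC_entry.
Qed.

Variable A : set (representation G).
Hypothesis iA : independent A.
Hypothesis mA : forall eta, smooth_rep (rep eta) -> exists2 xi, A xi & ~ orthogonal_reps xi eta.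
Let sA xi : A xi -> smooth_rep (rep xi) := iA.1 xi.

(** By maximality some member of A is not orthogonal to eta, which gives an intertwiner and equal
    dimensions; the equality is eliminated so that both live in dimension d. *)
Lemma equivalent_member d (eta : irrep G d) : smooth_rep eta ->
  exists (xi : irrep G d) T, [/\ A (existT _ d xi), T != 0 & forall x, xi x *m T = T *m eta x].
Proof.
move=> se; have [[d' xi] Ax nO] := mA (se : smooth_rep (rep (existT _ d eta))).
have [j [k [l [m ne]]]] : exists j k l m, ip (entry xi j k) (entry eta l m) != 0.
  apply: contrapT => H; apply: nO => j k l m; apply/eqP; apply: contrapT => ne.
  by apply: H; exists j, k, l, m; apply/negP.
have [T [dd T0 intT]] := equivalent_irreps cG ne; case: d / dd eta se T T0 intT l m nO ne.
by move=> eta _ T T0 intT _ _ _ _; exists xi, T.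
Qed.

Lemma coef_inj u v : (forall xi, A xi -> coef u xi = coef v xi) -> u = v.
Proof.
move=> uv; apply/eqP; rewrite -subr_eq0; apply/eqP; apply: smooth_function_eq => x.
have sh := smooth_functionC (u - v).
apply: (smooth_peter_weyl cG g sh) => d eta se j k.
have [xi [T [Ax T0 intT]]] := equivalent_member se.
apply: (ip_entry_equivalent (smoothC_cts sh) intT T0) => l m.
have /matrixP/(_ l m) := coef_sub u v (existT _ d xi).
by rewrite uv// subrr !mxE.
Qed.

Lemma coef_rapid u : rapid g A (coef u).
Proof.
move=> N; have [K K0 HK] := coef_decay cG g N (smooth_functionC u).
by exists K => xi Ax; apply: HK; exact: sA.
Qed.

Variable S : nat -> seq (representation G).
Hypothesis uS : forall m, uniq (S m).
Hypothesis memS : forall m xi, xi \in S m <-> A xi /\ ev xi <= m%:R.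

Definition fourier_partial_sum (c : forall xi, 'M[C]_(rdim xi)) m : smooth_function G :=
  \sum_(xi <- S m) \sum_j \sum_k ((rdim xi)%:R * c xi j k) *: to_smooth (rentry xi j k).

Lemma fourier_partial_sumE c m : fourier_partial_sum c m = fourier_sum S c m :> (G -> C).
Proof.
have sumE I (r : seq I) (P : pred I) (F : I -> smooth_function G) y :
    (\sum_(i <- r | P i) F i) y = \sum_(i <- r | P i) F i y.
  exact: (big_morph (fun f : smooth_function G => f y : C)).
apply/funext => x; rewrite /fourier_partial_sum /fourier_sum sumE big_seq [RHS]big_seq.
apply: eq_bigr => xi /memS[Ax _]; rewrite sumE; apply: eq_bigr => j _; rewrite sumE.
apply: eq_bigr => k _; transitivity ((rdim xi)%:R * c xi j k * to_smooth (rentry xi j k) x) => //.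
by rewrite (to_smoothE (sA Ax j k)).
Qed.

Lemma coef_fourier_partial_sum c m xi : A xi ->
  coef (fourier_partial_sum c m) xi = if ev xi <= m%:R then c xi else 0.
Proof. by move=> Ax; rewrite fourier_partial_sumE; exact: (coef_fourier_sum cG iA uS memS). Qed.

Lemma coef_fourier_partial_sum_near c xi : A xi -> \forall m \near \oo, coef (fourier_partial_sum c m) xi = c xi.
Proof.
move=> Ax; exists (Num.truncn (ev xi)).+1 => //= m Nm; rewrite coef_fourier_partial_sum//.
by rewrite (le_trans (ltW (truncnS_gt _)))// ler_nat.
Qed.

Lemma fourier_series c : rapid g A c ->
  exists u, fourier_partial_sum c @ \oo --> u /\ forall xi, A xi -> coef u xi = c xi.
Proof.
move=> rc; pose F m := fourier_sum S c m.
have sF m : smoothC (F m) by exact: (smoothC_fourier_sum iA memS).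
have cF s (e : R) : 0 < e -> exists N, forall k l x, (N <= k)%N -> (N <= l)%N ->
    taxi (cfields s (F k) x - cfields s (F l) x) <= e.
  move=> e0; have [K K0 HK] := fourier_sum_cauchy cG iA uS memS rc s.
  pose N := Num.truncn (2 * K / e).
  have KN : K / N.+1%:R <= e / 2.
    rewrite ler_pdivrMr ?ltr0n//.
    have : 2 * K / e <= N.+1%:R by apply: ltW; exact: truncnS_gt.
    rewrite ler_pdivrMr//; move: (N.+1%:R : R) => q; lra.
  exists N => k l x Nk Nl.
  have -> : cfields s (F k) x - cfields s (F l) x = (cfields s (F k) x - cfields s (F N) x) +
     - (cfields s (F l) x - cfields s (F N) x) by ring.
  apply: le_trans (taxiD _ _) _; rewrite taxiN.
  by rewrite [leRHS]splitr; apply: lerD; apply: le_trans (HK N _ x _) KN.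
have sR m : smoothR (fun x => complex.Re (F m x)) by case: (sF m).
have sI m : smoothR (fun x => complex.Im (F m x)) by case: (sF m).
have cR s (e : R) : 0 < e -> exists N, forall (k l : nat) x, (N <= k)%N -> (N <= l)%N ->
   `|fields s (fun x => complex.Re (F k x)) x - fields s (fun x => complex.Re (F l x)) x| <= e.
  move=> e0; have [N HN] := cF s e e0; exists N => k l x Nk Nl; apply: le_trans (HN k l x Nk Nl).
  by rewrite -!Re_cfields /taxi cRe_add cRe_opp lerDl.
have cI s (e : R) : 0 < e -> exists N, forall (k l : nat) x, (N <= k)%N -> (N <= l)%N ->
   `|fields s (fun x => complex.Im (F k x)) x - fields s (fun x => complex.Im (F l x)) x| <= e.
  move=> e0; have [N HN] := cF s e e0; exists N => k l x Nk Nl; apply: le_trans (HN k l x Nk Nl).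
  by rewrite -!Im_cfields /taxi cIm_add cIm_opp lerDr.
pose w x : C := (lim (complex.Re (F m x) @[m --> \oo]) +i* lim (complex.Im (F m x) @[m --> \oo]))%C.
have sw : smoothC w.
  have H1 := smoothR_limit g sR cR; have H2 := smoothR_limit g sI cI.
  by apply: SmoothC; rewrite /w /=; [exact: H1|exact: H2].
pose u := to_smooth w; have uE : u = w :> (G -> C) := to_smoothE sw.
have Fu : fourier_partial_sum c @ \oo --> u.
  apply: smooth_cvg => i s K e cK KC e0.
  have [N1 H1] := smoothR_limit_cvg g sR cR s cK KC e0.
  have [N2 H2] := smoothR_limit_cvg g sI cI s cK KC e0.
  exists (maxn N1 N2) => m z; rewrite geq_max => /andP[m1 m2] Kz.
  rewrite /local_Re /local_Im fourier_partial_sumE uE.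
  by split; [exact: H1|exact: H2].
exists u; split=> // xi Ax; apply: (coef_limit Fu); exact: coef_fourier_partial_sum_near.
Qed.

(** The limit of the series has the coefficients of u, and [coef_inj] identifies it with u. *)
Lemma fourier_inversion u : fourier_partial_sum (coef u) @ \oo --> u.
Proof.
have [v [Hv Ev]] := fourier_series (coef_rapid u).
by rewrite -[X in _ --> X](@coef_inj v u).
Qed.

Section operator.
Variable P : {linear smooth_function G -> smooth_function G}.
Hypothesis cP : continuous P.
Hypothesis iP : left_invariant P.

Lemma symbolE d (xi : irrep G d) j k x : smooth_rep xi ->
  P (to_smooth (entry xi j k)) x = \sum_l entry xi j l x * symbol P xi l k.
Proof.
move=> sxi; have s' j' k' : smooth (entry xi j' k') by apply/smoothCP; exact: sxi.
have := symbol_at_const iP s' x; rewrite /symbol_at => E.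
have : xi x *m symbol P xi = \matrix_(j, k) P (to_smooth (entry xi j k)) x.
  by have /unitarymxP U := rep_unitary xi x; rewrite -E mulmxA U mul1mx.
by move=> /matrixP/(_ j k); rewrite !mxE.
Qed.

Let acts u := forall eta, A eta -> coef (P u) eta = coef u eta *m (symbol P (rep eta))^T.

Let acts_linear (a : C) u v : acts u -> acts v -> acts (a *: u + v).
Proof.
move=> au av eta Ae.
by rewrite linearP !coef_linear au// av// mulmxDl scalemxAl.
Qed.

Let acts_sum I (r : seq I) (p : pred I) (F : I -> smooth_function G) :
  (forall i, p i -> acts (F i)) -> acts (\sum_(i <- r | p i) F i).
Proof.
move=> aF; elim/big_ind : _ => // [eta Ae|u v au av].
  by rewrite linear0 coef0 mul0mx.
by rewrite -[u]scale1r; exact: acts_linear.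
Qed.

Let acts_entry xi j k : A xi -> acts (to_smooth (rentry xi j k)).
Proof.
move=> Ax eta Ae; have sx := sA Ax.
have PE : (P (to_smooth (rentry xi j k)) : G -> C) =
    (fun x => \sum_l symbol P (rep xi) l k * rentry xi j l x).
  by apply/funext => x; rewrite (symbolE _ _ _ sx); apply: eq_bigr => l _; rewrite mulrC.
rewrite PE (to_smoothE (sx j k)); apply/matrixP => a b; rewrite !mxE.
rewrite (ip_suml cG); [|by move=> l; apply: ctsC_scale; exact: ctsC_rentry|exact: ctsC_rentry].
transitivity (\sum_l symbol P (rep xi) l k * ip (rentry xi j l) (rentry eta a b)).
  by apply: eq_bigr => l _; rewrite (ip_scalel cG)//; exact: ctsC_rentry.
have [E|ne] := pselect (xi = eta).
  rewrite -{}E in a b *.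
  rewrite (bigD1 b)//= big1 ?addr0 => [|l lb].
    rewrite [RHS](bigD1 k)//= big1 ?addr0 => [|l lk].
      by rewrite !mxE /rentry !(ip_entry_self cG) !eqxx; ring.
    by rewrite !mxE /rentry !(ip_entry_self cG) [k == l]eq_sym (negPf lk) mulr0 !mul0r.
  by rewrite /rentry !(ip_entry_self cG) (negPf lb) mulr0 mul0r mulr0.
rewrite big1 ?big1// => l _; first by rewrite !mxE (iA.2 _ _ Ax Ae ne) mul0r.
by rewrite (iA.2 _ _ Ax Ae ne) mulr0.
Qed.

(** Both sides are linear in u and agree on the entries of members of A, hence on partial sums;
    continuity of P and Fourier inversion extend the identity to u. *)
Lemma coef_operator u xi : A xi -> coef (P u) xi = coef u xi *m (symbol P (rep xi))^T.
Proof.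
move=> Ax; have acts_partial c m : acts (fourier_partial_sum c m).
  rewrite /fourier_partial_sum big_seq; apply: acts_sum => eta /memS[Ae _].
  apply: acts_sum => j _; apply: acts_sum => k _.
  rewrite -[_ *: _]addr0; apply: acts_linear; first exact: acts_entry.
  by move=> zeta Az; rewrite linear0 coef0 mul0mx.
apply: (@coef_limit (fun m => P (fourier_partial_sum (coef u) m))).
  apply: continuous_cvg; first exact: cP.
  exact: fourier_inversion.
have := coef_fourier_partial_sum_near (coef u) Ax; apply: filterS => m E.
by rewrite acts_partial// E.
Qed.

End operator.

End series.

(** * Singular values *)

Section singular_values.
Context {R : realType}.
Local Notation C := R[i].
Local Open Scope sesquilinear_scope.

Definition row_sqn d (v : 'rV[C]_d) : R := \sum_j sqn (v 0 j).

Lemma row_sqnE d (v : 'rV[C]_d) : (v *m v^t*) 0 0 = (row_sqn v)%:C%C.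
Proof.
rewrite mxE /row_sqn rmorph_sum; apply: eq_bigr => j _.
by rewrite !mxE mulcJ.
Qed.

Lemma row_sqn_ge0 d (v : 'rV[C]_d) : 0 <= row_sqn v.
Proof. by apply: sumr_ge0 => j _; exact: sqn_ge0. Qed.

Lemma row_sqn_unitary d (U : 'M[C]_d) (v : 'rV[C]_d) : U *m U^t* = 1%:M ->
  row_sqn (v *m U) = row_sqn v.
Proof.
move=> UU; apply: (@complexI R); rewrite -!row_sqnE adjM mulmxA -[v *m U *m _]mulmxA UU.
by rewrite mulmx1.
Qed.

Lemma row_sqn0 d : row_sqn (0 : 'rV[C]_d) = 0.
Proof. by rewrite /row_sqn big1// => j _; rewrite mxE sqn0. Qed.

Lemma row_sqn_delta d (j : 'I_d) : row_sqn (delta_mx 0 j) = 1.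
Proof.
rewrite /row_sqn (bigD1 j)//= big1 ?addr0 => [|k kj].
  by rewrite mxE !eqxx sqn_real expr1n.
by rewrite mxE (negPf kj) andbF sqn0.
Qed.

Lemma gram_spectral d (B : 'M[C]_d) : exists (U : 'M[C]_d) (D : 'rV[C]_d),
  U *m U^t* = 1%:M /\ B *m B^t* = U^t* *m diag_mx D *m U.
Proof.
set K := B *m B^t*.
have nK : K \is normalmx by apply/normalmxP; rewrite /K adjM adjK.
exists (spectralmx K), (spectral_diag K); split.
  by apply/unitarymxP; exact: spectral_unitarymx.
have sU := spectral_unitarymx K; have := orthomx_spectralP nK.
by rewrite /= invmx_unitary.
Qed.

Section spectral_decomposition.
Context {d : nat} (B U : 'M[C]_d) (D : 'rV[C]_d).
Local Notation K := (B *m B^t*).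
Hypothesis UU : U *m U^t* = 1%:M.
Hypothesis KE : K = U^t* *m diag_mx D *m U.

Let UU' : U^t* *m U = 1%:M.
Proof. exact: mulmx1C UU. Qed.

Let m i := row_sqn (row i U *m B).

Let DE i : D 0 i = (m i)%:C%C.
Proof.
rewrite /m -row_sqnE adjM mulmxA -[row i U *m B *m _]mulmxA KE.
have -> : row i U = delta_mx 0 i *m U by rewrite rowE.
rewrite adjM !mulmxA -[_ *m U *m U^t*]mulmxA UU mulmx1 -[_ *m U *m U^t*]mulmxA UU mulmx1.
rewrite -rowE row_diag_mx -scalemxAl mxE mxE (bigD1 i)//= big1 ?addr0 => [|j ji].
  by rewrite !mxE !eqxx conj1 !mulr1.
by rewrite !mxE (negPf ji) andbF mul0r.
Qed.

Let row_sqn_mul (z : 'rV[C]_d) : row_sqn (z *m U *m B) = \sum_i m i * sqn (z 0 i).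
Proof.
apply: (@complexI R); rewrite -row_sqnE !adjM !mulmxA -[_ *m B *m _]mulmxA KE.
rewrite !mulmxA -[z *m U *m _]mulmxA UU mulmx1 -[_ *m U *m U^t*]mulmxA UU mulmx1.
rewrite mxE rmorph_sum; apply: eq_bigr => i _.
by rewrite mul_mx_diag !mxE DE mulrAC mulcJ mulrC -rmorphM.
Qed.

Let rowU (y : 'rV[C]_d) : y *m U^t* *m U = y.
Proof. by rewrite -mulmxA UU' mulmx1. Qed.

Let row_sqnU (z : 'rV[C]_d) : row_sqn (z *m U) = row_sqn z.
Proof. exact: row_sqn_unitary. Qed.

Let eigenvalueK (a : R) : eigenvalue K a%:C%C <-> exists i, a = m i.
Proof.
split=> [/eigenvalueP[v vK v0]|[i ->]].
  pose z := v *m U^t*.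
  have z0 : z != 0 by apply: contra_neq v0 => z0; rewrite -(rowU v) -/z z0 mul0mx.
  have [j zj] : exists j, z 0 j != 0.
    apply: contrapT => H; move/eqP: z0; apply; apply/rowP => j; rewrite [RHS]mxE.
    by apply/eqP; apply: contrapT => zj; apply: H; exists j; apply/negP.
  have zD : z *m diag_mx D = a%:C%C *: z.
    by rewrite /z scalemxAl -vK KE !mulmxA -[_ *m U *m U^t*]mulmxA UU mulmx1.
  clearbody z; exists j; have /rowP/(_ j) := zD; rewrite mul_mx_diag !mxE DE mulrC => E.
  by have /(@complexI R) -> := mulIf zj E.
apply/eigenvalueP; exists (row i U).
  rewrite rowE KE !mulmxA -[_ *m U *m U^t*]mulmxA UU mulmx1 -[_ *m diag_mx _]rowE row_diag_mx DE.
  by rewrite -scalemxAl.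
apply: contra_eq_neq (row_sqn_delta i) => r0; rewrite -row_sqnU -rowE r0.
by rewrite row_sqn0 eq_sym oner_eq0.
Qed.

(** In the eigenbasis the squared length of an image is the sum of squared components weighted by
    the eigenvalues [m i]. The last two clauses serve the two directions of the theorem: a unit
    vector that is shortest among those with its image, and preimages of controlled length. *)
Lemma smallest_eigenvalue : B != 0 -> exists l : R, [/\ 0 < l,
  eigenvalue K l%:C%C /\ forall a : R, a != 0 -> eigenvalue K a%:C%C -> l <= a,
  exists y : 'rV[C]_d, [/\ row_sqn y = 1, row_sqn (y *m B) = l &
    forall y', y' *m B = y *m B -> 1 <= row_sqn y'] &
  forall y0, exists y, y *m B = y0 *m B /\ l * row_sqn y <= row_sqn (y *m B)].
Proof.
move=> B0; have m0 i : 0 <= m i by exact: row_sqn_ge0.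
have [i1 i10] : exists i, m i != 0.
  apply: contrapT => H; move/eqP: B0; apply.
  have mz i : m i = 0 by apply/eqP; apply: contrapT => mi; apply: H; exists i; apply/negP.
  apply/row_matrixP => i; rewrite row0 rowE -(rowU (delta_mx 0 i)).
  set v := _ *m U *m B.
  have : row_sqn v = 0 by rewrite /v row_sqn_mul big1// => j _; rewrite mz mul0r.
  move=> /eqP; rewrite /row_sqn psumr_eq0 => [/allP v0|j _]; last exact: sqn_ge0.
  apply/rowP => j; rewrite [RHS]mxE; apply/eqP; rewrite -sqn_eq0.
  exact: (implyP (v0 j (mem_index_enum j))).
case: (@arg_minP _ _ _ i1 (fun i => m i != 0) m i10) => i mi imin.
have l0 : 0 < m i by rewrite lt_neqAle eq_sym mi m0.
exists (m i); split=> //.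
- split=> [|a a0]; first by apply/eigenvalueK; exists i.
  by move=> /eigenvalueK[j E]; rewrite E in a0 *; exact: imin.
- exists (row i U); split=> //; first by rewrite rowE row_sqnU row_sqn_delta.
  (* [z *m U] is in the kernel of B, so the i-th component of z, which has nonzero weight, is 0: the
     i-th component of y' is 1. *)
  move=> y' E; pose z := y' *m U^t* - delta_mx 0 i.
  have zB : z *m U *m B = 0 by rewrite /z mulmxBl rowU -rowE mulmxBl E subrr.
  have : row_sqn (z *m U *m B) = 0 by rewrite zB row_sqn0.
  rewrite row_sqn_mul => /eqP; rewrite psumr_eq0 => [/allP H|j _]; last first.
    by rewrite mulr_ge0// sqn_ge0.
  have := implyP (H i (mem_index_enum i)) isT; rewrite mulf_eq0 (negPf mi) /= sqn_eq0.
  rewrite /z !mxE !eqxx subr_eq0 => /eqP zi.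
  rewrite -(rowU y') row_sqnU /row_sqn (bigD1 i)//= mxE zi sqn_real expr1n lerDl.
  by apply: sumr_ge0 => j _; exact: sqn_ge0.
(* Dropping the components of eigenvalue 0 keeps the image and leaves the shortest preimage. *)
- move=> y0; pose z0 := y0 *m U^t*; pose z := \row_j (if m j == 0 then 0 else z0 0 j).
  have zB : z *m U *m B = y0 *m B.
    rewrite -[in RHS](rowU y0) -/z0; apply/eqP; rewrite -subr_eq0 -!mulmxBl; apply/eqP.
    have : row_sqn ((z - z0) *m U *m B) = 0.
      rewrite row_sqn_mul big1// => j _; rewrite !mxE.
      by case: eqP => [->|_]; rewrite ?mul0r// subrr sqn0 mulr0.
    move=> /eqP; rewrite /row_sqn psumr_eq0 => [/allP v0|j _]; last exact: sqn_ge0.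
    apply/rowP => j; rewrite [RHS]mxE; apply/eqP; rewrite -sqn_eq0.
    exact: (implyP (v0 j (mem_index_enum j))).
  exists (z *m U); split; first exact: zB.
  rewrite row_sqnU row_sqn_mul /row_sqn mulr_sumr.
  apply: ler_sum => j _; rewrite mxE; case: (eqVneq (m j) 0) => [->|mj].
    by rewrite sqn0 !mulr0.
  by apply: ler_wpM2r; [exact: sqn_ge0|exact: imin].
Qed.

End spectral_decomposition.

Lemma eigenvalue_conj d (M : 'M[C]_d) (a : R) : eigenvalue M a%:C%C ->
  eigenvalue (map_mx Num.conj M) a%:C%C.
Proof.
move=> /eigenvalueP[v vM v0]; apply/eigenvalueP; exists (map_mx Num.conj v).
  by rewrite -map_mxM vM map_mxZ /= conj_real.
by rewrite map_mx_eq0.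
Qed.

(** The two Gram matrices are complex conjugates of each other, so they share their real
    eigenvalues. The left one defines singular values, the right one belongs to the action of the
    transpose on rows. *)
Lemma eigenvalue_gram d (M : 'M[C]_d) (a : R) :
  eigenvalue (M^t* *m M) a%:C%C <-> eigenvalue (M^T *m (M^T)^t*) a%:C%C.
Proof.
have E : map_mx Num.conj (M^t* *m M) = M^T *m (M^T)^t*.
  rewrite map_mxM; congr (_ *m _); apply/matrixP => i j; rewrite !mxE//.
  exact: conjCK.
split=> /eigenvalue_conj; first by rewrite E.
rewrite -E; set N := _ *m M.
have -> : map_mx Num.conj (map_mx Num.conj N) = N.
  by clearbody N; apply/matrixP => i j; rewrite !mxE; exact: conjCK.
by [].
Qed.

(* Stated for the action y |-> y *m M^T on row vectors, which is the action of M
   on column vectors. *)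
Lemma min_nonzero_singular_valueP d (M : 'M[C]_d) : M != 0 ->
  let l := min_nonzero_singular_value M in [/\ 0 < l,
  exists y : 'rV[C]_d, [/\ row_sqn y = 1, row_sqn (y *m M^T) = l ^+ 2 &
    forall y', y' *m M^T = y *m M^T -> 1 <= row_sqn y'] &
  forall y0, exists y, y *m M^T = y0 *m M^T /\ l ^+ 2 * row_sqn y <= row_sqn (y *m M^T)].
Proof.
move=> M0 l; have B0 : M^T != 0 by rewrite trmx_eq0.
have [U [D [UU KE]]] := gram_spectral M^T.
have [a [a0 [ea amin] Ey Ay]] := smallest_eigenvalue UU KE B0.
suff -> : l = Num.sqrt a by rewrite sqr_sqrtr ?ltW// sqrtr_gt0.
have s0 : 0 < Num.sqrt a by rewrite sqrtr_gt0.
have sa : singular_value M (Num.sqrt a) /\ Num.sqrt a != 0.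
  split; last by rewrite gt_eqF.
  split; first exact: ltW.
  rewrite sqr_sqrtr; last exact: ltW.
  exact: (eigenvalue_gram M a).2 ea.
have lb : lbound [set s | singular_value M s /\ s != 0] (Num.sqrt a).
  move=> s [[s1 es] sn]; rewrite -(ler_pXn2r (ltn0Sn 1)) ?nnegrE ?sqrtr_ge0// sqr_sqrtr; last exact: ltW.
  apply: amin; first by rewrite expf_neq0.
  exact: (eigenvalue_gram M (s ^+ 2)).1 es.
apply: le_anti; apply/andP; split; first by apply: ge_inf sa; exists (Num.sqrt a).
by apply: (lb_le_inf _ lb); exists (Num.sqrt a).
Qed.

Lemma eq_min_nonzero_singular_value d (M N : 'M[C]_d) :
  (forall a : R, eigenvalue (M^t* *m M) a%:C%C <-> eigenvalue (N^t* *m N) a%:C%C) ->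
  min_nonzero_singular_value M = min_nonzero_singular_value N.
Proof.
move=> H; apply: (congr1 (@inf R)); apply: eq_set => s; apply/propext.
split=> -[[s0 es] sn]; (split; last exact: sn); (split; first exact: s0).
  exact: (H _).1 es.
exact: (H _).2 es.
Qed.

(** T being unitary up to a scalar, the Gram matrix of the conjugate is the conjugate of the Gram
    matrix and has the same eigenvalues. *)
Lemma min_nonzero_singular_value_conj d (M T : 'M[C]_d) (c : C) : T \in unitmx -> c != 0 ->
  T *m T^t* = c%:M ->
  min_nonzero_singular_value (invmx T *m M *m T) = min_nonzero_singular_value M.
Proof.
move=> Tu c0 TT; have T1 : T^t* = c *: invmx T.
  by rewrite -[LHS](mulKmx Tu) TT mul_mx_scalar.
have T2 : (invmx T)^t* = c^-1 *: T.
  have H : (invmx T)^t* *m T^t* = 1%:M.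
    by rewrite -adjM mulmxV// trmx1 map_mx1.
  rewrite T1 -scalemxAr in H; move/(congr1 (fun A => c^-1 *: (A *m T))): H.
  by rewrite -scalemxAl scalerA mulVf// scale1r -mulmxA mulVmx// mulmx1 mul1mx.
have E : (invmx T *m M *m T)^t* *m (invmx T *m M *m T) = invmx T *m (M^t* *m M) *m T.
  rewrite !adjM T1 T2 -!(scalemxAl, scalemxAr) scalerA mulfV// scale1r.
  by rewrite !mulmxA (mulmxK Tu).
have H (a : R) : eigenvalue (invmx T *m (M^t* *m M) *m T) a%:C%C <-> eigenvalue (M^t* *m M) a%:C%C.
  move: (M^t* *m M) => N; split=> /eigenvalueP[v vM v0]; apply/eigenvalueP.
    exists (v *m invmx T); first by rewrite scalemxAl -vM !mulmxA (mulmxK Tu).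
    by apply: contra_neq v0 => vT; rewrite -[v](mulmxKV Tu) vT mul0mx.
  exists (v *m T); first by rewrite scalemxAl -vM !mulmxA (mulmxK Tu).
  by apply: contra_neq v0 => vT; rewrite -[v](mulmxK Tu) vT mul0mx.
by apply: eq_min_nonzero_singular_value => a; rewrite E; exact: H.
Qed.

End singular_values.

(** * Solvability *)

Section bracket.
Context {R : realType} {n : nat} {G : lieGroupType R n} (g : biinvariant_metric G).
Variables (d : nat) (xi : irrep G d).
Hypothesis nu0 : 0 <= laplace_eigenvalue g xi.
Let a := 1 + laplace_eigenvalue g xi.
Let a1 : 1 <= a. Proof. by rewrite lerDl. Qed.
Let a0 : 0 <= a. Proof. exact: le_trans ler01 a1. Qed.

(** The exponent is doubled because the bracket is the square root of a. *)
Lemma bracket_powR_nat N : bracket g xi `^ (- (N.*2)%:R) = a ^- N.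
Proof.
by rewrite powRN powR_mulrn ?sqrtr_ge0// /bracket -/a -mul2n exprM sqr_sqrtr.
Qed.

(** A crude comparison: the bracket lies between 1 and a. *)
Lemma bracket_powR_ge k p : k <= p%:R -> a ^- p <= bracket g xi `^ (- k).
Proof.
move=> kp; have b1 : 1 <= bracket g xi by rewrite /bracket -/a -sqrtr1 ler_wsqrtr.
have b0 : 0 < bracket g xi by exact: lt_le_trans ltr01 b1.
have ba : bracket g xi <= a.
  by rewrite -[leRHS](sqr_sqrtr a0) expr2 -[leLHS]mulr1; apply: ler_wpM2l => //; exact: ltW.
rewrite powRN lef_pV2 ?posrE ?powR_gt0 ?exprn_gt0//; last exact: lt_le_trans ltr01 a1.
apply: (@le_trans _ _ (bracket g xi `^ p%:R)); first exact: ler_powR.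
rewrite powR_mulrn; last exact: ltW.
apply: lerXn2r => //; rewrite nnegrE //; exact: ltW.
Qed.

End bracket.

Section symbols.
Context {R : realType} {n : nat} {G : lieGroupType R n}.
Local Notation C := R[i].
Variable P : {linear smooth_function G -> smooth_function G}.

Lemma symbol_entry d (xi : irrep G d) j k : symbol P xi j k = P (to_smooth (entry xi j k)) 1%g.
Proof.
rewrite /symbol /symbol_at rep1 trmx1 map_mx1.
by rewrite mul1mx mxE.
Qed.

(** [to_smooth] sends a non-smooth entry to 0, and one smooth entry makes all of them smooth; a
    representation that is not smooth therefore has symbol 0. *)
Lemma symbol_smooth_rep d (xi : irrep G d) : symbol P xi != 0 -> smooth_rep xi.
Proof.
move=> s0; apply: contrapT => nsx; move/eqP: s0; apply; apply/matrixP => j k.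
rewrite symbol_entry [RHS]mxE /to_smooth /insubd insubN /= ?linear0//.
apply/negP => /asboolP /smoothCP se; apply: nsx; exact: (smooth_rep_entry se).
Qed.

Lemma symbol_conj d (xi eta : irrep G d) (T : 'M[C]_d) : smooth_rep xi -> T != 0 ->
  (forall x, xi x *m T = T *m eta x) -> symbol P eta = invmx T *m symbol P xi *m T.
Proof.
move=> sx T0 intT; have se := smooth_rep_equivalent intT T0 sx.
apply/matrixP => j k; rewrite symbol_entry.
have -> : to_smooth (entry eta j k) =
    \sum_q \sum_p (invmx T j p * T q k) *: to_smooth (entry xi p q).
  apply: smooth_function_eq => x; rewrite (to_smoothE (se j k)).
  have sumE I (r : seq I) (F : I -> smooth_function G) :
      (\sum_(i <- r) F i) x = \sum_(i <- r) F i x.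
    exact: (big_morph (fun f : smooth_function G => f x : C)).
  rewrite sumE /entry (intertwiner_conj intT T0) !mxE; apply: eq_bigr => q _.
  rewrite sumE mxE mulr_suml; apply: eq_bigr => p _.
  transitivity (invmx T j p * T q k * to_smooth (entry xi p q) x) => //.
  by rewrite (to_smoothE (sx p q)) mulrAC.
have sumE I (r : seq I) (F : I -> smooth_function G) :
    (\sum_(i <- r) F i) 1%g = \sum_(i <- r) F i 1%g.
  exact: (big_morph (fun f : smooth_function G => f 1%g : C)).
rewrite linear_sum sumE mxE; apply: eq_bigr => q _.
rewrite linear_sum sumE mxE mulr_suml; apply: eq_bigr => p _.
by rewrite linearZ symbol_entry mulrAC.
Qed.

Lemma symbol_singular_value_conj d (xi eta : irrep G d) (T : 'M[C]_d) : smooth_rep xi -> T != 0 ->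
  (forall x, xi x *m T = T *m eta x) ->
  (symbol P eta != 0 -> symbol P xi != 0) /\
  min_nonzero_singular_value (symbol P eta) = min_nonzero_singular_value (symbol P xi).
Proof.
move=> sx T0 intT; rewrite (symbol_conj sx T0 intT); split.
  by apply: contra_neq => ->; rewrite mulmx0 mul0mx.
have [c c0 Tc] := intertwiner_adjoint intT T0.
exact: min_nonzero_singular_value_conj (intertwiner_unit intT T0) c0 Tc.
Qed.

Lemma annihilator_closed (K : set {linear smooth_function G -> C^o}) :
  (forall T, K T -> Defs.distribution T) -> closed (annihilator K).
Proof.
move=> dK; have -> : annihilator K = \bigcap_(T in K) [set f | T f = 0] by [].
apply: closed_bigI => T KT.
have c0 : closed [set (0 : C^o)].
  by apply: accessible_closed_set1; apply: hausdorff_accessible; exact: norm_hausdorff.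
apply: (closed_comp _ c0) => f _; exact: (dK T KT).
Qed.

(** Under solvability the range is the annihilator of [ker_transpose P], an intersection of kernels
    of continuous functionals. *)
Lemma solvable_closed_range : globally_solvable P -> closed_range P.
Proof.
move=> sP; have -> : closed_range P = closed (annihilator (ker_transpose P)).
  congr closed; apply/seteqP; split=> [_ [u _ <-] T [_ H]|f /sP[u <-]]; first exact: H.
  by exists u.
by apply: annihilator_closed => T [].
Qed.

End symbols.

Section solvability.
Context {R : realType} {n : nat} {G : lieGroupType R n}.
Hypothesis cG : compact [set: G].
Variable g : biinvariant_metric G.
Local Notation C := R[i].
Local Notation ev := (ev g).
Implicit Types (xi : representation G) (u h f : smooth_function G).

Variable A : set (representation G).
Hypothesis iA : independent A.
Hypothesis mA : forall eta, smooth_rep (rep eta) -> exists2 xi, A xi & ~ orthogonal_reps xi eta.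
Let sA xi : A xi -> smooth_rep (rep xi) := iA.1 xi.
Variable S : nat -> seq (representation G).
Hypothesis uS : forall m, uniq (S m).
Hypothesis memS : forall m xi, xi \in S m <-> A xi /\ ev xi <= m%:R.

Variable P : {linear smooth_function G -> smooth_function G}.
Hypothesis cP : continuous P.
Hypothesis iP : left_invariant P.

Local Notation sg xi := (symbol P (rep xi)).
Local Notation ms xi := (min_nonzero_singular_value (sg xi)).

Let ev0 xi : A xi -> 0 <= ev xi. Proof. by move=> Ax; apply: (ev_ge0 cG g); exact: sA. Qed.
Let ev1 xi : A xi -> 1 <= 1 + ev xi. Proof. by move=> Ax; rewrite lerDl ev0. Qed.

Let PE u xi : A xi -> coef (P u) xi = coef u xi *m (sg xi)^T.
Proof. exact: (coef_operator cG iA mA uS memS cP iP). Qed.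

(* The functionals h |-> (coef h xi *m z) j with (sg xi)^T *m z = 0 belong to the
   kernel of the transpose. *)
Lemma annihilator_coef f xi : A xi -> annihilator (ker_transpose P) f ->
  (coef f xi <= (sg xi)^T)%MS.
Proof.
move=> Ax fa; rewrite submxE; apply/eqP; apply/matrixP => j l; rewrite [RHS]mxE.
set K := cokermx _.
pose T0 h : C^o := (coef h xi *m K) j l.
have lT : linear T0.
  by move=> a h1 h2; rewrite /T0 (coef_linear cG) mulmxDl -scalemxAl !mxE.
pose T : {linear smooth_function G -> C^o} := HB.pack T0 (GRing.isLinear.Build _ _ _ _ T0 lT).
apply: (fa T); split=> [|h]; last first.
  by rewrite /= /T0 PE// -mulmxA mulmx_coker mulmx0 mxE.
apply: (functional_continuous cG (C := 4 * \sum_k taxi (K k l))).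
  by apply: mulr_ge0 => //; apply: sumr_ge0 => k _; exact: taxi_ge0.
move=> h M hM; rewrite /= /T0 mxE; apply: le_trans (taxi_sum _ _ _) _.
rewrite mulrAC mulr_sumr; apply: ler_sum => k _; apply: le_trans (taxiM _ _) _.
apply: ler_wpM2r; first exact: taxi_ge0.
apply: (coef_bound cG) => //; apply: smoothC_cts; exact: smooth_functionC.
Qed.

Lemma row_sqn_coef_decay h N : exists2 K : R, 0 <= K & forall xi, A xi -> forall j,
  row_sqn (row j (coef h xi)) <= (rdim xi)%:R * (K / (1 + ev xi) ^+ N) ^+ 2.
Proof.
have [K K0 HK] := coef_decay cG g N (smooth_functionC h); exists K => // xi Ax j.
have a0 : 0 < (1 + ev xi) ^+ N by rewrite exprn_gt0// (lt_le_trans ltr01)// ev1.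
set q := (K / _) ^+ 2; have <- : \sum_(k < rdim xi) q = (rdim xi)%:R * q.
  by rewrite sumr_const card_ord mulr_natl.
apply: ler_sum => k _; rewrite mxE; apply: le_trans (sqn_taxi _) _.
apply: lerXn2r; rewrite ?nnegrE; [exact: taxi_ge0|by rewrite divr_ge0// ltW|].
by rewrite ler_pdivlMr//; apply: HK; exact: sA.
Qed.

Lemma lower_bound_solvable (c0 : R) p : 0 < c0 ->
  (forall xi, A xi -> sg xi != 0 -> c0 * (1 + ev xi) ^- p <= ms xi) -> globally_solvable P.
Proof.
move=> c00 lb f fa.
(* Each row of the coefficient of f is solved separately by a preimage of controlled length; when
   the symbol vanishes, so does the coefficient of f, and 0 is a solution. *)
have H xi : exists M : 'M[C]_(rdim xi), A xi -> M *m (sg xi)^T = coef f xi /\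
    forall j, (c0 / (1 + ev xi) ^+ p) ^+ 2 * row_sqn (row j M) <= row_sqn (row j (coef f xi)).
  have [Ax|nA] := pselect (A xi); last by exists 0 => Ax; case: nA.
  have /submxP[D ED] := annihilator_coef Ax fa.
  have [s0|s0] := eqVneq (sg xi) 0.
    exists 0 => _; rewrite mul0mx ED s0 trmx0 mulmx0; split=> // j.
    by rewrite !row0 row_sqn0 mulr0.
  have [_ _ Hy] := min_nonzero_singular_valueP s0.
  pose y j := projT1 (cid (Hy (row j D))).
  have yP j : y j *m (sg xi)^T = row j D *m (sg xi)^T /\
     ms xi ^+ 2 * row_sqn (y j) <= row_sqn (y j *m (sg xi)^T).
    exact: projT2 (cid (Hy (row j D))).
  exists (\matrix_j y j) => _; split.
    by apply/row_matrixP => j; rewrite row_mul rowK (yP j).1 -row_mul ED.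
  move=> j; rewrite rowK; have [E1 E2] := yP j.
  apply: (le_trans _ (le_trans E2 _)); last by rewrite E1 -row_mul -ED.
  apply: ler_wpM2r; first exact: row_sqn_ge0.
  have q0 : 0 <= c0 / (1 + ev xi) ^+ p.
    by rewrite divr_ge0 ?ltW// exprn_gt0// (lt_le_trans ltr01)// ev1.
  apply: lerXn2r; rewrite ?nnegrE//; last exact: lb.
  exact: le_trans q0 (lb xi Ax s0).
pose c xi := projT1 (cid (H xi)).
have cE xi : A xi -> c xi *m (sg xi)^T = coef f xi by move=> Ax; case: (projT2 (cid (H xi)) Ax).
have cB xi j : A xi ->
    (c0 / (1 + ev xi) ^+ p) ^+ 2 * row_sqn (row j (c xi)) <= row_sqn (row j (coef f xi)).
  by move=> Ax; case: (projT2 (cid (H xi)) Ax).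
suff rc : rapid g A c.
  have [u [_ Hu]] := fourier_series cG iA uS memS rc; exists u.
  by apply: (coef_inj cG g mA) => xi Ax; rewrite PE// Hu// cE.
(* p powers pay for the inverse singular values and n powers for the dimension factor of
   [row_sqn_coef_decay]. *)
move=> N; have [K K0 HK] := row_sqn_coef_decay f (N + n + p).
have [K2 K20 HK2] := rdim_bound cG g iA.
pose Q := (1 + K2) * K / c0.
have Q0 : 0 <= Q by rewrite /Q divr_ge0 ?mulr_ge0 ?addr_ge0// ltW.
exists (2 * Q) => xi Ax j k.
have a1 := ev1 Ax; set a := 1 + ev xi in a1 *.
have aN m : 1 <= a ^+ m by rewrite exprn_ege1.
have a0 m : 0 < a ^+ m by exact: lt_le_trans ltr01 (aN m).
have ar (r d x w q : R) : 0 < x -> 1 <= w -> 0 < q -> 0 <= d -> d <= K2 * w ->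
    (c0 / q) ^+ 2 * r <= d * (K / (x * w * q)) ^+ 2 -> r <= (Q / x) ^+ 2.
  move=> x0 w1 q0 d0 dw h1; have w0 : 0 < w by lra.
  pose t := K / x; have h2 : c0 ^+ 2 * r <= d * (t / w) ^+ 2.
    have E1 : c0 ^+ 2 * r = q ^+ 2 * ((c0 / q) ^+ 2 * r) by field; rewrite gt_eqF.
    have E2 : d * (t / w) ^+ 2 = q ^+ 2 * (d * (K / (x * w * q)) ^+ 2).
      by rewrite /t; field; rewrite !gt_eqF.
    by rewrite E1 E2; apply: ler_wpM2l => //; apply: exprn_ge0; exact: ltW.
  have h3 : d * (t / w) ^+ 2 <= K2 * t ^+ 2.
    have E3 : d * (t / w) ^+ 2 = (d / w ^+ 2) * t ^+ 2 by field; rewrite gt_eqF.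
    rewrite E3; apply: ler_wpM2r; first exact: sqr_ge0.
    rewrite ler_pdivrMr ?exprn_gt0//; apply: le_trans dw _; apply: ler_wpM2l => //.
    by rewrite expr2 -[leLHS]mulr1; apply: ler_wpM2l => //; exact: ltW.
  have -> : Q / x = (1 + K2) * t / c0 by rewrite /Q /t; field; rewrite !gt_eqF.
  rewrite expr_div_n ler_pdivlMr ?exprn_gt0// mulrC; apply: le_trans h2 (le_trans h3 _).
  rewrite [in leRHS]exprMn; apply: ler_wpM2r; first exact: sqr_ge0.
  by move: K2 K20 {HK2 Q Q0 dw h3} => K2 K20; nra.
rewrite -ler_pdivlMr//.
rewrite -mulrA; apply: taxi_le; first by rewrite divr_ge0// ltW.
have sj : sqn (c xi j k) <= row_sqn (row j (c xi)).
  rewrite /row_sqn (bigD1 k)//= mxE lerDl; apply: sumr_ge0 => l _; exact: sqn_ge0.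
apply: le_trans sj _; apply: (ar _ (rdim xi)%:R (a ^+ N) (a ^+ n) (a ^+ p)) => //; first exact: HK2.
by rewrite -!exprD; apply: le_trans (cB xi j Ax) (HK xi Ax j).
Qed.

(* Otherwise there are x m with ms (x m) decreasing faster than every power of
   1 + ev.  With unit singular vectors y at the x m, the coefficients y *m sg^T are
   rapidly decreasing and their sum is in the closure of the range, but the
   coefficients of a preimage have norm at least 1 at every x m. *)
Lemma closed_range_lower_bound : closed_range P -> exists2 c0 : R, 0 < c0 & exists p : nat,
  forall xi, A xi -> sg xi != 0 -> c0 * (1 + ev xi) ^- p <= ms xi.
Proof.
move=> clP; apply: contrapT => nlb.
have H (m : nat) : exists xi, [/\ A xi, sg xi != 0 & ms xi < m.+1%:R^-1 * (1 + ev xi) ^- m].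
  apply: contrapT => nH; apply: nlb; exists m.+1%:R^-1; first by rewrite invr_gt0 ltr0n.
  exists m => xi Ax s0; rewrite leNgt; apply/negP => lt; apply: nH; exists xi; split=> //.
have [x Hx] := choice H.
pose B xi := exists m, xi = x m.
have Y xi : exists y : 'rV[C]_(rdim xi), sg xi != 0 -> [/\ row_sqn y = 1,
    row_sqn (y *m (sg xi)^T) = ms xi ^+ 2 &
    forall y', y' *m (sg xi)^T = y *m (sg xi)^T -> 1 <= row_sqn y'].
  have [s0|s0] := eqVneq (sg xi) 0; first by exists 0.
  by have [_ [y Hy] _] := min_nonzero_singular_valueP s0; exists y.
pose y xi := projT1 (cid (Y xi)); have yP xi : sg xi != 0 -> [/\ row_sqn (y xi) = 1,
    row_sqn (y xi *m (sg xi)^T) = ms xi ^+ 2 &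
    forall y', y' *m (sg xi)^T = y xi *m (sg xi)^T -> 1 <= row_sqn y'] := projT2 (cid (Y xi)).
(* The singular vector sits in the first row, present since dimensions are positive, and only at
   representations of the sequence. *)
pose e xi : 'M[C]_(rdim xi) :=
  \matrix_(j, k) (if `[< B xi >] && ((j : nat) == 0%N) then y xi 0 k else 0).
pose c xi := e xi *m (sg xi)^T.
have rowe xi j : row j (e xi) = if `[< B xi >] && ((j : nat) == 0%N) then y xi else 0.
  by apply/rowP => k; rewrite !mxE; case: ifP; rewrite ?mxE.
have rowc xi j : row j (c xi) = if `[< B xi >] && ((j : nat) == 0%N) then y xi *m (sg xi)^T else 0.
  by rewrite row_mul rowe; case: ifP; rewrite // mul0mx.
have ms_le m : 0 <= ms (x m) /\ ms (x m) * (1 + ev (x m)) ^+ m <= 1.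
  have [Ax s0 lt] := Hx m; have a1 := ev1 Ax.
  have [l0 _ _] := min_nonzero_singular_valueP s0; split; first exact: ltW.
  rewrite -ler_pdivlMr ?exprn_gt0 ?(lt_le_trans ltr01)//; apply: le_trans (ltW lt) _.
  apply: ler_wpM2r; first by rewrite invr_ge0 exprn_ge0// (le_trans ler01).
  by rewrite invf_le1 ?ltr0n// ler1n.
have rc : rapid g A c.
  (* For [N <= m] the decay of the singular value absorbs N powers of [1 + ev (x m)]; the finitely
     many earlier indices are covered by the sum in Q. *)
  move=> N; pose Q := 1 + \sum_(m < N) (1 + ev (x m)) ^+ N.
  have p0 m : 0 <= (1 + ev (x m)) ^+ N.
    by have [Ax _ _] := Hx m; rewrite exprn_ge0// (le_trans ler01)// ev1.
  have Q0 : 0 <= \sum_(m < N) (1 + ev (x m)) ^+ N by apply: sumr_ge0 => m _.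
  exists (2 * Q) => xi Ax j k.
  have -> : c xi j k = row j (c xi) 0 k by rewrite [RHS]mxE.
  rewrite rowc; case: ifPn => [/andP[/asboolP[m E] _]|_]; last first.
    by rewrite mxE taxi0 mul0r mulr_ge0// addr_ge0.
  move: j k; rewrite E => j k; have [_ s0 _] := Hx m; have [m0 m1] := ms_le m.
  have [_ E2 _] := yP _ s0.
  have T : taxi ((y (x m) *m (sg (x m))^T) 0 k) <= 2 * ms (x m).
    apply: taxi_le => //; rewrite -E2 /row_sqn (bigD1 k)//= lerDl.
    by apply: sumr_ge0 => l _; exact: sqn_ge0.
  apply: le_trans (ler_wpM2r (p0 m) T) _; rewrite -mulrA; apply: ler_wpM2l => //.
  have a1 : 1 <= 1 + ev (x m) by apply: ev1; case: (Hx m).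
  have [Nm|mN] := leqP N m.
    apply: (@le_trans _ _ 1); last by rewrite lerDl.
    apply: le_trans m1; apply: ler_wpM2l => //; exact: ler_weXn2l.
  have ms1 : ms (x m) <= 1.
    by apply: le_trans m1; rewrite -[leLHS]mulr1; apply: ler_wpM2l => //; rewrite exprn_ege1.
  apply: (@le_trans _ _ ((1 + ev (x m)) ^+ N)).
    by rewrite -[leRHS]mul1r; apply: ler_wpM2r.
  rewrite /Q (bigD1 (Ordinal mN))//= addrCA lerDl addr_ge0//; apply: sumr_ge0 => l _; exact: p0.
have Pe m : P (fourier_partial_sum S e m) = fourier_partial_sum S c m.
  apply: (coef_inj cG g mA) => xi Ax; rewrite PE// !(coef_fourier_partial_sum cG iA uS memS)//.
  by case: ifP => _; rewrite // mul0mx.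
have [f [Ff cf]] := fourier_series cG iA uS memS rc.
have [u _ Pu] : range P f.
  apply: (closed_cvg (range P) clP _ f Ff); apply: nearW => m.
  by rewrite -Pe; exists (fourier_partial_sum S e m).
have [K K0 HK] := row_sqn_coef_decay u n.+1; have [K2 K20 HK2] := rdim_bound cG g iA.
(* The first row of the coefficient of u at [x m] has squared length at least 1, yet the
   coefficients of u decay; this confines all the eigenvalues [ev (x m)] to a bounded interval. The
   exponent [n.+1] beats the growth of the dimension. *)
have evx m : ev (x m) <= K2 * K ^+ 2.
  have [Ax s0 _] := Hx m; have [_ _ Hy] := yP _ s0; have a1 := ev1 Ax.
  pose j := Ordinal (rdim_gt0 (x m)).
  have r1 : 1 <= row_sqn (row j (coef u (x m))).
    apply: Hy; rewrite -row_mul -PE// Pu cf// rowc.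
    by case: ifPn => // /negP; case; apply/andP; split=> //; apply/asboolP; exists m.
  have h1 := le_trans r1 (HK _ Ax j); rewrite [(1 + _) ^+ n.+1]exprS in h1.
  have h2 := HK2 _ Ax; have w1 : 1 <= (1 + ev (x m)) ^+ n by rewrite exprn_ege1.
  apply: (@le_trans _ _ (1 + ev (x m))); first by rewrite lerDr.
  move: w1 a1 h1 h2.
  move: (1 + ev (x m)) ((rdim (x m))%:R : R) => a d; move: (a ^+ n) => w w1 a1 h1 h2.
  have [a0 w0] : 0 < a /\ 0 < w by split; lra.
  have h3 : 1 <= K2 * w * (K / (a * w)) ^+ 2.
    by apply: le_trans h1 _; apply: ler_wpM2r => //; exact: sqr_ge0.
  have E : K2 * w * (K / (a * w)) ^+ 2 = K2 * K ^+ 2 / (a ^+ 2 * w) by field; rewrite !gt_eqF.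
  move: h3; rewrite E ler_pdivlMr ?mulr_gt0 ?exprn_gt0// mul1r => h3; apply: le_trans h3.
  rewrite -[leLHS]mulr1; apply: (@le_trans _ _ (a ^+ 2 * 1)).
    by rewrite [leRHS]mulr1 expr2; apply: ler_wpM2l => //; exact: ltW.
  by apply: ler_wpM2l => //; exact: sqr_ge0.
have t0 : 0 <= K2 * K ^+ 2 by rewrite mulr_ge0// exprn_ge0.
have [L [_ HL]] := finite_spectrum cG g iA t0.
(* Only finitely many representations have eigenvalue in that interval, so the singular values at
   the [x m] have a positive lower bound, against their choice for large m. *)
have [dl d0 Hd] : exists2 dl : R, 0 < dl & forall xi, xi \in L -> sg xi != 0 -> dl <= ms xi.
  elim: {HL}L => [|xi L [dl d0 Hd]]; first by exists 1.
  have [s0|s0] := eqVneq (sg xi) 0.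
    by exists dl => // eta; rewrite inE => /orP[/eqP ->|/Hd //]; rewrite s0 eqxx.
  have [l0 _ _] := min_nonzero_singular_valueP s0.
  exists (Num.min dl (ms xi)) => [|eta]; first by rewrite lt_min d0.
  rewrite inE => /orP[/eqP -> _|eL se]; first by rewrite ge_min lexx orbT.
  by rewrite ge_min Hd.
pose m := Num.truncn dl^-1; have [Ax s0 lt] := Hx m; have a1 := ev1 Ax.
have h1 : dl <= ms (x m) by apply: Hd => //; apply/HL.
have h2 : m.+1%:R^-1 < dl.
  by rewrite -[ltRHS]invrK ltf_pV2 ?posrE ?invr_gt0 ?ltr0n//; exact: truncnS_gt.
have h3 : m.+1%:R^-1 * (1 + ev (x m)) ^- m <= m.+1%:R^-1.
  rewrite -[leRHS]mulr1; apply: ler_wpM2l; first by rewrite invr_ge0.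
  by rewrite invf_le1 ?exprn_ege1// exprn_gt0// (lt_le_trans ltr01).
by have := lt_trans (lt_le_trans lt h3) (lt_le_trans h2 h1); rewrite ltxx.
Qed.

End solvability.

Theorem proposition4p3 (R : realType) (n : nat) (G : lieGroupType R n)
    (g : biinvariant_metric G)
    (P : {linear smooth_function G -> smooth_function G}) :
  compact [set: G] -> connected [set: G] ->
  continuous P -> left_invariant P ->
  (globally_solvable P <-> closed_range P) /\
  (globally_solvable P <->
   exists C k : R, [/\ 0 < C, 0 < k &
     forall (d : nat) (xi : irrep G d), symbol P xi != 0 ->
       C * bracket g xi `^ (- k) <= min_nonzero_singular_value (symbol P xi)]).
Proof.
move=> cG _ cP iP; have [A [iA mA]] := maximal_independent cG.
have [S HS] := spectrum_exists cG g iA.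
have uS m : uniq (S m) := (HS m).1.
have memS m xi : xi \in S m <-> A xi /\ ev g xi <= m%:R := (HS m).2 xi.
have sc := @solvable_closed_range _ _ _ P.
pose bound := exists C k : R, [/\ 0 < C, 0 < k &
  forall (d : nat) (xi : irrep G d), symbol P xi != 0 ->
    C * bracket g xi `^ (- k) <= min_nonzero_singular_value (symbol P xi)].
have cb : closed_range P -> bound.
  move=> /(closed_range_lower_bound cG iA mA uS memS cP iP) [c0 c00 [p lb]].
  (* Doubling accounts for the square root in the bracket, and [p.+1] in place of p keeps the
     exponent positive. *)
  exists c0, (p.+1.*2)%:R; split=> // d eta s0.
  (* The bound is known on A; eta is equivalent to a member, with the same Laplace eigenvalue and
     the same smallest nonzero singular value of the symbol. *)
  have [xi [T [Ax T0 intT]]] := equivalent_member cG mA (symbol_smooth_rep s0).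
  have sx : smooth_rep xi := iA.1 _ Ax.
  have [nz ->] := symbol_singular_value_conj P sx T0 intT.
  have bE : bracket g eta = bracket g xi.
    by rewrite /bracket (laplace_eigenvalue_equivalent cG g intT T0 sx).
  have nu0 : 0 <= laplace_eigenvalue g xi := ev_ge0 cG g (iA.1 _ Ax).
  rewrite bE bracket_powR_nat//; apply: le_trans (lb _ Ax (nz s0)).
  apply: ler_wpM2l; first exact: ltW.
  have a1 : 1 <= 1 + laplace_eigenvalue g xi by rewrite lerDl.
  have a0 : 0 < 1 + laplace_eigenvalue g xi by exact: lt_le_trans ltr01 a1.
  by rewrite lef_pV2 ?posrE ?exprn_gt0//; exact: ler_weXn2l.
have bs : bound -> globally_solvable P.
  move=> [c0 [k [c00 k0 lb]]].
  apply: (lower_bound_solvable cG iA mA uS memS cP iP (p := (Num.truncn k).+1) c00).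
  move=> xi Ax s0; apply: le_trans (lb _ _ s0); apply: ler_wpM2l; first exact: ltW.
  apply: bracket_powR_ge; first exact: (ev_ge0 cG g (iA.1 _ Ax)).
  by apply: ltW; exact: truncnS_gt.
split; split; [exact: sc|by move=> /cb/bs|by move=> /sc/cb|exact: bs].
Qed.
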